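(* As $\varepsilon\downarrow 0$, $$\mathbb{P}\{\mathcal{W}<\varepsilon\}\sim \exp\Big\{-\sigma\,\omega^2+\omega\, M_1(\omega)-\tfrac12\log\omega+M_2(\omega)\Big\},$$ where $\omega=\omega(\varepsilon)$, and $M_1$ and $M_2$ are bounded functions which are periodic in $\omega$ with period $\log a$.
   Context: Let $X$ be a non-degenerate random variable with values in $\{1,2,\dots\}$, $p_k=\mathbb{P}\{X=k\}$ (so $p_0=0$), with $p_1>0$. Let $Y$ be a random variable with values in $\{1,2,\dots\}$, $q_k=\mathbb{P}\{Y=k\}$ (so $q_0=0$). Assume $\mathbb{E}X\log X<\infty$ and $\mathbb{E}\log Y<\infty$, and put $a=\mathbb{E}X\in(1,\infty)$, $\nu=\min\{i:q_i>0\}\ge 1$. The Galton–Watson process with immigration $(\mathcal{Z}_n)_{n\ge0}$ is defined by $\mathcal{Z}_0=Y_0$ and $\mathcal{Z}_{n+1}=X^{(n)}_1+\dots+X^{(n)}_{\mathcal{Z}_n}+Y_{n+1}$, $n\ge 0$, where all $X_i^{(n)}$ are distributed as $X$, all $Y_j$ are distributed as $Y$, and all these variables are independent. The limit $\mathcal{W}=\lim_{n\to\infty}\mathcal{Z}_n/a^n$ exists and is positive (and finite) almost surely. Put $$\sigma=\frac{\nu\log(1/p_1)}{2\log^2 a}.$$ The function $\omega$ is defined implicitly in a right neighbourhood of zero by $\omega(\varepsilon)-\log\omega(\varepsilon)+\log\log a=\log(1/\varepsilon)$, taking the solution with $\omega(\varepsilon)\to\infty$ (so $\omega(\varepsilon)\sim\log(1/\varepsilon)$)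 as $\varepsilon\downarrow 0$. The notation $g\sim h$ means $g/h\to1$. *)

(* Defs.v *)
From HB Require Import structures.
From mathcomp Require Import all_boot all_order all_algebra.
From mathcomp Require Import all_classical all_reals all_analysis.

Set Implicit Arguments.
Unset Strict Implicit.
Unset Printing Implicit Defensive.

Import Order.TTheory GRing.Theory Num.Theory.
Import numFieldNormedType.Exports.

Local Open Scope classical_set_scope.
Local Open Scope ring_scope.

Section probability_notions.
Context (d : measure_display) (T : measurableType d) (R : realType).
Variable P : probability T R.

Definition mutually_independent (d' : measure_display)
    (E : measurableType d') (I : eqType) (V : I -> T -> E) : Prop :=
  forall (s : seq I) (A : I -> set E), uniq s ->
    (forall i, measurable (A i)) ->
    P (\bigcap_(i in [set` s]) (V i @^-1` A i)) =
    (\prod_(i <- s) P (V i @^-1` A i))%E.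

Definition same_law (d' : measure_display) (E : measurableType d')
    (U V : {RV P >-> E}) : Prop :=
  forall A, measurable A -> distribution P U A = distribution P V A.

(* The library's [pmf] is restricted to real-valued random variables. *)
Definition mass (X : {RV P >-> nat}) (k : nat) : R :=
  fine (P (X @^-1` [set k])).

Definition nonconstant_rv (X : {RV P >-> nat}) : Prop :=
  ~ exists k : nat, P (X @^-1` [set k]) = 1%E.

Definition mean (X : {RV P >-> nat}) : R :=
  fine 'E_P[fun w => (X w)%:R].

(* All offspring and immigration variables as a single family:
   [inl (n, i)] is the i-th offspring variable of generation n and
   [inr j] the j-th immigration variable. *)
Definition joint_family (Xs : nat -> nat -> {RV P >-> nat})
    (Ys : nat -> {RV P >-> nat}) (k : nat * nat + nat) : T -> nat :=
  match k with
  | inl (n, i) => Xs n i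
  | inr j => Ys j
  end.

(* The individuals of generation n are numbered from 0. *)
Fixpoint gwi (Xs : nat -> nat -> {RV P >-> nat})
    (Ys : nat -> {RV P >-> nat}) (n : nat) (w : T) : nat :=
  match n with
  | 0 => Ys 0%N w
  | m.+1 => (\sum_(i < gwi Xs Ys m w) Xs m i w + Ys m.+1 w)%N
  end.

End probability_notions.

(* The second clause selects the branch tending to infinity; it also keeps
   [ln (omega e)] away from the junk values of [ln] on nonpositive reals. *)
Definition is_omega (R : realType) (a : R) (omega : R -> R) : Prop :=
  (\forall e \near 0^'+, omega e - ln (omega e) + ln (ln a) = ln (1 / e)) /\
  omega e @[e --> 0^'+] --> +oo.

Definition sigma (R : realType) (nu : nat) (p1 a : R) : R :=
  nu%:R * ln (1 / p1) / (2 * ln a ^+ 2).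

(* Main.v *)
(* Let phi be the Laplace transform of W and psi that of the limit of Z_n / a^n
   for the process without immigration started by one individual, so that
   psi(a z) = f(psi z) and phi(a z) = Q(psi(a z)) phi(z), where f and Q are the
   generating functions of X and Y.  Iterating, phi(a^m v) = phi(v) times the
   product of Q(psi(a^j v)) for 1 <= j <= m, and since f(w) ~ p_1 w and
   Q(w) ~ q_nu w^nu near 0, the second differences of log phi(a^m v) in m tend
   geometrically to nu log p_1; this produces the quadratic term.
   Tilting the law of W by e^{-u W} with u = a^m v, the characteristic function
   at v (1 + i t) of the tilted law is, up to geometrically small errors, the
   m-th power of a fixed function h with expansion 1 - i A t - B t^2 / 2 and with
   |h| <= e^{-c t^2}.  Writing omega = omega_0 + m log a, the choice
   v = nu e^{omega_0} A(v), possible by a supremum argument, places epsilon at the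
   mean of the tilted law; a local limit theorem (Fejer kernels and the
   monotonicity of s |-> P(u W < s)) then gives the factor of order m^{-1/2}. *)
Require Import Defs.
From HB Require Import structures.
From mathcomp Require Import all_boot all_order all_algebra.
From mathcomp Require Import all_classical all_reals all_analysis.
From mathcomp Require Import measurable_realfun.
From mathcomp Require Import complex.
From mathcomp Require Import ring lra zify.

Import Order.TTheory GRing.Theory Num.Theory.
Import numFieldNormedType.Exports.

Local Open Scope classical_set_scope.
Local Open Scope ring_scope.

Import ComplexField.Normc.

Set Implicit Arguments.
Unset Strict Implicit.
Unset Printing Implicit Defensive.

(** With only E X log X and E log Y finite, W need not have useful moments. Every moment used below
    is therefore one of a tilted law, where the weight e^{-x} makes all powers integrable. The X log
    X condition gives psi the derivative -1 at 0, which excludes a degenerate limit. The mean A(v)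
    is not shown to be continuous in v. Expansions are stated as inequalities for all t with uniform
    constants; these survive subsequential limits, which is what the supremum argument uses. M1 and
    M2 arise by choosing data for each phase, so they come out bounded and periodic and nothing
    more. The Gaussian bound on the modulus is available for |t| in a compact set only. A Fejer
    kernel has a compactly supported transform, so that is enough; the smoothing is undone by
    one-sided regularity. The object smoothed is e^{-s} times a distribution function, normalized:
    it is the density of the tilted law convolved with an exponential law, whence a factor 1/(1 + i
    t). The equation for omega says that epsilon = omega e^{-omega} / log a, so with u = nu A
    e^omega the product u epsilon is exactly nu A omega / log a. *)

Notation Cx x := (real_complex_def (Phant _) x).
Notation Re := complex.Re.
Notation Im := complex.Im.

(** * Elementary inequalities for sine, cosine and the real exponential *)

Section real_inequalities.
Context {R : realType}.
Implicit Types x y : R.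

(** The one-sided Taylor bounds for sine and cosine below form a ladder: the derivative of each
    difference to be bounded is the difference bounded before. *)
Lemma le_of_derive_ge0 (f df : R -> R) x :
  (forall y : R, is_derive y 1 f (df y)) -> (forall y, 0 <= y -> 0 <= df y) ->
  0 <= x -> f 0 <= f x.
Proof.
move=> fdf df0 x0.
have cf : {within `[0, x], continuous f}.
  apply: derivable_within_continuous => y _.
  by have [] := fdf y.
have [c] := MVT_segment x0 (fun y _ => fdf y) cf.
rewrite in_itv/= => /andP[c0 _] e.
by rewrite -subr_ge0 e mulr_ge0 ?df0// subr0.
Qed.

Lemma sin_le_id x : 0 <= x -> sin x <= x.
Proof.
move=> x0; rewrite -subr_ge0.
have h1 (y : R) : is_derive y 1 (fun y => y - sin y) (1 - cos y).
  by apply: is_deriveB.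
have h2 (y : R) : 0 <= y -> 0 <= 1 - cos y by rewrite subr_ge0 cos_le1.
by have := le_of_derive_ge0 h1 h2 x0; rewrite sin0 subr0.
Qed.

Lemma cos_ge_quadratic_pos x : 0 <= x -> 1 - x ^+ 2 / 2 <= cos x.
Proof.
move=> x0; rewrite -subr_ge0.
have h1 (y : R) : is_derive y 1 (fun y => cos y - (1 - y ^+ 2 / 2)) (y - sin y).
  by apply: is_derive_eq; rewrite !scaler0 /GRing.scale/=; lra.
have h2 (y : R) : 0 <= y -> 0 <= y - sin y by rewrite subr_ge0; exact: sin_le_id.
have := le_of_derive_ge0 h1 h2 x0.
by rewrite cos0 expr0n/= mul0r !subr0 subrr.
Qed.

Lemma sin_ge_cubic x : 0 <= x -> x - x ^+ 3 / 6 <= sin x.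
Proof.
move=> x0; rewrite -subr_ge0.
have h1 (y : R) : is_derive y 1 (fun y => sin y - (y - y ^+ 3 / 6)) (cos y - (1 - y ^+ 2 / 2)).
  by apply: is_derive_eq; rewrite !scaler0 /GRing.scale/=; lra.
have h2 (y : R) : 0 <= y -> 0 <= cos y - (1 - y ^+ 2 / 2).
  by rewrite subr_ge0; exact: cos_ge_quadratic_pos.
have := le_of_derive_ge0 h1 h2 x0.
by rewrite sin0 expr0n/= mul0r !subr0.
Qed.

Lemma cos_le_quartic x : 0 <= x -> cos x <= 1 - x ^+ 2 / 2 + x ^+ 4 / 24.
Proof.
move=> x0; rewrite -subr_ge0.
have h1 (y : R) : is_derive y 1 (fun y => 1 - y ^+ 2 / 2 + y ^+ 4 / 24 - cos y)
    (sin y - (y - y ^+ 3 / 6)).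
  by apply: is_derive_eq; rewrite !scaler0 /GRing.scale/=; lra.
have h2 (y : R) : 0 <= y -> 0 <= sin y - (y - y ^+ 3 / 6).
  by rewrite subr_ge0; exact: sin_ge_cubic.
have := le_of_derive_ge0 h1 h2 x0.
by rewrite cos0 !expr0n/= !mul0r subr0 addr0 subrr.
Qed.

Lemma normr_sin_le x : `|sin x| <= `|x|.
Proof.
wlog x0 : x / 0 <= x => [h|].
  have [|/ltW x0] := leP 0 x; first exact: h.
  by rewrite -normrN -sinN -(normrN x) h// oppr_ge0.
rewrite (ger0_norm x0) ler_norml sin_le_id// andbT.
have := sin_ge_cubic x0; have [x1|x1] := leP x 1.
  move=> h; apply: le_trans h; rewrite -subr_ge0.
  have : x ^+ 3 <= x by rewrite -[leRHS]mulr1 exprS ler_wpM2l// expr_le1.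
  lra.
by move=> _; apply: le_trans (sin_geN1 x); lra.
Qed.

Lemma normr_cosB1_le x : `|cos x - 1| <= x ^+ 2 / 2.
Proof.
wlog x0 : x / 0 <= x => [h|].
  have [|/ltW x0] := leP 0 x; first exact: h.
  by rewrite -cosN -(sqrrN x) h// oppr_ge0.
have := cos_ge_quadratic_pos x0; have := cos_le1 x.
by rewrite ler_norml; lra.
Qed.

Lemma normr_cosB1_le_id x : `|cos x - 1| <= `|x|.
Proof.
have [x1|x1] := leP `|x| 1.
  apply: (le_trans (normr_cosB1_le x)); rewrite -real_normK ?num_real//.
  have : `|x| ^+ 2 <= `|x| by rewrite expr2 ler_piMl.
  by have := normr_ge0 x; lra.
have [x2|x2] := leP 2 `|x|.
  apply: le_trans x2; have := cos_le1 x; have := cos_geN1 x.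
  by rewrite ler_norml; lra.
apply: (le_trans (normr_cosB1_le x)); rewrite -real_normK ?num_real//.
nra.
Qed.

Lemma normr_sinB_le x : `|sin x - x| <= `|x| ^+ 3.
Proof.
wlog x0 : x / 0 <= x => [h|].
  have [|/ltW x0] := leP 0 x; first exact: h.
  have -> : sin x - x = - (sin (- x) - - x) by rewrite sinN; ring.
  by rewrite normrN -(normrN x) h// oppr_ge0.
have := sin_ge_cubic x0; have := sin_le_id x0.
have x3 : 0 <= x ^+ 3 by rewrite exprn_ge0.
by rewrite (ger0_norm x0) ler_norml; lra.
Qed.

Lemma normr_cosB2_le x : `|cos x - 1 + x ^+ 2 / 2| <= `|x| ^+ 3.
Proof.
wlog x0 : x / 0 <= x => [h|].
  have [|/ltW x0] := leP 0 x; first exact: h.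
  by rewrite -cosN -(normrN x) -(sqrrN x) h// oppr_ge0.
have := cos_ge_quadratic_pos x0; have := cos_le_quartic x0.
have x3 : 0 <= x ^+ 3 by rewrite exprn_ge0.
rewrite (ger0_norm x0) ler_norml => h1 h2; apply/andP; split; first lra.
have [x1|x1] := leP x 1.
  have : x ^+ 4 <= x ^+ 3 by rewrite exprS ler_piMl.
  lra.
have : x ^+ 2 <= x ^+ 3 by rewrite [leRHS]exprS ler_peMl ?exprn_ge0// ltW.
have := cos_le1 x; lra.
Qed.

Lemma expRN_lip x y : 0 <= x -> 0 <= y -> `|expR (- x) - expR (- y)| <= `|x - y|.
Proof.
wlog xy : x y / x <= y => [h|] x0 y0.
  have [|/ltW xy] := leP x y; first by move=> /h; apply.
  by rewrite distrC (distrC x) h.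
rewrite ger0_norm; last by rewrite subr_ge0 ler_expR lerN2.
rewrite distrC ger0_norm ?subr_ge0//.
have -> : expR (- y) = expR (- x) * expR (- (y - x)).
  by rewrite -expRD; congr expR; lra.
rewrite -{1}[expR (- x)]mulr1 -mulrBr.
have h1 : 1 - expR (- (y - x)) <= y - x by have := expR_ge1Dx (- (y - x)); lra.
apply: le_trans h1; rewrite ler_piMl ?expR_le1 ?oppr_le0// subr_ge0 expR_le1; lra.
Qed.

Lemma expRN_quad x : 0 <= x -> `|expR (- x) - 1 + x| <= x ^+ 2.
Proof.
move=> x0; have h := expR_ge1Dx (- x).
rewrite ger0_norm; last lra.
have := expR_ge1Dx x; have := expR_gt0 (- x); have := expRxMexpNx_1 x.
have [x1|x1] := leP 1 x.
  have : expR (- x) <= 1 by rewrite expR_le1 oppr_le0.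
  nra.
move=> e1 e2 e3.
have : expR (- x) * (1 + x) <= 1 by rewrite -[leRHS]e1 mulrC ler_wpM2r// ltW.
nra.
Qed.

(** Half of the exponential pays for the power: e^{x/2} = (e^{x/4})^2 >= (1 + x/4)^2 >= x. The next
    two lemmas use (x/4)^2 and (x/6)^3 in the same way, hence 16 and 216. They bound moments
    weighted by e^{-x} by a Laplace transform at half the argument. *)
Lemma xexpN_le x : 0 <= x -> x * expR (- x) <= expR (- (x / 2)).
Proof.
move=> x0.
have -> : expR (- (x / 2)) = expR (x / 2) * expR (- x) by rewrite -expRD; congr expR; lra.
rewrite ler_wpM2r ?expR_ge0//.
have -> : x / 2 = 2%:R * (x / 4) by lra.
rewrite expRM_natl; have h := expR_ge1Dx (x / 4).
have : (1 + x / 4) ^+ 2 <= expR (x / 4) ^+ 2.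
  by rewrite lerXn2r ?nnegrE ?expR_ge0//; lra.
by have := sqr_ge0 (1 - x / 4); lra.
Qed.

Lemma x2expN_le x : 0 <= x -> x ^+ 2 * expR (- x) <= 16 * expR (- (x / 2)).
Proof.
move=> x0.
have -> : expR (- (x / 2)) = expR (x / 2) * expR (- x) by rewrite -expRD; congr expR; lra.
rewrite mulrA ler_wpM2r ?expR_ge0//.
have -> : x / 2 = 2%:R * (x / 4) by lra.
rewrite expRM_natl; have h := expR_ge1Dx (x / 4).
have : (x / 4) ^+ 2 <= expR (x / 4) ^+ 2.
  by rewrite lerXn2r ?nnegrE ?divr_ge0 ?expR_ge0//; lra.
have -> : (x / 4) ^+ 2 = x ^+ 2 / 16 by field.
lra.
Qed.

Lemma x3expN_le x : 0 <= x -> x ^+ 3 * expR (- x) <= 216 * expR (- (x / 2)).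
Proof.
move=> x0.
have -> : expR (- (x / 2)) = expR (x / 2) * expR (- x) by rewrite -expRD; congr expR; lra.
rewrite mulrA ler_wpM2r ?expR_ge0//.
have -> : x / 2 = 3%:R * (x / 6) by lra.
rewrite expRM_natl; have h := expR_ge1Dx (x / 6).
have : (x / 6) ^+ 3 <= expR (x / 6) ^+ 3.
  by rewrite lerXn2r ?nnegrE ?divr_ge0 ?expR_ge0//; lra.
have -> : (x / 6) ^+ 3 = x ^+ 3 / 216 by field.
lra.
Qed.

End real_inequalities.

(** * Complex numbers, the function e^{-z}, differences of powers and products *)

Section complex_numbers.
Context {R : realType}.
Local Notation C := (complex R).
Implicit Types (z w : C) (x y t : R).
Local Open Scope complex_scope.

Lemma normc_ge0 z : 0 <= normc z.
Proof. by case: z => x y /=; rewrite sqrtr_ge0. Qed.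

Lemma normc_sqr z : normc z ^+ 2 = Re z ^+ 2 + Im z ^+ 2.
Proof. by case: z => x y /=; rewrite sqr_sqrtr// addr_ge0 ?sqr_ge0. Qed.

Lemma normc_Cx x : normc (Cx x) = `|x|.
Proof. by rewrite /= expr0n addr0 sqrtr_sqr. Qed.

Lemma normc_X z n : normc (z ^+ n) = normc z ^+ n.
Proof.
by elim: n => [|n ih]; rewrite ?expr0 ?normc1// !exprS normcM ih.
Qed.

Lemma normcB z w : normc (z - w) = normc (w - z).
Proof. by rewrite -normcN opprB. Qed.

Lemma le_normcB z w : normc (z - w) <= normc z + normc w.
Proof. by rewrite (le_trans (le_normcD _ _))// normcN. Qed.

Lemma le_normc_tri z w v : normc (z - w) <= normc (z - v) + normc (v - w).
Proof. by rewrite (le_trans _ (le_normcD _ _))// addrA subrK. Qed.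

Lemma normc_dist z w : `|normc z - normc w| <= normc (z - w).
Proof.
have h (x y : C) : normc x <= normc (x - y) + normc y.
  by rewrite -{1}(subrK y x) le_normcD.
rewrite ler_norml lerBlDr h andbT lerNl opprB lerBlDr normcB; exact: h.
Qed.

Lemma le_Re_normc z : `|Re z| <= normc z.
Proof.
rewrite -(ler_pXn2r (n := 2))// ?nnegrE ?normc_ge0//.
by rewrite normc_sqr real_normK ?num_real// lerDl sqr_ge0.
Qed.

Lemma le_Im_normc z : `|Im z| <= normc z.
Proof.
rewrite -(ler_pXn2r (n := 2))// ?nnegrE ?normc_ge0//.
by rewrite normc_sqr real_normK ?num_real// lerDr sqr_ge0.
Qed.

Lemma normc_le_ReIm z : normc z <= `|Re z| + `|Im z|.
Proof.
rewrite -(ler_pXn2r (n := 2))// ?nnegrE ?normc_ge0// ?addr_ge0//.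
rewrite normc_sqr sqrrD !real_normK ?num_real//.
by rewrite -addrA lerD2l lerDr mulrn_wge0// mulr_ge0.
Qed.

Lemma normc_sum (I : Type) (s : seq I) (F : I -> C) :
  normc (\sum_(i <- s) F i) <= \sum_(i <- s) normc (F i).
Proof.
elim: s => [|i s ih]; first by rewrite !big_nil normc0.
by rewrite !big_cons (le_trans (le_normcD _ _))// lerD2l.
Qed.

Lemma ReD z w : Re (z + w) = Re z + Re w. Proof. by case: z; case: w. Qed.
Lemma ImD z w : Im (z + w) = Im z + Im w. Proof. by case: z; case: w. Qed.
Lemma ReN z : Re (- z) = - Re z. Proof. by case: z. Qed.
Lemma ImN z : Im (- z) = - Im z. Proof. by case: z. Qed.
Lemma ReM z w : Re (z * w) = Re z * Re w - Im z * Im w.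
Proof. by case: z; case: w. Qed.
Lemma ImM z w : Im (z * w) = Re z * Im w + Im z * Re w.
Proof. by case: z; case: w. Qed.
Lemma ReZ x z : Re (Cx x * z) = x * Re z.
Proof. by case: z => a b /=; rewrite mul0r subr0. Qed.
Lemma ImZ x z : Im (Cx x * z) = x * Im z.
Proof. by case: z => a b /=; rewrite mul0r addr0. Qed.
Lemma CxM x y : Cx (x * y) = Cx x * Cx y. Proof. exact: rmorphM. Qed.
Lemma CxD x y : Cx (x + y) = Cx x + Cx y. Proof. exact: rmorphD. Qed.
Lemma CxN x : Cx (- x) = - Cx x. Proof. exact: rmorphN. Qed.
Lemma CxB x y : Cx (x - y) = Cx x - Cx y. Proof. exact: rmorphB. Qed.
Lemma CxX x n : Cx (x ^+ n) = Cx x ^+ n. Proof. exact: rmorphXn. Qed.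
Lemma CxV x : Cx x^-1 = (Cx x)^-1. Proof. exact: fmorphV. Qed.
Lemma Cx0 : Cx (0 : R) = 0. Proof. by []. Qed.
Lemma Cx1 : Cx (1 : R) = 1. Proof. by []. Qed.
Lemma Cx_eq0 x : (Cx x == 0) = (x == 0). Proof. exact: fmorph_eq0. Qed.

(** The function e^{-z}; with this sign its modulus is at most 1 on the right half-plane, where all
    transforms below are evaluated. *)
Definition cexpN z : C :=
  (expR (- Re z) * cos (Im z)) +i* (- (expR (- Re z) * sin (Im z))).

Lemma cexpND z w : cexpN (z + w) = cexpN z * cexpN w.
Proof.
case: z w => [x y] [x' y']; rewrite /cexpN /= opprD expRD cosD sinD.
by apply/eqP; rewrite eq_complex /=; apply/andP; split; apply/eqP; ring.
Qed.

Lemma cexpN_Cx x : cexpN (Cx x) = Cx (expR (- x)).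
Proof.
by rewrite /cexpN /= cos0 sin0 mulr1 mulr0 oppr0.
Qed.

Lemma cexpN0 : cexpN 0 = 1.
Proof. by rewrite -Cx0 cexpN_Cx oppr0 expR0. Qed.

Lemma cexpN_natM z n : cexpN (z * n%:R) = cexpN z ^+ n.
Proof.
elim: n => [|n ih]; first by rewrite mulr0 cexpN0.
by rewrite -natr1 mulrDr mulr1 cexpND ih exprSr.
Qed.

Lemma normc_cexpN z : normc (cexpN z) = expR (- Re z).
Proof.
rewrite /cexpN /= sqrrN !exprMn -mulrDr cos2Dsin2 mulr1 sqrtr_sqr.
by rewrite ger0_norm ?expR_ge0.
Qed.

Lemma normc_cexpN_le1 z : 0 <= Re z -> normc (cexpN z) <= 1.
Proof. by move=> z0; rewrite normc_cexpN expR_le1 oppr_le0. Qed.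

Lemma cexpN_im t : cexpN (0 +i* t) = cos t +i* (- sin t).
Proof. by rewrite /cexpN /= oppr0 expR0 !mul1r. Qed.

Lemma cexpNE z : cexpN z = Cx (expR (- Re z)) * cexpN (0 +i* Im z).
Proof. by rewrite -cexpN_Cx -cexpND; congr cexpN; case: z => x y; apply/eqP; rewrite eq_complex /= addr0 add0r !eqxx. Qed.

Lemma cexpN_imB1 t : normc (cexpN (0 +i* t) - 1) <= `|t|.
Proof.
rewrite -(ler_pXn2r (n := 2))// ?nnegrE ?normc_ge0//.
rewrite normc_sqr cexpN_im /= subr0 sqrrN.
have -> : (cos t - 1) ^+ 2 + sin t ^+ 2 = 2 * (1 - cos t).
  by have := cos2Dsin2 t; rewrite sqrrB; lra.
rewrite real_normK ?num_real//.
have := normr_cosB1_le t; rewrite ler_norml => /andP[+ _]; lra.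
Qed.

Lemma cexpN_im_quad t : normc (cexpN (0 +i* t) - 1 + (0 +i* t)) <= t ^+ 2 *+ 2.
Proof.
have [t1|t1] := leP `|t| 1; last first.
  rewrite (le_trans (le_normcD _ _))// (le_trans (lerD (cexpN_imB1 _) (lexx _)))//.
  rewrite [normc (_ +i* _)%C]/= expr0n add0r sqrtr_sqr -mulr2n lerMn2r /=.
  rewrite -[t ^+ 2]real_normK ?num_real// expr2 ler_peMl// ltW//.
rewrite (le_trans (normc_le_ReIm _))// cexpN_im /= subr0 addr0 mulr2n lerD//.
  by rewrite (le_trans (normr_cosB1_le _))// ler_pdivrMr// ler_peMr ?sqr_ge0// ler1n.
rewrite addrC distrC (le_trans (normr_sinB_le _))// exprS -[t ^+ 2]real_normK ?num_real//.
by rewrite ler_piMl ?exprn_ge0.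
Qed.

Lemma cexpN_im_cubic t :
  normc (cexpN (0 +i* t) - 1 + (0 +i* t) + Cx (t ^+ 2 / 2)) <= `|t| ^+ 3 *+ 2.
Proof.
rewrite (le_trans (normc_le_ReIm _))// cexpN_im /= subr0 !addr0 mulr2n lerD//.
  exact: normr_cosB2_le.
by rewrite addrC distrC normr_sinB_le.
Qed.

Lemma cexpN_lip z w : 0 <= Re z -> 0 <= Re w ->
  normc (cexpN z - cexpN w) <= `|Re z - Re w| + `|Im z - Im w|.
Proof.
move=> z0 w0.
have -> : cexpN z - cexpN w =
    Cx (expR (- Re z) - expR (- Re w)) * cexpN (0 +i* Im z)
  + cexpN w * (cexpN (0 +i* (Im z - Im w)) - 1).
  rewrite mulrBr mulr1 -cexpND.
  have -> : w + (0 +i* (Im z - Im w)) = Re w +i* Im z.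
    by case: w w0 => x y _ /=; congr (_ +i* _); ring.
  rewrite [cexpN (Re w +i* _)]cexpNE /= [cexpN z]cexpNE CxB; ring.
rewrite (le_trans (le_normcD _ _))// lerD// normcM.
  by rewrite normc_Cx normc_cexpN /= oppr0 expR0 mulr1 expRN_lip.
rewrite -[leRHS]mul1r ler_pM ?normc_ge0 ?cexpN_imB1//.
exact: normc_cexpN_le1.
Qed.

Lemma cexpNB1_le z : 0 <= Re z -> normc (cexpN z - 1) <= normc z *+ 2.
Proof.
move=> z0; rewrite -cexpN0 (le_trans (cexpN_lip z0 _))//= !subr0 mulr2n lerD//.
  exact: le_Re_normc.
exact: le_Im_normc.
Qed.

Lemma cexpN_quad z : 0 <= Re z -> normc (cexpN z - 1 + z) <= 4 * normc z ^+ 2.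
Proof.
move=> z0; pose x := Re z; pose y := Im z.
have -> : cexpN z - 1 + z = Cx (expR (- x) - 1 + x)
    + (cexpN (0 +i* y) - 1 + (0 +i* y))
    + Cx (expR (- x) - 1) * (cexpN (0 +i* y) - 1).
  rewrite [cexpN z]cexpNE -/x -/y.
  have -> : z = Cx x + (0 +i* y).
    by rewrite /x /y; case: z {z0 x y} => a b; apply/eqP; rewrite eq_complex /= addr0 add0r !eqxx.
  by rewrite !CxD CxN; ring.
rewrite (le_trans (le_normcD _ _))//.
rewrite (le_trans (lerD (le_normcD _ _) (lexx _)))//.
rewrite normc_Cx normcM normc_Cx normc_sqr -/x -/y.
have h1 := expRN_quad z0; have h2 := cexpN_im_quad y; have h3 := cexpN_imB1 y.
have h4 : `|expR (- x) - 1| <= `|x|.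
  by have := @expRN_lip _ x 0 z0 (lexx _); rewrite oppr0 expR0 addr0.
have h5 : `|expR (- x) - 1| * normc (cexpN (0 +i* y) - 1) <= `|x| * `|y|.
  by rewrite ler_pM ?normc_ge0.
have h6 : `|x| * `|y| <= (x ^+ 2 + y ^+ 2) / 2.
  rewrite -(real_normK (num_real x)) -(real_normK (num_real y)).
  have := sqr_ge0 (`|x| - `|y|); rewrite sqrrB; lra.
rewrite -/x in h1; rewrite mulr2n in h2.
have := sqr_ge0 x; have := sqr_ge0 y; lra.
Qed.

Lemma normc_powB_le z w r n : normc z <= r -> normc w <= r ->
  normc (z ^+ n - w ^+ n) <= normc (z - w) * (n%:R * r ^+ n.-1).
Proof.
move=> zr wr; rewrite subrXX normcM ler_wpM2l ?normc_ge0//.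
rewrite (le_trans (normc_sum _ _))//.
rewrite mulr_natl -[X in _ *+ X]card_ord -sumr_const ler_sum// => i _.
have r0 : 0 <= r := le_trans (normc_ge0 z) zr.
rewrite normcM !normc_X.
have -> : r ^+ n.-1 = r ^+ (n.-1 - i) * r ^+ i.
  by rewrite -exprD subnK// -ltnS prednK//; case: n i => // -[].
by rewrite -subn1 subnAC subn1 ler_pM ?exprn_ge0 ?normc_ge0// lerXn2r// ?nnegrE ?normc_ge0.
Qed.

Lemma normc_powB1_le z n : normc z <= 1 ->
  normc (z ^+ n - 1) <= n%:R * normc (z - 1).
Proof.
move=> z1; have := @normc_powB_le z 1 1 n z1 _.
by rewrite normc1 expr1n !expr1n mulr1 mulrC; exact.
Qed.

(** Each of the n terms of 1 + r + ... + r^{n-1} is at least the last one. This gives generating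
    functions the Lipschitz constant 1/(1 - r) on the disc of radius r < 1, with no moment
    involved. *)
Lemma natr_geo_le (r : R) n : 0 <= r < 1 -> n%:R * r ^+ n.-1 <= (1 - r)^-1.
Proof.
move=> /andP[r0 r1].
apply: (@le_trans _ _ (\sum_(i < n) r ^+ i)).
  rewrite mulr_natl -[X in _ *+ X]card_ord -sumr_const ler_sum// => i _.
  by apply: ler_wiXn2l => //; [exact: ltW|case: n i => [[]//|n i]; rewrite -ltnS ltn_ord].
rewrite -[leRHS]mul1r ler_pdivlMr ?subr_gt0//.
rewrite mulrC (_ : _ * _ = 1 - r ^+ n) ?gerBl ?exprn_ge0//.
by rewrite -[RHS]opprB subrX1 -mulNr opprB.
Qed.

(** One factor is exchanged at a time. The power q^{n-1} is kept because q will be Gaussian in t,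
    and the error has to inherit the decay of the product. *)
Lemma normc_prodB_le (n : nat) (u v : nat -> C) (q : R) :
  (forall i, (i < n)%N -> normc (u i) <= q) ->
  (forall i, (i < n)%N -> normc (v i) <= q) ->
  normc (\prod_(i < n) u i - \prod_(i < n) v i) <=
  (\sum_(i < n) normc (u i - v i)) * q ^+ n.-1.
Proof.
elim: n => [|n ih] uq vq; first by rewrite !big_ord0 subrr normc0 mul0r.
rewrite !big_ord_recr /=.
have q0 : 0 <= q := le_trans (normc_ge0 _) (uq 0%N isT).
have -> : \prod_(i < n) u i * u n - \prod_(i < n) v i * v n =
  (\prod_(i < n) u i - \prod_(i < n) v i) * u n
  + (\prod_(i < n) v i) * (u n - v n) by ring.
rewrite (le_trans (le_normcD _ _))// !normcM mulrDl lerD//.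
  case: n => [|n] in ih uq vq *; first by rewrite !big_ord0 subrr normc0 !mul0r.
  rewrite [q ^+ _]exprSr mulrA ler_pM ?normc_ge0//; last exact: uq.
  by apply: ih => i /ltnW ?; [apply: uq|apply: vq].
rewrite mulrC ler_wpM2l ?normc_ge0//.
elim: n vq {ih uq} => [|n ih] vq; first by rewrite big_ord0 normc1.
rewrite big_ord_recr/= normcM exprSr ler_pM ?normc_ge0//; last exact: vq.
by apply: ih => i /ltnW ?; apply: vq.
Qed.

End complex_numbers.

(** * Real and complex expectations *)

Section expectation.
Context d (T : measurableType d) (R : realType) (P : probability T R).
Local Notation C := (complex R).
Local Open Scope complex_scope.
Implicit Types (h : T -> R) (u v : T -> C).

Definition Ex h : R := (\int[P]_w h w)%R.
Definition itg h := P.-integrable setT (EFin \o h).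

Lemma itg_measurable h : itg h -> measurable_fun setT h.
Proof. by move=> /integrableP[/measurable_EFinP]. Qed.

Lemma itg_bounded h M : measurable_fun setT h -> (forall w, `|h w| <= M) -> itg h.
Proof.
move=> mh hM; apply: measurable_bounded_integrable => //.
  by rewrite (le_lt_trans (probability_le1 _ _))// ltry.
exists M; split; first exact: num_real.
by move=> x Mx w _ /=; rewrite (le_trans (hM w))// ltW.
Qed.

Lemma itg_le h h' : measurable_fun setT h -> itg h' ->
  (forall w, `|h w| <= h' w) -> itg h.
Proof.
move=> mh ih' hh'; apply: le_integrable ih' => //; first exact/measurable_EFinP.
by move=> w _ /=; rewrite lee_fin (le_trans (hh' w)) ?ler_norm.
Qed.

Lemma itg_cst r : itg (fun=> r).
Proof. exact: (@itg_bounded _ `|r|). Qed.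

Lemma itgD h h' : itg h -> itg h' -> itg (fun w => h w + h' w).
Proof.
move=> i1 i2; have := integrableD measurableT i1 i2.
by apply: eq_integrable.
Qed.

Lemma itgZ r h : itg h -> itg (fun w => r * h w).
Proof.
move=> i1; have := integrableZl measurableT r i1.
by apply: eq_integrable.
Qed.

Lemma itgN h : itg h -> itg (fun w => - h w).
Proof.
move=> i1; have := itgZ (-1) i1.
by apply: eq_integrable => // w _ /=; rewrite mulN1r.
Qed.

Lemma itgB h h' : itg h -> itg h' -> itg (fun w => h w - h' w).
Proof. by move=> i1 i2; exact: (itgD i1 (itgN i2)). Qed.

Lemma ExD h h' : itg h -> itg h' -> Ex (fun w => h w + h' w) = Ex h + Ex h'.
Proof. by move=> i1 i2; rewrite /Ex RintegralD. Qed.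

Lemma ExB h h' : itg h -> itg h' -> Ex (fun w => h w - h' w) = Ex h - Ex h'.
Proof. by move=> i1 i2; rewrite /Ex RintegralB. Qed.

Lemma ExZ r h : itg h -> Ex (fun w => r * h w) = r * Ex h.
Proof. by move=> i1; rewrite /Ex RintegralZl. Qed.

Lemma Ex_cst r : Ex (fun=> r) = r.
Proof.
rewrite /Ex Rintegral_cst// -[RHS]mulr1; congr (r * _); rewrite -[RHS]/(fine 1%E); congr fine.
exact: probability_setT.
Qed.

Lemma le_Ex h h' : itg h -> itg h' -> (forall w, h w <= h' w) -> Ex h <= Ex h'.
Proof. by move=> i1 i2 hh'; apply: le_Rintegral. Qed.

Lemma Ex_ge0 h : (forall w, 0 <= h w) -> 0 <= Ex h.
Proof. by move=> h0; apply: Rintegral_ge0. Qed.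

Lemma eq_Ex h h' : h =1 h' -> Ex h = Ex h'.
Proof. by move=> hh'; congr Ex; apply/funext. Qed.

Lemma itg_sum (I : Type) (s : seq I) (F : I -> T -> R) :
  (forall i, itg (F i)) -> itg (fun w => \sum_(i <- s) F i w).
Proof.
move=> iF; elim: s => [|i s ih].
  by under [X in itg X]eq_fun do rewrite big_nil; exact: itg_cst.
under [X in itg X]eq_fun do rewrite big_cons.
exact: itgD.
Qed.

Lemma Ex_sum (I : Type) (s : seq I) (F : I -> T -> R) :
  (forall i, itg (F i)) -> Ex (fun w => \sum_(i <- s) F i w) = \sum_(i <- s) Ex (F i).
Proof.
move=> iF; elim: s => [|i s ih].
  rewrite big_nil -[RHS](Ex_cst 0); apply: eq_Ex => w; exact: big_nil.
rewrite big_cons -ih -ExD//; last exact: itg_sum.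
by apply: eq_Ex => w; exact: big_cons.
Qed.

Definition CE u : C := Ex (fun w => Re (u w)) +i* Ex (fun w => Im (u w)).
Definition citg u := itg (fun w => Re (u w)) /\ itg (fun w => Im (u w)).
Definition cmeas u := measurable_fun setT (fun w => Re (u w)) /\
  measurable_fun setT (fun w => Im (u w)).

Lemma eq_CE u v : u =1 v -> CE u = CE v.
Proof. by move=> uv; congr CE; apply/funext. Qed.

Lemma citg_meas u : citg u -> cmeas u.
Proof. by move=> [/itg_measurable ? /itg_measurable]. Qed.

Lemma citg_le u h : cmeas u -> itg h -> (forall w, normc (u w) <= h w) -> citg u.
Proof.
move=> [m1 m2] ih uh; split; apply: itg_le ih _ => // w;
  apply: le_trans (uh w); [exact: le_Re_normc|exact: le_Im_normc].
Qed.

Lemma citg_bounded u M : cmeas u -> (forall w, normc (u w) <= M) -> citg u.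
Proof. by move=> mu uM; apply: citg_le uM => //; exact: itg_cst. Qed.

Lemma cmeasD u v : cmeas u -> cmeas v -> cmeas (fun w => u w + v w).
Proof.
move=> [a b] [a' b']; split.
  by under eq_fun do rewrite ReD; exact: measurable_funD.
by under eq_fun do rewrite ImD; exact: measurable_funD.
Qed.

Lemma cmeasM u v : cmeas u -> cmeas v -> cmeas (fun w => u w * v w).
Proof.
move=> [a b] [a' b']; split.
  by under eq_fun do rewrite ReM; apply: measurable_funB; exact: measurable_funM.
by under eq_fun do rewrite ImM; apply: measurable_funD; exact: measurable_funM.
Qed.

Lemma cmeas_cst (c : C) : cmeas (fun=> c).
Proof. by split. Qed.

Lemma cmeas_Cx h : measurable_fun setT h -> cmeas (fun w => Cx (h w)).
Proof. by split. Qed.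

Lemma cmeas_nat (N : T -> nat) (g : nat -> C) : measurable_fun setT N ->
  cmeas (fun w => g (N w)).
Proof.
move=> mN; split.
  exact: (@measurableT_comp _ _ _ _ _ _ (fun n => Re (g n)) _ N).
exact: (@measurableT_comp _ _ _ _ _ _ (fun n => Im (g n)) _ N).
Qed.

Lemma citgD u v : citg u -> citg v -> citg (fun w => u w + v w).
Proof.
move=> [a b] [a' b']; split.
  by under [X in itg X]eq_fun do rewrite ReD; exact: itgD.
by under [X in itg X]eq_fun do rewrite ImD; exact: itgD.
Qed.

Lemma citgZ (c : C) u : citg u -> citg (fun w => c * u w).
Proof.
move=> [a b]; split.
  by under [X in itg X]eq_fun do rewrite ReM; apply: itgB; exact: itgZ.
by under [X in itg X]eq_fun do rewrite ImM; apply: itgD; exact: itgZ.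
Qed.

Lemma citgB u v : citg u -> citg v -> citg (fun w => u w - v w).
Proof.
move=> a b; have := citgD a (citgZ (-1) b).
by congr citg; apply/funext => w; rewrite mulN1r.
Qed.

Lemma citg_cst (c : C) : citg (fun=> c).
Proof. by split; exact: itg_cst. Qed.

Lemma citg_Cx h : itg h -> citg (fun w => Cx (h w)).
Proof. by split => //; exact: itg_cst. Qed.

Lemma CED u v : citg u -> citg v -> CE (fun w => u w + v w) = CE u + CE v.
Proof.
move=> [a b] [a' b']; apply/eqP; rewrite eq_complex /=; apply/andP; split; apply/eqP.
  by under eq_Ex do rewrite ReD; exact: ExD.
by under eq_Ex do rewrite ImD; exact: ExD.
Qed.

Lemma CEZ (c : C) u : citg u -> CE (fun w => c * u w) = c * CE u.
Proof.
move=> [a b]; apply/eqP; rewrite eq_complex ReM ImM /=; apply/andP; split; apply/eqP.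
  by under eq_Ex do rewrite ReM; rewrite ExB ?ExZ//; exact: itgZ.
by under eq_Ex do rewrite ImM; rewrite ExD ?ExZ//; exact: itgZ.
Qed.

Lemma CEB u v : citg u -> citg v -> CE (fun w => u w - v w) = CE u - CE v.
Proof.
move=> a b; rewrite -[in RHS]mulN1r -CEZ// -CED//; last exact: citgZ.
by apply: eq_CE => w; rewrite mulN1r.
Qed.

Lemma CE_cst (c : C) : CE (fun=> c) = c.
Proof. by rewrite /CE !Ex_cst; case: c. Qed.

Lemma CE_Cx h : CE (fun w => Cx (h w)) = Cx (Ex h).
Proof. by rewrite /CE /= Ex_cst. Qed.

Lemma CE_sum (I : Type) (s : seq I) (F : I -> T -> C) :
  (forall i, citg (F i)) -> CE (fun w => \sum_(i <- s) F i w) = \sum_(i <- s) CE (F i).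
Proof.
move=> iF; elim: s => [|i s ih].
  rewrite big_nil -[RHS](CE_cst 0); apply: eq_CE => w; exact: big_nil.
rewrite big_cons -ih -CED//; first by apply: eq_CE => w; exact: big_cons.
elim: s {ih} => [|j s ih].
  by under [X in citg X]eq_fun do rewrite big_nil; exact: citg_cst.
by under [X in citg X]eq_fun do rewrite big_cons; exact: citgD.
Qed.

(** Multiplying by the conjugate of the expectation turns its squared modulus into the real part of
    an expectation. This gives the constant 1, which matters because bounds such as |f(z)| <= f(|z|)
    are iterated. *)
Lemma normc_CE_le u h : citg u -> itg h -> (forall w, normc (u w) <= h w) ->
  normc (CE u) <= Ex h.
Proof.
move=> iu ih uh; have h0 w : 0 <= h w := le_trans (normc_ge0 _) (uh w).
have [->|c0] := eqVneq (normc (CE u)) 0; first exact: Ex_ge0.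
have cp : 0 < normc (CE u) by rewrite lt_def c0 normc_ge0.
rewrite -(ler_pM2l cp) -expr2 -ExZ// normc_sqr.
pose c := Re (CE u) +i* - Im (CE u).
have -> : Re (CE u) ^+ 2 + Im (CE u) ^+ 2 = Re (c * CE u).
  by rewrite ReM /c /=; ring.
rewrite -CEZ//= le_Ex//; [by have [] := citgZ c iu|exact: itgZ|] => w.
rewrite (le_trans (ler_norm _))// (le_trans (le_Re_normc _))// normcM.
have -> : normc c = normc (CE u) by rewrite /c /CE /= sqrrN.
by rewrite ler_wpM2l ?normc_ge0.
Qed.

Lemma normc_CE_le_cst u M : cmeas u -> (forall w, normc (u w) <= M) -> normc (CE u) <= M.
Proof.
move=> mu uM; rewrite -[leRHS]Ex_cst normc_CE_le//; first exact: citg_bounded uM.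
exact: itg_cst.
Qed.

Lemma Ex_dct (h_ : nat -> T -> R) h M : (forall n, measurable_fun setT (h_ n)) ->
  measurable_fun setT h -> (forall n w, `|h_ n w| <= M) ->
  {ae P, forall w, h_ ^~ w @ \oo --> h w} -> Ex (h_ n) @[n --> \oo] --> Ex h.
Proof.
move=> mh_ mh hM hh.
have [||||| i _ cv] := @dominated_convergence _ _ _ P setT measurableT
  (fun n w => (h_ n w)%:E) (EFin \o h) (fun=> M%:E).
- by move=> n; exact/measurable_EFinP.
- exact/measurable_EFinP.
- apply: filterS hh => w hw _ /=; apply: cvg_EFin => //; exact: nearW.
- exact: itg_cst.
- by apply: aeW => w n _; rewrite lee_fin.
apply: fine_cvg; rewrite /Ex /Rintegral fineK//.
exact: integrable_fin_num.
Qed.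

End expectation.

(** * Convergence of complex sequences, componentwise *)

Section complex_convergence.
Context {R : realType}.
Local Notation C := (complex R).
Implicit Types (u v : nat -> C) (k l : C).

Definition ccvg u l :=
  Re (u n) @[n --> \oo] --> Re l /\ Im (u n) @[n --> \oo] --> Im l.

Lemma ccvg_unique u k l : ccvg u k -> ccvg u l -> k = l.
Proof.
move=> [a b] [a' b']; apply/eqP; rewrite eq_complex.
by rewrite (cvg_unique _ a a')// (cvg_unique _ b b')// !eqxx.
Qed.

Lemma ccvg_cst l : ccvg (fun=> l) l.
Proof. by split; exact: cvg_cst. Qed.

Lemma ccvgD u v k l : ccvg u k -> ccvg v l -> ccvg (fun n => u n + v n) (k + l).
Proof.
move=> [a b] [a' b']; split; rewrite ?ReD ?ImD.
  by under eq_fun do rewrite ReD; exact: cvgD.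
by under eq_fun do rewrite ImD; exact: cvgD.
Qed.

Lemma ccvgM u v k l : ccvg u k -> ccvg v l -> ccvg (fun n => u n * v n) (k * l).
Proof.
move=> [a b] [a' b']; split; rewrite ?ReM ?ImM.
  by under eq_fun do rewrite ReM; apply: cvgB; exact: cvgM.
by under eq_fun do rewrite ImM; apply: cvgD; exact: cvgM.
Qed.

Lemma ccvgN u k : ccvg u k -> ccvg (fun n => - u n) (- k).
Proof.
move=> h; have := ccvgM (ccvg_cst (-1)) h.
by rewrite mulN1r; under eq_fun do rewrite mulN1r.
Qed.

Lemma ccvgB u v k l : ccvg u k -> ccvg v l -> ccvg (fun n => u n - v n) (k - l).
Proof. by move=> a b; exact: (ccvgD a (ccvgN b)). Qed.

Lemma ccvgX u k m : ccvg u k -> ccvg (fun n => u n ^+ m) (k ^+ m).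
Proof.
move=> uk; elim: m => [|m ih]; first exact: ccvg_cst.
by rewrite exprS; under eq_fun do rewrite exprS; exact: ccvgM.
Qed.

Lemma ccvg_Cx (x : nat -> R) (y : R) : x @ \oo --> y -> ccvg (fun n => Cx (x n)) (Cx y).
Proof. by move=> xy; split => //; exact: cvg_cst. Qed.

Lemma ccvg_shift u l m : ccvg u l -> ccvg (fun n => u (n + m)%N) l.
Proof.
by move=> [a b]; split; [have := cvg_shiftn m (fun n => Re (u n)) _|have := cvg_shiftn m (fun n => Im (u n)) _] => ->.
Qed.

Lemma ccvgP u l : normc (u n - l) @[n --> \oo] --> (0 : R) -> ccvg u l.
Proof.
move=> h; split; apply/cvgrPdist_le => e e0.
  move/cvgrPdist_le : h => /(_ e e0); apply: filterS => n.
  rewrite sub0r normrN ger0_norm ?normc_ge0//; apply: le_trans.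
  by rewrite normcB (le_trans _ (le_Re_normc _))// ReD ReN.
move/cvgrPdist_le : h => /(_ e e0); apply: filterS => n.
rewrite sub0r normrN ger0_norm ?normc_ge0//; apply: le_trans.
by rewrite normcB (le_trans _ (le_Im_normc _))// ImD ImN.
Qed.

Lemma ccvg_dist u l : ccvg u l -> normc (u n - l) @[n --> \oo] --> (0 : R).
Proof.
move=> h; have [a b] := ccvgB h (ccvg_cst l).
apply: (@squeeze_cvgr _ _ _ _ (fun=> 0) (fun n => `|Re (u n - l)| + `|Im (u n - l)|)).
- by near=> n; rewrite normc_ge0 normc_le_ReIm.
- exact: cvg_cst.
- move: a b; rewrite subrr /= => a b.
  have := cvgD (cvg_norm a) (cvg_norm b).
  by rewrite normr0 addr0; apply.
Unshelve. all: by end_near. Qed.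

Lemma ccvg_normc u l : ccvg u l -> normc (u n) @[n --> \oo] --> normc l.
Proof.
move=> /ccvg_dist h; apply/cvgrPdist_le => e e0.
move/cvgrPdist_le : h => /(_ e e0); apply: filterS => n.
rewrite sub0r normrN ger0_norm ?normc_ge0//; apply: le_trans.
by rewrite distrC normc_dist.
Qed.

Lemma ccvg_normc_le u l c (b : nat -> R) (B : R) : ccvg u l ->
  (\forall n \near \oo, normc (u n - c) <= b n) -> b @ \oo --> B ->
  normc (l - c) <= B.
Proof.
move=> ul ub bB; have h := ccvg_normc (ccvgB ul (ccvg_cst c)).
by apply: ler_cvg_to h bB ub.
Qed.

Lemma ccvg_cauchy u (b : nat -> R) : (forall n, normc (u n.+1 - u n) <= b n) ->
  cvgn (series b) -> exists l, ccvg u l.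
Proof.
move=> ub cb.
have key (v : nat -> R) : (forall n, `|v n.+1 - v n| <= b n) -> cvgn v.
  move=> vb; have cs : cvgn (series (fun n => v n.+1 - v n)).
    apply: normed_cvg; apply: series_le_cvg cb => [n|n|n]; first exact: normr_ge0.
      by apply: le_trans (vb n); exact: normr_ge0.
    exact: vb.
  have -> : v = (fun n => v 0%N + series (fun n => v n.+1 - v n) n).
    by apply/funext => n; rewrite seriesEnat/= telescope_sumr// addrC subrK.
  by apply: is_cvgD => //; exact: is_cvg_cst.
have /cvg_ex [x hx] : cvgn (fun n => Re (u n)).
  by apply: key => n; rewrite -ReN -ReD (le_trans (le_Re_normc _)).
have /cvg_ex [y hy] : cvgn (fun n => Im (u n)).
  by apply: key => n; rewrite -ImN -ImD (le_trans (le_Im_normc _)).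
by exists (Complex x y).
Qed.

End complex_convergence.

(** * Dominated convergence and decomposition along a discrete variable *)

Section expectation_convergence.
Context d (T : measurableType d) (R : realType) (P : probability T R).
Local Notation C := (complex R).
Implicit Types (u v : T -> C).

Definition cbdd u := cmeas u /\ exists M : R, forall w, normc (u w) <= M.

Lemma cbdd_citg u : cbdd u -> citg P u.
Proof. by move=> [mu [M uM]]; exact: citg_bounded uM. Qed.

Lemma cbddM u v : cbdd u -> cbdd v -> cbdd (fun w => u w * v w).
Proof.
move=> [mu [M uM]] [mv [N vN]]; split; first exact: cmeasM.
by exists (M * N) => w; rewrite normcM ler_pM ?normc_ge0.
Qed.

Lemma cbdd_cst (c : C) : cbdd (fun=> c).
Proof. by split; [exact: cmeas_cst|exists (normc c)]. Qed.

Lemma cbdd_nat (N : T -> nat) (g : nat -> C) M : measurable_fun setT N ->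
  (forall n, normc (g n) <= M) -> cbdd (fun w => g (N w)).
Proof. by move=> mN gM; split; [exact: cmeas_nat|exists M]. Qed.

Lemma cbdd_prod (I : Type) (s : seq I) (F : I -> T -> C) :
  (forall i, cbdd (F i)) -> cbdd (fun w => \prod_(i <- s) F i w).
Proof.
move=> bF; elim: s => [|i s ih].
  by under [X in cbdd X]eq_fun do rewrite big_nil; exact: cbdd_cst.
by under [X in cbdd X]eq_fun do rewrite big_cons; exact: cbddM.
Qed.

Lemma normc_bool (b : bool) : normc (b%:R : C) <= 1.
Proof. by case: b; rewrite ?normc1 ?normc0. Qed.

Lemma CE_dct (u_ : nat -> T -> C) u M : (forall n, cmeas (u_ n)) -> cmeas u ->
  (forall n w, normc (u_ n w) <= M) ->
  {ae P, forall w, ccvg (u_ ^~ w) (u w)} -> ccvg (fun n => CE P (u_ n)) (CE P u).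
Proof.
move=> mu_ [ma mb] uM uu; split => /=.
  apply: (@Ex_dct _ _ _ _ _ _ M) => //.
  - by move=> n; have [] := mu_ n.
  - by move=> n w; exact: le_trans (le_Re_normc _) (uM n w).
  - by apply: filterS uu => w [].
apply: (@Ex_dct _ _ _ _ _ _ M) => //.
- by move=> n; have [] := mu_ n.
- by move=> n w; exact: le_trans (le_Im_normc _) (uM n w).
- by apply: filterS uu => w [].
Qed.

Lemma CE_nat_cvg (N : T -> nat) u : measurable_fun setT N -> cbdd u ->
  ccvg (fun n => \sum_(0 <= k < n) CE P (fun w => u w * (N w == k)%:R)) (CE P u).
Proof.
move=> mN [mu [M uM]].
have bN k : cbdd (fun w => u w * (N w == k)%:R).
  apply: cbddM; first by split => //; exists M.
  by apply: (@cbdd_nat N (fun m => (m == k)%:R) 1) => // n; exact: normc_bool.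
have E n w : \sum_(0 <= k < n) u w * (N w == k)%:R = u w * (N w < n)%:R.
  rewrite -big_distrr/=; congr (_ * _).
  case: ltnP => h.
    rewrite (bigD1_seq (N w)) ?iota_uniq ?mem_index_iota//= eqxx big1 ?addr0// => i.
    by rewrite eq_sym => /negbTE->.
  rewrite big_nat big1// => i /= ilt; case: eqP => // e.
  by move: ilt; rewrite -e ltnNge h.
have -> : (fun n => \sum_(0 <= k < n) CE P (fun w => u w * (N w == k)%:R)) =
    (fun n => CE P (fun w => u w * (N w < n)%:R)).
  apply/funext => n; rewrite -CE_sum; last by move=> k; exact: cbdd_citg.
  by apply: eq_CE => w; rewrite E.
apply: (@CE_dct _ _ M) => //.
- move=> n; apply: cmeasM => //; exact: (cmeas_nat (fun m => (m < n)%:R)).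
- move=> n w; rewrite normcM -[leRHS]mulr1 ler_pM ?normc_ge0 ?normc_bool//.
- apply: aeW => w; apply: ccvgP; apply: cvg_near_cst; exists (N w).+1 => // n /= h.
  by rewrite h mulr1 subrr normc0.
Qed.

(** Conditioning on a discrete variable in elementary form: equality may be checked on each event
    [N w == k]. The independence arguments for the process run through this lemma. *)
Lemma CE_eq_nat (N : T -> nat) u v : measurable_fun setT N -> cbdd u -> cbdd v ->
  (forall k, CE P (fun w => u w * (N w == k)%:R) = CE P (fun w => v w * (N w == k)%:R)) ->
  CE P u = CE P v.
Proof.
move=> mN bu bv uv; apply: ccvg_unique (CE_nat_cvg mN bu) _.
by under eq_fun do under eq_bigr do rewrite uv; exact: CE_nat_cvg.
Qed.

Lemma CE_indic (A : set T) (b : T -> bool) : measurable A -> (forall w, b w <-> A w) ->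
  CE P (fun w => (b w)%:R) = Cx (fine (P A)).
Proof.
move=> mA bA; have -> : CE P (fun w => (b w)%:R) = CE P (fun w => Cx (\1_A w)).
  apply: eq_CE => w; rewrite indicE; congr (_ : C).
  have -> : (w \in A) = b w by apply/idP/idP; rewrite inE => /bA.
  by case: (b w).
by rewrite CE_Cx /Ex /Rintegral integral_indic// setIT.
Qed.

Lemma CE_law (N N' : {RV P >-> nat}) (g : nat -> C) M : same_law N N' ->
  (forall n, normc (g n) <= M) ->
  CE P (fun w => g (N w)) = CE P (fun w => g (N' w)).
Proof.
move=> NN' gM.
have bg (L : {RV P >-> nat}) : cbdd (fun w => g (L w)) by exact: cbdd_nat gM.
apply: ccvg_unique (CE_nat_cvg (N := N) _ (bg N)) _ => //.
have key (L : {RV P >-> nat}) k :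
    CE P (fun w => g (L w) * (L w == k)%:R) = g k * Cx (fine (P (L @^-1` [set k]))).
  rewrite -(@CE_indic _ (fun w => L w == k))//; last 2 first.
    by rewrite -[X in measurable X]setTI; exact: measurable_funPT.
    by move=> w; split => [/eqP|->].
  rewrite -CEZ; last first.
    apply: (cbdd_citg (@cbdd_nat L (fun m => (m == k)%:R) 1 _ _)) => // n.
    exact: normc_bool.
  by apply: eq_CE => w; case: eqP => [->//|_]; rewrite !mulr0.
under eq_fun do under eq_bigr do rewrite key.
have e k : P (N @^-1` [set k]) = P (N' @^-1` [set k]) by exact: (NN' [set k]).
under eq_fun do under eq_bigr do rewrite e -key.
exact: CE_nat_cvg.
Qed.

End expectation_convergence.

(** The preimage splits over the countably many values of the random index; this makes sums with a
    random number of terms measurable. *)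
Lemma measurable_fun_nat_comp d (T : measurableType d) (F : nat -> T -> nat) (N : T -> nat) :
  measurable_fun setT N -> (forall j, measurable_fun setT (F j)) ->
  measurable_fun setT (fun w => F (N w) w).
Proof.
move=> mN mF _ Y mY; rewrite setTI.
have -> : (fun w => F (N w) w) @^-1` Y =
    \bigcup_j ((N @^-1` [set j]) `&` (F j @^-1` Y)).
  apply/seteqP; split => [w /= Yw|w [j _ [/= <-]]//].
  by exists (N w).
apply: bigcup_measurable => j _; apply: measurableI.
  by rewrite -[X in measurable X]setTI; exact: mN.
by rewrite -[X in measurable X]setTI; exact: mF.
Qed.

(** * Independence and generating functions for the branching process *)

Section branching_with_immigration.
Context d (T : measurableType d) (R : realType) (P : probability T R).
Variables (X Y : {RV P >-> nat}).
Variables (Xs : nat -> nat -> {RV P >-> nat}) (Ys : nat -> {RV P >-> nat}).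
Hypothesis Xs_law : forall n i, same_law (Xs n i) X.
Hypothesis Ys_law : forall j, same_law (Ys j) Y.
Hypothesis indep : mutually_independent P (joint_family Xs Ys).
Local Notation C := (complex R).
Local Notation K := (nat * nat + nat)%type.
Local Notation V := (joint_family Xs Ys).
Implicit Types (S : pred K) (s l : seq K) (u : T -> C).

Let mV k : measurable_fun setT (V k).
Proof. by case: k => [[n i]|j] /=; exact: measurable_funPT. Qed.

Lemma cbdd_V k (g : nat -> C) M : (forall n, normc (g n) <= M) ->
  cbdd (fun w => g (V k w)).
Proof. by move=> gM; apply: cbdd_nat gM. Qed.

Let cbdd_ind k (a : pred nat) : cbdd (fun w => (a (V k w))%:R : C).
Proof. by apply: (@cbdd_V k (fun n => (a n)%:R) 1) => n; exact: normc_bool. Qed.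

Let cbdd_inds s (a : K -> pred nat) : cbdd (fun w => \prod_(i <- s) ((a i (V i w))%:R : C)).
Proof. by apply: cbdd_prod => i; exact: cbdd_ind. Qed.

(** Independence of [u] from the variables indexed by [S], tested on finite products of indicators;
    for [u = 1] it is mutual independence. Stated with expectations, it is stable under multiplying
    [u] by a function of one more variable. *)
Definition free_of S u := forall s (a : K -> pred nat), uniq s -> all S s ->
  CE P (fun w => u w * \prod_(i <- s) (a i (V i w))%:R) =
  CE P u * \prod_(i <- s) CE P (fun w => (a i (V i w))%:R).

Lemma free_of_sub S S' u : (forall k, S' k -> S k) -> free_of S u -> free_of S' u.
Proof. by move=> SS' fu s a us /allP sS; apply: fu => //; apply/allP => i /sS /SS'. Qed.

Lemma free_of_cst1 : free_of predT (fun=> 1).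
Proof.
move=> s a us _; rewrite CE_cst mul1r.
have mA i : measurable ([set n | a i n] : set nat) by [].
have := indep us mA => indA.
have mVA i : measurable (V i @^-1` [set n | a i n]).
  by rewrite -[X in measurable X]setTI; exact: mV.
have E i : CE P (fun w => (a i (V i w))%:R) = Cx (fine (P (V i @^-1` [set n | a i n]))).
  exact: CE_indic.
under eq_bigr do rewrite E.
have -> : CE P (fun w => 1 * \prod_(i <- s) ((a i (V i w))%:R : C)) =
    CE P (fun w => (all (fun i => a i (V i w)) s)%:R).
  apply: eq_CE => w; rewrite mul1r.
  elim: (s) => [|i l ih]; first by rewrite big_nil.
  by rewrite big_cons ih /= -natrM mulnb.
rewrite (CE_indic P (A := \bigcap_(i in [set` s]) (V i @^-1` [set n | a i n]))); last 2 first.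
- by apply: fin_bigcap_measurable => //; exact: finite_seq.
- by move=> w; split => [/allP h i /h|h]; [|apply/allP => i /h].
rewrite indA; elim: (s) => [|i l ih]; first by rewrite !big_nil.
rewrite !big_cons fineM ?fin_num_measure//; first by rewrite CxM ih.
elim: (l) => [|j l' ihl]; first by rewrite big_nil.
by rewrite big_cons fin_numM// fin_num_measure.
Qed.

(** On the event that V i equals k the factor g(V i) is a constant, and the indicator of this event
    joins the finite product that [free_of] allows. The index i is then used up, so it leaves
    [S]. *)
Lemma free_of_mul S u i (g : nat -> C) M : cbdd u -> free_of S u -> S i ->
    (forall n, normc (g n) <= M) ->
  free_of (fun k => S k && (k != i)) (fun w => u w * g (V i w)) /\
  CE P (fun w => u w * g (V i w)) = CE P u * CE P (fun w => g (V i w)).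
Proof.
move=> bu fu Si gM.
have bg := cbdd_V i gM.
have key s (a : K -> pred nat) : uniq s -> all (fun k => S k && (k != i)) s ->
    CE P (fun w => u w * g (V i w) * \prod_(i <- s) (a i (V i w))%:R) =
    CE P u * \prod_(i <- s) CE P (fun w => (a i (V i w))%:R) * CE P (fun w => g (V i w)).
  move=> us /allP sS; set c := CE P u * _.
  rewrite -CEZ; last exact: cbdd_citg.
  apply: (CE_eq_nat (mV i)).
  - by apply: cbddM; [exact: cbddM|exact: cbdd_inds].
  - by apply: cbddM => //; exact: cbdd_cst.
  move=> k; pose a' j : pred nat := if j == i then (pred1 k : pred nat) else a j.
  have uis : uniq (i :: s).
    by rewrite /= us andbT; apply/negP => /sS; rewrite eqxx andbF.
  have iS : all S (i :: s) by rewrite /= Si; apply/allP => j /sS /andP[].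
  have aE j : j \in s -> a' j = a j.
    by move=> /sS /andP[_ /negbTE]; rewrite /a' => ->.
  have := fu (i :: s) a' uis iS; rewrite big_cons.
  have -> : \prod_(j <- s) CE P (fun w => (a' j (V j w))%:R) =
      \prod_(j <- s) CE P (fun w => (a j (V j w))%:R).
    by apply: eq_big_seq => j /aE ->.
  have -> : CE P (fun w => u w * \prod_(j <- i :: s) (a' j (V j w))%:R) =
      CE P (fun w => u w * \prod_(j <- s) (a j (V j w))%:R * (V i w == k)%:R).
    apply: eq_CE => w; rewrite big_cons {1}/a' eqxx /= -mulrA; congr (_ * _).
    rewrite mulrC; congr (_ * _); apply: eq_big_seq => j /aE ->//.
  move=> e.
  transitivity (g k * CE P (fun w => u w * \prod_(j <- s) (a j (V j w))%:R * (V i w == k)%:R)).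
    rewrite -CEZ; last first.
      apply: cbdd_citg; apply: cbddM; last exact: (cbdd_ind i (pred1 k)).
      by apply: cbddM => //; exact: cbdd_inds.
    by apply: eq_CE => w; case: eqP => [->|_]; rewrite ?mulr0// !mulr1; ring.
  rewrite e {1}/a' eqxx.
  transitivity (g k * c * CE P (fun w => (V i w == k)%:R)).
    by rewrite /c /=; ring.
  rewrite -(CEZ (g k * c) (cbdd_citg P (cbdd_ind i (pred1 k)))).
  by apply: eq_CE => w /=; case: eqP => [->|_]; rewrite ?mulr0// !mulr1 mulrC.
have e0 : CE P (fun w => u w * g (V i w)) = CE P u * CE P (fun w => g (V i w)).
  have := key [::] (fun=> predT) isT isT; rewrite big_nil mulr1 => <-.
  by apply: eq_CE => w; rewrite big_nil mulr1.
split => // s a us sS; rewrite key// e0; ring.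
Qed.

Lemma CE_free_prod S u l (G : K -> nat -> C) : cbdd u -> free_of S u ->
    uniq l -> all S l -> (forall k n, normc (G k n) <= 1) ->
  CE P (fun w => u w * \prod_(i <- l) G i (V i w)) =
  CE P u * \prod_(i <- l) CE P (fun w => G i (V i w)).
Proof.
move=> + + + + G1; elim: l S u => [|i l ih] S u bu fu.
  by rewrite big_nil mulr1 => _ _; apply: eq_CE => w; rewrite big_nil mulr1.
move=> /= /andP[il ul] /andP[Si /allP Sl].
have [f' e] := free_of_mul bu fu Si (G1 i).
rewrite big_cons mulrA -e -(ih _ _ _ f')//.
- by apply: eq_CE => w; rewrite big_cons mulrA.
- by apply: cbddM => //; apply: cbdd_V (G1 i).
- apply/allP => j jl; rewrite Sl//=; apply: contraNneq il => <-//.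
Qed.

(** Induction on [l] with [g] arbitrary: on the event that the first variable equals k, the rest of
    the sum is composed with the shifted function n |-> g (b i k + n). *)
Lemma free_of_sum S u l (b : K -> nat -> nat) (g : nat -> C) M : cbdd u ->
    free_of S u -> uniq l -> all S l -> (forall n, normc (g n) <= M) ->
  free_of (fun k => S k && (k \notin l))
    (fun w => u w * g (\sum_(i <- l) b i (V i w))%N).
Proof.
move=> bu fu; elim: l g => [|i l ih] g.
  move=> _ _ gM s a us sS; under eq_CE do rewrite big_nil mulrAC.
  have sS' : all S s by apply: sub_all sS => k /andP[].
  transitivity (g 0%N * CE P (fun w => u w * \prod_(i <- s) (a i (V i w))%:R)).
    rewrite -CEZ; last by apply: cbdd_citg; apply: cbddM => //; exact: cbdd_inds.
    by apply: eq_CE => w; rewrite mulrC.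
  rewrite fu// mulrA; congr (_ * _).
  rewrite -CEZ; last exact: cbdd_citg.
  by apply: eq_CE => w; rewrite big_nil mulrC.
move=> /= /andP[il ul] /andP[Si lS] gM s a us sS.
have msum (l' : seq K) : measurable_fun setT (fun w => (\sum_(i <- l') b i (V i w))%N).
  elim: l' => [|j l' ihl]; first by under eq_fun do rewrite big_nil; exact: measurable_cst.
  under eq_fun do rewrite big_cons.
  apply: (measurable_fun_nat_comp (F := fun m w => (b j m + \sum_(i <- l') b i (V i w))%N)) => // m.
  by apply: (@measurableT_comp _ _ _ _ _ _ (fun n => (b j m + n)%N)).
have bg : cbdd (fun w => u w * g (\sum_(j <- i :: l) b j (V j w))%N).
  by apply: cbddM => //; apply: cbdd_nat gM.
rewrite mulrC -CEZ; last exact: cbdd_citg.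
set c := \prod_(_ <- _) _.
apply: (CE_eq_nat (mV i)).
- by apply: cbddM => //; exact: cbdd_inds.
- by apply: cbddM => //; exact: cbdd_cst.
move=> k; pose gk n := g (b i k + n)%N.
have gkM n : normc (gk n) <= M by exact: gM.
have fk := ih gk ul lS gkM.
have bk : cbdd (fun w => u w * gk (\sum_(j <- l) b j (V j w))%N).
  by apply: cbddM => //; apply: cbdd_nat gkM.
pose a' j : pred nat := if j == i then (pred1 k : pred nat) else a j.
have sS' j : j \in s -> [&& S j, j != i & j \notin l].
  by move/allP : sS => h /h; rewrite in_cons negb_or.
have uis : uniq (i :: s).
  by rewrite /= us andbT; apply/negP => /sS'; rewrite eqxx andbF.
have aS : all (fun k => S k && (k \notin l)) (i :: s).
  by rewrite /= Si il; apply/allP => j /sS' /and3P[-> _ ->].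
have aE j : j \in s -> a' j = a j.
  by move=> /sS' /and3P[_ /negbTE]; rewrite /a' => ->.
(* The induction hypothesis is used twice, with [i :: s] and with [i] alone; substituting the second
   identity into the first leaves the factor [c] of the variables in [s]. *)
have e1 := fk (i :: s) a' uis aS.
have e2 := fk [:: i] a' isT; rewrite /= Si il in e2; have {}e2 := e2 isT.
move: e1; rewrite big_cons mulrA.
have -> : \prod_(j <- s) CE P (fun w => (a' j (V j w))%:R) = c.
  by apply: eq_big_seq => j /aE ->.
move: e2; rewrite big_seq1 => <- e1.
transitivity (CE P (fun w => u w * gk (\sum_(j <- l) b j (V j w))%N *
    \prod_(j <- i :: s) (a' j (V j w))%:R)).
  apply: eq_CE => w; rewrite !big_cons {1}/a' eqxx /=.
  case: eqP => [->|_]; last by rewrite mulr0 mul0r mulr0.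
  rewrite mulr1 mul1r; congr (_ * _); apply: eq_big_seq => j /aE ->//.
rewrite e1 mulrC -CEZ; last first.
  by apply: cbdd_citg; apply: cbddM => //; exact: cbdd_inds.
apply: eq_CE => w; rewrite big_seq1 big_cons /a' eqxx /=.
by case: eqP => [->|_]; rewrite ?mulr0// !mulr1.
Qed.

Variable c : nat -> nat -> nat.

(* [c n = id] gives the process with immigration; [c 0 = 1] and [c n = 0] for
   [n > 0] give the process without immigration started by one individual. *)
Fixpoint gproc (n : nat) (w : T) : nat :=
  match n with
  | 0 => c 0%N (Ys 0%N w)
  | m.+1 => (\sum_(i < gproc m w) Xs m i w + c m.+1 (Ys m.+1 w))%N
  end.

Lemma measurable_gproc n : measurable_fun setT (gproc n).
Proof.
elim: n => [|n ih] /=; first by apply: measurableT_comp.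
have msum j : measurable_fun setT (fun w => (\sum_(i < j) Xs n i w)%N).
  elim: j => [|j ihj]; first by under eq_fun do rewrite big_ord0; exact: measurable_cst.
  under eq_fun do rewrite big_ord_recr /=.
  apply: (measurable_fun_nat_comp (F := fun m w => (m + Xs n j w)%N)) => // m.
  exact: (@measurableT_comp _ _ _ _ _ _ (fun k => (m + k)%N)).
apply: (measurable_fun_nat_comp (F := fun j w => (\sum_(i < j) Xs n i w + c n.+1 (Ys n.+1 w))%N)) => // j.
apply: (measurable_fun_nat_comp (F := fun m w => (m + c n.+1 (Ys n.+1 w))%N)) => // m.
exact: (@measurableT_comp _ _ _ _ _ _ (fun k => (m + c n.+1 k)%N)).
Qed.

(** The variables on which generation n does not depend. Those consumed by the next generation, when
    generation n has size j, are listed in [gen_list n j]. *)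
Definition future n : pred K := fun k =>
  match k with inl (m, _) => (n <= m)%N | inr j => (n < j)%N end.

Let gen_list n j : seq K := inr n.+1 :: [seq inl (n, i) | i <- iota 0 j].

Let gen_list_uniq n j : uniq (gen_list n j).
Proof.
rewrite /gen_list /= map_inj_uniq ?iota_uniq ?andbT; last by move=> x y [].
by apply/negP => /mapP[].
Qed.

Let gen_list_future n j : all (future n) (gen_list n j).
Proof. by rewrite /gen_list /= ltnS leqnn /=; apply/allP => k /mapP[i _ ->] /=. Qed.

(** The number of summands forming generation n + 1 is random. On the event that generation n has
    size k it becomes a sum over the fixed list [gen_list n k], to which [free_of_sum] applies, this
    event being free of later variables by induction. *)
Lemma free_gproc n j : free_of (future n) (fun w => (gproc n w == j)%:R).
Proof.
elim: n j => [|n ih] j.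
  have := (free_of_mul (cbdd_cst _ 1) free_of_cst1 (i := inr 0%N) isT
    (g := fun m => (c 0%N m == j)%:R) (fun=> normc_bool _ _)).1.
  move=> h; apply: free_of_sub (_ : free_of _ _) => /=; last first.
    by move: h; congr free_of; apply/funext => w; rewrite mul1r.
  by move=> [[]|[]].
move=> s a us sS.
have bZ k m : cbdd (fun w => (gproc k w == m)%:R : C).
  apply: (cbdd_nat (measurable_gproc k) (g := fun p => (p == m)%:R) (M := 1)) => p.
  exact: normc_bool.
rewrite mulrC -CEZ; last exact: cbdd_citg.
set cc := \prod_(_ <- _) _.
apply: (CE_eq_nat (measurable_gproc n)).
- by apply: cbddM => //; exact: cbdd_inds.
- by apply: cbddM => //; exact: cbdd_cst.
move=> k.
pose b (i : K) : nat -> nat := match i with inl _ => id | inr m => c m end.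
have sumE w : (\sum_(i <- gen_list n k) b i (V i w) =
    \sum_(i < k) Xs n i w + c n.+1 (Ys n.+1 w))%N.
  by rewrite big_cons /= addnC big_map -{1}(subn0 k) big_mkord.
pose g m : C := (m == j)%:R.
have g1 m : normc (g m) <= 1 by exact: normc_bool.
have fk := free_of_sum b (bZ n k) (ih k) (gen_list_uniq n k) (gen_list_future n k) g1.
have bk : cbdd (fun w => (gproc n w == k)%:R * g (\sum_(i <- gen_list n k) b i (V i w))%N).
  apply: cbddM => //; under [X in cbdd X]eq_fun do rewrite sumE.
  apply: cbdd_nat g1.
  apply: (measurable_fun_nat_comp (F := fun m w => (\sum_(i < k) Xs n i w + c n.+1 m)%N)) => // m.
  elim: (k) => [|j' ihj]; first by under eq_fun do rewrite big_ord0; exact: measurable_cst.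
  under eq_fun do rewrite big_ord_recr /=.
  apply: (measurable_fun_nat_comp (F := fun p w => (\sum_(i < j') Xs n i w + p + c n.+1 m)%N)) => // p.
  under eq_fun do rewrite -addnAC.
  exact: (@measurableT_comp _ _ _ _ _ _ (fun q => (q + p)%N)).
have sF : all (fun k0 => future n k0 && (k0 \notin gen_list n k)) s.
  apply/allP => i /(allP sS); case: i => [[m i]|m] /= h.
    rewrite (leq_trans _ h)//= in_cons /=; apply/negP => /mapP[i' _ [e _]].
    by rewrite e ltnn in h.
  rewrite (ltn_trans _ h)//= in_cons negb_or; apply/andP; split.
    by apply/negP => /eqP[e]; rewrite e ltnn in h.
  by apply/negP => /mapP[].
transitivity (CE P (fun w => (gproc n w == k)%:R * g (\sum_(i <- gen_list n k) b i (V i w))%N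
    * \prod_(i <- s) (a i (V i w))%:R)).
  apply: eq_CE => w; rewrite sumE /g /=; case: (gproc n w =P k) => [->|_]; last by rewrite mulr0 !mul0r.
  by rewrite mulr1 mul1r.
rewrite fk// mulrC -CEZ; last exact: cbdd_citg.
apply: eq_CE => w; rewrite sumE /g /=; case: (gproc n w =P k) => [->|_]; last by rewrite !mul0r !mulr0.
by rewrite mulr1 mul1r.
Qed.

(** The branching property: on the event that generation n has size k, the next one is a sum of k
    independent copies of X and one immigration term, so z to its power has mean q f(z)^k there. *)
Lemma CE_gproc_S n (z : C) : normc z <= 1 ->
  CE P (fun w => z ^+ gproc n.+1 w) =
  CE P (fun w => z ^+ c n.+1 (Y w)) * CE P (fun w => CE P (fun w => z ^+ X w) ^+ gproc n w).
Proof.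
move=> z1.
have zn k : normc (z ^+ k) <= 1 by rewrite normc_X exprn_ile1 ?normc_ge0.
set f := CE P (fun w => z ^+ X w).
have f1 : normc f <= 1.
  by apply: normc_CE_le_cst => //; apply: cmeas_nat.
have fn k : normc (f ^+ k) <= 1 by rewrite normc_X exprn_ile1 ?normc_ge0.
have bZ k m : cbdd (fun w => (gproc k w == m)%:R : C).
  apply: (cbdd_nat (measurable_gproc k) (g := fun p => (p == m)%:R) (M := 1)) => p.
  exact: normc_bool.
set q := CE P (fun w => z ^+ c _ _).
have bf : cbdd (fun w => f ^+ gproc n w).
  exact: (cbdd_nat (measurable_gproc n) (g := fun p => f ^+ p) (M := 1)).
rewrite -CEZ; last exact: cbdd_citg.
apply: (CE_eq_nat (measurable_gproc n)).
- exact: (cbdd_nat (measurable_gproc n.+1) (g := fun p => z ^+ p) (M := 1)).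
- by apply: cbddM => //; exact: cbdd_cst.
move=> k.
pose G (i : K) m : C := match i with inl _ => z ^+ m | inr p => z ^+ c p m end.
have G1 i m : normc (G i m) <= 1 by case: i => *; exact: zn.
have := CE_free_prod (bZ n k) (free_gproc k) (gen_list_uniq n k) (gen_list_future n k) G1.
have -> : \prod_(i <- gen_list n k) CE P (fun w => G i (V i w)) = q * f ^+ k.
  rewrite big_cons /=; congr (_ * _).
    by apply: (CE_law (g := fun m => z ^+ c n.+1 m) (M := 1)).
  rewrite big_map -{1}(subn0 k) big_mkord -[in RHS](card_ord k) -prodr_const.
  apply: eq_bigr => i _ /=.
  by apply: (CE_law (g := fun m => z ^+ m) (M := 1)).
rewrite mulrC -CEZ; last exact: cbdd_citg.
move=> e.
transitivity (CE P (fun w => (gproc n w == k)%:R * \prod_(i <- gen_list n k) G i (V i w))).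
  apply: eq_CE => w /=; case: eqP => [->|_]; last by rewrite mulr0 mul0r.
  rewrite mulr1 mul1r big_cons /= exprD mulrC; congr (_ * _).
  rewrite big_map (_ : iota 0 k = index_iota 0 k) ?big_mkord/=; last by rewrite /index_iota subn0.
  by rewrite (big_morph (fun m => z ^+ m) (exprD z) (expr0 z)).
rewrite e; apply: eq_CE => w; case: eqP => [->|_]; last by rewrite !mulr0.
by rewrite !mulr1.
Qed.

End branching_with_immigration.

Lemma exists_expr_ge (R : realType) (a c : R) : 1 < a -> exists K, c <= a ^+ K.
Proof.
move=> a1; have h n : 1 + n%:R * (a - 1) <= a ^+ n.
  elim: n => [|n ih]; first by rewrite mul0r addr0 expr0.
  have n0 : 0 <= n%:R :> R by [].
  have h1 : a * (1 + n%:R * (a - 1)) <= a * a ^+ n by rewrite ler_wpM2l//; lra.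
  have h2 : 0 <= n%:R * (a - 1) ^+ 2 by rewrite mulr_ge0// sqr_ge0.
  by rewrite exprS -natr1; lra.
exists (Num.trunc (c / (a - 1))).+1; apply: le_trans (h _).
have := truncnS_gt (c / (a - 1)); rewrite ltr_pdivrMr ?subr_gt0//; lra.
Qed.

(** * Generating functions of an integer-valued variable *)

Section generating_functions.
Context d (T : measurableType d) (R : realType) (P : probability T R).
Local Notation C := (complex R).
Variables (N : T -> nat) (mN : measurable_fun setT N).
Implicit Types (z : C) (x y r : R).

Definition gf z : C := CE P (fun w => z ^+ N w).
Definition gfR x : R := Ex P (fun w => x ^+ N w).

Lemma gf_Cx x : gf (Cx x) = Cx (gfR x).
Proof. by rewrite -CE_Cx; apply: eq_CE => w; rewrite CxX. Qed.

Lemma cbdd_pow z : normc z <= 1 -> cbdd (fun w => z ^+ N w).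
Proof.
move=> z1; apply: (cbdd_nat (g := fun n => z ^+ n) (M := 1)) => // n.
by rewrite normc_X exprn_ile1 ?normc_ge0.
Qed.

Lemma measurable_natfun (h : nat -> R) : measurable_fun setT (fun w => h (N w)).
Proof. exact: (@measurableT_comp _ _ _ _ _ _ h _ N). Qed.

Lemma itg_pow x : 0 <= x <= 1 -> itg P (fun w => x ^+ N w).
Proof.
move=> /andP[x0 x1]; apply: (@itg_bounded _ _ _ _ _ 1); first exact: (measurable_natfun (fun n => x ^+ n)).
by move=> w; rewrite ger0_norm ?exprn_ge0// exprn_ile1.
Qed.

Lemma normc_gf_le z r : normc z <= r -> r <= 1 -> normc (gf z) <= gfR r.
Proof.
move=> zr r1; have r0 : 0 <= r := le_trans (normc_ge0 z) zr.
apply: normc_CE_le; first by apply/cbdd_citg/cbdd_pow; exact: le_trans zr r1.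
  by apply: itg_pow; rewrite r0.
by move=> w; rewrite normc_X lerXn2r// ?nnegrE ?normc_ge0.
Qed.

Lemma gfR_ge0 x : 0 <= x -> 0 <= gfR x.
Proof. by move=> x0; apply: Ex_ge0 => w; rewrite exprn_ge0. Qed.

Lemma gfR_le x y : 0 <= x -> x <= y -> y <= 1 -> gfR x <= gfR y.
Proof.
move=> x0 xy y1; apply: le_Ex => [||w].
- by apply: itg_pow; rewrite x0 (le_trans xy).
- by apply: itg_pow; rewrite y1 (le_trans x0).
- by rewrite lerXn2r// ?nnegrE// (le_trans x0).
Qed.

Lemma gfR1 : gfR 1 = 1.
Proof. by rewrite -[RHS](Ex_cst P 1); apply: eq_Ex => w; rewrite expr1n. Qed.

Lemma gfR_le1 x : 0 <= x <= 1 -> gfR x <= 1.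
Proof. by move=> /andP[x0 x1]; rewrite -[leRHS]gfR1; exact: gfR_le. Qed.

Lemma normc_gf_le1 z : normc z <= 1 -> normc (gf z) <= 1.
Proof. by move=> z1; rewrite -[leRHS]gfR1; exact: normc_gf_le. Qed.

Lemma gf_lip (z w : C) r : normc z <= r -> normc w <= r -> r < 1 ->
  normc (gf z - gf w) <= normc (z - w) / (1 - r).
Proof.
move=> zr wr r1; have r0 : 0 <= r := le_trans (normc_ge0 z) zr.
have bz : cbdd (fun t => z ^+ N t) by apply/cbdd_pow/(le_trans zr)/ltW.
have bw : cbdd (fun t => w ^+ N t) by apply/cbdd_pow/(le_trans wr)/ltW.
rewrite -CEB; [|exact: cbdd_citg|exact: cbdd_citg].
apply: normc_CE_le_cst; first exact: citg_meas (citgB (cbdd_citg P bz) (cbdd_citg P bw)).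
move=> t; apply: le_trans (normc_powB_le _ zr wr) _.
by rewrite ler_wpM2l ?normc_ge0// natr_geo_le// r0.
Qed.

Lemma gf_cvg (z_ : nat -> C) z : (forall n, normc (z_ n) <= 1) -> normc z <= 1 ->
  ccvg z_ z -> ccvg (fun n => gf (z_ n)) (gf z).
Proof.
move=> z1 zl h; apply: (CE_dct (M := 1)).
- by move=> n; have [] := cbdd_pow (z1 n).
- by have [] := cbdd_pow zl.
- by move=> n w; rewrite normc_X exprn_ile1 ?normc_ge0.
- by apply: aeW => w; exact: ccvgX.
Qed.

(** For N >= 1 the quotient of the generating function by its argument is nondecreasing, here
    without division. This is what carries a contraction obtained at one scale to all later
    iterates. *)
Lemma gfR_ratio x y : (forall w, (1 <= N w)%N) -> 0 <= x -> x <= y -> y <= 1 ->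
  gfR x * y <= gfR y * x.
Proof.
move=> N1 x0 xy y1; have y0 := le_trans x0 xy.
have ix : itg P (fun w => x ^+ N w) by apply: itg_pow; rewrite x0 (le_trans xy).
have iy : itg P (fun w => y ^+ N w) by apply: itg_pow; rewrite y1 y0.
rewrite mulrC [leRHS]mulrC -ExZ// -ExZ//; apply: le_Ex => [||w]; [exact: itgZ..|].
rewrite -(prednK (N1 w)) !exprS [leLHS]mulrCA.
by rewrite ler_wpM2l// ler_wpM2l// lerXn2r.
Qed.

Lemma itg_indic (A : set T) : measurable A -> itg P (\1_A : T -> R).
Proof. by move=> mA; exact: integrable_indic. Qed.

Lemma Ex_indic (A : set T) : measurable A -> Ex P (\1_A : T -> R) = fine (P A).
Proof. by move=> mA; rewrite /Ex /Rintegral integral_indic// setIT. Qed.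

Lemma measurable_fiber k : measurable (N @^-1` [set k]).
Proof. by rewrite -[X in measurable X]setTI; exact: mN. Qed.

Lemma gfR_ge_mass0 x : 0 <= x <= 1 -> fine (P (N @^-1` [set 0%N])) <= gfR x.
Proof.
move=> x01; rewrite -Ex_indic; last exact: measurable_fiber.
apply: le_Ex => [||w]; [exact/itg_indic/measurable_fiber|exact: itg_pow|].
rewrite indicE; case: (boolP (w \in _)) => [/set_mem /= ->|_]; first by rewrite expr0.
by case/andP: x01 => x0 _; rewrite exprn_ge0.
Qed.

Lemma gfR0 : gfR 0 = fine (P (N @^-1` [set 0%N])).
Proof.
rewrite -Ex_indic; last exact: measurable_fiber.
apply: eq_Ex => w; rewrite indicE expr0n; congr (nat_of_bool _)%:R.
by apply: esym; apply/idP/idP => [/set_mem/eqP//|/eqP h]; rewrite inE.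
Qed.

End generating_functions.

(** * The offspring generating function near 0 and near 1 *)

Section offspring.
Context d (T : measurableType d) (R : realType) (P : probability T R).
Local Notation C := (complex R).
Variables (X : {RV P >-> nat}).
Hypothesis (X_ge1 : forall w, (1 <= X w)%N) (X_nondeg : nonconstant_rv X).
Hypothesis (p1_gt0 : 0 < mass X 1).
Hypothesis (XlogX : ('E_P[fun w => ((X w)%:R * ln (X w)%:R)%R] < +oo)%E).
Implicit Types (z : C) (x y r : R).

Let mX : measurable_fun setT X. Proof. exact: measurable_funPT. Qed.

Definition offmean : R := Ex P (fun w => (X w)%:R).
Local Notation a := offmean.

Lemma mean_Ex : mean X = offmean.
Proof. by rewrite /mean unlock. Qed.

Lemma itg_XlnX : itg P (fun w => (X w)%:R * ln (X w)%:R).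
Proof.
apply/integrableP; split; first exact/measurable_EFinP/(measurable_natfun mX (fun n => n%:R * ln n%:R)).
move: XlogX; rewrite unlock; congr (_ < _)%E; apply: eq_integral => w _ /=.
by rewrite ger0_norm// mulr_ge0// ln_ge0// ler1n.
Qed.

Lemma itg_X : itg P (fun w => (X w)%:R).
Proof.
apply: (itg_le (h' := fun w => 1 + (X w)%:R * ln (X w)%:R)).
- exact: (measurable_natfun mX (fun n => n%:R)).
- by apply: itgD; [exact: itg_cst|exact: itg_XlnX].
move=> w; rewrite ger0_norm//; set x : R := (X w)%:R.
have x1 : 1 <= x by rewrite ler1n.
have x0 : 0 < x by apply: lt_le_trans x1.
have h : ln x^-1 <= x^-1 - 1.
  by have := @le_ln1Dx R (x^-1 - 1); rewrite [1 + (_ - 1)]addrC subrK; apply; rewrite ltrBDl subrr invr_gt0.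
rewrite lnV// in h.
have : x * (1 - x^-1) <= x * ln x by rewrite ler_wpM2l ?(ltW x0)//; lra.
by rewrite mulrBr mulr1 divff ?gt_eqF//; lra.
Qed.

Lemma mass_le1 k : mass X k <= 1.
Proof.
rewrite /mass -lee_fin fineK ?fin_num_measure//; last exact: measurable_fiber.
by apply: probability_le1; exact: measurable_fiber.
Qed.

Lemma mass1_lt1 : mass X 1 < 1.
Proof.
rewrite lt_neqAle mass_le1 andbT; apply/eqP => h; apply: X_nondeg; exists 1%N.
by rewrite -[LHS]fineK ?fin_num_measure//; [rewrite -/(mass X 1) h|exact: measurable_fiber].
Qed.

(** Otherwise the event X >= 2 is a countable union of null events and X = 1 almost surely. This
    second atom is the source of the Gaussian contraction in [psi_ray_contraction]. *)
Lemma exists_mass_ge2 : exists2 k, (2 <= k)%N & 0 < mass X k.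
Proof.
apply/not_exists2P => h.
have h0 k : (2 <= k)%N -> P (X @^-1` [set k]) = 0%E.
  move=> k2; have [//|/negP] := h k; rewrite -leNgt => m0.
  rewrite -[LHS]fineK ?fin_num_measure//; last exact: measurable_fiber.
  congr (_%:E); apply/eqP; rewrite eq_le m0 fine_ge0//.
have mF k : measurable (X @^-1` [set k]) by exact: measurable_fiber.
have : P (\bigcup_(k in [set k | (2 <= k)%N]) X @^-1` [set k]) = 0%E.
  pose F k := if (2 <= k)%N then X @^-1` [set k] else set0.
  have -> : \bigcup_(k in [set k | (2 <= k)%N]) X @^-1` [set k] = \bigcup_k F k.
    apply/seteqP; split => [w [k /= k2 kw]|w [k _]]; first by exists k => //; rewrite /F k2.
    by rewrite /F; case: ifP => // k2 kw; exists k.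
  have mF' k : measurable (F k) by rewrite /F; case: ifP.
  apply/negligibleP; first by apply: bigcup_measurable.
  apply: negligible_bigcup => k; apply/negligibleP => //.
  by rewrite /F; case: ifP => [/h0//|_]; exact: measure0.
have -> : \bigcup_(k in [set k | (2 <= k)%N]) X @^-1` [set k] = ~` (X @^-1` [set 1%N]).
  apply/seteqP; split => [w [k /= k2 kw] e|w /= h1]; first by rewrite -kw e in k2.
  exists (X w) => //=; rewrite ltn_neqAle X_ge1 andbT; apply/eqP => e; exact/h1.
rewrite probability_setC//; have := mass1_lt1; rewrite /mass.
rewrite -[P (X @^-1` _)]fineK ?fin_num_measure// => l1 [/eqP].
by rewrite subr_eq0 => /eqP e; move: l1; rewrite -e ltxx.
Qed.

(** The factor g in f(z) = z g(z), so that g(0) = p_1. *)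
Definition gX := gf P (fun w => (X w).-1).
Definition gXR := gfR P (fun w => (X w).-1).
Let mX1 : measurable_fun setT (fun w => (X w).-1).
Proof. exact: (@measurableT_comp _ _ _ _ _ _ predn). Qed.

Lemma gf_gX z : normc z <= 1 -> gf P X z = z * gX z.
Proof.
move=> z1; rewrite -CEZ; last exact/cbdd_citg/cbdd_pow.
by apply: eq_CE => w; rewrite -exprS prednK.
Qed.

Lemma gfR_gXR x : 0 <= x <= 1 -> gfR P X x = x * gXR x.
Proof.
move=> x1; rewrite -ExZ; last exact/itg_pow.
by apply: eq_Ex => w; rewrite -exprS prednK.
Qed.

Let fiber1 : (fun w => (X w).-1) @^-1` [set 0%N] = X @^-1` [set 1%N].
Proof.
apply/seteqP; split => w /=; last by move=> ->.
by have := X_ge1 w; case: (X w) => [|[|]].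
Qed.

Lemma gXR0 : gXR 0 = mass X 1.
Proof. by rewrite /gXR gfR0// fiber1. Qed.

Lemma gXR_ge x : 0 <= x <= 1 -> mass X 1 <= gXR x.
Proof. by move=> x01; rewrite /mass -fiber1; exact: gfR_ge_mass0. Qed.

Lemma gXR_gt0 x : 0 <= x <= 1 -> 0 < gXR x.
Proof. by move=> /gXR_ge; exact: lt_le_trans. Qed.

(** By r^{X-1} <= r + (1 - r) 1_{X = 1} and p_1 < 1. The number g(r) is the geometric rate, called
    theta, of the convergences below. *)
Lemma gXR_lt1 r : 0 <= r -> r < 1 -> gXR r < 1.
Proof.
move=> r0 r1; have p1 := mass1_lt1.
have -> : gXR r = r * (1 - mass X 1) + mass X 1 - (r * (1 - mass X 1) + mass X 1 - gXR r) by ring.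
apply: (@le_lt_trans _ _ (r * (1 - mass X 1) + mass X 1)); last first.
  rewrite -ltrBrDr gtr_pMl// subr_gt0//.
rewrite gerBl subr_ge0.
apply: (@le_trans _ _ (Ex P (fun w => r + (1 - r) * \1_(X @^-1` [set 1%N]) w))).
  have mA : measurable (X @^-1` [set 1%N]) by exact: measurable_fiber.
  apply: le_Ex => [||w].
  - by apply: itg_pow => //; rewrite r0 ltW.
  - by apply: itgD; [exact: itg_cst|apply: itgZ; exact: itg_indic].
  rewrite indicE; case: (boolP (w \in _)) => [/set_mem /= ->|/negP h].
    by rewrite expr0 mulr1; lra.
  have {}h : X w <> 1%N by move=> e; apply: h; rewrite inE.
  have := X_ge1 w; move: h; case: (X w) => [|[|n]]//= _ _.
  by rewrite mulr0 addr0 exprS ler_piMr// exprn_ile1// ltW.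
have mA : measurable (X @^-1` [set 1%N]) by exact: measurable_fiber.
rewrite ExD ?ExZ; [|exact: itg_indic|exact: itg_cst|by apply: itgZ; exact: itg_indic].
rewrite Ex_cst Ex_indic// -/(mass X 1); lra.
Qed.

Lemma offmean_gt1 : 1 < a.
Proof.
have mA : measurable (X @^-1` [set 1%N]) by exact: measurable_fiber.
apply: (@lt_le_trans _ _ (Ex P (fun w => 2 + (- 1) * \1_(X @^-1` [set 1%N]) w))).
  rewrite ExD ?ExZ; [|exact: itg_indic|exact: itg_cst|by apply: itgZ; exact: itg_indic].
  by rewrite Ex_cst Ex_indic// -/(mass X 1); have := mass1_lt1; lra.
apply: le_Ex => [||w].
- by apply: itgD; [exact: itg_cst|apply: itgZ; exact: itg_indic].
- exact: itg_X.
rewrite indicE; case: (boolP (w \in _)) => [/set_mem /= ->|/negP h]; first lra.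
have {}h : X w <> 1%N by move=> e; apply: h; rewrite inE.
by have := X_ge1 w; move: h; case: (X w) => [|[|n]]//= _ _; rewrite mulr0 addr0 ler_nat.
Qed.

Lemma offmean_gt0 : 0 < a.
Proof. exact: lt_trans offmean_gt1. Qed.

Lemma gfX_lip (z w : C) : normc z <= 1 -> normc w <= 1 ->
  normc (gf P X z - gf P X w) <= a * normc (z - w).
Proof.
move=> z1 w1.
have bz : cbdd (fun t => z ^+ X t) by apply/cbdd_pow.
have bw : cbdd (fun t => w ^+ X t) by apply/cbdd_pow.
rewrite -CEB; [|exact: cbdd_citg|exact: cbdd_citg].
rewrite mulrC -ExZ; last exact: itg_X.
apply: normc_CE_le.
- by apply: citgB; exact: cbdd_citg.
- by apply: itgZ; exact: itg_X.
move=> t; apply: le_trans (normc_powB_le _ z1 w1) _.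
by rewrite expr1n mulr1.
Qed.

(* [2] bounds [|z^j w^l - 1|] everywhere and [X * delta] bounds it near [1]. *)
Definition eta delta : R := Ex P (fun w => (X w)%:R * Num.min 2 ((X w)%:R * delta)) / a.

Let min2_ge0 n (delta : R) : 0 <= delta -> 0 <= Num.min 2 (n%:R * delta).
Proof. by move=> d0; rewrite le_min ler0n mulr_ge0. Qed.

Let itg_eta delta : 0 <= delta -> itg P (fun w => (X w)%:R * Num.min 2 ((X w)%:R * delta)).
Proof.
move=> d0; apply: (itg_le (h' := fun w => 2 * (X w)%:R)).
- exact: (measurable_natfun mX (fun n => n%:R * Num.min 2 (n%:R * delta))).
- by apply: itgZ; exact: itg_X.
move=> w; rewrite ger0_norm; last by rewrite mulr_ge0// min2_ge0.
by rewrite mulrC ler_wpM2r// ge_min lexx.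
Qed.

Lemma eta_ge0 delta : 0 <= delta -> 0 <= eta delta.
Proof.
move=> d0; rewrite divr_ge0 ?(ltW offmean_gt0)// Ex_ge0// => w.
by rewrite mulr_ge0// min2_ge0.
Qed.

Lemma eta_le delta delta' : 0 <= delta -> delta <= delta' -> eta delta <= eta delta'.
Proof.
move=> d0 dd; rewrite ler_wpM2r ?invr_ge0 ?(ltW offmean_gt0)//.
apply: le_Ex => [||w]; [exact: itg_eta|exact/itg_eta/(le_trans d0)|].
rewrite ler_wpM2l// le_min !ge_min lexx /=; apply/orP; right.
by rewrite ler_wpM2l.
Qed.

(** Takes the place of a second-order Taylor formula, as X may lack a second moment. In the
    factorization of z^n - w^n the n terms z^j w^l are compared with 1, and the error is a truncated
    moment relative to |z - w|. *)
Lemma gfX_expansion (z w : C) delta : normc z <= 1 -> normc w <= 1 ->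
  normc (z - 1) <= delta -> normc (w - 1) <= delta ->
  normc (gf P X z - gf P X w - Cx a * (z - w)) <= a * eta delta * normc (z - w).
Proof.
move=> z1 w1 zd wd; have d0 : 0 <= delta := le_trans (normc_ge0 _) zd.
have bz : cbdd (fun t => z ^+ X t) by apply/cbdd_pow.
have bw : cbdd (fun t => w ^+ X t) by apply/cbdd_pow.
have iX : citg P (fun t => Cx (X t)%:R) by apply: citg_Cx; exact: itg_X.
have -> : Cx a * (z - w) = CE P (fun t => (z - w) * Cx (X t)%:R).
  by rewrite CEZ// CE_Cx mulrC.
rewrite -CEB; [|exact: cbdd_citg|exact: cbdd_citg].
rewrite -CEB; [|by apply: citgB; exact: cbdd_citg|exact: citgZ].
rewrite /eta mulrCA divff ?gt_eqF ?offmean_gt0// mulr1 mulrC -ExZ; last exact: itg_eta.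
apply: normc_CE_le.
- by apply: citgB; [apply: citgB; exact: cbdd_citg|exact: citgZ].
- by apply: itgZ; exact: itg_eta.
move=> t; rewrite subrXX.
have -> : Cx (X t)%:R = \sum_(i < X t) (1 : C).
  by rewrite sumr_const card_ord rmorph_nat.
rewrite -mulrBr -sumrB normcM ler_wpM2l ?normc_ge0//.
apply: (le_trans (normc_sum _ _)).
rewrite [leRHS]mulr_natl -[X in _ <= _ *+ X]card_ord -sumr_const ler_sum// => i _.
have zi k : normc (z ^+ k) <= 1 by rewrite normc_X exprn_ile1 ?normc_ge0.
have wi k : normc (w ^+ k) <= 1 by rewrite normc_X exprn_ile1 ?normc_ge0.
rewrite le_min; apply/andP; split.
  apply: (le_trans (le_normcB _ _)); rewrite normcM normc1 -[leRHS](@natrD R 1 1) lerD//.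
  by rewrite -[leRHS]mulr1 ler_pM ?normc_ge0.
have -> : z ^+ ((X t).-1 - i) * w ^+ i - 1 =
  z ^+ ((X t).-1 - i) * (w ^+ i - 1) + (z ^+ ((X t).-1 - i) - 1) by ring.
apply: (le_trans (le_normcD _ _)).
apply: (@le_trans _ _ (i%:R * delta + ((X t).-1 - i)%:R * delta)).
  apply: lerD.
    rewrite normcM -[leRHS]mul1r ler_pM ?normc_ge0//.
    apply: (le_trans (normc_powB1_le _ w1)); exact: ler_wpM2l.
  apply: (le_trans (normc_powB1_le _ z1)); exact: ler_wpM2l.
rewrite -mulrDl -natrD ler_wpM2r// ler_nat.
by have := ltn_ord i; have := X_ge1 t; lia.
Qed.

(** Designed to telescope: summed over the arguments x, x/a, x/a^2, ... the right-hand side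
    collapses to a multiple of ln (1 + x). The 3 comes from min(2, x) <= 3 x / (1 + x), and each
    logarithmic increment is at least (1 - 1/a) x / (1 + x). *)
Let min2_ln x : 0 <= x -> Num.min 2 x <= (3 * a / (a - 1)) * (ln (1 + x) - ln (1 + x / a)).
Proof.
move=> x0; have a1 := offmean_gt1; have a0 := offmean_gt0.
have xa : 0 <= x / a by rewrite divr_ge0// ltW.
have h1 : Num.min 2 x <= 3 * (x / (1 + x)).
  rewrite mulrA ler_pdivlMr ?ltr_wpDr//.
  have [x2|x2] := leP x 2; first nra.
  lra.
apply: (le_trans h1).
have h2 : (1 - a^-1) * (x / (1 + x)) <= ln (1 + x) - ln (1 + x / a).
  rewrite -ln_div ?posrE ?ltr_wpDr//.
  have -> : (1 + x) / (1 + x / a) = ((1 + x / a) / (1 + x))^-1 by rewrite invf_div.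
  rewrite lnV ?posrE ?divr_gt0 ?ltr_wpDr// lerNr.
  have -> : - ((1 - a^-1) * (x / (1 + x))) = (1 + x / a) / (1 + x) - 1.
    by field; repeat (apply/andP; split); apply: lt0r_neq0; lra.
  rewrite -{1}[(1 + x / a) / _](subrK 1) [X in ln X]addrC le_ln1Dx//.
  have : 0 < (1 + x / a) / (1 + x) by rewrite divr_gt0 ?ltr_wpDr.
  lra.
have -> : 3 * (x / (1 + x)) = (3 * a / (a - 1)) * ((1 - a^-1) * (x / (1 + x))).
  by field; repeat (apply/andP; split); apply: lt0r_neq0; lra.
rewrite ler_wpM2l// divr_ge0 ?mulr_ge0 ?subr_ge0 ?ltW//.
Qed.

(** The X log X condition in the form in which it is used. By [min2_ln] the sum telescopes under the
    expectation to a multiple of E X ln (1 + X), uniformly in M. *)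
Lemma eta_sum_le : exists B, forall M, \sum_(0 <= i < M) eta (a ^- i) <= B.
Proof.
have a1 := offmean_gt1; have a0 := offmean_gt0.
pose c := 3 * a / (a - 1).
have c0 : 0 <= c by rewrite /c divr_ge0 ?mulr_ge0 ?subr_ge0 ?ltW.
have iB : itg P (fun w => c * ((X w)%:R + (X w)%:R * ln (X w)%:R)).
  by apply: itgZ; apply: itgD; [exact: itg_X|exact: itg_XlnX].
exists (Ex P (fun w => c * ((X w)%:R + (X w)%:R * ln (X w)%:R)) / a) => M.
have ai i : 0 <= a ^- i by rewrite invr_ge0 exprn_ge0// ltW.
rewrite -mulr_suml ler_wpM2r ?invr_ge0 ?(ltW a0)//.
rewrite -Ex_sum; last by move=> i; exact: itg_eta.
apply: le_Ex => //; first by apply: itg_sum => i; exact: itg_eta.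
move=> w; rewrite -mulr_sumr; set x : R := (X w)%:R.
have x1 : 1 <= x by rewrite ler1n.
have x0 : 0 < x by apply: lt_le_trans x1.
have -> : c * (x + x * ln x) = x * (c * (1 + ln x)) by ring.
rewrite ler_wpM2l ?(ltW x0)//.
apply: (@le_trans _ _ (\sum_(0 <= i < M) c * (ln (1 + x * a ^- i) - ln (1 + x * a ^- i.+1)))).
  apply: ler_sum => i _.
  have -> : x * a ^- i.+1 = x * a ^- i / a by rewrite exprSr invfM mulrA.
  by apply: min2_ln; rewrite mulr_ge0// ltW.
rewrite -mulr_sumr ler_wpM2l//.
have -> : \sum_(0 <= i < M) (ln (1 + x * a ^- i) - ln (1 + x * a ^- i.+1)) =
    ln (1 + x) - ln (1 + x * a ^- M).
  rewrite -[LHS]opprK -sumrN.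
  under eq_bigr do rewrite opprB.
  by rewrite telescope_sumr// opprB expr0 invr1 mulr1.
have h0 : 0 <= ln (1 + x * a ^- M) by rewrite ln_ge0// lerDl mulr_ge0// ltW.
have : ln (1 + x) <= ln (2 * x) by rewrite ler_ln ?posrE; lra.
rewrite lnM ?posrE//.
have : ln 2 <= 1 :> R by have := @le_ln1Dx R 1; rewrite -(natrD R 1 1); apply; lra.
lra.
Qed.

(** The total error of M successive linearizations of f, at distances c/a, c/a^2, ... from 1. The
    index starts at 1 because the last linearization takes place one generation before the distance
    c is reached. *)
Definition etasum M c := \sum_(0 <= i < M) eta (c * a ^- i.+1).

Lemma etasum_bounded c : 0 <= c -> exists B, forall M, etasum M c <= B.
Proof.
move=> c0; have [B hB] := eta_sum_le.
have a1 := offmean_gt1; have a0 := offmean_gt0.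
have [K hK] := exists_expr_ge c a1.
have ai i : 0 <= a ^- i by rewrite invr_ge0 exprn_ge0// ltW.
exists (\sum_(0 <= i < K) eta (a ^+ (K - i.+1)) + B) => M.
apply: (@le_trans _ _ (\sum_(0 <= i < K + M) eta (a ^+ K * a ^- i.+1))).
  rewrite (big_cat_nat (n := M)) ?leq_addl//= -[leLHS]addr0 lerD//.
    apply: ler_sum => i _; apply: eta_le; first exact: mulr_ge0.
    by rewrite ler_wpM2r.
  by apply: sumr_ge0 => i _; apply: eta_ge0; rewrite mulr_ge0 ?exprn_ge0// ltW.
rewrite (big_cat_nat (n := K)) ?leq_addr//=; apply: lerD.
  rewrite !big_nat; apply: ler_sum => i /andP[_ iK].
  by rewrite -{1}(subnK iK) exprD mulfK// expf_eq0 gt_eqF ?andbF.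
apply: le_trans (hB (M.+1)).
rewrite -{1}[K]add0n big_addn addKn big_nat_recl//= -[leLHS]add0r lerD ?eta_ge0//.
apply: ler_sum => i _.
rewrite -addSn exprD invfM mulrCA divff ?mulr1// expf_neq0// gt_eqF//.
Qed.

(** When c <= a^{-K} the terms are dominated by those of the convergent series of [eta (a ^- i)]
    beyond K. *)
Lemma etasum_small e : 0 < e -> exists2 c0, 0 < c0 &
  forall c M, 0 <= c -> c <= c0 -> etasum M c <= e.
Proof.
move=> e0; have [B hB] := eta_sum_le.
have a1 := offmean_gt1; have a0 := offmean_gt0.
have ai i : 0 <= a ^- i by rewrite invr_ge0 exprn_ge0// ltW.
have cv : cvgn (series (fun i => eta (a ^- i))).
  apply: nondecreasing_is_cvgn.
    by apply: nondecreasing_series => i _ _; exact: eta_ge0.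
  by exists B => _ [M _ <-]; exact: hB.
have /cvgrPdist_le /(_ (e / 2)) := cv.
rewrite divr_gt0// => /(_ isT) [K _ hK].
exists (a ^- K); first by rewrite invr_gt0 exprn_gt0.
move=> c M c0 cK.
apply: (@le_trans _ _ (\sum_(0 <= i < M) eta (a ^- (i + K.+1)))).
  apply: ler_sum => i _; apply: eta_le; first exact: mulr_ge0.
  by rewrite addnS -addSn exprD invfM mulrC ler_wpM2l.
have -> : \sum_(0 <= i < M) eta (a ^- (i + K.+1)) =
    series (fun i => eta (a ^- i)) (M + K.+1)%N - series (fun i => eta (a ^- i)) K.+1.
  rewrite !seriesEnat /= [X in _ = X - _](big_cat_nat (n := K.+1)) ?leq_addl//=.
  by rewrite addrAC subrr add0r -[in RHS](add0n K.+1) big_addn add0n addnK.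
have h1 := hK (M + K.+1)%N (leq_trans (leqnSn _) (leq_addl _ _)).
have h2 := hK K.+1 (leqnSn _).
move: h1 h2; rewrite /= !ler_norml; lra.
Qed.

End offspring.

(** * The transform psi of the normalized limit without immigration *)

Section normalized_limit.
Context d (T : measurableType d) (R : realType) (P : probability T R).
Local Notation C := (complex R).

Record offspring_law (X : {RV P >-> nat}) : Prop := OffspringLaw {
  offspring_ge1 : forall w, (1 <= X w)%N;
  offspring_nondeg : nonconstant_rv X;
  offspring_p1 : 0 < mass X 1;
  offspring_XlogX : ('E_P[fun w => ((X w)%:R * ln (X w)%:R)%R] < +oo)%E
}.

Variables (X : {RV P >-> nat}) (HX : offspring_law X).
Local Notation a := (offmean X).
Local Notation f := (gf P X).
Local Notation fR := (gfR P X).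
Implicit Types (z : C) (x y r : R).

Let X1 := offspring_ge1 HX.
Let Xnd := offspring_nondeg HX.
Let p1 := offspring_p1 HX.
Let Xlog := offspring_XlogX HX.
Let mX : measurable_fun setT X. Proof. exact: measurable_funPT. Qed.
Let a1 : 1 < a := offmean_gt1 X1 Xnd Xlog.
Let a0 : 0 < a := offmean_gt0 X1 Xnd Xlog.
Let aX n : 0 < a ^+ n. Proof. exact: exprn_gt0. Qed.
Let aV n : 0 <= a ^- n. Proof. by rewrite invr_ge0 ltW. Qed.

Definition fit j z : C := iter j f z.
Definition fitR j x : R := iter j fR x.

Lemma fit_Cx j x : fit j (Cx x) = Cx (fitR j x).
Proof. by elim: j => //= j ->; rewrite gf_Cx. Qed.

Lemma fitR01 j x : 0 <= x <= 1 -> 0 <= fitR j x <= 1.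
Proof.
move=> x01; elim: j => //= j ih.
by case/andP: (ih) => i0 _; rewrite gfR_ge0//= gfR_le1.
Qed.

Lemma fitR_ge0 j x : 0 <= x -> x <= 1 -> 0 <= fitR j x.
Proof. by move=> x0 x1; have /andP[] := @fitR01 j x (introT andP (conj x0 x1)). Qed.

Lemma fitR_le1 j x : 0 <= x -> x <= 1 -> fitR j x <= 1.
Proof. by move=> x0 x1; have /andP[] := @fitR01 j x (introT andP (conj x0 x1)). Qed.

Lemma normc_fit_le j z r : normc z <= r -> r <= 1 -> normc (fit j z) <= fitR j r.
Proof.
move=> zr r1; have r0 : 0 <= r := le_trans (normc_ge0 z) zr.
elim: j => //= j ih; apply: normc_gf_le => //.
exact: fitR_le1.
Qed.

Lemma fitR1 j : fitR j 1 = 1.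
Proof. by elim: j => //= j ->; rewrite gfR1. Qed.

Lemma normc_fit_le1 j z : normc z <= 1 -> normc (fit j z) <= 1.
Proof. by move=> z1; rewrite -[leRHS](fitR1 j) normc_fit_le. Qed.

Lemma fitR_le j x y : 0 <= x -> x <= y -> y <= 1 -> fitR j x <= fitR j y.
Proof.
move=> x0 xy y1; elim: j => //= j ih; apply: gfR_le => //.
  by apply: fitR_ge0 => //; exact: le_trans xy y1.
by apply: fitR_le1 => //; exact: le_trans x0 xy.
Qed.

(** The monotone quotient of [gfR_ratio] passes to the iterates. The induction divides by the
    iterate at y, so its vanishing is treated apart. *)
Lemma fitR_ratio j x y : 0 <= x -> x <= y -> y <= 1 -> fitR j x * y <= fitR j y * x.
Proof.
move=> x0 xy y1; elim: j => [|j ih] /=; first by rewrite mulrC.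
have y0 := le_trans x0 xy; have x1 := le_trans xy y1.
have /andP[fx0 fx1] := @fitR01 j x (introT andP (conj x0 x1)).
have /andP[fy0 fy1] := @fitR01 j y (introT andP (conj y0 y1)).
have fxy := fitR_le j x0 xy y1.
have h := gfR_ratio P mX X1 fx0 fxy fy1.
have [fy|fy] := ltP 0 (fitR j y); last first.
  have ey : fitR j y = 0 by apply/eqP; rewrite eq_le fy fy0.
  have ex : fitR j x = 0 by apply/eqP; rewrite eq_le fx0 -ey fxy.
  by rewrite ex ey gfR_gXR ?lexx ?ler01// !mul0r.
rewrite -(ler_pM2r fy).
have -> : fR (fitR j x) * y * fitR j y = fR (fitR j x) * fitR j y * y by ring.
apply: (le_trans (ler_wpM2r y0 h)).
have -> : fR (fitR j y) * fitR j x * y = fR (fitR j y) * (fitR j x * y) by ring.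
have -> : fR (fitR j y) * x * fitR j y = fR (fitR j y) * (fitR j y * x) by ring.
by rewrite ler_wpM2l ?gfR_ge0.
Qed.

Lemma fit_lip j (z w : C) : normc z <= 1 -> normc w <= 1 ->
  normc (fit j z - fit j w) <= a ^+ j * normc (z - w).
Proof.
move=> z1 w1; elim: j => [|j ih]; first by rewrite mul1r.
rewrite exprS -mulrA; apply: le_trans (gfX_lip X1 Xlog _ _) _; try exact: normc_fit_le1.
by rewrite ler_wpM2l// ltW.
Qed.

Lemma fit_cvg j (z_ : nat -> C) z : (forall n, normc (z_ n) <= 1) -> normc z <= 1 ->
  ccvg z_ z -> ccvg (fun n => fit j (z_ n)) (fit j z).
Proof.
move=> z1 zl h; elim: j => //= j ih; apply: gf_cvg => //.
- by move=> n; exact: normc_fit_le1.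
- exact: normc_fit_le1.
Qed.

(** The Laplace transform of Z_n / a^n for the process without immigration started by one
    individual. *)
Definition psin n z := fit n (cexpN (Cx (a ^- n) * z)).

Let Re_scale n z : 0 <= Re z -> 0 <= Re (Cx (a ^- n) * z).
Proof. by move=> z0; rewrite ReZ mulr_ge0. Qed.

Let normc_scale n z : normc (Cx (a ^- n) * z) = a ^- n * normc z.
Proof. by rewrite normcM normc_Cx ger0_norm. Qed.

(** With s = z / a^{n+1} this compares the n-th iterate at f(e^{-s}) and at e^{-a s}. The two points
    differ by a relative error [eta] plus terms of order s^2, and the Lipschitz constant a^n of the
    iterate undoes the scaling. Both bounds are summable in n. *)
Lemma psin_step n z : 0 <= Re z -> normc (psin n.+1 z - psin n z) <=
  2 * normc z * eta X (normc z *+ 2 * a ^- n.+1) + 8 * normc z ^+ 2 * a ^- n.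
Proof.
move=> z0; pose s := Cx (a ^- n.+1) * z.
have s0 : 0 <= Re s by exact: Re_scale.
have as0 : 0 <= Re (Cx a * s) by rewrite ReZ mulr_ge0// ltW.
have es : Cx (a ^- n) * z = Cx a * s.
  rewrite /s mulrA -CxM; congr (Cx _ * z).
  by rewrite exprS invfM mulrA divff ?mul1r// gt_eqF.
have -> : psin n.+1 z = fit n (f (cexpN s)) by rewrite /psin /fit iterSr.
rewrite /psin es.
apply: (le_trans (fit_lip _ _ _)).
- by apply: normc_gf_le1 => //; exact: normc_cexpN_le1.
- exact: normc_cexpN_le1.
have -> : f (cexpN s) - cexpN (Cx a * s) =
    (f (cexpN s) - f 1 - Cx a * (cexpN s - 1)) + Cx a * (cexpN s - 1 + s)
    - (cexpN (Cx a * s) - 1 + Cx a * s).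
  by rewrite -{2}Cx1 gf_Cx gfR1 Cx1; ring.
have ns : normc s = a ^- n.+1 * normc z by exact: normc_scale.
have h1 : normc (f (cexpN s) - f 1 - Cx a * (cexpN s - 1)) <=
    a * eta X (normc s *+ 2) * (normc s *+ 2).
  have e1 := cexpNB1_le s0.
  apply: (le_trans (gfX_expansion (delta := normc s *+ 2) X1 Xnd p1 Xlog _ _ e1 _)).
  - exact: normc_cexpN_le1.
  - by rewrite normc1.
  - by rewrite subrr normc0 mulrn_wge0// normc_ge0.
  - rewrite ler_wpM2l// mulr_ge0 ?(ltW a0)// eta_ge0// mulrn_wge0// normc_ge0//.
have h2 : normc (Cx a * (cexpN s - 1 + s)) <= a * (4 * normc s ^+ 2).
  by rewrite normcM normc_Cx gtr0_norm// ler_wpM2l ?cexpN_quad// ltW.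
have h3 : normc (cexpN (Cx a * s) - 1 + Cx a * s) <= 4 * (a * normc s) ^+ 2.
  by apply: (le_trans (cexpN_quad as0)); rewrite normcM normc_Cx gtr0_norm.
apply: (@le_trans _ _ (a ^+ n * (a * eta X (normc s *+ 2) * (normc s *+ 2) +
   a * (4 * normc s ^+ 2) + 4 * (a * normc s) ^+ 2))).
  rewrite ler_wpM2l ?(ltW (aX n))//.
  apply: (le_trans (le_normcB _ _)); apply: lerD => //.
  by apply: (le_trans (le_normcD _ _)); apply: lerD.
have an0 : a ^+ n != 0 by rewrite gt_eqF.
have ann0 : a != 0 by rewrite gt_eqF.
have -> : normc z *+ 2 * a ^- n.+1 = normc s *+ 2 by rewrite ns mulrC mulrnAr.
have -> : normc s = normc z / a ^+ n / a.
  by rewrite ns exprS; field; rewrite an0 ann0.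
set x := normc z; set E := eta _ _.
have -> : a ^+ n * (a * E * (x / a ^+ n / a *+ 2) + a * (4 * (x / a ^+ n / a) ^+ 2) +
   4 * (a * (x / a ^+ n / a)) ^+ 2) =
   2 * x * E + (4 / a * x ^+ 2 * a ^- n + 4 * x ^+ 2 * a ^- n).
  by field; rewrite an0 ann0.
rewrite lerD2l -mulrDl ler_wpM2r// -mulrDl ler_wpM2r ?sqr_ge0//.
have : 4 / a <= 4 by rewrite ler_pdivrMr// ler_peMr// ltW.
lra.
Qed.

Let cvg_aV : a ^- n @[n --> \oo] --> 0.
Proof.
have h : `|a^-1| < 1 by rewrite ger0_norm ?invr_ge0 ?(ltW a0)// invf_lt1.
have := cvg_geometric 1 h; rewrite /geometric /=.
by under eq_fun do rewrite mul1r exprVn.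
Qed.

Lemma psin_is_cvg z : 0 <= Re z -> exists l, ccvg (psin^~ z) l.
Proof.
move=> z0; apply: (ccvg_cauchy (fun n => psin_step n z0)).
have z2 : 0 <= normc z *+ 2 by rewrite mulrn_wge0// normc_ge0.
have [B hB] := etasum_bounded X1 Xnd Xlog z2.
have c1 : cvgn (series (fun n => eta X (normc z *+ 2 * a ^- n.+1))).
  apply: nondecreasing_is_cvgn.
    apply: nondecreasing_series => i _ _; apply: eta_ge0 => //.
    by rewrite mulr_ge0.
  by exists B => _ [M _ <-]; exact: hB.
have c2 : cvgn (series (fun n => a ^- n)).
  have := @is_cvg_geometric_series R 1 a^-1.
  rewrite /geometric /=; under eq_fun do rewrite mul1r exprVn; apply.
  by rewrite ger0_norm ?invr_ge0 ?(ltW a0)// invf_lt1.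
have -> : series (fun n => 2 * normc z * eta X (normc z *+ 2 * a ^- n.+1) + 8 * normc z ^+ 2 * a ^- n) =
  (fun n => 2 * normc z * series (fun n => eta X (normc z *+ 2 * a ^- n.+1)) n +
            8 * normc z ^+ 2 * series (fun n => a ^- n) n).
  by apply/funext => n; rewrite !seriesEnat/= !mulr_sumr -big_split.
by apply: is_cvgD; apply: is_cvgM => //; exact: is_cvg_cst.
Qed.

Definition psi z : C := Complex (limn (fun n => Re (psin n z))) (limn (fun n => Im (psin n z))).

Lemma psi_cvg z : 0 <= Re z -> ccvg (psin^~ z) (psi z).
Proof.
move=> /psin_is_cvg[l [h1 h2]]; rewrite /psi; split => /=.
  by rewrite (cvg_lim _ h1).
by rewrite (cvg_lim _ h2).
Qed.

Lemma normc_psin_le1 n z : 0 <= Re z -> normc (psin n z) <= 1.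
Proof. by move=> z0; apply/normc_fit_le1/normc_cexpN_le1/Re_scale. Qed.

Lemma normc_psi_le1 z : 0 <= Re z -> normc (psi z) <= 1.
Proof.
move=> z0; have h := psi_cvg z0; rewrite -[psi z]subr0.
apply: (ccvg_normc_le (b := fun=> 1) h); last exact: cvg_cst.
by apply: nearW => n; rewrite subr0 normc_psin_le1.
Qed.

Lemma psi_scale z : 0 <= Re z -> psi (Cx a * z) = f (psi z).
Proof.
move=> z0; have az0 : 0 <= Re (Cx a * z) by rewrite ReZ mulr_ge0// ltW.
have h1 := ccvg_shift 1 (psi_cvg az0).
apply: ccvg_unique h1 _.
have -> : (fun n => psin (n + 1) (Cx a * z)) = (fun n => f (psin n z)).
  apply/funext => n; rewrite /psin addn1 /=; congr (f (fit n (cexpN _))).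
  rewrite mulrA -CxM; congr (Cx _ * z).
  by rewrite exprS invfM mulrAC mulVf ?mul1r// gt_eqF.
by apply: gf_cvg => //; [move=> n; exact: normc_psin_le1|exact: normc_psi_le1|exact: psi_cvg].
Qed.

Lemma psi_scale_iter j z : 0 <= Re z -> psi (Cx (a ^+ j) * z) = fit j (psi z).
Proof.
move=> z0; elim: j => [|j ih]; first by rewrite expr0 Cx1 mul1r.
rewrite exprS CxM -mulrA psi_scale ?ih//.
by rewrite ReZ mulr_ge0// ltW.
Qed.

Definition psiR x : R := Re (psi (Cx x)).

Lemma psi_Cx x : 0 <= x -> psi (Cx x) = Cx (psiR x).
Proof.
move=> x0; have x0' : 0 <= Re (Cx x) by [].
have [h1 h2] := psi_cvg x0'.
apply/eqP; rewrite eq_complex /= eqxx /=; apply/eqP.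
have : Im (psin n (Cx x)) @[n --> \oo] --> 0.
  have -> : (fun n => Im (psin n (Cx x))) = (fun=> 0); last exact: cvg_cst.
  by apply/funext => n; rewrite /psin -CxM cexpN_Cx fit_Cx.
by move=> h3; exact: (cvg_unique _ h2 h3).
Qed.

Lemma psinR_cvg x : 0 <= x -> fitR n (expR (- (a ^- n * x))) @[n --> \oo] --> psiR x.
Proof.
move=> x0; have x0' : 0 <= Re (Cx x) by [].
have [h1 _] := psi_cvg x0'.
by move: h1; under eq_fun do rewrite /psin -CxM cexpN_Cx fit_Cx.
Qed.

Lemma psiR_scale_iter j x : 0 <= x -> psiR (a ^+ j * x) = fitR j (psiR x).
Proof.
move=> x0; have := @psi_scale_iter j (Cx x) x0.
rewrite -CxM !psi_Cx// ?fit_Cx ?mulr_ge0// ?ltW//.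
by move=> /complexI.
Qed.

Lemma normc_psi_le z : 0 <= Re z -> normc (psi z) <= psiR (Re z).
Proof.
move=> z0; have h := psi_cvg z0; rewrite -[psi z]subr0.
apply: (ccvg_normc_le h _ (psinR_cvg z0)).
apply: nearW => n; rewrite subr0; apply: normc_fit_le.
  by rewrite normc_cexpN ReZ.
by rewrite expR_le1 oppr_le0 mulr_ge0.
Qed.

Lemma psiR_ge0 x : 0 <= x -> 0 <= psiR x.
Proof. by move=> x0; apply: le_trans (normc_ge0 (psi (Cx x))) _; exact: normc_psi_le. Qed.

Lemma psiR_le x y : 0 <= x -> x <= y -> psiR y <= psiR x.
Proof.
move=> x0 xy; have y0 := le_trans x0 xy.
apply: ler_cvg_to (psinR_cvg y0) (psinR_cvg x0) _.
apply: nearW => n; apply: fitR_le; first exact: expR_ge0.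
  by rewrite ler_expR lerN2 ler_wpM2l.
by rewrite expR_le1 oppr_le0 mulr_ge0.
Qed.

Lemma psiR_le1 x : 0 <= x -> psiR x <= 1.
Proof. by move=> x0; have := @normc_psi_le1 (Cx x) x0; rewrite psi_Cx// normc_Cx ger0_norm// psiR_ge0. Qed.

Let scaled_diff n (z w : C) : 0 <= Re z -> 0 <= Re w ->
  a ^+ n * normc (cexpN (Cx (a ^- n) * z) - cexpN (Cx (a ^- n) * w)) <=
  `|Re z - Re w| + `|Im z - Im w|.
Proof.
move=> z0 w0; have h := cexpN_lip (Re_scale n z0) (Re_scale n w0).
apply: (le_trans (ler_wpM2l (ltW (aX n)) h)).
rewrite !ReZ !ImZ -!mulrBr !normrM !(ger0_norm (aV n)) -mulrDr mulrA divff ?mul1r//.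
by rewrite gt_eqF.
Qed.

Lemma psi_lip (z w : C) : 0 <= Re z -> 0 <= Re w ->
  normc (psi z - psi w) <= `|Re z - Re w| + `|Im z - Im w|.
Proof.
move=> z0 w0; have h := ccvgB (psi_cvg z0) (psi_cvg w0).
rewrite -[psi z - psi w]subr0.
apply: (ccvg_normc_le (b := fun=> _) h); last exact: cvg_cst.
apply: nearW => n; rewrite subr0; apply: le_trans (scaled_diff n z0 w0).
by apply: fit_lip; exact/normc_cexpN_le1/Re_scale.
Qed.

(** The difference of two orbits divided by a^j, called [D j], is almost constant: one step changes
    it by at most [eta] at the current distance from 1, times the initial difference. The total
    drift is then controlled by [etasum], while [D 0] is a difference of exponentials. *)
Lemma psi_expansion (c E : R) (z w : C) : 0 <= Re z -> 0 <= Re w ->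
  normc z <= c -> normc w <= c -> (forall M, etasum X M (c *+ 2) <= E) ->
  normc (psi z - psi w + (z - w)) <= 2 * normc (z - w) * E.
Proof.
move=> z0 w0 zc wc hE; have c0 : 0 <= c := le_trans (normc_ge0 z) zc.
have c2 : 0 <= c *+ 2 by rewrite mulrn_wge0.
have h := ccvgB (psi_cvg z0) (psi_cvg w0).
rewrite -[z - w]opprK [psi z - psi w + _]addrC addrC.
have E0 : 0 <= E by apply: le_trans (hE 0%N); rewrite /etasum big_geq.
pose b n := 2 * normc (- - (z - w)) * E + 4 * (normc z ^+ 2 + normc w ^+ 2) * a ^- n.
apply: (ccvg_normc_le (b := b) h); last first.
  rewrite -[X in _ --> X]addr0; apply: cvgD; first exact: cvg_cst.
  by rewrite -(mulr0 (4 * (normc z ^+ 2 + normc w ^+ 2))); apply: cvgM => //; exact: cvg_cst.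
apply: nearW => n; rewrite /b {b} !opprK.
pose u j := fit j (cexpN (Cx (a ^- n) * z)).
pose v j := fit j (cexpN (Cx (a ^- n) * w)).
pose D j := Cx (a ^- j) * (u j - v j).
have u1 j : normc (u j) <= 1 by apply/normc_fit_le1/normc_cexpN_le1/Re_scale.
have v1 j : normc (v j) <= 1 by apply/normc_fit_le1/normc_cexpN_le1/Re_scale.
have fone j : fit j 1 = 1 by rewrite -[X in fit j X]Cx1 fit_Cx fitR1.
have ub j : normc (u j - 1) <= c *+ 2 * a ^- n * a ^+ j.
  rewrite -(fone j); apply: le_trans (fit_lip _ _ _) _.
  - exact/normc_cexpN_le1/Re_scale.
  - by rewrite normc1.
  rewrite mulrC ler_wpM2r ?(ltW (aX j))//; apply: (le_trans (cexpNB1_le (Re_scale n z0))).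
  by rewrite normc_scale -mulrnAr mulrC ler_wpM2r// lerMn2r.
have vb j : normc (v j - 1) <= c *+ 2 * a ^- n * a ^+ j.
  rewrite -(fone j); apply: le_trans (fit_lip _ _ _) _.
  - exact/normc_cexpN_le1/Re_scale.
  - by rewrite normc1.
  rewrite mulrC ler_wpM2r ?(ltW (aX j))//; apply: (le_trans (cexpNB1_le (Re_scale n w0))).
  by rewrite normc_scale -mulrnAr mulrC ler_wpM2r// lerMn2r.
have D0 j : normc (D j) <= normc (D 0%N).
  rewrite /D !normcM !normc_Cx !(ger0_norm (aV _)) expr0 invr1 mul1r.
  rewrite mulrC ler_pdivrMr// mulrC; apply: fit_lip; exact/normc_cexpN_le1/Re_scale.
have DS j : normc (D j.+1 - D j) <= normc (D 0%N) * eta X (c *+ 2 * a ^- n * a ^+ j).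
  have -> : D j.+1 - D j = Cx (a ^- j.+1) * (f (u j) - f (v j) - Cx a * (u j - v j)).
    have e : Cx (a ^- j) = Cx (a ^- j.+1) * Cx a.
      by rewrite -CxM exprS invfM mulrAC mulVf ?mul1r// gt_eqF.
    rewrite /D (_ : u j.+1 = f (u j))// (_ : v j.+1 = f (v j))// e; ring.
  rewrite normcM normc_Cx (ger0_norm (aV _)).
  apply: (le_trans (ler_wpM2l (aV _) (gfX_expansion X1 Xnd p1 Xlog (u1 j) (v1 j) (ub j) (vb j)))).
  have eta0 : 0 <= eta X (c *+ 2 * a ^- n * a ^+ j).
    by apply: eta_ge0 => //; rewrite !mulr_ge0// ltW.
  apply: (@le_trans _ _ (normc (D j) * eta X (c *+ 2 * a ^- n * a ^+ j))).
    rewrite /D normcM normc_Cx (ger0_norm (aV _)) exprS invfM.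
    rewrite le_eqVlt; apply/orP; left; apply/eqP.
    by field; rewrite !gt_eqF.
  by rewrite ler_wpM2r.
have Dn : normc (D n - D 0%N) <= normc (D 0%N) * E.
  have -> : D n - D 0%N = \sum_(0 <= j < n) (D j.+1 - D j) by rewrite telescope_sumr.
  apply: (le_trans (normc_sum _ _)).
  apply: (@le_trans _ _ (\sum_(0 <= j < n) normc (D 0%N) * eta X (c *+ 2 * a ^- n * a ^+ j))).
    by apply: ler_sum => j _.
  rewrite -mulr_sumr ler_wpM2l ?normc_ge0//.
  (* Read backwards, the distances 2 c a^{j - n} for j < n are 2c/a, ..., 2c/a^n, the arguments in
     [etasum]. *)
  apply: le_trans (hE n); rewrite /etasum big_nat_rev /= add0n.
  rewrite !big_nat; apply: ler_sum => j /andP[_ jn].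
  rewrite le_eqVlt; apply/orP; left; apply/eqP; congr (eta X _); rewrite -mulrA; congr (_ * _).
  rewrite -{1}(subnK jn) exprD invfM mulrAC mulVf ?mul1r// gt_eqF//.
have un : psin n z = u n by [].
have vn : psin n w = v n by [].
have D00 : D 0%N = cexpN (Cx (a ^- n) * z) - cexpN (Cx (a ^- n) * w).
  by rewrite /D expr0 invr1 Cx1 mul1r.
have an : Cx (a ^+ n) * D n = u n - v n.
  by rewrite /D mulrA -CxM divff ?gt_eqF// Cx1 mul1r.
have -> : psin n z - psin n w + (z - w) = Cx (a ^+ n) * (D n - D 0%N)
   + Cx (a ^+ n) * (cexpN (Cx (a ^- n) * z) - 1 + Cx (a ^- n) * z)
   - Cx (a ^+ n) * (cexpN (Cx (a ^- n) * w) - 1 + Cx (a ^- n) * w).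
  have e (y : C) : Cx (a ^+ n) * (Cx (a ^- n) * y) = y.
    by rewrite mulrA -CxM divff ?gt_eqF// Cx1 mul1r.
  rewrite un vn -an mulrBr D00.
  rewrite !mulrDr !e; ring.
apply: (le_trans (le_normcB _ _)); apply: (le_trans (lerD (le_normcD _ _) (lexx _))).
rewrite !normcM !normc_Cx !(gtr0_norm (aX n)) -addrA; apply: lerD.
  apply: (le_trans (ler_wpM2l (ltW (aX n)) Dn)); rewrite mulrA ler_wpM2r//.
  rewrite D00; apply: (le_trans (scaled_diff n z0 w0)).
  rewrite mulr_natl mulr2n -!ReN -!ImN -ReD -ImD.
  by apply: lerD; [exact: le_Re_normc|exact: le_Im_normc].
have q (y : C) : 0 <= Re y -> a ^+ n * normc (cexpN (Cx (a ^- n) * y) - 1 + Cx (a ^- n) * y) <=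
    4 * normc y ^+ 2 * a ^- n.
  move=> y0; apply: (le_trans (ler_wpM2l (ltW (aX n)) (cexpN_quad (Re_scale n y0)))).
  rewrite normc_scale le_eqVlt; apply/orP; left; apply/eqP.
  by field; rewrite gt_eqF.
by have := q z z0; have := q w w0; lra.
Qed.

(** Strict differentiability of psi at 0 with derivative -1 in the closed right half-plane. It shows
    that psi is not constant, and that it moves along vertical directions. *)
Lemma psi_near e : 0 < e -> exists2 c, 0 < c & forall z w : C, 0 <= Re z -> 0 <= Re w ->
  normc z <= c -> normc w <= c -> normc (psi z - psi w + (z - w)) <= e * normc (z - w).
Proof.
move=> e0; have e2 : 0 < e / 2 by rewrite divr_gt0.
have [c c0 hc] := etasum_small X1 Xnd Xlog e2.
exists (c / 2); first by rewrite divr_gt0.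
move=> z w z0 w0 zc wc.
have -> : e * normc (z - w) = 2 * normc (z - w) * (e / 2) by field.
apply: (psi_expansion z0 w0 zc wc) => M; apply: hc.
  by rewrite mulrn_wge0// divr_ge0// ltW.
by rewrite mulr2n; lra.
Qed.

Lemma psi0 : psi 0 = 1.
Proof.
have h0 : 0 <= Re (0 : C) by [].
apply: ccvg_unique (psi_cvg h0) _.
have -> : psin^~ 0 = (fun=> 1); last exact: ccvg_cst.
by apply/funext => n; rewrite /psin mulr0 cexpN0 -[X in fit n X]Cx1 fit_Cx fitR1.
Qed.

Let psiR_small : exists2 c, 0 < c & forall x, 0 <= x -> x <= c ->
  `|psiR x - 1 + x| <= x / 2.
Proof.
have [|c c0 hc] := @psi_near (1 / 2); first by rewrite divr_gt0.
exists c => // x x0 xc.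
have := hc (Cx x) 0 x0 (lexx _); rewrite normc_Cx normc0 ger0_norm// => /(_ xc (ltW c0)).
by rewrite !subr0 psi0 psi_Cx// -Cx1 -CxB -CxD !normc_Cx (ger0_norm x0); lra.
Qed.

Lemma psiR_lt1 x : 0 < x -> psiR x < 1.
Proof.
move=> x0; have [c c0 hc] := psiR_small.
pose y := Num.min x c; have y0 : 0 < y by rewrite lt_min x0.
apply: (@le_lt_trans _ _ (psiR y)).
  by apply: psiR_le; [exact: ltW|rewrite ge_min lexx].
have := hc y (ltW y0); rewrite ge_min lexx orbT => /(_ isT); rewrite ler_norml; lra.
Qed.

Lemma fitR_gt0 j x : 0 < x -> x <= 1 -> 0 < fitR j x.
Proof.
move=> x0 x1; elim: j => //= j ih.
have /andP[f0 f1] := @fitR01 j x (introT andP (conj (ltW x0) x1)).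
by rewrite gfR_gXR ?f0// mulr_gt0// gXR_gt0// f0.
Qed.

(** Near 0 by the expansion; elsewhere by writing x = a^K y with y small, as iterates of f preserve
    positivity. *)
Lemma psiR_gt0 x : 0 <= x -> 0 < psiR x.
Proof.
move=> x0; have [c c0 hc] := psiR_small.
pose c' := Num.min c (1 / 2); have c'0 : 0 < c' by rewrite lt_min c0 divr_gt0.
have [K hK] := exists_expr_ge (x / c') a1.
have xK : a ^- K * x <= c'.
  by rewrite mulrC ler_pdivrMr// mulrC -ler_pdivrMr.
have xK0 : 0 <= a ^- K * x by rewrite mulr_ge0.
have -> : x = a ^+ K * (a ^- K * x) by rewrite mulrA divff ?mul1r// gt_eqF.
rewrite psiR_scale_iter//; apply: fitR_gt0; last exact: psiR_le1.
have := hc _ xK0; move: xK; rewrite le_min => /andP[xc x1] /(_ xc).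
rewrite ler_norml; lra.
Qed.

End normalized_limit.

(** * Sequences with geometrically small differences *)

Section geometric_sequences.
Context {R : realType}.
Local Notation C := (complex R).

Lemma sum_geo_le (q : R) n : 0 <= q < 1 -> \sum_(0 <= i < n) q ^+ i <= (1 - q)^-1.
Proof.
move=> /andP[q0 q1].
rewrite -[leRHS]mul1r ler_pdivlMr ?subr_gt0// mulrC big_mkord.
rewrite (_ : _ * _ = 1 - q ^+ n) ?gerBl ?exprn_ge0//.
by rewrite -[RHS]opprB subrX1 -mulNr opprB.
Qed.

Lemma geo_ccvg (u : nat -> C) (K q : R) : 0 <= K -> 0 <= q < 1 ->
  (forall n, normc (u n.+1 - u n) <= K * q ^+ n) ->
  exists2 l, ccvg u l & forall n, normc (u n - l) <= K * q ^+ n / (1 - q).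
Proof.
move=> K0 /andP[q0 q1] hu.
have [|l ul] := ccvg_cauchy hu.
  have := @is_cvg_geometric_series R K q; rewrite /geometric /=; apply.
  by rewrite ger0_norm.
exists l => // n.
rewrite normcB; apply: (ccvg_normc_le (b := fun=> _) ul); last exact: cvg_cst.
exists n => // m /= nm.
rewrite -(telescope_sumr (fun i => u i) nm).
apply: (le_trans (normc_sum _ _)).
apply: (@le_trans _ _ (\sum_(n <= i < m) K * q ^+ i)); first by apply: ler_sum.
rewrite -{1}[n]add0n big_addn.
under eq_bigr do rewrite exprD mulrCA.
rewrite -mulr_suml mulrC ler_wpM2l ?mulr_ge0 ?exprn_ge0//.
by apply: sum_geo_le; rewrite q0.
Qed.

Lemma geo_cvg (u : nat -> R) (K q : R) : 0 <= K -> 0 <= q < 1 ->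
  (forall n, `|u n.+1 - u n| <= K * q ^+ n) ->
  exists2 l, u @ \oo --> l & forall n, `|u n - l| <= K * q ^+ n / (1 - q).
Proof.
move=> K0 q01 hu.
have [|l [ul _] hl] := @geo_ccvg (fun n => Cx (u n)) K q K0 q01.
  by move=> n; rewrite -CxB normc_Cx.
exists (Re l) => // n; apply: le_trans (hl n).
by apply: le_trans (le_Re_normc _); rewrite ReD ReN.
Qed.

(** Without its drift lam n, [D] has geometrically small increments and a limit beta; the sums of
    the remaining deviations then converge to gamma. The explicit bounds on beta and gamma are what
    makes M1 and M2 bounded. *)
Lemma second_difference_sum (D : nat -> R) (lam K q : R) : 0 <= K -> 0 <= q < 1 ->
  (forall n, `|D n.+1 - D n - lam| <= K * q ^+ n) ->
  exists beta gamma, [/\ `|beta - D 0%N| <= K / (1 - q), `|gamma| <= K / (1 - q) ^+ 2 &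
  forall m, `|\sum_(0 <= j < m) D j.+1 -
     (lam * (m%:R * (m%:R + 1) / 2) + beta * m%:R + gamma)| <= K / (1 - q) ^+ 2 * q ^+ m].
Proof.
move=> K0 /andP[q0 q1] hD; have q01 : 0 <= q < 1 by rewrite q0.
have q1' : 0 < 1 - q by rewrite subr_gt0.
pose E n := D n - lam * n%:R.
have [|beta _ hb] := @geo_cvg E K q K0 q01.
  move=> n; rewrite (le_trans _ (hD n))// le_eqVlt; apply/orP; left; apply/eqP.
  by congr `|_|; rewrite /E -natr1; ring.
pose S m := \sum_(0 <= j < m) (E j.+1 - beta).
have K1 : 0 <= K / (1 - q) * q by rewrite mulr_ge0// divr_ge0// ltW.
have [|gamma _ hg] := @geo_cvg S (K / (1 - q) * q) q K1 q01.
  move=> n; rewrite /S big_nat_recr//= [X in `|X|]addrAC subrr add0r.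
  by rewrite (le_trans (hb n.+1))// exprS le_eqVlt; apply/orP; left; apply/eqP; ring.
have hK : K / (1 - q) * q / (1 - q) <= K / (1 - q) ^+ 2.
  have -> : K / (1 - q) * q / (1 - q) = K / (1 - q) ^+ 2 * q.
    by field; rewrite gt_eqF.
  by rewrite ler_piMr ?divr_ge0 ?sqr_ge0// ltW.
exists beta, gamma; split.
- by have := hb 0%N; rewrite /E mulr0 subr0 expr0 mulr1 distrC.
- have := hg 0%N; rewrite /S big_geq// sub0r normrN expr0 mulr1 => h.
  exact: le_trans h hK.
- move=> m; have -> : \sum_(0 <= j < m) D j.+1 -
     (lam * (m%:R * (m%:R + 1) / 2) + beta * m%:R + gamma) = S m - gamma.
    rewrite opprD addrA; congr (_ - _).
    rewrite /S /E; elim: m => [|m ih]; first by rewrite !big_geq//; ring.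
    by rewrite !big_nat_recr//= -ih -!natr1; field.
  apply: (le_trans (hg m)); rewrite mulrAC; apply: ler_wpM2r => //.
  exact: exprn_ge0.
Qed.

End geometric_sequences.

(** * Iterates of f relative to a real orbit; factoring the immigration law *)

Section iterates.
Context d (T : measurableType d) (R : realType) (P : probability T R).
Local Notation C := (complex R).
Variables (X : {RV P >-> nat}) (HX : offspring_law X).
Local Notation a := (offmean X).
Local Notation f := (gf P X).
Local Notation fR := (gfR P X).
Local Notation g := (gX X).
Local Notation gR := (gXR X).
Implicit Types (z : C) (x y r : R).

Let X1 := offspring_ge1 HX.
Let Xnd := offspring_nondeg HX.
Let p1 := offspring_p1 HX.
Let mX : measurable_fun setT X. Proof. exact: measurable_funPT. Qed.
Let mX1 : measurable_fun setT (fun w => (X w).-1).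
Proof. exact: (@measurableT_comp _ _ _ _ _ _ predn). Qed.

Lemma gXR_le x y : 0 <= x -> x <= y -> y <= 1 -> gR x <= gR y.
Proof. exact: gfR_le. Qed.

Lemma gXR_theta r : 0 <= r -> r < 1 -> 0 <= gR r < 1.
Proof. by move=> r0 r1; rewrite gfR_ge0//= gXR_lt1. Qed.

Lemma fitR_geo j x r : 0 <= x -> x <= r -> r < 1 -> fitR X j x <= x * gR r ^+ j.
Proof.
move=> x0 xr r1; have x1 : x <= 1 := le_trans xr (ltW r1).
have r0 := le_trans x0 xr; have /andP[th0 th1] := gXR_theta r0 r1.
elim: j => [|j ih]; first by rewrite mulr1.
have f0 := fitR_ge0 X j x0 x1.
have fx : fitR X j x <= x by apply: (le_trans ih); rewrite ler_piMr ?exprn_ile1// ltW.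
rewrite /= gfR_gXR//; last by rewrite f0 fitR_le1.
rewrite exprSr mulrA ler_pM// ?gfR_ge0//.
by apply: gXR_le => //; [exact: le_trans fx xr|exact: ltW].
Qed.

(** Dividing by a real positive orbit removes the common decay of the iterates, so that the ratio
    converges. *)
Definition rho (x0 : R) z j : C := fit X j z / Cx (fitR X j x0).

(** From f(w) = w g(w), consecutive ratios differ by the relative variation of g between the two
    orbits. As g is Lipschitz and both orbits tend to 0 like theta^j, the increments are
    summable. *)
Lemma rho_bounds r : 0 < r -> r < 1 -> exists2 K, 0 <= K &
  forall (z : C) x0, normc z <= r -> 0 < x0 -> x0 <= r ->
  (forall j, normc (rho x0 z j.+1 - rho x0 z j) <= K * gR r ^+ j * normc (z / Cx x0 - 1)) /\
  (forall j, normc (rho x0 z j - 1) <= K * normc (z / Cx x0 - 1)).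
Proof.
move=> r0 r1; have /andP[th0 th1] := gXR_theta (ltW r0) r1.
set th := gR r in th0 th1 *.
have th1' : 0 < 1 - th by rewrite subr_gt0.
(* The Lipschitz constant 1/(1 - r) of g, divided by its lower bound p_1. *)
pose k := ((1 - r) * mass X 1)^-1.
have k0 : 0 <= k by rewrite invr_ge0 mulr_ge0 ?subr_ge0 ?(ltW p1)// ltW.
pose K1 := expR (k / (1 - th)).
have K1_1 : 1 <= K1.
  by apply: le_trans (expR_ge1Dx _); rewrite lerDl divr_ge0// ltW.
have K10 : 0 <= K1 := expR_ge0 _.
exists ((k + 1) * K1); first by rewrite mulr_ge0 ?addr_ge0.
move=> z x0 zr x00 x0r; have x01 : x0 <= 1 := le_trans x0r (ltW r1).
set e0 := normc _; have e00 : 0 <= e0 := normc_ge0 _.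
have xj0 j : 0 < fitR X j x0 by apply: fitR_gt0.
have xjr j : fitR X j x0 <= r.
  apply: (le_trans (fitR_geo j (ltW x00) x0r r1)).
  by apply: le_trans x0r; rewrite ler_piMr ?(ltW x00)// exprn_ile1// ltW.
have wj j : normc (fit X j z) <= r * th ^+ j.
  apply: (le_trans (normc_fit_le X j zr (ltW r1))).
  by apply: fitR_geo => //; exact: ltW.
have wjr j : normc (fit X j z) <= r.
  by apply: (le_trans (wj j)); rewrite ler_piMr ?(ltW r0)// exprn_ile1// ltW.
have step j : normc (rho x0 z j.+1 - rho x0 z j) <= k * th ^+ j * normc (rho x0 z j - 1).
  have xj1 : 0 <= fitR X j x0 <= 1 by rewrite (ltW (xj0 j)) (le_trans (xjr j))// ltW.
  have wj1 : normc (fit X j z) <= 1 by rewrite (le_trans (wjr j))// ltW.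
  have gp := gXR_gt0 X1 p1 xj1.
  have CxJ : Cx (fitR X j x0) != 0 by rewrite Cx_eq0 gt_eqF.
  have Cxg : Cx (gR (fitR X j x0)) != 0 by rewrite Cx_eq0 gt_eqF.
  have -> : rho x0 z j.+1 - rho x0 z j =
      fit X j z * (g (fit X j z) - g (Cx (fitR X j x0))) / Cx (fitR X j x0) /
      Cx (gR (fitR X j x0)).
    rewrite /rho /= gf_gX// gfR_gXR// /gX gf_Cx -/(gR _) -/(gX X) CxM.
    by field; rewrite CxJ Cxg.
  have gl := gf_lip P mX1 (wjr j) (_ : normc (Cx (fitR X j x0)) <= r) r1.
  rewrite !normcM !normcV !normc_Cx !gtr0_norm//.
  have {}gl := gl _; rewrite normc_Cx gtr0_norm// in gl.
  have e : normc (fit X j z - Cx (fitR X j x0)) = fitR X j x0 * normc (rho x0 z j - 1).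
    have -> : fit X j z - Cx (fitR X j x0) = Cx (fitR X j x0) * (rho x0 z j - 1).
      by rewrite /rho; field; rewrite CxJ.
    by rewrite normcM normc_Cx gtr0_norm.
  have {}gl := gl (xjr j); rewrite e in gl.
  have gpi : (gR (fitR X j x0))^-1 <= (mass X 1)^-1.
    by rewrite lef_pV2 ?posrE//; exact: gXR_ge.
  set A := normc (fit X j z); set B := normc (_ - _) in gl *; set e1 := normc (rho _ _ _ - 1) in gl *.
  have e10 : 0 <= e1 := normc_ge0 _.
  have A0 : 0 <= A := normc_ge0 _.
  have hB : B / fitR X j x0 <= e1 / (1 - r).
    rewrite ler_pdivrMr// (le_trans gl)// le_eqVlt; apply/orP; left; apply/eqP; ring.
  have -> : A * B / fitR X j x0 / gR (fitR X j x0) = A * (B / fitR X j x0) * (gR (fitR X j x0))^-1 by ring.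
  apply: (@le_trans _ _ (th ^+ j * (e1 / (1 - r)) * (mass X 1)^-1)); last first.
    rewrite le_eqVlt; apply/orP; left; apply/eqP; rewrite /k; field.
    by rewrite subr_eq0 !gt_eqF.
  apply: ler_pM => //.
  - by rewrite mulr_ge0// divr_ge0 ?normc_ge0// ltW.
  - by rewrite invr_ge0 ltW.
  - apply: ler_pM => //; first by rewrite divr_ge0 ?normc_ge0// ltW.
    by apply: (le_trans (wj j)); rewrite ler_piMl ?exprn_ge0// ltW.
(* A discrete Gronwall argument: the distance to 1 grows at most by the factor 1 + k theta^j, which
   is bounded by e^{k theta^j}. *)
have dev j : normc (rho x0 z j - 1) <= expR (k * \sum_(0 <= i < j) th ^+ i) * e0.
  elim: j => [|j ih]; first by rewrite big_geq// mulr0 expR0 mul1r.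
  have -> : rho x0 z j.+1 - 1 = (rho x0 z j.+1 - rho x0 z j) + (rho x0 z j - 1) by ring.
  apply: (le_trans (le_normcD _ _)); apply: (le_trans (lerD (step j) (lexx _))).
  rewrite -{2}[normc _]mul1r -mulrDl big_nat_recr//= mulrDr expRD [X in X * e0]mulrC -mulrA.
  rewrite ler_pM ?normc_ge0 ?addr_ge0 ?mulr_ge0 ?exprn_ge0//.
  by rewrite addrC expR_ge1Dx.
have dev' j : normc (rho x0 z j - 1) <= K1 * e0.
  apply: (le_trans (dev j)); rewrite ler_wpM2r// ler_expR ler_wpM2l// sum_geo_le//.
  by rewrite th0.
split=> j; last first.
  by apply: (le_trans (dev' j)); rewrite ler_wpM2r// ler_peMl// lerDr.
apply: (le_trans (step j)).
apply: (@le_trans _ _ (k * th ^+ j * (K1 * e0))).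
  by rewrite ler_wpM2l// mulr_ge0// exprn_ge0.
have -> : (k + 1) * K1 * th ^+ j * e0 = k * th ^+ j * (K1 * e0) + K1 * th ^+ j * e0 by ring.
by rewrite lerDl !mulr_ge0// exprn_ge0.
Qed.

Variables (Y : {RV P >-> nat}) (nu : nat).
Hypothesis Y_ge1 : forall w, (1 <= Y w)%N.
Hypothesis q_nu : 0 < mass Y nu.
Hypothesis nu_min : forall i : nat, 0 < mass Y i -> (nu <= i)%N.
Let mY : measurable_fun setT Y. Proof. exact: measurable_funPT. Qed.
Local Notation Y' := (fun w => (Y w - nu)%N).
Let mY' : measurable_fun setT Y'.
Proof. exact: (@measurableT_comp _ _ _ _ _ _ (subn^~ nu)). Qed.

Lemma mass_lt_nu k : (k < nu)%N -> mass Y k = 0.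
Proof.
move=> knu; apply/eqP; rewrite eq_le fine_ge0// andbT leNgt; apply/negP => /nu_min.
by rewrite leqNgt knu.
Qed.

(** [Y >= nu] is known only almost surely and the subtraction is truncated, so the identity fails
    pointwise. It is checked on each event Y = k, the values k < nu having mass 0. *)
Lemma gf_Y z : normc z <= 1 -> gf P Y z = z ^+ nu * gf P Y' z.
Proof.
move=> z1; have zn k : normc (z ^+ k) <= 1 by rewrite normc_X exprn_ile1 ?normc_ge0.
have bY : cbdd (fun w => z ^+ Y w) by apply: (cbdd_pow mY).
have bY' : cbdd (fun w => z ^+ Y' w) by apply: (cbdd_pow mY').
rewrite -CEZ; last exact: cbdd_citg.
apply: (CE_eq_nat mY) => //.
  by apply: cbddM => //; exact: cbdd_cst.
move=> k; have bk : cbdd (fun w => (Y w == k)%:R : C).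
  by apply: (cbdd_nat (g := fun m => (m == k)%:R) (M := 1)) => // n; exact: normc_bool.
have e (u : C) : CE P (fun w => u * (Y w == k)%:R) = u * Cx (mass Y k).
  rewrite CEZ; last exact: cbdd_citg.
  rewrite (CE_indic P (A := Y @^-1` [set k]))//; first exact: measurable_fiber.
  by move=> w; split => [/eqP|->].
transitivity (CE P (fun w => z ^+ k * (Y w == k)%:R)).
  by apply: eq_CE => w; case: eqP => [->//|_]; rewrite !mulr0.
transitivity (CE P (fun w => z ^+ nu * z ^+ (k - nu) * (Y w == k)%:R)); last first.
  by apply: eq_CE => w; case: eqP => [->//|_]; rewrite !mulr0.
rewrite !e; have [knu|nuk] := ltnP k nu; first by rewrite mass_lt_nu// Cx0 !mulr0.
by rewrite -exprD subnKC.
Qed.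

Lemma gfR_Y x : 0 <= x <= 1 -> gfR P Y x = x ^+ nu * gfR P Y' x.
Proof.
move=> x01; apply: (@complexI R); rewrite -gf_Cx gf_Y; last first.
  by case/andP: x01 => x0 x1; rewrite normc_Cx ger0_norm.
by rewrite gf_Cx -CxX -CxM.
Qed.

Lemma gfR_Y'_ge x : 0 <= x <= 1 -> mass Y nu <= gfR P Y' x.
Proof.
move=> x01; apply: (le_trans _ (gfR_ge_mass0 P mY' x01)).
rewrite /mass fine_le ?fin_num_measure//; last first.
- apply: le_measure; rewrite ?inE; try exact: measurable_fiber.
  by move=> w /= ->; rewrite subnn.
- exact: measurable_fiber.
- exact: measurable_fiber.
Qed.

End iterates.

Ltac neq0 := repeat (apply/andP; split); apply: lt0r_neq0; first [done | lra].

Lemma Cx_nat (R : realType) (n : nat) : Cx (n%:R : R) = n%:R.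
Proof. exact: rmorph_nat. Qed.

Lemma ln_diff_le (R : realType) (s s0 : R) : 0 < s0 -> s0 <= s ->
  0 <= ln s - ln s0 <= (s - s0) / s0.
Proof.
move=> s00 ss; have s0' : 0 < s := lt_le_trans s00 ss.
rewrite subr_ge0 ler_ln ?posrE// ss /= -ln_div ?posrE//.
have := @le_ln1Dx R (s / s0 - 1); rewrite [1 + _]addrC subrK => h.
have -> : (s - s0) / s0 = s / s0 - 1 by field; rewrite gt_eqF.
by apply: h; have := divr_gt0 s0' s00; lra.
Qed.

(** * Immigration ratios and contraction of psi along rays *)

Section ratios.
Context d (T : measurableType d) (R : realType) (P : probability T R).
Local Notation C := (complex R).
Variables (X : {RV P >-> nat}) (HX : offspring_law X).
Local Notation a := (offmean X).
Local Notation f := (gf P X).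
Local Notation fR := (gfR P X).
Local Notation g := (gX X).
Local Notation gR := (gXR X).
Variables (Y : {RV P >-> nat}) (nu : nat).
Hypothesis Y_ge1 : forall w, (1 <= Y w)%N.
Hypothesis q_nu : 0 < mass Y nu.
Hypothesis nu_min : forall i : nat, 0 < mass Y i -> (nu <= i)%N.
Implicit Types (z : C) (x y r : R).

Let X1 := offspring_ge1 HX.
Let Xnd := offspring_nondeg HX.
Let p1 := offspring_p1 HX.
Let Xlog := offspring_XlogX HX.
Let mX : measurable_fun setT X. Proof. exact: measurable_funPT. Qed.
Let mX1 : measurable_fun setT (fun w => (X w).-1).
Proof. exact: (@measurableT_comp _ _ _ _ _ _ predn). Qed.
Let mY : measurable_fun setT Y. Proof. exact: measurable_funPT. Qed.
Local Notation Y' := (fun w => (Y w - nu)%N).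
Let mY' : measurable_fun setT Y'.
Proof. exact: (@measurableT_comp _ _ _ _ _ _ (subn^~ nu)). Qed.
Local Notation Q := (gf P Y).
Local Notation QR := (gfR P Y).
Let a1 : 1 < a := offmean_gt1 X1 Xnd Xlog.
Let a0 : 0 < a := offmean_gt0 X1 Xnd Xlog.

Lemma gfR_lip (N : T -> nat) (x y r : R) : measurable_fun setT N ->
  0 <= x -> x <= y -> y <= r -> r < 1 -> gfR P N y - gfR P N x <= (y - x) / (1 - r).
Proof.
move=> mN x0 xy yr r1.
have nx : normc (Cx x) <= r by rewrite normc_Cx ger0_norm// (le_trans xy).
have ny : normc (Cx y) <= r by rewrite normc_Cx ger0_norm// (le_trans x0).
have := gf_lip P mN ny nx r1.
rewrite !gf_Cx -!CxB !normc_Cx (ger0_norm (_ : 0 <= y - x)) ?subr_ge0//.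
by apply: le_trans; exact: ler_norm.
Qed.

Lemma QR_gt0 x : 0 < x -> x <= 1 -> 0 < QR x.
Proof.
move=> x0 x1; have x01 : 0 <= x <= 1 by rewrite (ltW x0).
rewrite (gfR_Y nu_min x01) mulr_gt0 ?exprn_gt0//.
exact: lt_le_trans q_nu (gfR_Y'_ge Y nu x01).
Qed.

(** With Q(x) = x^nu Q'(x) and f(x) = x g(x), the logarithmic increment is nu ln g(x_j) plus an
    increment of ln Q'. Since x_j decays geometrically, g(x_j) approaches p_1 and Q'(x_j) approaches
    Q'(0) at that rate; these are the two summands of [K]. *)
Lemma ln_QR_step r : 0 < r -> r < 1 -> exists2 K, 0 <= K & forall x j, 0 < x -> x <= r ->
  `|ln (QR (fitR X j.+1 x)) - ln (QR (fitR X j x)) - nu%:R * ln (mass X 1)| <= K * gR r ^+ j.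
Proof.
move=> r0 r1; have /andP[th0 th1] := gXR_theta HX (ltW r0) r1.
have r1' : 0 < 1 - r by rewrite subr_gt0.
pose c0 := gfR P Y' 0.
have c00 : 0 < c0.
  by apply: lt_le_trans q_nu (gfR_Y'_ge _ _ _); rewrite lexx ler01.
pose K := nu%:R / ((1 - r) * mass X 1) + 1 / ((1 - r) * c0).
have K0 : 0 <= K by rewrite addr_ge0// divr_ge0// mulr_ge0// ltW.
exists K => // x j x0 xr; have x1 : x <= 1 := le_trans xr (ltW r1).
set xj := fitR X j x; set xj1 := fitR X j.+1 x.
have xjp : 0 < xj by exact: fitR_gt0.
have xj1p : 0 < xj1 by exact: fitR_gt0.
have xjr : xj <= r.
  apply: (le_trans (fitR_geo HX j (ltW x0) xr r1)).
  by apply: le_trans xr; rewrite ler_piMr ?(ltW x0)// exprn_ile1// ltW.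
have xjle1 : 0 <= xj <= 1 by rewrite ltW//= (le_trans xjr)// ltW.
have xj1le1 : 0 <= xj1 <= 1 by rewrite ltW//=; exact: fitR_le1 (ltW x0) x1.
have xjth : xj <= gR r ^+ j.
  apply: (le_trans (fitR_geo HX j (ltW x0) xr r1)).
  by rewrite ler_piMl// exprn_ge0.
have e1 : xj1 = xj * gR xj by rewrite /xj1 /= gfR_gXR.
have gp : 0 < gR xj := gXR_gt0 X1 p1 xjle1.
have g1 : gR xj <= 1 by apply: gfR_le1.
have xj1r : xj1 <= xj by rewrite e1 ler_piMr// ltW.
have Q'p y : 0 <= y <= 1 -> c0 <= gfR P Y' y.
  by move=> /andP[y0 y1]; exact: gfR_le.
rewrite !(gfR_Y nu_min)//.
have Q1 := Q'p _ xjle1; have Q2 := Q'p _ xj1le1.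
have Q10 := lt_le_trans c00 Q1; have Q20 := lt_le_trans c00 Q2.
rewrite !lnM ?posrE ?exprn_gt0// !lnXn// e1 lnM ?posrE//.
have := ln_diff_le c00 Q1; have := ln_diff_le c00 Q2.
have g10 : mass X 1 <= gR xj := gXR_ge X1 xjle1.
have := ln_diff_le p1 g10.
have L1 : gR xj - mass X 1 <= xj / (1 - r).
  by rewrite -(gXR0 X1) -[X in _ <= X / _]subr0; apply: gfR_lip => //; exact: ltW.
have L2 : gfR P Y' xj - c0 <= xj / (1 - r).
  by rewrite -[X in _ <= X / _]subr0; apply: gfR_lip => //; exact: ltW.
have L3 : gfR P Y' xj1 - c0 <= xj / (1 - r).
  apply: (@le_trans _ _ (xj1 / (1 - r))); last by rewrite ler_wpM2r// invr_ge0 ltW.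
  rewrite -[X in _ <= X / _]subr0; apply: gfR_lip => //; first exact: ltW.
  exact: le_trans xj1r xjr.
rewrite -/xj1 -e1 -/c0 => /andP[A0 A1] /andP[B0 B1] /andP[D0 D1].
have A1' : ln (gR xj) - ln (mass X 1) <= gR r ^+ j / (1 - r) / mass X 1.
  apply: (le_trans A1); rewrite ler_wpM2r ?invr_ge0 ?(ltW p1)//.
  by apply: (le_trans L1); rewrite ler_wpM2r// invr_ge0 ltW.
have B1' : ln (gfR P Y' xj1) - ln c0 <= gR r ^+ j / (1 - r) / c0.
  apply: (le_trans B1); rewrite ler_wpM2r ?invr_ge0 ?(ltW c00)//.
  by apply: (le_trans L3); rewrite ler_wpM2r// invr_ge0 ltW.
have D1' : ln (gfR P Y' xj) - ln c0 <= gR r ^+ j / (1 - r) / c0.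
  apply: (le_trans D1); rewrite ler_wpM2r ?invr_ge0 ?(ltW c00)//.
  by apply: (le_trans L2); rewrite ler_wpM2r// invr_ge0 ltW.
have eK : K * gR r ^+ j = nu%:R * (gR r ^+ j / (1 - r) / mass X 1) + gR r ^+ j / (1 - r) / c0.
  by rewrite /K; field; neq0.
have N0 : 0 <= nu%:R * (ln (gR xj) - ln (mass X 1)) by rewrite mulr_ge0.
have N1 : nu%:R * (ln (gR xj) - ln (mass X 1)) <= nu%:R * (gR r ^+ j / (1 - r) / mass X 1).
  by rewrite ler_wpM2l.
rewrite eK -[(ln xj + _) *+ nu]mulr_natl -[ln xj *+ nu]mulr_natl.
have -> : nu%:R * (ln xj + ln (gR xj)) + ln (gfR P Y' xj1) - (nu%:R * ln xj + ln (gfR P Y' xj)) -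
   nu%:R * ln (mass X 1) = nu%:R * (ln (gR xj) - ln (mass X 1)) + (ln (gfR P Y' xj1) - ln c0)
    - (ln (gfR P Y' xj) - ln c0) by ring.
by rewrite ler_norml; apply/andP; split; lra.
Qed.

(** A bound at j = 0 that holds for all j, by the monotone quotient of the iterates. [Qrho_le] adds
    one application of Q, whose quotient is monotone because Y >= 1. *)
Lemma rho_le j z x0 : normc z <= x0 -> 0 < x0 -> x0 <= 1 ->
  normc (rho X x0 z j) <= normc z / x0.
Proof.
move=> zx x00 x01; rewrite /rho normcM normcV normc_Cx gtr0_norm; last exact: fitR_gt0.
have h := fitR_ratio HX j (normc_ge0 z) zx x01.
have fp : 0 < fitR X j x0 by exact: fitR_gt0.
rewrite ler_pdivrMr// mulrAC ler_pdivlMr//.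
apply: le_trans (_ : fitR X j (normc z) * x0 <= _); last by rewrite [leRHS]mulrC.
rewrite ler_wpM2r ?(ltW x00)//; apply: normc_fit_le => //.
exact: le_trans zx x01.
Qed.

Definition Qrho (x0 : R) z j : C := Q (fit X j z) / Cx (QR (fitR X j x0)).

Lemma Qrho_le j z x0 : normc z <= x0 -> 0 < x0 -> x0 <= 1 ->
  normc (Qrho x0 z j) <= normc z / x0.
Proof.
move=> zx x00 x01; have z1 : normc z <= 1 := le_trans zx x01.
have fp : 0 < fitR X j x0 by exact: fitR_gt0.
have f1 : fitR X j x0 <= 1 by apply: fitR_le1 => //; exact: ltW.
have Qp := QR_gt0 fp f1.
rewrite /Qrho normcM normcV normc_Cx gtr0_norm//.
have h := fitR_ratio HX j (normc_ge0 z) zx x01.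
set y := fitR X j (normc z) in h.
have y0 : 0 <= y by apply: fitR_ge0 => //; exact: normc_ge0.
have yx : y <= fitR X j x0 by apply: fitR_le => //; exact: normc_ge0.
have h2 := gfR_ratio P mY Y_ge1 y0 yx f1.
have h3 : normc (Q (fit X j z)) <= QR y.
  apply: normc_gf_le => //; first exact: normc_fit_le.
  exact: le_trans yx f1.
rewrite ler_pdivrMr//; apply: (le_trans h3).
rewrite -(ler_pM2r fp); apply: (le_trans h2).
have -> : normc z / x0 * QR (fitR X j x0) * fitR X j x0 =
   QR (fitR X j x0) * (fitR X j x0 * normc z / x0) by ring.
by rewrite ler_wpM2l ?(ltW Qp)// ler_pdivlMr.
Qed.

(** Q(w) is w^nu times a function that is Lipschitz and bounded below at the real orbit. The power
    nu of the ratio factors out and the second factor is close to its value at the real orbit. *)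
Lemma Qrho_rho r : 0 < r -> r < 1 -> exists2 K, 0 <= K & forall j z x0,
  normc z <= x0 -> 0 < x0 -> x0 <= r ->
  normc (Qrho x0 z j - rho X x0 z j ^+ nu) <= K * gR r ^+ j * normc (z / Cx x0 - 1).
Proof.
move=> r0 r1; have /andP[th0 th1] := gXR_theta HX (ltW r0) r1.
have r1' : 0 < 1 - r by rewrite subr_gt0.
have [K K0 hK] := rho_bounds HX r0 r1.
exists (K / ((1 - r) * mass Y nu)); first by rewrite divr_ge0// mulr_ge0// ltW.
move=> j z x0 zx x00 x0r; have x01 : x0 <= 1 := le_trans x0r (ltW r1).
have [_ /(_ j) dev] := hK z x0 (le_trans zx x0r) x00 x0r.
set e0 := normc (z / Cx x0 - 1) in dev *.
have fp : 0 < fitR X j x0 by exact: fitR_gt0.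
have f1 : fitR X j x0 <= 1 by apply: fitR_le1 => //; exact: ltW.
have f01 : 0 <= fitR X j x0 <= 1 by rewrite ltW.
have fth : fitR X j x0 <= gR r ^+ j.
  apply: (le_trans (fitR_geo HX j (ltW x00) x0r r1)).
  by rewrite ler_piMl// exprn_ge0.
have fr : fitR X j x0 <= r.
  apply: (le_trans (fitR_geo HX j (ltW x00) x0r r1)).
  by apply: le_trans x0r; rewrite ler_piMr ?(ltW x00)// exprn_ile1// ltW.
have z1 : normc z <= 1 := le_trans zx x01.
have w1 : normc (fit X j z) <= 1 by exact: normc_fit_le1.
have wr : normc (fit X j z) <= r.
  by apply: le_trans fr; exact: normc_fit_le.
have Q'g := gfR_Y'_ge Y nu f01.
have Q'p := lt_le_trans q_nu Q'g.
have C1 : Cx (fitR X j x0) != 0 by rewrite Cx_eq0 gt_eqF.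
have C2 : Cx (gfR P Y' (fitR X j x0)) != 0 by rewrite Cx_eq0 gt_eqF.
have -> : Qrho x0 z j - rho X x0 z j ^+ nu = rho X x0 z j ^+ nu *
   ((gf P Y' (fit X j z) - gf P Y' (Cx (fitR X j x0))) / Cx (gfR P Y' (fitR X j x0))).
  rewrite /Qrho /rho (gf_Y nu_min)// (gfR_Y nu_min)// CxM CxX gf_Cx expr_div_n.
  by field; rewrite C2 expf_neq0.
rewrite normcM normc_X.
have rl : normc (rho X x0 z j) ^+ nu <= 1.
  rewrite exprn_ile1 ?normc_ge0//; apply: (le_trans (rho_le j zx x00 x01)).
  by rewrite ler_pdivrMr// mul1r.
apply: (@le_trans _ _ (1 * (fitR X j x0 * (K * e0) / (1 - r) / mass Y nu))); last first.
  have -> : K / ((1 - r) * mass Y nu) * gR r ^+ j * e0 = gR r ^+ j * (K * e0) / (1 - r) / mass Y nu.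
    by field; neq0.
  rewrite mul1r; do 2 (rewrite ler_wpM2r ?invr_ge0 ?(ltW q_nu) ?(ltW r1')//).
  by rewrite ler_wpM2r// mulr_ge0// normc_ge0.
apply: ler_pM => //; rewrite ?exprn_ge0 ?normc_ge0//.
rewrite normcM normcV normc_Cx gtr0_norm//.
apply: ler_pM; rewrite ?normc_ge0 ?invr_ge0 ?(ltW Q'p)//; last by rewrite lef_pV2 ?posrE.
have fn : normc (Cx (fitR X j x0)) <= r by rewrite normc_Cx gtr0_norm.
apply: (le_trans (gf_lip P mY' wr fn r1)); rewrite ler_wpM2r ?invr_ge0 ?(ltW r1')//.
have -> : fit X j z - Cx (fitR X j x0) = Cx (fitR X j x0) * (rho X x0 z j - 1).
  by rewrite /rho; field; rewrite C1.
by rewrite normcM normc_Cx gtr0_norm// ler_wpM2l// ltW.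
Qed.

(** Of the series of g only the terms p_1 and p_k w^{k-1} are examined; all others are bounded by
    their moduli. The two are aligned only if w^{k-1} is real and nonnegative, and the imaginary
    part measures the loss. *)
Lemma normc_gX_le (w : C) (w0 : R) k : (2 <= k)%N -> normc w <= w0 -> w0 <= 1 ->
  normc (g w) <= gR w0 - mass X 1 * mass X k * Im (w ^+ k.-1) ^+ 2 / 2.
Proof.
move=> k2 ww w01; have w00 : 0 <= w0 := le_trans (normc_ge0 w) ww.
have w1 : normc w <= 1 := le_trans ww w01.
pose b n := (n == 1%N) || (n == k).
have mXk j : measurable (X @^-1` [set j]) by exact: measurable_fiber.
have bE n : (b n)%:R = (n == 1%N)%:R + (n == k)%:R :> C.
  by rewrite /b; case: eqP => [->|_]; [rewrite eq_sym gtn_eqF//= addr0|rewrite add0r].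
have bER n : (b n)%:R = (n == 1%N)%:R + (n == k)%:R :> R.
  by rewrite /b; case: eqP => [->|_]; [rewrite eq_sym gtn_eqF//= addr0|rewrite add0r].
have bb j : cbdd (fun t => (X t == j)%:R : C).
  by apply: (cbdd_nat (g := fun m => (m == j)%:R) (M := 1)) => // n; exact: normc_bool.
have bw : cbdd (fun t => w ^+ (X t).-1) by apply: (cbdd_pow mX1).
have CEb (c : C) j : CE P (fun t => c * (X t == j)%:R) = c * Cx (mass X j).
  rewrite CEZ; last exact: cbdd_citg.
  rewrite (CE_indic P (A := X @^-1` [set j]))//.
  by move=> t; split => [/eqP|->].
have ib j : itg P (fun t => (X t == j)%:R : R).
  apply: (@itg_bounded _ _ _ _ _ 1); first exact: (measurable_natfun mX (fun n => (n == j)%:R)).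
  by move=> t; case: (X t == j); rewrite ?normr1 ?normr0.
have Exb (c : R) j : Ex P (fun t => c * (X t == j)%:R) = c * mass X j.
  rewrite ExZ// /mass -Ex_indic//; congr (_ * _); apply: eq_Ex => t; rewrite indicE.
  by congr (nat_of_bool _)%:R; apply/eqP/idP => [e|/set_mem//]; rewrite inE.
pose s := w ^+ k.-1; pose s0 := w0 ^+ k.-1.
have iR : itg P (fun t => w0 ^+ (X t).-1) by apply: (itg_pow P mX1); rewrite w00.
have bbw : cbdd (fun t => w ^+ (X t).-1 * (~~ b (X t))%:R).
  apply: cbddM => //; apply: (cbdd_nat (g := fun m => (~~ b m)%:R) (M := 1)) => // n.
  exact: normc_bool.
have e1 : g w = Cx (mass X 1) + s * Cx (mass X k) + CE P (fun t => w ^+ (X t).-1 * (~~ b (X t))%:R).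
  have -> : Cx (mass X 1) = CE P (fun t => 1 * (X t == 1%N)%:R) by rewrite CEb mul1r.
  rewrite -CEb -CED; [|by apply/citgZ/cbdd_citg..].
  rewrite -CED; [|by apply: citgD; apply/citgZ/cbdd_citg|exact: cbdd_citg].
  apply: eq_CE => t; rewrite /b; case: eqP => [->|h1] /=.
    by rewrite eq_sym gtn_eqF//= expr0 !mulr0 !mul1r !addr0.
  by case: eqP => [->|_] /=; rewrite ?mulr0 ?mulr1 ?add0r ?addr0.
have e2 : Ex P (fun t => w0 ^+ (X t).-1 * (~~ b (X t))%:R) = gR w0 - (mass X 1 + s0 * mass X k).
  have -> : mass X 1 = Ex P (fun t => 1 * (X t == 1%N)%:R) by rewrite Exb mul1r.
  rewrite -Exb -ExD; [|exact: itgZ|exact: itgZ].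
  rewrite -ExB; [|exact: iR|by apply: itgD; exact: itgZ].
  apply: eq_Ex => t; rewrite /b; case: eqP => [->|h1] /=.
    by rewrite eq_sym gtn_eqF//= expr0 !mulr0 mulr1 addr0 subrr.
  by case: eqP => [->|_] /=; rewrite ?mulr0 ?mulr1 ?add0r ?subrr ?subr0.
rewrite e1; apply: (le_trans (le_normcD _ _)).
have h2 : normc (CE P (fun t => w ^+ (X t).-1 * (~~ b (X t))%:R)) <=
    gR w0 - (mass X 1 + s0 * mass X k).
  rewrite -e2; apply: normc_CE_le.
  - exact: cbdd_citg.
  - apply: (itg_le (h' := fun t => w0 ^+ (X t).-1)) => //.
      exact: (measurable_natfun mX (fun n => w0 ^+ n.-1 * (~~ b n)%:R)).
    move=> t; rewrite normrM ger0_norm ?exprn_ge0// ler_piMr ?exprn_ge0//.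
    by case: (~~ _); rewrite ?normr1 ?normr0.
  move=> t; rewrite normcM normc_X.
  case: (~~ _); last by rewrite normc0 !mulr0.
  by rewrite normc1 !mulr1 lerXn2r ?nnegrE ?normc_ge0.
have s1 : normc s <= s0 by rewrite normc_X lerXn2r ?nnegrE ?normc_ge0.
have s00 : 0 <= s0 by rewrite exprn_ge0.
have s01 : s0 <= 1 by rewrite exprn_ile1.
have mk : 0 <= mass X k by rewrite fine_ge0.
have m1 := p1; have mk1 := mass_le1 X k; have m11 := mass_le1 X 1.
(* Compared after squaring. The cross term gains through Re s <= s_0 - (Im s)^2 / 2, where s_0 <= 1,
   and p_1 + s_0 p_k <= 1 lets the loss leave the square. *)
have key : normc (Cx (mass X 1) + s * Cx (mass X k)) <=
    mass X 1 + s0 * mass X k - mass X 1 * mass X k * Im s ^+ 2 / 2.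
  have sum1 : mass X 1 + s0 * mass X k <= 1.
    have : 0 <= gR w0 - (mass X 1 + s0 * mass X k).
      by rewrite -e2; apply: Ex_ge0 => t; rewrite mulr_ge0// exprn_ge0.
    have : gR w0 <= 1 by apply: gfR_le1; rewrite ?w00.
    lra.
  have Is : Im s ^+ 2 <= s0 ^+ 2.
    apply: (@le_trans _ _ (normc s ^+ 2)); first by rewrite normc_sqr lerDr sqr_ge0.
    by rewrite lerXn2r ?nnegrE ?normc_ge0.
  have Is1 : Im s ^+ 2 <= s0 by apply: (le_trans Is); rewrite expr2 ler_piMl.
  have rhs0 : 0 <= mass X 1 + s0 * mass X k - mass X 1 * mass X k * Im s ^+ 2 / 2.
    have h9 : mass X k * Im s ^+ 2 <= mass X k * s0 by rewrite ler_wpM2l.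
    have h10 : 0 <= mass X k * Im s ^+ 2 by rewrite mulr_ge0 ?sqr_ge0.
    have h11 : mass X 1 * (mass X k * Im s ^+ 2) <= mass X k * Im s ^+ 2 by rewrite ler_piMl.
    have h12 : 0 <= mass X k * s0 by rewrite mulr_ge0.
    lra.
  rewrite -(ler_pXn2r (n := 2))// ?nnegrE ?normc_ge0//.
  have -> : normc (Cx (mass X 1) + s * Cx (mass X k)) ^+ 2 =
      mass X 1 ^+ 2 + 2 * mass X 1 * mass X k * Re s + mass X k ^+ 2 * normc s ^+ 2.
    by rewrite !normc_sqr [s * _]mulrC ReD ImD ReZ ImZ /=; ring.
  have n2 : normc s ^+ 2 <= s0 ^+ 2 by rewrite lerXn2r ?nnegrE ?normc_ge0.
  have Res : Re s <= s0 - Im s ^+ 2 / 2.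
    have hs : Re s ^+ 2 <= s0 ^+ 2 - Im s ^+ 2 by move: n2; rewrite normc_sqr; lra.
    have r0' : 0 <= s0 - Im s ^+ 2 / 2.
      have := sqr_ge0 (Im s); lra.
    have [rn|rp] := ltP (Re s) 0; first by apply: le_trans (ltW rn) r0'.
    rewrite -(ler_pXn2r (n := 2))// ?nnegrE//; apply: (le_trans hs).
    have h3 : s0 * Im s ^+ 2 <= Im s ^+ 2 by rewrite ler_piMl ?sqr_ge0.
    have h4 := sqr_ge0 (Im s ^+ 2); lra.
  set M := mass X 1 in m1 m11 sum1 rhs0 *; set N := mass X k in mk mk1 sum1 rhs0 *.
  set I2 := Im s ^+ 2 in Res Is Is1 rhs0 *.
  have I20 : 0 <= I2 by exact: sqr_ge0.
  apply: (@le_trans _ _ ((M + s0 * N) ^+ 2 - M * N * I2)).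
    have h5 : M * N * Re s <= M * N * (s0 - I2 / 2) by rewrite ler_wpM2l// mulr_ge0// ltW.
    have h6 : N ^+ 2 * normc s ^+ 2 <= N ^+ 2 * s0 ^+ 2 by rewrite ler_wpM2l ?sqr_ge0.
    lra.
  have MN : 0 <= M * N * I2 by rewrite mulr_ge0// mulr_ge0// ltW.
  have h7 : M * N * I2 * (M + s0 * N) <= M * N * I2 by rewrite ler_piMr.
  have h8 := sqr_ge0 (M * N * I2 / 2).
  lra.
rewrite -/s; lra.
Qed.

(** The point v (1 + i t): measured in units of v, the frequency t does not change when v is
    multiplied by a. *)
Definition ray (v t : R) : C := Complex v (v * t).

(** The point is scaled down until psi is nearly affine; there psi has imaginary part close to -v'
    t. One application of f then loses a factor 1 - c t^2 by [normc_gX_le], and the remaining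
    iterations keep the loss. *)
Lemma psi_ray_contraction vmin vmax A0 : 0 < vmin -> vmin <= vmax -> 0 <= A0 ->
  exists2 c, 0 < c & forall v t, vmin <= v -> v <= vmax -> `|t| <= A0 ->
    normc (psi X (ray v t)) <= psiR X v * expR (- (c * t ^+ 2)).
Proof.
move=> vm0 vmM A00; have [k k2 mk] := exists_mass_ge2 X1 Xnd.
have [|c0 c00 hc0] := psi_near HX (e := 1 / 4); first by rewrite divr_gt0.
(* Below [c0] the affine approximation has relative error 1/4; below 1/(16 k) all products of fewer
   than k factors near 1 stay within 1/8 of 1. *)
pose c1 := Num.min c0 (1 / (16 * k%:R)).
have kp : 0 < k%:R :> R by rewrite ltr0n; exact: leq_trans k2.
have c10 : 0 < c1 by rewrite lt_min c00 divr_gt0// mulr_gt0.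
have [n hn] := exists_expr_ge (vmax * (1 + A0) / c1) a1.
have an0 : 0 < a ^+ n by exact: exprn_gt0.
have an1 : 0 < a ^+ n.+1 by exact: exprn_gt0.
pose c := mass X 1 * mass X k * (vmin / a ^+ n.+1) ^+ 2 / 8.
have cp : 0 < c.
  by rewrite /c !(divr_gt0, mulr_gt0, exprn_gt0).
exists c => // v t vv vM tA.
have v0 : 0 < v := lt_le_trans vm0 vv.
pose v' := v / a ^+ n.+1.
have v'0 : 0 < v' by rewrite divr_gt0.
pose z' := ray v' t.
have z'0 : 0 <= Re z' by exact: ltW.
have v'c : v' * (1 + `|t|) <= c1.
  apply: (@le_trans _ _ (vmax * (1 + A0) / a ^+ n)).
    have vM0 : 0 <= vmax by rewrite (le_trans _ vM)// ltW.
    have hv : v' <= vmax / a ^+ n.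
      rewrite /v' ler_pdivrMr//.
      have -> : vmax / a ^+ n * a ^+ n.+1 = vmax * a by rewrite exprS; field; neq0.
      by apply: (le_trans vM); rewrite ler_peMr// ltW.
    by rewrite [leRHS]mulrAC ler_pM ?(ltW v'0)// ?addr_ge0 ?lerD2l//.
  by rewrite ler_pdivrMr// [leRHS]mulrC -ler_pdivrMr.
have nz' : normc z' <= v' * (1 + `|t|).
  apply: (le_trans (normc_le_ReIm _)); rewrite /z' /ray /= [`|v' * t|]normrM (gtr0_norm v'0).
  by rewrite mulrDr mulr1.
have z'c : normc z' <= c1 by exact: le_trans nz' v'c.
have v'c1 : v' <= c1.
  by apply: le_trans v'c; rewrite ler_peMr ?(ltW v'0)// lerDl.
set w := psi X z'; set w0 := psiR X v'.
have w00 : 0 < w0 by apply: psiR_gt0 => //; exact: ltW.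
have w01 : w0 <= 1 by apply: psiR_le1 => //; exact: ltW.
have ww : normc w <= w0 by exact: (normc_psi_le HX z'0).
have nv' : normc (Cx v') = v' by rewrite normc_Cx gtr0_norm.
have hw : normc (w - Cx w0 + Complex 0 (v' * t)) <= v' * `|t| / 4.
  have := hc0 z' (Cx v') z'0 (ltW v'0).
  have -> : z' - Cx v' = Complex 0 (v' * t).
    by apply/eqP; rewrite eq_complex /= subrr subr0 !eqxx.
  rewrite (psi_Cx HX (ltW v'0)) nv'.
  have -> : normc (Complex 0 (v' * t)) = v' * `|t|.
    by rewrite /= expr0n add0r sqrtr_sqr normrM gtr0_norm.
  move=> h; apply: (le_trans (h _ _)); [| |lra].
    by apply: (le_trans z'c); rewrite ge_min lexx.
  by apply: (le_trans v'c1); rewrite ge_min lexx.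
have near1 (y : C) : 0 <= Re y -> normc y <= c1 -> normc (psi X y - 1) <= c1 *+ 2.
  move=> y0 yc; rewrite -(psi0 HX); apply: (le_trans (psi_lip HX y0 _)) => //.
  rewrite !subr0 mulr2n lerD// (le_trans _ yc)//; [exact: le_Re_normc|exact: le_Im_normc].
have w1 : normc (w - 1) <= c1 *+ 2 by exact: near1.
have w01' : normc (Cx w0 - 1) <= c1 *+ 2.
  by rewrite -(psi_Cx HX (ltW v'0)); apply: near1; rewrite ?nv'//; exact: ltW.
have wn1 : normc w <= 1 by exact: le_trans ww w01.
have nw0 : normc (Cx w0) <= 1 by rewrite normc_Cx gtr0_norm.
pose m := k.-1; have m1 : 1 <= m%:R :> R by rewrite ler1n /m; case: (k) k2 => [|[]].
pose S := \sum_(i < m) w ^+ (m.-1 - i) * Cx w0 ^+ i.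
have hS : normc (S - m%:R) <= m%:R / 8.
  have -> : (m%:R : C) = \sum_(i < m) 1 by rewrite sumr_const card_ord.
  rewrite /S -sumrB; apply: (le_trans (normc_sum _ _)).
  rewrite mulr_natl -[X in _ *+ X]card_ord -sumr_const ler_sum// => i _.
  have -> : w ^+ (m.-1 - i) * Cx w0 ^+ i - 1 =
    w ^+ (m.-1 - i) * (Cx w0 ^+ i - 1) + (w ^+ (m.-1 - i) - 1) by ring.
  apply: (le_trans (le_normcD _ _)).
  apply: (@le_trans _ _ (i%:R * (c1 *+ 2) + (m.-1 - i)%:R * (c1 *+ 2))).
    apply: lerD.
      rewrite normcM -[leRHS]mul1r ler_pM ?normc_ge0//.
        by rewrite normc_X exprn_ile1 ?normc_ge0.
      by apply: (le_trans (normc_powB1_le _ nw0)); rewrite ler_wpM2l.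
    by apply: (le_trans (normc_powB1_le _ wn1)); rewrite ler_wpM2l.
  rewrite -mulrDl -natrD.
  apply: (@le_trans _ _ (k%:R * (c1 *+ 2))).
    rewrite ler_wpM2r ?mulrn_wge0 ?(ltW c10)// ler_nat.
    have im : (i <= m.-1)%N by rewrite -ltnS prednK ?ltn_ord// (leq_ltn_trans _ (ltn_ord i)).
    by rewrite subnKC// (leq_trans (leq_pred _))// leq_pred.
  have : c1 <= 1 / (16 * k%:R) by rewrite ge_min lexx orbT.
  rewrite ler_pdivlMr ?mulr_gt0// mulr2n; lra.
pose s := w ^+ m.
(* Since w - w_0 is -i v' t up to a quarter of its size and the cofactor [S] is within m/8 of m, Im
   s is -m v' t with an error of at most half of it. *)
have Ims : (v' * t / 2) ^+ 2 <= Im s ^+ 2.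
  have es : s - Cx (w0 ^+ m) = (w - Cx w0) * S by rewrite /s CxX subrXX.
  have ewS : (w - Cx w0) * S + Complex 0 (m%:R * (v' * t)) =
     (w - Cx w0) * (S - m%:R) + m%:R * (w - Cx w0 + Complex 0 (v' * t)).
    have -> : Complex 0 (m%:R * (v' * t)) = m%:R * Complex 0 (v' * t) :> C.
      rewrite -(Cx_nat _ m).
      by apply/eqP; rewrite eq_complex /= mul0r !mulr0 subr0 addr0 !eqxx.
    by ring.
  have nw : normc (w - Cx w0) <= 5 / 4 * (v' * `|t|).
    have -> : w - Cx w0 = (w - Cx w0 + Complex 0 (v' * t)) - Complex 0 (v' * t) by ring.
    apply: (le_trans (le_normcB _ _)).
    have -> : normc (Complex 0 (v' * t)) = v' * `|t|.
      by rewrite /= expr0n add0r sqrtr_sqr normrM gtr0_norm.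
    lra.
  have nm : normc (m%:R : C) = m%:R.
    by rewrite -Cx_nat normc_Cx ger0_norm.
  have vt0 : 0 <= v' * `|t| by rewrite mulr_ge0// ltW.
  have m0 : 0 <= m%:R :> R by [].
  have bound : normc ((w - Cx w0) * S + Complex 0 (m%:R * (v' * t))) <= m%:R * (v' * `|t|) / 2.
    rewrite ewS; apply: (le_trans (le_normcD _ _)); rewrite !normcM nm.
    apply: (@le_trans _ _ (5 / 4 * (v' * `|t|) * (m%:R / 8) + m%:R * (v' * `|t| / 4))).
      by apply: lerD; [rewrite ler_pM ?normc_ge0|rewrite ler_wpM2l].
    have : 0 <= m%:R * (v' * `|t|) by rewrite mulr_ge0.
    lra.
  have ImE : Im ((w - Cx w0) * S + Complex 0 (m%:R * (v' * t))) = Im s + m%:R * (v' * t).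
    by rewrite -es !ImD ImN /= oppr0 addr0.
  have hI : `|Im s + m%:R * (v' * t)| <= m%:R * (v' * `|t|) / 2.
    by rewrite -ImE; apply: le_trans (le_Im_normc _) bound.
  have hI2 : m%:R * (v' * `|t|) / 2 <= `|Im s|.
    have : m%:R * (v' * `|t|) = `|m%:R * (v' * t)| by rewrite [`|m%:R * _|]normrM [`|v' * t|]normrM (ger0_norm m0) (gtr0_norm v'0).
    have := ler_normB (Im s + m%:R * (v' * t)) (Im s).
    rewrite addrAC subrr add0r; lra.
  rewrite -[X in _ <= X]real_normK ?num_real// -[X in X <= _]real_normK ?num_real//.
  rewrite lerXn2r ?nnegrE//; apply: le_trans hI2.
  rewrite [`|v' * t / 2|]normrM [`|v' * t|]normrM (gtr0_norm v'0) normfV [`|2|]ger0_norm// ler_wpM2r ?invr_ge0//.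
  by rewrite ler_peMl.
have gR0 : 0 < gR w0 by apply: gXR_gt0 => //; rewrite w01 ltW.
have gR1 : gR w0 <= 1 by apply: gfR_le1; rewrite ?w01 ?ltW.
have fw : normc (f w) <= fR w0 * (1 - c * t ^+ 2).
  rewrite gf_gX// normcM gfR_gXR ?w01 ?(ltW w00)//.
  have hg := normc_gX_le k2 ww w01; rewrite -/m -/s in hg.
  have ct : c * t ^+ 2 <= mass X 1 * mass X k * Im s ^+ 2 / 2.
    apply: (@le_trans _ _ (mass X 1 * mass X k * (v' * t / 2) ^+ 2 / 2)); last first.
      by rewrite ler_wpM2r ?invr_ge0// ler_wpM2l// mulr_ge0 ?ltW.
    have -> : mass X 1 * mass X k * (v' * t / 2) ^+ 2 / 2 =
       mass X 1 * mass X k * (v / a ^+ n.+1) ^+ 2 / 8 * t ^+ 2 by rewrite /v'; field; rewrite gt_eqF.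
    have mm0 : 0 <= mass X 1 * mass X k by rewrite mulr_ge0 ?ltW.
    rewrite /c ler_wpM2r ?sqr_ge0// ler_wpM2r ?invr_ge0// ler_wpM2l//.
    rewrite lerXn2r ?nnegrE ?divr_ge0 ?(ltW vm0) ?(ltW v0) ?(ltW an1)//.
    by rewrite ler_wpM2r ?invr_ge0 ?(ltW an1).
  have ct2 : gR w0 * (c * t ^+ 2) <= c * t ^+ 2.
    by rewrite ler_piMl// mulr_ge0 ?sqr_ge0// ltW.
  apply: (@le_trans _ _ (w0 * (gR w0 * (1 - c * t ^+ 2)))); last by rewrite mulrA.
  by rewrite ler_pM ?normc_ge0//; apply: (le_trans hg); lra.
have zE : ray v t = Cx (a ^+ n) * (Cx a * z').
  rewrite mulrA -CxM /z' /ray -exprSr; apply/eqP.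
  rewrite eq_complex /= !mul0r subr0 addr0 /v'; apply/andP; split; apply/eqP; field;
  by rewrite ?gt_eqF.
have az0 : 0 <= Re (Cx a * z') by rewrite ReZ mulr_ge0// ltW.
rewrite zE (psi_scale_iter HX)// (psi_scale HX)// -/w.
have vE : v = a ^+ n * (a ^+ 1 * v').
  by rewrite expr1 mulrA -exprSr /v'; field; rewrite gt_eqF.
have av'0 : 0 <= a ^+ 1 * v' by rewrite expr1 mulr_ge0 ?(ltW a0)// ltW.
rewrite [in leRHS]vE (psiR_scale_iter HX n av'0) (psiR_scale_iter HX 1 (ltW v'0)) /=.
rewrite -/w0; set y0 := fR w0; rewrite -/y0 in fw.
have y00 : 0 < y0 by rewrite /y0 gfR_gXR ?w01 ?(ltW w00)// mulr_gt0.
have y01 : y0 <= 1 by apply: gfR_le1; rewrite ?w01 ?ltW.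
have ct0 : 0 <= c * t ^+ 2 by rewrite mulr_ge0 ?sqr_ge0// ltW.
have fwy : normc (f w) <= y0 by apply: (le_trans fw); rewrite ler_piMr ?(ltW y00)// gerBl.
have fw1 : normc (f w) <= 1 by exact: le_trans fwy y01.
apply: (le_trans (normc_fit_le X n (lexx _) fw1)).
(* The loss won in one application of f passes through the other n iterations, as the quotient of
   the iterate by its argument is monotone. *)
have h := fitR_ratio HX n (normc_ge0 (f w)) fwy y01.
rewrite -(ler_pM2r y00); apply: (le_trans h).
rewrite -mulrA ler_wpM2l; [|by apply: fitR_ge0 => //; exact: ltW|].
  by [].
rewrite mulrC; apply: (le_trans fw); rewrite ler_wpM2l ?(ltW y00)//.
by have := expR_ge1Dx (- (c * t ^+ 2)); lra.
Qed.

End ratios.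

(** * Quadratic expansions and their limits *)

Section quadratic_expansions.
Context {R : realType}.
Local Notation C := (complex R).

(** A first moment A and a second moment B expressed by an inequality for all t instead of
    derivatives at 0. In this form they pass to pointwise limits with the same constant. *)
Definition quad_exp (K : R) (h : R -> C) (A B : R) := forall t,
  normc (h t - 1 + Complex 0 (t * A) + Cx (t ^+ 2 / 2 * B)) <= K * `|t| ^+ 3.

Lemma bounded_cvg_subseq (u : nat -> R) (M : R) : (forall n, `|u n| <= M) ->
  exists phi : nat -> nat, [/\ {homo phi : m n / (m < n)%N}, (forall n, (n <= phi n)%N) &
    cvgn (u \o phi)].
Proof.
move=> uM; have [|phi iphi cphi] := @bolzano_weierstrass R u.
  exists M; split; first exact: num_real.
  by move=> x Mx n _ /=; rewrite (le_trans (uM n))// ltW.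
have hphi : {homo phi : m n / (m < n)%N}.
  by move=> m n; rewrite !ltnNge; apply: contra; rewrite -leEnat iphi.
exists phi; split => // n; elim: n => // n ih.
by apply: leq_ltn_trans ih _; exact: hphi.
Qed.

Lemma cvg_subseq (V : topologicalType) (u : nat -> V) (l : V) (phi : nat -> nat) :
  (forall n, (n <= phi n)%N) -> u @ \oo --> l -> (u \o phi) @ \oo --> l.
Proof.
move=> hphi ul; apply: cvg_comp ul => S [N _ hN].
by exists N => // n /= Nn; apply: hN => /=; exact: leq_trans Nn (hphi n).
Qed.

(** Compactness: the bounded coefficients converge along a subsequence and every condition is
    closed. The moving bounds [al] and [be] on A are what the saddle point argument exploits. *)
Lemma quad_exp_limit (h_ : nat -> R -> C) (h : R -> C) (al be : nat -> R) (alpha beta K : R) :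
  (forall n, exists A B, [/\ al n <= A, A <= be n, 0 <= B, B <= K & quad_exp K (h_ n) A B]) ->
  (forall t, ccvg (h_^~ t) (h t)) -> al @ \oo --> alpha -> be @ \oo --> beta ->
  exists A B, [/\ alpha <= A, A <= beta, 0 <= B, B <= K & quad_exp K h A B].
Proof.
move=> /choice[A_ /choice[B_ hAB]] hh hal hbe.
have [M1 hM1] : exists M, forall n, `|al n| <= M.
  have [M [_ hM]] := cvg_seq_bounded (cvgP _ hal).
  by exists (M + 1) => n; apply: (hM (M + 1)) => //; rewrite ltrDl.
have [M2 hM2] : exists M, forall n, `|be n| <= M.
  have [M [_ hM]] := cvg_seq_bounded (cvgP _ hbe).
  by exists (M + 1) => n; apply: (hM (M + 1)) => //; rewrite ltrDl.
have [n|phi [_ gphi /cvg_ex[A hA]]] := @bounded_cvg_subseq A_ (M1 + M2).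
  have [h1 h2 _ _ _] := hAB n.
  have b1 := hM1 n; have b2 := hM2 n; have b3 := normr_ge0 (al n).
  have b4 := normr_ge0 (be n); have b5 := ler_norm (be n).
  have b6 := ler_norm (- al n); rewrite normrN in b6.
  rewrite ler_norml; apply/andP; split; lra.
have [n|phi' [_ gphi' /cvg_ex[B hB]]] := @bounded_cvg_subseq (B_ \o phi) `|K|.
  have [_ _ B0 BK _] := hAB (phi n).
  by rewrite /= ger0_norm// (le_trans BK)// ler_norm.
pose s := phi \o phi'.
have gs n : (n <= s n)%N by apply: leq_trans (gphi' n) (gphi _).
have hA' : (A_ \o s) @ \oo --> A by exact: (cvg_subseq gphi' hA).
exists A, B; split.
- apply: ler_cvg_to (cvg_subseq gs hal) hA' _; apply: nearW => n /=.
  by have [] := hAB (s n).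
- apply: ler_cvg_to hA' (cvg_subseq gs hbe) _; apply: nearW => n /=.
  by have [] := hAB (s n).
- apply: ler_cvg_to (cvg_cst 0) hB _; apply: nearW => n /=.
  by have [] := hAB (s n).
- apply: ler_cvg_to hB (cvg_cst K) _; apply: nearW => n /=.
  by have [] := hAB (s n).
- move=> t; rewrite -[X in normc X]subr0.
  have hs : ccvg (fun n => h_ (s n) t) (h t).
    by have [a b] := hh t; split; [exact: (cvg_subseq gs a)|exact: (cvg_subseq gs b)].
  have c1 : ccvg (fun n => Complex 0 (t * A_ (s n))) (Complex 0 (t * A)).
    split => /=; first exact: cvg_cst.
    by apply: cvgM => //; exact: cvg_cst.
  have c2 : ccvg (fun n => Cx (t ^+ 2 / 2 * B_ (s n))) (Cx (t ^+ 2 / 2 * B)).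
    by apply: ccvg_Cx; apply: cvgM => //; exact: cvg_cst.
  have h2 := ccvgD (ccvgD (ccvgB hs (ccvg_cst 1)) c1) c2.
  apply: (ccvg_normc_le (b := fun=> _) h2); last exact: cvg_cst.
  by apply: nearW => n; rewrite subr0; have [_ _ _ _] := hAB (s n); exact.
Qed.

End quadratic_expansions.

(** * Moments of the tilted limit without immigration *)

Section tilted_moments.
Context d (T : measurableType d) (R : realType) (P : probability T R).
Local Notation C := (complex R).
Variables (X : {RV P >-> nat}) (HX : offspring_law X).
Variables (Y : {RV P >-> nat}).
Variables (Xs : nat -> nat -> {RV P >-> nat}) (Ys : nat -> {RV P >-> nat}).
Hypothesis Xs_law : forall n i, same_law (Xs n i) X.
Hypothesis Ys_law : forall j, same_law (Ys j) Y.
Hypothesis indep : mutually_independent P (joint_family Xs Ys).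
Local Notation a := (offmean X).
Local Notation f := (gf P X).
Implicit Types (z : C) (x y r : R).

Let X1 := offspring_ge1 HX.
Let Xnd := offspring_nondeg HX.
Let p1 := offspring_p1 HX.
Let Xlog := offspring_XlogX HX.
Let mX : measurable_fun setT X. Proof. exact: measurable_funPT. Qed.
Let a1 : 1 < a := offmean_gt1 X1 Xnd Xlog.
Let a0 : 0 < a := offmean_gt0 X1 Xnd Xlog.
Let aX n : 0 < a ^+ n. Proof. exact: exprn_gt0. Qed.
Let aV n : 0 <= a ^- n. Proof. by rewrite invr_ge0 ltW. Qed.

Let cGW (n m : nat) : nat := (n == 0%N).
Let G := gproc Xs Ys cGW.
Let mG n : measurable_fun setT (G n). Proof. exact: measurable_gproc. Qed.

Lemma gw_gf n z : normc z <= 1 -> CE P (fun w => z ^+ G n w) = fit X n z.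
Proof.
elim: n z => [|n ih] z z1.
  by rewrite /G /= -[RHS](CE_cst P); apply: eq_CE => w; rewrite expr1.
rewrite /G (CE_gproc_S Xs_law Ys_law indep)// /cGW /=.
have -> : CE P (fun=> z ^+ 0) = 1 by rewrite expr0 CE_cst.
rewrite mul1r -/(gf P X z) -/cGW -/G ih ?normc_gf_le1//.
by rewrite /fit -iterSr.
Qed.

Let xG (V : R) n w : R := a ^- n * V * (G n w)%:R.

Let mxG V n : measurable_fun setT (xG V n).
Proof. exact: (measurable_natfun (mG n) (fun m => a ^- n * V * m%:R)). Qed.

Let xG0 V n w : 0 < V -> 0 <= xG V n w.
Proof. by move=> V0; rewrite /xG !mulr_ge0// ltW. Qed.

Definition psinR n (V : R) := fitR X n (expR (- (a ^- n * V))).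

Let mexpG V n : measurable_fun setT (fun w => expR (- xG V n w)).
Proof. exact: (measurable_natfun (mG n) (fun m => expR (- (a ^- n * V * m%:R)))). Qed.

Let iexpG V n : 0 < V -> itg P (fun w => expR (- xG V n w)).
Proof.
move=> V0; apply: (@itg_bounded _ _ _ _ _ 1) => // w.
by rewrite ger0_norm ?expR_ge0// expR_le1 oppr_le0 xG0.
Qed.

Let psin_rayE n V t : 0 < V -> psin X n (ray V t) =
  CE P (fun w => Cx (expR (- xG V n w)) * cexpN (Complex 0 (xG V n w * t))).
Proof.
move=> V0; have r0 : 0 <= Re (Cx (a ^- n) * ray V t) by rewrite ReZ mulr_ge0//= ltW.
rewrite /psin -gw_gf; last exact: normc_cexpN_le1.
apply: eq_CE => w; rewrite -cexpN_natM -cexpN_Cx -cexpND; congr cexpN.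
rewrite -Cx_nat.
apply/eqP; rewrite eq_complex /= !mul0r !mulr0 !subr0 !addr0 add0r /xG.
by apply/andP; split; apply/eqP; ring.
Qed.

Let psinRE n V : 0 < V -> psinR n V = Ex P (fun w => expR (- xG V n w)).
Proof.
move=> V0; apply: (@complexI R); rewrite /psinR -fit_Cx -gw_gf; last first.
  by rewrite normc_Cx ger0_norm ?expR_ge0// expR_le1 oppr_le0 mulr_ge0// ltW.
rewrite -CE_Cx; apply: eq_CE => w; rewrite -CxX -expRM_natl.
by congr (Cx (expR _)); rewrite /xG; ring.
Qed.

(** A and B are the means of x e^{-x} and x^2 e^{-x} for x = V Z_n / a^n. The lower bound for A
    rests on e^{-x} - e^{-a x} <= (a - 1) x e^{-x}; the constant 432 is 2 times 216, from
    [cexpN_im_cubic] and [x3expN_le]. *)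
Lemma psin_expand n V : 0 < V -> exists A B,
  [/\ (psinR n V - psinR n (a * V)) / (a - 1) <= A, A <= psinR n (V / 2),
      0 <= B, B <= 16 * psinR n (V / 2) &
  forall t, normc (psin X n (ray V t) - Cx (psinR n V) + Complex 0 (t * A)
    + Cx (t ^+ 2 / 2 * B)) <= 432 * psinR n (V / 2) * `|t| ^+ 3].
Proof.
move=> V0; have V20 : 0 < V / 2 by rewrite divr_gt0.
have aV0 : 0 < a * V by rewrite mulr_gt0.
pose x := xG V n; have x0 w : 0 <= x w by exact: xG0.
have x2 w : xG (V / 2) n w = x w / 2 by rewrite /x /xG; ring.
have xa w : xG (a * V) n w = a * x w by rewrite /x /xG; ring.
have i2 : itg P (fun w => expR (- (x w / 2))).
  by move: (iexpG n V20); congr (itg P _); apply/funext => w; rewrite x2.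
have ia : itg P (fun w => expR (- (a * x w))).
  by move: (iexpG n aV0); congr (itg P _); apply/funext => w; rewrite xa.
have iA : itg P (fun w => x w * expR (- x w)).
  apply: itg_le i2 _; first by apply: measurable_funM; [exact: mxG|exact: mexpG].
  by move=> w; rewrite ger0_norm; [exact: xexpN_le|exact: mulr_ge0 (x0 w) (expR_ge0 _)].
have iB : itg P (fun w => x w ^+ 2 * expR (- x w)).
  apply: (itg_le (h' := fun w => 16 * expR (- (x w / 2)))).
  - by apply: measurable_funM; [apply: measurable_funX; exact: mxG|exact: mexpG].
  - exact: itgZ.
  - by move=> w; rewrite ger0_norm; [exact: x2expN_le|exact: mulr_ge0 (exprn_ge0 _ (x0 w)) (expR_ge0 _)].
have E2 : psinR n (V / 2) = Ex P (fun w => expR (- (x w / 2))).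
  by rewrite psinRE//; apply: eq_Ex => w; rewrite x2.
exists (Ex P (fun w => x w * expR (- x w))), (Ex P (fun w => x w ^+ 2 * expR (- x w))); split.
- rewrite ler_pdivrMr ?subr_gt0// [leRHS]mulrC -ExZ// !psinRE// -ExB; [|exact: iexpG..].
  apply: le_Ex; [by apply: itgB; exact: iexpG|exact: itgZ|] => w.
  rewrite xa -/(x w).
  have -> : expR (- (a * x w)) = expR (- x w) * expR (- ((a - 1) * x w)).
    by rewrite -expRD; congr expR; ring.
  rewrite -{1}[expR (- x w)]mulr1 -mulrBr mulrA mulrC ler_wpM2r ?expR_ge0//.
  by have := expR_ge1Dx (- ((a - 1) * x w)); lra.
- by rewrite E2; apply: le_Ex => // w; exact: xexpN_le.
- by apply: Ex_ge0 => w; exact: mulr_ge0 (exprn_ge0 _ (x0 w)) (expR_ge0 _).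
- by rewrite E2 -ExZ//; apply: le_Ex => //; [exact: itgZ|move=> w; exact: x2expN_le].
move=> t; rewrite psin_rayE// psinRE//.
pose u w : C := Cx (expR (- x w)) * cexpN (Complex 0 (x w * t)).
have mu : cmeas u.
  apply: (cmeas_nat (fun m => Cx (expR (- (a ^- n * V * m%:R))) * cexpN (Complex 0 (a ^- n * V * m%:R * t)))).
  exact: mG.
have iu : citg P u.
  apply: (@citg_bounded _ _ _ _ _ 1) => // w.
  rewrite /u normcM normc_Cx normc_cexpN /= oppr0 expR0 mulr1 ger0_norm ?expR_ge0//.
  by rewrite expR_le1 oppr_le0.
have iv : citg P (fun w => Cx (expR (- x w))) by apply: citg_Cx; exact: iexpG.
have iA' : citg P (fun w => Complex 0 t * Cx (x w * expR (- x w))).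
  by apply: citgZ; exact: citg_Cx.
have iB' : citg P (fun w => Cx (t ^+ 2 / 2) * Cx (x w ^+ 2 * expR (- x w))).
  by apply: citgZ; exact: citg_Cx.
have -> : Complex 0 (t * Ex P (fun w => x w * expR (- x w))) =
    CE P (fun w => Complex 0 t * Cx (x w * expR (- x w))).
  rewrite CEZ ?CE_Cx; last exact: citg_Cx.
  by apply/eqP; rewrite eq_complex /= !mul0r mulr0 subr0 add0r !eqxx.
have -> : Cx (t ^+ 2 / 2 * Ex P (fun w => x w ^+ 2 * expR (- x w))) =
    CE P (fun w => Cx (t ^+ 2 / 2) * Cx (x w ^+ 2 * expR (- x w))).
  by rewrite CEZ ?CE_Cx; [rewrite CxM|exact: citg_Cx].
rewrite -CE_Cx -CEB// -CED//; last exact: citgB.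
rewrite -CED//; last by apply: citgD => //; exact: citgB.
rewrite -mulrA [_ * `|t| ^+ 3]mulrC mulrA E2 -ExZ//.
apply: normc_CE_le; [by apply: citgD => //; apply: citgD => //; exact: citgB|exact: itgZ|].
move=> w; rewrite -/(x w).
have -> : Cx (expR (- x w)) * cexpN (Complex 0 (x w * t)) - Cx (expR (- x w)) +
    Complex 0 t * Cx (x w * expR (- x w)) + Cx (t ^+ 2 / 2) * Cx (x w ^+ 2 * expR (- x w)) =
    Cx (expR (- x w)) * (cexpN (Complex 0 (x w * t)) - 1 + Complex 0 (x w * t) +
    Cx ((x w * t) ^+ 2 / 2)).
  have -> : Complex 0 t * Cx (x w * expR (- x w)) = Cx (expR (- x w)) * Complex 0 (x w * t).
    apply/eqP; rewrite eq_complex /= !mul0r !mulr0 !subr0 !addr0 eqxx /=.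
    by apply/eqP; ring.
  have -> : Cx (t ^+ 2 / 2) * Cx (x w ^+ 2 * expR (- x w)) =
      Cx (expR (- x w)) * Cx ((x w * t) ^+ 2 / 2).
    by rewrite -!CxM; congr (Cx _); ring.
  by ring.
rewrite normcM normc_Cx ger0_norm ?expR_ge0//.
apply: (le_trans (ler_wpM2l (expR_ge0 _) (cexpN_im_cubic _))).
rewrite normrM (ger0_norm (x0 w)) exprMn mulr2n.
have := x3expN_le (x0 w); have t3 : 0 <= `|t| ^+ 3 by rewrite exprn_ge0.
move=> h; have := ler_wpM2r t3 h; lra.
Qed.

Lemma psinR_psiR V : 0 <= V -> psinR n V @[n --> \oo] --> psiR X V.
Proof. by move=> V0; exact: psinR_cvg. Qed.

(* dividing by [psiR V > 0] makes the expansion one of a characteristic function *)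
Lemma psi_expand V : 0 < V -> exists A B,
  [/\ (1 - psiR X (a * V) / psiR X V) / (a - 1) <= A, A <= psiR X (V / 2) / psiR X V,
      0 <= B, B <= 432 * psiR X (V / 2) / psiR X V + 1 &
   quad_exp (432 * psiR X (V / 2) / psiR X V + 1) (fun t => psi X (ray V t) / Cx (psiR X V)) A B].
Proof.
move=> V0; have V20 : 0 < V / 2 by rewrite divr_gt0.
have aV0 : 0 < a * V by rewrite mulr_gt0.
have pV : 0 < psiR X V by apply: psiR_gt0 => //; exact: ltW.
have cV := psinR_psiR (ltW V0); have cV2 := psinR_psiR (ltW V20); have caV := psinR_psiR (ltW aV0).
have pV0 n : 0 < psinR n V.
  by apply: fitR_gt0; rewrite ?expR_gt0// expR_le1 oppr_le0 mulr_ge0// ltW.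
have iV : (psinR n V)^-1 @[n --> \oo] --> (psiR X V)^-1 by apply: cvgV => //; rewrite gt_eqF.
set K := _ + 1.
have cK : 432 * psinR n (V / 2) / psinR n V @[n --> \oo] --> 432 * psiR X (V / 2) / psiR X V.
  by apply: cvgM => //; apply: cvgM => //; exact: cvg_cst.
(* The added 1 in [K] absorbs the convergence error from some N on, and all sequences below are
   shifted by this N. *)
have [N _ hN] : \forall n \near \oo, 432 * psinR n (V / 2) / psinR n V <= K.
  by move/cvgrPdist_le : cK => /(_ 1 ltr01); apply: filterS => n; rewrite /K ler_norml; lra.
have p20 n : 0 <= psinR n (V / 2).
  by apply: fitR_ge0; rewrite ?expR_ge0// expR_le1 oppr_le0 mulr_ge0// ltW.
apply: (@quad_exp_limit _ (fun n t => psin X (n + N) (ray V t) / Cx (psinR (n + N) V)) _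
  (fun n => (1 - psinR (n + N) (a * V) / psinR (n + N) V) / (a - 1))
  (fun n => psinR (n + N) (V / 2) / psinR (n + N) V)).
- move=> n; have [A [B [h1 h2 h3 h4 h5]]] := psin_expand (n + N) V0.
  have hn := hN (n + N)%N (leq_addl _ _).
  have p0 := pV0 (n + N)%N.
  exists (A / psinR (n + N) V), (B / psinR (n + N) V); split.
  + rewrite ler_pdivlMr//; apply: le_trans h1.
    rewrite le_eqVlt; apply/orP; left; apply/eqP; field.
    by rewrite !gt_eqF// subr_gt0.
  + by rewrite ler_wpM2r// invr_ge0 ltW.
  + by rewrite divr_ge0// ltW.
  + apply: le_trans hn; rewrite ler_wpM2r ?invr_ge0 ?(ltW p0)//.
    by apply: (le_trans h4); rewrite ler_wpM2r// ler_nat.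
  + move=> t; apply: (@le_trans _ _ (432 * psinR (n + N) (V / 2) / psinR (n + N) V * `|t| ^+ 3)); last first.
      by rewrite ler_wpM2r// exprn_ge0.
    have -> : psin X (n + N) (ray V t) / Cx (psinR (n + N) V) - 1 +
       Complex 0 (t * (A / psinR (n + N) V)) + Cx (t ^+ 2 / 2 * (B / psinR (n + N) V)) =
       (psin X (n + N) (ray V t) - Cx (psinR (n + N) V) + Complex 0 (t * A) + Cx (t ^+ 2 / 2 * B))
       / Cx (psinR (n + N) V).
      have -> : Complex 0 (t * (A / psinR (n + N) V)) = Complex 0 (t * A) / Cx (psinR (n + N) V).
        by rewrite -CxV; apply/eqP; rewrite eq_complex /= !mul0r mulr0 subr0 add0r mulrA !eqxx.
      rewrite mulrA [Cx (_ / _)]CxM CxV; field.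
      by rewrite Cx_eq0 gt_eqF.
    by rewrite normcM normcV normc_Cx gtr0_norm// [leRHS]mulrAC ler_wpM2r// invr_ge0 ltW.
- move=> t; apply: ccvgM.
    apply: (@ccvg_shift _ (fun n => psin X n (ray V t)) _ N); apply: (psi_cvg HX); exact: ltW.
  under eq_fun do rewrite -CxV.
  rewrite -CxV; apply: ccvg_Cx.
  by have := cvg_shiftn N (fun n => (psinR n V)^-1) => ->.
- apply: cvgM; last exact: cvg_cst.
  apply: cvgB; first exact: cvg_cst.
  apply: cvgM.
    by have := cvg_shiftn N (fun n => psinR n (a * V)) => ->.
  by have := cvg_shiftn N (fun n => (psinR n V)^-1) => ->.
- apply: cvgM.
    by have := cvg_shiftn N (fun n => psinR n (V / 2)) => ->.
  by have := cvg_shiftn N (fun n => (psinR n V)^-1) => ->.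
Qed.

End tilted_moments.

(** * Uniqueness, variance and centering of quadratic expansions *)

Section complex_limits.
Context {R : realType}.
Local Notation C := (complex R).

Definition climit (u : nat -> C) : C :=
  Complex (limn (fun n => Re (u n))) (limn (fun n => Im (u n))).

Lemma climitE (u : nat -> C) l : ccvg u l -> climit u = l.
Proof. by case: l => x y [/= h1 h2]; rewrite /climit (cvg_lim _ h1)// (cvg_lim _ h2). Qed.

Lemma quad_exp_le (K K' : R) h A B : K <= K' -> quad_exp K h A B -> quad_exp K' h A B.
Proof.
by move=> KK hK t; apply: (le_trans (hK t)); rewrite ler_wpM2r// exprn_ge0.
Qed.

(** Imaginary parts give |t| |A - A'| <= 2 K |t|^3. The saddle point argument identifies two first
    moments of the same function by this. *)
Lemma quad_exp_inj (K : R) h A B A' B' : quad_exp K h A B -> quad_exp K h A' B' -> A = A'.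
Proof.
move=> h1 h2; apply/eqP; rewrite -subr_eq0 -normr_le0; apply/ler_addgt0Pr => e e0; rewrite add0r.
have K0 : 0 <= K by have := h1 1; rewrite normr1 !expr1n [K * 1]mulr1; apply: le_trans; exact: normc_ge0.
pose t := Num.min 1 (e / (2 * K + 1)).
have K1 : 0 < 2 * K + 1 by lra.
have t0 : 0 < t by rewrite lt_min ltr01 divr_gt0.
have t1 : t <= 1 by rewrite ge_min lexx.
have tK : (2 * K + 1) * t <= e by rewrite mulrC -ler_pdivlMr// ge_min lexx orbT.
have := h1 t; have := h2 t; rewrite (gtr0_norm t0).
set E' := h t - 1 + _ + _; set E := h t - 1 + _ + _ => e2 e1.
have : `|Im (E - E')| <= 2 * (K * t ^+ 3).
  apply: (le_trans (le_Im_normc _)); apply: (le_trans (le_normcB _ _)); lra.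
have -> : Im (E - E') = t * (A - A').
  by rewrite /E /E' !(ImD, ImN) /=; ring.
rewrite [`|t * _|]normrM (gtr0_norm t0).
have -> : 2 * (K * t ^+ 3) = t * (2 * K * (t * t)) by ring.
rewrite ler_pM2l// => /le_trans; apply; apply: le_trans tK.
have tt : t * t <= t by rewrite ler_piMl// ltW.
have : 2 * K * (t * t) <= 2 * K * t by rewrite ler_wpM2l// mulr_ge0.
lra.
Qed.

(* the variance [B - A^2] read off a modulus bound *)
Lemma quad_exp_variance (h : R -> C) (A B K c : R) : 0 <= K -> 0 <= A -> 0 < c ->
  quad_exp K h A B -> (forall t, `|t| <= 1 -> normc (h t) <= expR (- (c * t ^+ 2))) ->
  c *+ 2 <= B - A ^+ 2.
Proof.
move=> K0 A0 c0 hq hb; apply/ler_addgt0Pl => e e0.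
(* Collects the coefficients of all error terms of order at least t^3; after division by t^2 they
   contribute at most M t <= e. *)
pose M := 4 * c ^+ 2 + 2 * K + K ^+ 2; have M0 : 0 < M.
  by have := exprn_gt0 2 c0; have := sqr_ge0 K; rewrite /M; lra.
pose t := Num.min 1 (e / M).
have t0 : 0 < t by rewrite lt_min ltr01 divr_gt0.
have t1 : t <= 1 by rewrite ge_min lexx.
have tM : M * t <= e by rewrite mulrC -ler_pdivlMr// ge_min lexx orbT.
have nt : `|t| = t by rewrite gtr0_norm.
have := hq t; rewrite nt; set E := h t - 1 + _ + _ => hE.
have hb' := hb t _; rewrite nt in hb'; have {}hb := hb' t1.
pose Q : C := 1 - Complex 0 (t * A) - Cx (t ^+ 2 / 2 * B).
have QE : Q = h t - E by rewrite /Q /E; ring.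
have nQ : normc Q <= expR (- (c * t ^+ 2)) + K * t ^+ 3.
  by rewrite QE (le_trans (le_normcB _ _))// lerD.
have Q2 : 1 - (B - A ^+ 2) * t ^+ 2 <= normc Q ^+ 2.
  have -> : Q = Complex (1 - t ^+ 2 / 2 * B) (- (t * A)).
    by apply/eqP; rewrite eq_complex /=; apply/andP; split; apply/eqP; ring.
  rewrite normc_sqr /=; have := sqr_ge0 (t ^+ 2 / 2 * B); lra.
have ct0 : 0 <= c * t ^+ 2 by rewrite mulr_ge0 ?sqr_ge0// ltW.
set q := expR _ in nQ hb.
have q0 : 0 <= q := expR_ge0 _.
have q1 : q <= 1 by rewrite expR_le1 oppr_le0.
have qq : q ^+ 2 <= 1 - 2 * (c * t ^+ 2) + 4 * (c * t ^+ 2) ^+ 2.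
  have -> : q ^+ 2 = expR (- (2 * (c * t ^+ 2))).
    by rewrite /q -expRM_natl; congr expR; ring.
  have := @expRN_quad R (2 * (c * t ^+ 2)); rewrite mulr_ge0// => /(_ isT).
  rewrite ler_norml => /andP[_]; rewrite exprMn; lra.
have Kt0 : 0 <= K * t ^+ 3 by rewrite mulr_ge0// exprn_ge0// ltW.
have nQ2 : normc Q ^+ 2 <= (q + K * t ^+ 3) ^+ 2.
  by rewrite lerXn2r ?nnegrE ?normc_ge0// addr_ge0.
have h1 : (q + K * t ^+ 3) ^+ 2 <= q ^+ 2 + 2 * (K * t ^+ 3) + (K * t ^+ 3) ^+ 2.
  rewrite sqrrD -mulr_natl; have : q * (K * t ^+ 3) <= K * t ^+ 3 by rewrite ler_piMl.
  lra.
have t2 : 0 < t ^+ 2 by rewrite exprn_gt0.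
rewrite -(ler_pM2l t2).
have h2 : t ^+ 2 * (c *+ 2) <= t ^+ 2 * (B - A ^+ 2) + 4 * (c * t ^+ 2) ^+ 2
    + 2 * (K * t ^+ 3) + (K * t ^+ 3) ^+ 2.
  rewrite mulr2n; lra.
have h3 : 4 * (c * t ^+ 2) ^+ 2 <= t ^+ 2 * (4 * c ^+ 2 * t).
  have -> : 4 * (c * t ^+ 2) ^+ 2 = t ^+ 2 * (4 * c ^+ 2 * (t * t)) by ring.
  have tt : t * t <= t by rewrite ler_piMl// ltW.
  by rewrite ler_wpM2l ?(ltW t2)// ler_wpM2l// mulr_ge0// sqr_ge0.
have h4 : (K * t ^+ 3) ^+ 2 <= t ^+ 2 * (K ^+ 2 * t).
  have -> : (K * t ^+ 3) ^+ 2 = t ^+ 2 * (K ^+ 2 * (t * t ^+ 3)) by ring.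
  have tt : t * t ^+ 3 <= t by rewrite ler_piMr ?(ltW t0)// exprn_ile1// ltW.
  by rewrite ler_wpM2l ?(ltW t2)// ler_wpM2l// sqr_ge0.
have h5 : 2 * (K * t ^+ 3) = t ^+ 2 * (2 * K * t) by ring.
apply: (le_trans h2).
apply: (@le_trans _ _ (t ^+ 2 * (B - A ^+ 2) + t ^+ 2 * (M * t))).
  rewrite h5 /M; have -> : t ^+ 2 * ((4 * c ^+ 2 + 2 * K + K ^+ 2) * t) =
    t ^+ 2 * (4 * c ^+ 2 * t) + t ^+ 2 * (2 * K * t) + t ^+ 2 * (K ^+ 2 * t) by ring.
  lra.
by rewrite [leRHS]mulrDr [leLHS]addrC lerD2r ler_wpM2l// ltW.
Qed.

(** The polynomials 1 - i A t - B t^2/2 and 1 + i A t - A^2 t^2/2 multiply to 1 - (B - A^2) t^2/2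
    plus terms of order 3 and 4. The bound |t| <= A0 turns fourth order into third. *)
Lemma quad_exp_centered (K A0 : R) : 0 <= K -> 0 <= A0 -> exists2 K', 0 <= K' &
  forall (h : R -> C) A B, 0 <= A -> A <= K -> 0 <= B -> B <= K -> A ^+ 2 <= B ->
  quad_exp K h A B -> forall t, `|t| <= A0 ->
  normc (h t * cexpN (Complex 0 (- (t * A))) - Cx (expR (- ((B - A ^+ 2) * t ^+ 2 / 2)))) <=
  K' * `|t| ^+ 3.
Proof.
move=> K0 A00.
pose P0 := 1 + A0 * K + A0 ^+ 2 / 2 * K.
have P00 : 0 <= P0 by rewrite /P0 !addr_ge0// !mulr_ge0// divr_ge0// sqr_ge0.
exists (K + P0 * (K ^+ 3 *+ 2) + (K ^+ 3 / 2 + K ^+ 2 / 2 + A0 * K ^+ 3 / 4) + A0 * K ^+ 2 / 4).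
  by rewrite !addr_ge0// ?divr_ge0 ?mulr_ge0 ?mulrn_wge0 ?exprn_ge0.
move=> h A B A_0 AK B_0 BK AB hq t tA0.
set e := cexpN _.
have ne : normc e = 1 by rewrite /e normc_cexpN /= oppr0 expR0.
pose E := h t - 1 + Complex 0 (t * A) + Cx (t ^+ 2 / 2 * B).
have hE : normc E <= K * `|t| ^+ 3 by exact: hq.
pose Q : C := 1 - Complex 0 (t * A) - Cx (t ^+ 2 / 2 * B).
have hQ : h t = Q + E by rewrite /Q /E; ring.
pose E' := e - 1 + Complex 0 (- (t * A)) + Cx ((- (t * A)) ^+ 2 / 2).
have tA0' : 0 <= `|t| by [].
have t3 : 0 <= `|t| ^+ 3 by rewrite exprn_ge0.
have hE' : normc E' <= K ^+ 3 *+ 2 * `|t| ^+ 3.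
  apply: (le_trans (cexpN_im_cubic _)); rewrite normrN normrM exprMn mulrC -mulrnAl ler_wpM2r//.
  rewrite lerMn2r /= (ger0_norm A_0) lerXn2r ?nnegrE//.
have nQ : normc Q <= P0.
  rewrite /Q (le_trans (le_normcB _ _))// lerD//.
    rewrite (le_trans (le_normcB _ _))// normc1 lerD2l.
    rewrite /= expr0n add0r sqrtr_sqr normrM (ger0_norm A_0).
    by rewrite ler_pM.
  rewrite normc_Cx normrM normrM normfV (ger0_norm B_0) ger0_norm ?sqr_ge0// [`|2|]ger0_norm//.
  rewrite ler_pM// ?divr_ge0 ?sqr_ge0//.
  rewrite ler_wpM2r ?invr_ge0// -[X in X <= _]real_normK ?num_real// lerXn2r ?nnegrE//.
pose Q' : C := 1 - Complex 0 (- (t * A)) - Cx ((- (t * A)) ^+ 2 / 2).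
have eE : e = Q' + E' by rewrite /Q' /E'; ring.
pose y := (B - A ^+ 2) * t ^+ 2 / 2.
have y0 : 0 <= y by rewrite /y divr_ge0// mulr_ge0 ?sqr_ge0// subr_ge0.
have QQ : Q * Q' = Cx (1 - y) + (Complex 0 ((A * (A ^+ 2 - B)) / 2 * t ^+ 3) + Cx (B * A ^+ 2 / 4 * t ^+ 4)).
  rewrite /Q /Q' /y; apply/eqP; rewrite eq_complex; apply/andP; split; apply/eqP;
  by rewrite !(ReM, ImM, ReD, ImD, ReN, ImN) /=; field.
rewrite -/y.
have -> : h t * e - Cx (expR (- y)) = E * e + Q * E' +
   (Complex 0 ((A * (A ^+ 2 - B)) / 2 * t ^+ 3) + Cx (B * A ^+ 2 / 4 * t ^+ 4))
   - Cx (expR (- y) - 1 + y).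
  rewrite hQ mulrDl [X in Q * X]eE mulrDr QQ !(CxD, CxB) Cx1 CxN; ring.
set s := `|t| ^+ 3 in t3 hE hE' *.
have -> : (K + P0 * (K ^+ 3 *+ 2) + (K ^+ 3 / 2 + K ^+ 2 / 2 + A0 * K ^+ 3 / 4) + A0 * K ^+ 2 / 4) * s
  = K * s + P0 * (K ^+ 3 *+ 2 * s) + (K ^+ 3 / 2 + K ^+ 2 / 2 + A0 * K ^+ 3 / 4) * s + A0 * K ^+ 2 / 4 * s.
  by ring.
rewrite (le_trans (le_normcB _ _))//; apply: lerD.
- rewrite (le_trans (le_normcD _ _))//; apply: lerD.
    rewrite (le_trans (le_normcD _ _))//; apply: lerD.
      by rewrite normcM ne mulr1.
    by rewrite normcM ler_pM ?normc_ge0.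
  rewrite (le_trans (normc_le_ReIm _))// ReD ImD /= add0r addr0.
  have t4 : `|t ^+ 4| <= A0 * s.
    by rewrite normrX exprS ler_wpM2r.
  have c1 : `|B * A ^+ 2 / 4 * t ^+ 4| <= A0 * K ^+ 3 / 4 * s.
    rewrite normrM ger0_norm; last by rewrite divr_ge0// mulr_ge0// sqr_ge0.
    have : B * A ^+ 2 / 4 <= K ^+ 3 / 4.
      by rewrite ler_wpM2r ?invr_ge0// [K ^+ 3]exprS ler_pM// ?sqr_ge0// lerXn2r ?nnegrE.
    move=> h1; have := ler_pM (_ : 0 <= B * A ^+ 2 / 4) (normr_ge0 (t ^+ 4)) h1 t4.
    rewrite divr_ge0 ?mulr_ge0 ?sqr_ge0// => /(_ isT); lra.
  have c2 : `|A * (A ^+ 2 - B) / 2 * t ^+ 3| <= (K ^+ 3 / 2 + K ^+ 2 / 2) * s.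
    rewrite normrM normrX ler_wpM2r// -mulrDl normrM normfV [`|2|]ger0_norm// ler_wpM2r ?invr_ge0//.
    rewrite mulrBr (le_trans (ler_normB _ _))// ger0_norm ?mulr_ge0 ?sqr_ge0//.
    rewrite ger0_norm ?mulr_ge0// -exprS lerD//.
      by rewrite lerXn2r ?nnegrE.
    by rewrite expr2 ler_pM.
  rewrite mulrDl; lra.
- rewrite normc_Cx (le_trans (expRN_quad y0))//.
  have : y <= K * t ^+ 2 / 2.
    rewrite /y ler_wpM2r ?invr_ge0// ler_wpM2r ?sqr_ge0//.
    by rewrite (le_trans _ BK)// gerBl sqr_ge0.
  move=> yK; apply: (@le_trans _ _ ((K * t ^+ 2 / 2) ^+ 2)).
    have Kt2 : 0 <= K * t ^+ 2 / 2 by rewrite divr_ge0// mulr_ge0// sqr_ge0.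
    by rewrite lerXn2r ?nnegrE.
  have -> : (K * t ^+ 2 / 2) ^+ 2 = K ^+ 2 / 4 * (t ^+ 2) ^+ 2 by field.
  rewrite -[t ^+ 2]real_normK ?num_real//.
  have -> : A0 * K ^+ 2 / 4 * s = K ^+ 2 / 4 * (A0 * s) by field.
  rewrite ler_wpM2l ?divr_ge0 ?sqr_ge0//.
  have -> : (`|t| ^+ 2) ^+ 2 = `|t| * s by rewrite /s; ring.
  by rewrite ler_wpM2r.
Qed.

End complex_limits.

(** * The limiting ratio along rays and the saddle point equation *)

Section phase.
Context d (T : measurableType d) (R : realType) (P : probability T R).
Local Notation C := (complex R).
Variables (X : {RV P >-> nat}) (HX : offspring_law X).
Variables (Y : {RV P >-> nat}) (nu : nat).
Hypothesis Y_ge1 : forall w, (1 <= Y w)%N.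
Hypothesis q_nu : 0 < mass Y nu.
Hypothesis nu_min : forall i : nat, 0 < mass Y i -> (nu <= i)%N.
Variables (Xs : nat -> nat -> {RV P >-> nat}) (Ys : nat -> {RV P >-> nat}).
Hypothesis Xs_law : forall n i, same_law (Xs n i) X.
Hypothesis Ys_law : forall j, same_law (Ys j) Y.
Hypothesis indep : mutually_independent P (joint_family Xs Ys).
Local Notation a := (offmean X).
Local Notation f := (gf P X).
Local Notation fR := (gfR P X).
Local Notation gR := (gXR X).
Implicit Types (z : C) (x y r v t : R).

Let X1 := offspring_ge1 HX.
Let Xnd := offspring_nondeg HX.
Let p1 := offspring_p1 HX.
Let Xlog := offspring_XlogX HX.
Let a1 : 1 < a := offmean_gt1 X1 Xnd Xlog.
Let a0 : 0 < a := offmean_gt0 X1 Xnd Xlog.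
Let aX n : 0 < a ^+ n. Proof. exact: exprn_gt0. Qed.

Definition rhov v t := rho X (psiR X v) (psi X (ray v t)).
(** The function h of the overview, the limit of psi(a^j v (1 + i t)) / psi(a^j v). It depends on v
    only up to powers of a. *)
Definition Hfun v t : C := climit (rhov v t).

Lemma psi_ray_le v t : 0 < v -> normc (psi X (ray v t)) <= psiR X v.
Proof. by move=> v0; exact: (normc_psi_le HX (ltW v0 : 0 <= Re (ray v t))). Qed.

Lemma psiR_01 v : 0 < v -> 0 < psiR X v < 1.
Proof. by move=> v0; rewrite (psiR_gt0 HX (ltW v0)) (psiR_lt1 HX v0). Qed.

Lemma ray_scale j v t : ray (a ^+ j * v) t = Cx (a ^+ j) * ray v t.
Proof.
by apply/eqP; rewrite eq_complex /= !mul0r subr0 addr0 mulrA !eqxx.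
Qed.

Lemma rhovE v t j : 0 < v ->
  rhov v t j = psi X (ray (a ^+ j * v) t) / Cx (psiR X (a ^+ j * v)).
Proof.
move=> v0; rewrite /rhov /rho ray_scale (psi_scale_iter HX)//; last exact: (ltW v0).
by rewrite (psiR_scale_iter HX j (ltW v0)).
Qed.

Let ray_dev v t : 0 < v -> normc (psi X (ray v t) / Cx (psiR X v) - 1) <= v / psiR X v * `|t|.
Proof.
move=> v0; have /andP[p0 _] := psiR_01 v0.
have -> : psi X (ray v t) / Cx (psiR X v) - 1 =
    (psi X (ray v t) - psi X (Cx v)) / Cx (psiR X v).
  by rewrite (psi_Cx HX (ltW v0)); field; rewrite Cx_eq0 gt_eqF.
rewrite normcM normcV normc_Cx gtr0_norm// mulrAC ler_wpM2r ?invr_ge0 ?(ltW p0)//.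
apply: (le_trans (psi_lip HX _ _)); try exact: (ltW v0).
by rewrite /= subrr normr0 add0r subr0 normrM gtr0_norm.
Qed.

(** The factor |t|, from the Lipschitz bound on psi, is essential: summed over j the errors are
    O(|t|), and against a Gaussian of variance of order 1/m this integrates to order 1/m, below the
    main term m^{-1/2}. *)
Lemma Hfun_rate vmin vmax : 0 < vmin -> vmin <= vmax -> exists K th, [/\ 0 <= K, 0 <= th < 1 &
  forall v t j, vmin <= v -> v <= vmax ->
  [/\ normc (rhov v t j - Hfun v t) <= K * th ^+ j * `|t|,
      normc (Qrho X Y (psiR X v) (psi X (ray v t)) j - Hfun v t ^+ nu) <= K * th ^+ j * `|t| &
      ccvg (rhov v t) (Hfun v t)]].
Proof.
move=> vm0 vmM; have /andP[r0 r1] := psiR_01 vm0.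
have vM0 : 0 < vmax := lt_le_trans vm0 vmM.
have /andP[pM0 _] := psiR_01 vM0.
have th01 := gXR_theta HX (ltW r0) r1; have /andP[th0 th1] := th01.
have [K1 K10 hK1] := rho_bounds HX r0 r1.
have [K2 K20 hK2] := Qrho_rho HX q_nu nu_min r0 r1.
pose D := vmax / psiR X vmax; have D0 : 0 <= D by rewrite divr_ge0// ltW.
pose th := gR (psiR X vmin).
have th1' : 0 < 1 - th by rewrite subr_gt0.
pose K3 := K1 * D / (1 - th); have K30 : 0 <= K3 by exact: divr_ge0 (mulr_ge0 K10 D0) (ltW th1').
exists (K3 + (K2 * D + nu%:R * K3)), th; split => //.
  by rewrite !addr_ge0// mulr_ge0.
move=> v t j vmv vvM; have v0 : 0 < v := lt_le_trans vm0 vmv.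
have /andP[pv0 pv1] := psiR_01 v0.
have pvr : psiR X v <= psiR X vmin by exact: (psiR_le HX (ltW vm0) vmv).
have zx := psi_ray_le t v0.
have dev : normc (psi X (ray v t) / Cx (psiR X v) - 1) <= D * `|t|.
  apply: (le_trans (ray_dev t v0)); rewrite ler_wpM2r// /D ler_pM ?invr_ge0 ?(ltW v0) ?(ltW pv0)//.
  by rewrite lef_pV2 ?posrE//; exact: (psiR_le HX (ltW v0) vvM).
have [s1 _] := hK1 _ _ (le_trans zx pvr) pv0 pvr.
have s1' n : normc (rhov v t n.+1 - rhov v t n) <= K1 * D * `|t| * th ^+ n.
  apply: (le_trans (s1 n)).
  have -> : K1 * D * `|t| * th ^+ n = K1 * th ^+ n * (D * `|t|) by ring.
  by rewrite ler_wpM2l// mulr_ge0// exprn_ge0.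
have Kt : 0 <= K1 * D * `|t| by exact: mulr_ge0 (mulr_ge0 K10 D0) (normr_ge0 _).
have [l hl hlr] := geo_ccvg Kt th01 s1'.
have Hl : Hfun v t = l by exact: climitE.
rewrite Hl; have hr : normc (rhov v t j - l) <= K3 * th ^+ j * `|t|.
  by apply: (le_trans (hlr j)); rewrite /K3 le_eqVlt; apply/orP; left; apply/eqP; rewrite -/th; ring.
have tj : 0 <= th ^+ j * `|t| by rewrite mulr_ge0// exprn_ge0.
have rn1 i : normc (rhov v t i) <= 1.
  apply: (le_trans (rho_le HX i zx pv0 (ltW pv1))).
  by rewrite ler_pdivrMr// mul1r.
have ln1 : normc l <= 1.
  rewrite -[l]subr0; apply: (ccvg_normc_le (b := fun=> _) hl); last exact: cvg_cst.
  by apply: nearW => n; rewrite subr0.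
split => //.
  apply: (le_trans hr); rewrite ler_wpM2r// ler_wpM2r ?exprn_ge0// lerDl.
  exact: addr_ge0 (mulr_ge0 K20 D0) (mulr_ge0 (ler0n _ _) K30).
have -> : Qrho X Y (psiR X v) (psi X (ray v t)) j - l ^+ nu =
  (Qrho X Y (psiR X v) (psi X (ray v t)) j - rhov v t j ^+ nu) + (rhov v t j ^+ nu - l ^+ nu) by ring.
apply: (le_trans (le_normcD _ _)).
apply: (@le_trans _ _ (K2 * th ^+ j * (D * `|t|) + nu%:R * (K3 * th ^+ j * `|t|))).
  apply: lerD.
    apply: (le_trans (hK2 j _ _ zx pv0 pvr)); rewrite ler_wpM2l// mulr_ge0// exprn_ge0//.
  apply: (le_trans (normc_powB_le nu (rn1 j) ln1)).
  by rewrite expr1n mulr1 mulrC ler_wpM2l.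
have -> : (K3 + (K2 * D + nu%:R * K3)) * th ^+ j * `|t| =
  K3 * (th ^+ j * `|t|) + (K2 * th ^+ j * (D * `|t|) + nu%:R * (K3 * th ^+ j * `|t|)) by ring.
by rewrite lerDr mulr_ge0.
Qed.

Lemma rhov_cvg v t : 0 < v -> ccvg (rhov v t) (Hfun v t).
Proof.
move=> v0; have [K [th [_ _ h]]] := Hfun_rate v0 (lexx v).
by have [] := h v t 0%N (lexx _) (lexx _).
Qed.

Lemma Hfun_scale v t : 0 < v -> Hfun (a * v) t = Hfun v t.
Proof.
move=> v0; have av0 : 0 < a * v by rewrite mulr_gt0.
apply: ccvg_unique (rhov_cvg t av0) _.
have := ccvg_shift 1 (rhov_cvg t v0); congr ccvg; apply/funext => j.
by rewrite !rhovE// mulrA -exprSr addn1.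
Qed.

(** [psi_expand] at a^j v has constants governed by psi(a^j v / 2) / psi(a^j v). [rho_bounds] for
    the real point psi(v / 2) bounds this in j, while 1 - psi(a V) / psi(V) = 1 - g(psi V) keeps A
    away from 0. Then j tends to infinity. *)
Lemma Hfun_expand_local vmin vmax : 0 < vmin -> vmin <= vmax -> exists al K, [/\ 0 < al, 0 <= K &
  forall v, vmin <= v -> v <= vmax -> exists A B,
   [/\ al <= A, A <= K, 0 <= B, B <= K & quad_exp K (Hfun v) A B]].
Proof.
move=> vm0 vmM; have /andP[r0 r1] := psiR_01 vm0.
have vM0 : 0 < vmax := lt_le_trans vm0 vmM.
have /andP[pM0 _] := psiR_01 vM0.
have /andP[th0 th1] := gXR_theta HX (ltW r0) r1.
have vm20 : 0 < vmin / 2 by rewrite divr_gt0.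
have /andP[r20 r21] := psiR_01 vm20.
have [K1 K10 hK1] := rho_bounds HX r20 r21.
pose K2 := 1 + K1 * ((psiR X vmax)^-1 + 1).
have K20 : 0 <= K2 by rewrite addr_ge0// mulr_ge0// addr_ge0// invr_ge0 ltW.
pose al := (1 - gR (psiR X vmin)) / (a - 1).
exists al, (432 * K2 + 1); split.
- by rewrite divr_gt0// subr_gt0.
- by rewrite addr_ge0// mulr_ge0.
move=> v vmv vvM; have v0 : 0 < v := lt_le_trans vm0 vmv.
have key j : psiR X (a ^+ j * v / 2) / psiR X (a ^+ j * v) <= K2.
  have v20 : 0 < v / 2 by rewrite divr_gt0.
  rewrite -mulrA (psiR_scale_iter HX j (ltW v20)) (psiR_scale_iter HX j (ltW v0)).
  have /andP[pv0 pv1] := psiR_01 v0; have /andP[pv20 pv21] := psiR_01 v20.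
  have nz : normc (Cx (psiR X (v / 2))) <= psiR X (vmin / 2).
    rewrite normc_Cx gtr0_norm//; apply: (psiR_le HX (ltW vm20)).
    by rewrite ler_wpM2r// invr_ge0.
  have xr : psiR X v <= psiR X (vmin / 2).
    apply: (psiR_le HX (ltW vm20)); apply: le_trans vmv.
    by rewrite ler_pdivrMr// ler_peMr// ?(ltW vm0)// ler1n.
  have [_ /(_ j)] := hK1 _ _ nz pv0 xr.
  rewrite /rho fit_Cx -!CxV -!CxM -!Cx1 -!CxB !normc_Cx => h.
  have h1 := ler_norm (fitR X j (psiR X (v / 2)) / fitR X j (psiR X v) - 1).
  have h2 : `|psiR X (v / 2) / psiR X v - 1| <= (psiR X vmax)^-1 + 1.
    apply: (le_trans (ler_normB _ _)); rewrite normr1 lerD2r ger0_norm ?divr_ge0 ?(ltW pv20) ?(ltW pv0)//.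
    rewrite -[leRHS]mul1r ler_pM ?invr_ge0 ?(ltW pv20) ?(ltW pv0) ?(ltW pv21)//.
    by rewrite lef_pV2 ?posrE//; exact: (psiR_le HX (ltW v0) vvM).
  have h3 := ler_wpM2l K10 h2; rewrite /K2; lra.
apply: (@quad_exp_limit _ (fun j t => rhov v t j) _ (fun=> al) (fun=> 432 * K2 + 1)).
- move=> j; have V0 : 0 < a ^+ j * v by rewrite mulr_gt0.
  have [A [B [h1 h2 h3 h4 h5]]] := psi_expand HX Xs_law Ys_law indep V0.
  have kj := key j.
  have hK : 432 * psiR X (a ^+ j * v / 2) / psiR X (a ^+ j * v) + 1 <= 432 * K2 + 1.
    by rewrite lerD2r -mulrA ler_wpM2l.
  exists A, B; split => //.
  + apply: le_trans h1; rewrite /al ler_wpM2r ?invr_ge0 ?subr_ge0 ?(ltW a1)// lerD2l lerN2.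
    have /andP[pV0 pV1] := psiR_01 V0.
    have := psiR_scale_iter HX 1 (ltW V0); rewrite expr1 /= => ->.
    rewrite gfR_gXR//; last by rewrite (ltW pV0) (ltW pV1).
    rewrite mulrAC divff ?gt_eqF// mul1r; apply: gXR_le; first exact: ltW.
      apply: (psiR_le HX (ltW vm0)); apply: (le_trans vmv).
      by rewrite ler_peMl ?(ltW v0)// exprn_ege1// ltW.
    exact: ltW.
  + by apply: (le_trans h2); apply: (le_trans kj); lra.
  + exact: le_trans h4 hK.
  + move=> t; have := quad_exp_le hK h5 t.
    by rewrite rhovE.
- by move=> t; exact: rhov_cvg.
- exact: cvg_cst.
- exact: cvg_cst.
Qed.

(** Invariance under v |-> a v reduces every v > 0 to the interval [1, a], so the constants are
    global; the saddle point is searched over a range that itself depends on them. *)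
Lemma Hfun_expand : exists al K, [/\ 0 < al, 0 <= K &
  forall v, 0 < v -> exists A B,
   [/\ al <= A, A <= K, 0 <= B, B <= K & quad_exp K (Hfun v) A B]].
Proof.
have [al [K [al0 K0 h]]] := Hfun_expand_local ltr01 (ltW a1).
exists al, K; split => // v v0.
suff [v' [v'1 v'a Hv]] : exists v', [/\ 1 <= v', v' <= a & Hfun v = Hfun v'].
  by rewrite Hv; exact: h.
have up n u : 1 <= u -> u <= a ^+ n -> exists v', [/\ 1 <= v', v' <= a & Hfun u = Hfun v'].
  elim: n u => [|n ih] u u1 un.
    by exists u; split => //; apply: (le_trans un); exact: ltW.
  have [ua|ua] := leP u a; first by exists u.
  have [||v' [h1 h2 h3]] := ih (u / a).
  - by rewrite ler_pdivlMr// mul1r ltW.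
  - by rewrite ler_pdivrMr// -exprSr.
  exists v'; split => //; rewrite -h3; apply/funext => t.
  rewrite -[in LHS](divfK (_ : a != 0) u) ?gt_eqF// mulrC Hfun_scale// divr_gt0//.
  exact: lt_le_trans u1.
have [n hn] := exists_expr_ge v^-1 a1.
have sc j : Hfun (a ^+ j * v) = Hfun v.
  elim: j => [|j ih]; first by rewrite mul1r.
  by apply/funext => t; rewrite exprS -mulrA Hfun_scale ?mulr_gt0// ih.
rewrite -(sc n); have v1 : 1 <= a ^+ n * v.
  by rewrite -[leLHS](mulVf (_ : v != 0)) ?gt_eqF// ler_wpM2r// ltW.
have [N hN] := exists_expr_ge (a ^+ n * v) a1.
exact: up v1 hN.
Qed.

Lemma Hfun_seq_cvg (v_ : nat -> R) v t vmin vmax : 0 < vmin ->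
  (forall n, vmin <= v_ n) -> (forall n, v_ n <= vmax) -> vmin <= v -> v <= vmax ->
  v_ @ \oo --> v -> ccvg (fun n => Hfun (v_ n) t) (Hfun v t).
Proof.
move=> vm0 h1 h2 h3 h4 hv; have vmM := le_trans h3 h4.
have [K [th [K0 th01 hK]]] := Hfun_rate vm0 vmM; have /andP[th0 th1] := th01.
have v0 : 0 < v := lt_le_trans vm0 h3.
have vn0 n : 0 < v_ n := lt_le_trans vm0 (h1 n).
have cpsi : ccvg (fun n => psi X (ray (v_ n) t)) (psi X (ray v t)).
  apply: ccvgP; apply: (@squeeze_cvgr _ _ _ _ (fun=> 0) (fun n => `|v_ n - v| * (1 + `|t|))).
  - apply: nearW => n; rewrite normc_ge0 /=.
    apply: (le_trans (psi_lip HX (ltW (vn0 n) : 0 <= Re (ray (v_ n) t)) (ltW v0 : 0 <= Re (ray v t)))).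
    by rewrite /= -mulrBl [`|_ * t|]normrM mulrDr mulr1.
  - exact: cvg_cst.
  - rewrite -[X in _ --> X](mul0r (1 + `|t|)); apply: cvgM; last exact: cvg_cst.
    apply/cvgr0Pnorm_le => e e0; move/cvgrPdist_le : hv => /(_ e e0).
    by apply: filterS => n; rewrite normr_id distrC.
have cR : psiR X (v_ n) @[n --> \oo] --> psiR X v.
  apply/cvgrPdist_le => e e0; move/cvgrPdist_le : hv => /(_ e e0); apply: filterS => n.
  apply: le_trans; have := psi_lip HX (ltW v0 : 0 <= Re (Cx v)) (ltW (vn0 n) : 0 <= Re (Cx (v_ n))).
  rewrite (psi_Cx HX (ltW v0)) (psi_Cx HX (ltW (vn0 n))) -CxB normc_Cx => h; apply: (le_trans h).
  by rewrite /= subr0 normr0 addr0.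
have cj j : ccvg (fun n => rhov (v_ n) t j) (rhov v t j).
  rewrite /rhov /rho; apply: ccvgM.
    apply: fit_cvg => //.
    - by move=> n; exact: (normc_psi_le1 HX (ltW (vn0 n) : 0 <= Re (ray (v_ n) t))).
    - exact: (normc_psi_le1 HX (ltW v0 : 0 <= Re (ray v t))).
  have fj0 u : 0 < u -> 0 < fitR X j (psiR X u).
    move=> u0; have /andP[pu0 pu1] := psiR_01 u0.
    by apply: fitR_gt0 => //; exact: ltW.
  have cf : ccvg (fun n => fit X j (Cx (psiR X (v_ n)))) (fit X j (Cx (psiR X v))).
    apply: fit_cvg.
    - by move=> n; have /andP[q0 q1] := psiR_01 (vn0 n); rewrite normc_Cx gtr0_norm// ltW.
    - by have /andP[q0 q1] := psiR_01 v0; rewrite normc_Cx gtr0_norm// ltW.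
    - exact: ccvg_Cx.
  have [cf1 _] := cf; rewrite fit_Cx /= in cf1.
  have -> : (fun n => (Cx (fitR X j (psiR X (v_ n))))^-1) =
     (fun n => Cx (fitR X j (psiR X (v_ n)))^-1) by apply/funext => n; rewrite CxV.
  rewrite -CxV; apply: ccvg_Cx; apply: cvgV; first by rewrite gt_eqF// fj0.
  by move: cf1; under eq_fun do rewrite fit_Cx.
apply: ccvgP; apply/cvgrPdist_le => e e0.
have th1' : 0 < 1 - th by rewrite subr_gt0.
have Kt : 0 <= K * `|t| by rewrite mulr_ge0.
have [j hj] : exists j, K * th ^+ j * `|t| <= e / 4.
  have : K * `|t| * th ^+ n @[n --> \oo] --> K * `|t| * 0.
    apply: cvgM; first exact: cvg_cst.
    have := @cvg_geometric R 1 th; rewrite ger0_norm// => /(_ th1).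
    by rewrite /geometric /=; under eq_fun do rewrite mul1r.
  rewrite mulr0 => /cvgr0Pnorm_le /(_ (e / 4)); rewrite divr_gt0// => /(_ isT)[j _ /(_ j (leqnn j))].
  by rewrite /= ger0_norm ?mulr_ge0 ?exprn_ge0// => hj; exists j; rewrite mulrAC.
have := ccvg_dist (cj j) => /cvgr0Pnorm_le /(_ (e / 2)); rewrite divr_gt0// => /(_ isT).
apply: filterS => n; rewrite ger0_norm ?normc_ge0// => hn.
rewrite sub0r normrN ger0_norm ?normc_ge0//.
have -> : Hfun (v_ n) t - Hfun v t = (rhov (v_ n) t j - rhov v t j) +
   (rhov v t j - Hfun v t) - (rhov (v_ n) t j - Hfun (v_ n) t) by ring.
apply: (le_trans (le_normcB _ _)); apply: (le_trans (lerD (le_normcD _ _) (lexx _))).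
have [e1 _ _] := hK v t j h3 h4; have [e2 _ _] := hK (v_ n) t j (h1 n) (h2 n).
lra.
Qed.

(** Solves v = c A(v) with no continuity of A. The set [S] collects the v with v <= c A(v); at its
    supremum, limits from below give a first moment >= v / c and limits from above give one <= v /
    c, and first moments are unique. *)
Lemma saddle_point K al c : 0 < al -> 0 <= K -> 0 < c ->
  (forall v, 0 < v -> exists A B,
     [/\ al <= A, A <= K, 0 <= B, B <= K & quad_exp K (Hfun v) A B]) ->
  exists v A B, [/\ c * al <= v, v = c * A, A <= K, 0 <= B <= K & quad_exp K (Hfun v) A B].
Proof.
move=> al0 K0 c0 hE.
pose S := [set v | c * al <= v /\ exists A B,
  [/\ al <= A, A <= K, 0 <= B, B <= K & quad_exp K (Hfun v) A B] /\ v <= c * A].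
have cal : 0 < c * al by rewrite mulr_gt0.
have Slo : S (c * al).
  split => //; have [A [B hAB]] := hE _ cal; exists A, B; split => //.
  by have [h _ _ _ _] := hAB; rewrite ler_wpM2l// ltW.
have SK v : S v -> v <= c * K.
  by move=> [_ [A [B [[_ AK _ _ _] vA]]]]; apply: (le_trans vA); rewrite ler_wpM2l// ltW.
have hs : has_sup S by split; [exists (c * al)|exists (c * K) => v /SK].
pose v := sup S.
have vlo : c * al <= v by exact: (ub_le_sup (proj2 hs)).
have vK : v <= c * K by apply: ge_sup => //; exists (c * al).
have v0 : 0 < v := lt_le_trans cal vlo.
have hn0 n : 0 < n.+1%:R^-1 :> R by rewrite invr_gt0.
have hn1 n : n.+1%:R^-1 <= 1 :> R by rewrite invf_le1// ler1n.
have ch : (fun n => n.+1%:R^-1 : R) @ \oo --> (0 : R) by exact: cvg_harmonic.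
have /choice[u hu] : forall n, exists x, S x /\ v - n.+1%:R^-1 < x.
  by move=> n; have [x Sx vx] := sup_adherent (hn0 n) hs; exists x.
have cu : u @ \oo --> v.
  apply: (@squeeze_cvgr _ _ _ _ (fun n => v - n.+1%:R^-1) (fun=> v)).
  - apply: nearW => n; have [Su vu] := hu n; rewrite ltW//=.
    exact: (ub_le_sup (proj2 hs)).
  - by rewrite -[X in _ --> X]subr0; apply: cvgB => //; exact: cvg_cst.
  - exact: cvg_cst.
have cu' : (fun n => v + n.+1%:R^-1) @ \oo --> v.
  by rewrite -[X in _ --> X]addr0; apply: cvgD => //; exact: cvg_cst.
have [A [B [h1 h2 h3 h4 h5]]] : exists A B,
    [/\ v / c <= A, A <= K, 0 <= B, B <= K & quad_exp K (Hfun v) A B].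
  apply: (@quad_exp_limit _ (fun n => Hfun (u n)) _ (fun n => u n / c) (fun=> K)).
  - move=> n; have [[_ [A [B [[_ b2 b3 b4 b5] uA]]]] _] := hu n.
    by exists A, B; split => //; rewrite ler_pdivrMr// mulrC.
  - move=> t; apply: (Hfun_seq_cvg t cal (vmax := c * K)) => // n; have [Su _] := hu n.
      by have [] := Su.
    exact: SK.
  - by apply: cvgM => //; exact: cvg_cst.
  - exact: cvg_cst.
(* Points v + 1/(n+1) lie outside [S], so every expansion there has A1 < (v + 1/(n+1)) / c. *)
have [A' [B' [h1' h2' h3' h4' h5']]] : exists A B,
    [/\ al <= A, A <= v / c, 0 <= B, B <= K & quad_exp K (Hfun v) A B].
  apply: (@quad_exp_limit _ (fun n => Hfun (v + n.+1%:R^-1)) _ (fun=> al)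
    (fun n => (v + n.+1%:R^-1) / c)).
  - move=> n; have vn0 : 0 < v + n.+1%:R^-1 by rewrite addr_gt0.
    have [A1 [B1 hAB]] := hE _ vn0; have [b1 b2 b3 b4 b5] := hAB.
    exists A1, B1; split => //; rewrite leNgt; apply/negP => hA.
    have : S (v + n.+1%:R^-1).
      split; first by rewrite (le_trans vlo)// lerDl ltW.
      exists A1, B1; split => //; rewrite mulrC -ler_pdivrMr//; exact: ltW.
    by move=> /(ub_le_sup (proj2 hs)); rewrite -/v gerDl leNgt hn0.
  - move=> t; apply: (Hfun_seq_cvg t cal (vmax := c * K + 1)) => // [n|n|].
    + by rewrite (le_trans vlo)// lerDl ltW.
    + by rewrite lerD.
    + by rewrite (le_trans vK)// lerDl.
  - exact: cvg_cst.
  - by apply: cvgM => //; exact: cvg_cst.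
have AA : A = A' by exact: quad_exp_inj h5 h5'.
exists v, A, B; split => //; last by rewrite h3 h4.
have -> : A = v / c by apply/eqP; rewrite eq_le h1 andbT AA h2'.
by rewrite mulrC divfK// gt_eqF.
Qed.

End phase.

(** * Products of immigration ratios *)

Section phase_products.
Context d (T : measurableType d) (R : realType) (P : probability T R).
Local Notation C := (complex R).
Variables (X : {RV P >-> nat}) (HX : offspring_law X).
Variables (Y : {RV P >-> nat}) (nu : nat).
Hypothesis Y_ge1 : forall w, (1 <= Y w)%N.
Hypothesis q_nu : 0 < mass Y nu.
Hypothesis nu_min : forall i : nat, 0 < mass Y i -> (nu <= i)%N.
Local Notation a := (offmean X).
Implicit Types (z : C) (x y r v t : R).

Lemma nu_ge1 : (1 <= nu)%N.
Proof.
rewrite lt0n; apply/eqP => nu0; move: q_nu; rewrite nu0 /mass.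
have -> : Y @^-1` [set 0%N] = set0.
  by apply/seteqP; split => // w /= Y0; have := Y_ge1 w; rewrite Y0.
by rewrite measure0 ltxx.
Qed.

(** What m scalings by a multiply the normalized transform of W by along the ray, as [lap_ratio]
    shows; the immigration present at scale v stays outside, hence the index j + 1. *)
Definition Rprod v t m : C := \prod_(j < m) Qrho X Y (psiR X v) (psi X (ray v t)) j.+1.

(* Each factor is [O(theta^j |t|)]-close to a fixed function with a Gaussian expansion. *)
Lemma Rprod_bounds vmin vmax K A0 : 0 < vmin -> vmin <= vmax -> 0 <= K -> 1 <= A0 ->
  exists D c, [/\ 0 <= D, 0 < c &
  forall v A B, vmin <= v -> v <= vmax -> 0 <= A -> A <= K -> 0 <= B -> B <= K ->
    quad_exp K (Hfun X v) A B ->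
  c <= B - A ^+ 2 /\
  forall m t, `|t| <= A0 ->
   normc (Rprod v t m) <= expR (- (c * m%:R * t ^+ 2)) /\
   normc (Rprod v t m * cexpN (Complex 0 (- (nu%:R * A * m%:R * t))) -
      Cx (expR (- (nu%:R * (B - A ^+ 2) * m%:R * t ^+ 2 / 2)))) <=
   D * (`|t| + m%:R * `|t| ^+ 3) * expR (- (c * m%:R * t ^+ 2))].
Proof.
move=> vm0 vmM K0 A01; have A00 : 0 <= A0 by exact: le_trans A01.
have [c c0 hc] := psi_ray_contraction HX vm0 vmM A00.
have [K1 [th [K10 /andP[th0 th1] hK1]]] := Hfun_rate HX q_nu nu_min vm0 vmM.
have [K2 K20 hK2] := quad_exp_centered K0 A00.
(* [normc_prodB_le] leaves q^{m-1}; the factor e^{c A0^2} bounds 1/q and restores q^m. *)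
pose D := (K1 / (1 - th) + nu%:R * K2) * expR (c * A0 ^+ 2).
have th1' : 0 < 1 - th by rewrite subr_gt0.
have D10 : 0 <= K1 / (1 - th) by rewrite divr_ge0// ltW.
have nK20 : 0 <= nu%:R * K2 by rewrite mulr_ge0.
have nu1 := nu_ge1.
have nu1R : 1 <= nu%:R :> R by rewrite ler1n.
exists D, c; split => //; first by rewrite mulr_ge0 ?addr_ge0 ?expR_ge0.
move=> v A B h1 h2 A_0 AK B_0 BK hq.
have v0 : 0 < v := lt_le_trans vm0 h1.
have /andP[pv0 pv1] := psiR_01 HX v0.
have zv t : normc (psi X (ray v t)) <= psiR X v by exact: psi_ray_le.
have zq t : `|t| <= A0 -> normc (psi X (ray v t)) / psiR X v <= expR (- (c * t ^+ 2)).
  by move=> tA; rewrite ler_pdivrMr// mulrC; exact: hc.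
have rq t j : `|t| <= A0 -> normc (rhov X v t j) <= expR (- (c * t ^+ 2)).
  by move=> tA; apply: (le_trans _ (zq t tA)); exact: (rho_le HX j (zv t) pv0 (ltW pv1)).
have Hq t : `|t| <= A0 -> normc (Hfun X v t) <= expR (- (c * t ^+ 2)).
  move=> tA; have [_ _ cH] := hK1 v t 0%N h1 h2.
  rewrite -[Hfun X v t]subr0; apply: (ccvg_normc_le (b := fun=> _) cH); last exact: cvg_cst.
  by apply: nearW => n; rewrite subr0; exact: rq.
have kap : c *+ 2 <= B - A ^+ 2.
  by apply: (quad_exp_variance K0 A_0 c0 hq) => t t1; apply: Hq; exact: le_trans t1 A01.
set k := B - A ^+ 2 in kap *.
have ck : c <= k by rewrite (le_trans _ kap)// mulr2n lerDl ltW.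
split => // m t tA.
pose q := expR (- (c * t ^+ 2)).
have q0 : 0 <= q := expR_ge0 _.
have t20 : 0 <= t ^+ 2 := sqr_ge0 t.
have q1 : q <= 1 by rewrite expR_le1 oppr_le0 mulr_ge0// ltW.
have Qq j : normc (Qrho X Y (psiR X v) (psi X (ray v t)) j) <= q.
  apply: (le_trans _ (zq t tA)).
  exact: (Qrho_le HX Y_ge1 q_nu nu_min j (zv t) pv0 (ltW pv1)).
have qm : q ^+ m = expR (- (c * m%:R * t ^+ 2)).
  by rewrite /q -expRM_natl; congr expR; ring.
split.
  rewrite -qm /Rprod; elim: m {qm} => [|m ih]; first by rewrite big_ord0 normc1.
  by rewrite big_ord_recr /= normcM exprSr ler_pM ?normc_ge0.
(* An empty product has no factor to spare for q^{m-1}; here both products are 1. *)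
have [m0|m0] := posnP m.
  have e0 : cexpN (Complex 0 (- (nu%:R * A * 0%:R * t))) = 1.
    by rewrite mulr0 mul0r oppr0 (_ : Complex 0 0 = 0)// cexpN0.
  rewrite m0 /Rprod big_ord0 mul1r e0.
  have -> : - (nu%:R * k * 0%:R * t ^+ 2 / 2) = 0 by rewrite mulr0 !mul0r oppr0.
  rewrite expR0 Cx1 subrr normc0 mul0r addr0 mulr_ge0 ?expR_ge0//.
  by rewrite mulr_ge0// mulr_ge0 ?expR_ge0// addr_ge0.
pose e : C := cexpN (Complex 0 (- (nu%:R * A * t))).
have ne : normc e = 1 by rewrite normc_cexpN /= oppr0 expR0.
pose E := expR (- (k * t ^+ 2 / 2)).
have Eq : E <= q.
  rewrite ler_expR lerN2 ler_pdivlMr// mulrAC ler_wpM2r//.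
  by rewrite mulr_natr.
pose u j := Qrho X Y (psiR X v) (psi X (ray v t)) j.+1 * e.
pose g (j : nat) : C := Cx (E ^+ nu).
have E0 : 0 <= E := expR_ge0 _.
have E1 : E <= 1 by exact: le_trans Eq q1.
have -> : Rprod v t m * cexpN (Complex 0 (- (nu%:R * A * m%:R * t))) = \prod_(j < m) u j.
  rewrite big_split /= prodr_const card_ord; congr (_ * _).
  rewrite /e -cexpN_natM; congr cexpN; rewrite -Cx_nat.
  by apply/eqP; rewrite eq_complex; apply/andP; split; apply/eqP => /=; ring.
have -> : Cx (expR (- (nu%:R * k * m%:R * t ^+ 2 / 2))) = \prod_(j < m) g j.
  rewrite prodr_const card_ord -CxX -exprM /E -expRM_natl natrM; congr (Cx (expR _)); ring.
have uq i : (i < m)%N -> normc (u i) <= q by move=> _; rewrite normcM ne mulr1.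
have Enq : E ^+ nu <= q.
  apply: le_trans Eq; rewrite -[leRHS]expr1; exact: ler_wiXn2l.
have gq i : (i < m)%N -> normc (g i) <= q.
  by move=> _; rewrite normc_Cx ger0_norm ?exprn_ge0.
apply: (le_trans (normc_prodB_le uq gq)).
pose h := Hfun X v t.
have h1q : normc h <= 1 by apply: le_trans (Hq t tA) q1.
have AB : A ^+ 2 <= B by rewrite -subr_ge0 (le_trans (ltW c0)).
have main : normc (h ^+ nu * e - Cx (E ^+ nu)) <= nu%:R * K2 * `|t| ^+ 3.
  have -> : e = cexpN (Complex 0 (- (t * A))) ^+ nu.
    rewrite -cexpN_natM; congr cexpN; rewrite -Cx_nat.
    by apply/eqP; rewrite eq_complex; apply/andP; split; apply/eqP => /=; ring.
  rewrite -exprMn CxX; set h' := h * _.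
  have h'1 : normc h' <= 1 by rewrite normcM normc_cexpN /= oppr0 expR0 mulr1.
  have E1' : normc (Cx E) <= 1 by rewrite normc_Cx ger0_norm.
  apply: (le_trans (normc_powB_le nu h'1 E1')); rewrite expr1n mulr1 mulrC -mulrA ler_wpM2l//.
  by have := hK2 _ _ _ A_0 AK B_0 BK AB hq t tA.
have step i : normc (u i - g i) <= K1 * `|t| * th ^+ i + nu%:R * K2 * `|t| ^+ 3.
  have -> : u i - g i = (Qrho X Y (psiR X v) (psi X (ray v t)) i.+1 - h ^+ nu) * e +
     (h ^+ nu * e - Cx (E ^+ nu)) by rewrite /u /g; ring.
  apply: (le_trans (le_normcD _ _)); apply: lerD => //.
  have [_ s _] := hK1 v t i.+1 h1 h2.
  rewrite normcM ne mulr1; apply: (le_trans s).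
  rewrite [leLHS]mulrAC ler_wpM2l ?mulr_ge0// exprS ler_piMl ?exprn_ge0//; exact: ltW.
have sum : \sum_(i < m) normc (u i - g i) <=
    (K1 / (1 - th) + nu%:R * K2) * (`|t| + m%:R * `|t| ^+ 3).
  apply: (@le_trans _ _ (\sum_(i < m) (K1 * `|t| * th ^+ i + nu%:R * K2 * `|t| ^+ 3))).
    by apply: ler_sum => i1 _; exact: step.
  rewrite big_split /= sumr_const card_ord -mulr_sumr -mulr_natr.
  have := @sum_geo_le R th m; rewrite th0 th1 => /(_ isT); rewrite big_mkord => hs.
  have h3 : K1 * `|t| * \sum_(i < m) th ^+ i <= K1 / (1 - th) * `|t|.
    by rewrite [leRHS]mulrAC ler_wpM2l// mulr_ge0.
  have t3 : 0 <= m%:R * `|t| ^+ 3 by rewrite mulr_ge0// exprn_ge0.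
  have h4 : 0 <= K1 / (1 - th) * (m%:R * `|t| ^+ 3) by exact: mulr_ge0.
  have h5 : 0 <= nu%:R * K2 * `|t| by exact: mulr_ge0.
  lra.
apply: (@le_trans _ _ ((K1 / (1 - th) + nu%:R * K2) * (`|t| + m%:R * `|t| ^+ 3) * q ^+ m.-1)).
  by rewrite ler_wpM2r ?exprn_ge0.
have -> : D * (`|t| + m%:R * `|t| ^+ 3) * expR (- (c * m%:R * t ^+ 2)) =
  (K1 / (1 - th) + nu%:R * K2) * (`|t| + m%:R * `|t| ^+ 3) * (expR (c * A0 ^+ 2) * q ^+ m).
  by rewrite qm /D; ring.
rewrite ler_wpM2l//.
  by rewrite mulr_ge0 ?addr_ge0// mulr_ge0// exprn_ge0.
rewrite -[in leRHS](prednK m0) [q ^+ _.+1]exprS [leRHS]mulrA ler_peMl ?exprn_ge0//.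
rewrite /q -expRD -expR0 ler_expR subr_ge0 ler_wpM2l ?(ltW c0)//.
by rewrite -[leLHS]real_normK ?num_real// lerXn2r ?nnegrE.
Qed.

End phase_products.

(** * The Laplace transform of a nonnegative variable *)

Section laplace_transform.
Context d (T : measurableType d) (R : realType) (P : probability T R).
Local Notation C := (complex R).
Variable V : T -> R.
Hypothesis mV : measurable_fun setT V.
Hypothesis V0 : forall w, 0 <= V w.
Implicit Types (z : C) (x v t : R).

Definition lap z : C := CE P (fun w => cexpN (z * Cx (V w))).
Definition lapR x : R := Ex P (fun w => expR (- (x * V w))).

Let ReV z w : Re (z * Cx (V w)) = Re z * V w.
Proof. by rewrite ReM /= mulr0 subr0. Qed.

Let ImV z w : Im (z * Cx (V w)) = Im z * V w.
Proof. by rewrite ImM /= mulr0 add0r. Qed.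

Lemma cmeas_cexpN z : cmeas (fun w => cexpN (z * Cx (V w))).
Proof.
have mx : measurable_fun setT (fun w => expR (- (Re z * V w))).
  by apply: measurableT_comp => //; apply: measurableT_comp => //; exact: measurable_funM.
have my : measurable_fun setT (fun w => Im z * V w) by exact: measurable_funM.
rewrite /cexpN; split => /=; under eq_fun do rewrite ReV ImV.
  apply: measurable_funM => //; apply: measurableT_comp => //.
  by apply: continuous_measurable_fun; exact: continuous_cos.
apply: measurableT_comp => //; apply: measurable_funM => //; apply: measurableT_comp => //.
by apply: continuous_measurable_fun; exact: continuous_sin.
Qed.

Lemma normc_cexpN_V z w : normc (cexpN (z * Cx (V w))) = expR (- (Re z * V w)).
Proof. by rewrite normc_cexpN ReV. Qed.

Lemma measurable_expNV x : measurable_fun setT (fun w => expR (- (x * V w))).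
Proof.
by apply: measurableT_comp => //; apply: measurableT_comp => //; exact: measurable_funM.
Qed.

Lemma itg_expNV x : 0 <= x -> itg P (fun w => expR (- (x * V w))).
Proof.
move=> x0; apply: (@itg_bounded _ _ _ _ _ 1); first exact: measurable_expNV.
by move=> w; rewrite ger0_norm ?expR_ge0// expR_le1 oppr_le0 mulr_ge0.
Qed.

Lemma citg_cexpN z : 0 <= Re z -> citg P (fun w => cexpN (z * Cx (V w))).
Proof.
move=> z0; apply: (citg_le (cmeas_cexpN z) (itg_expNV z0)) => w.
by rewrite normc_cexpN_V.
Qed.

Lemma lap_Cx x : lap (Cx x) = Cx (lapR x).
Proof. by rewrite -CE_Cx; apply: eq_CE => w; rewrite -CxM cexpN_Cx. Qed.

Lemma normc_lap_le z : 0 <= Re z -> normc (lap z) <= lapR (Re z).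
Proof.
move=> z0; apply: normc_CE_le; [exact: citg_cexpN|exact: itg_expNV|].
by move=> w; rewrite normc_cexpN_V.
Qed.

Lemma lapR_le1 x : 0 <= x -> lapR x <= 1.
Proof.
move=> x0; rewrite -[leRHS](Ex_cst P); apply: le_Ex; [exact: itg_expNV|exact: itg_cst|].
by move=> w; rewrite expR_le1 oppr_le0 mulr_ge0.
Qed.

Lemma lapR_le x v : 0 <= x -> x <= v -> lapR v <= lapR x.
Proof.
move=> x0 xv; have v0 := le_trans x0 xv; apply: le_Ex; [exact: itg_expNV|exact: itg_expNV|].
by move=> w; rewrite ler_expR lerN2 ler_wpM2r.
Qed.

Lemma lapR_gt0 x : 0 <= x -> 0 < lapR x.
Proof.
move=> x0; have l_ge0 : 0 <= lapR x by apply: Ex_ge0 => w; exact: expR_ge0.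
rewrite lt0r l_ge0 andbT; apply/eqP => l0.
have /ae_eq_integral_abs : measurable_fun setT (EFin \o (fun w => expR (- (x * V w)))).
  exact/measurable_EFinP/measurable_expNV.
move=> /(_ P measurableT)[h _].
have {}h : ae_eq P setT (EFin \o (fun w => expR (- (x * V w)))) (cst 0%E).
  apply: h; under eq_integral do rewrite /= ger0_norm ?expR_ge0//.
  move: l0; rewrite /lapR /Ex /Rintegral => l0.
  have fin := integrable_fin_num measurableT (itg_expNV x0).
  by rewrite -[LHS](fineK fin) l0.
have : {ae P, forall w : T, False}.
  by apply: filterS h => w /(_ I) /= /eqP; rewrite eqe gt_eqF ?expR_gt0.
move=> [A [mA A0]] hA.
have AT : A = setT by apply/seteqP; split => // w _; exact: hA.
move: A0; rewrite AT probability_setT => /eqP; rewrite eqe oner_eq0//.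
Qed.

(* [x e^{-x} <= e^{-x/2}] bounds the derivative along the vertical direction *)
Lemma lap_ray v t : 0 < v -> normc (lap (ray v t) - Cx (lapR v)) <= lapR (v / 2) * `|t|.
Proof.
move=> v0; have v20 : 0 <= v / 2 by rewrite divr_ge0// ltW.
rewrite -lap_Cx -CEB; [|exact: (citg_cexpN (ltW v0 : 0 <= Re (ray v t)))|
  exact: (citg_cexpN (ltW v0 : 0 <= Re (Cx v)))].
rewrite mulrC -ExZ; last exact: itg_expNV.
apply: normc_CE_le.
- by apply: citgB; [exact: (citg_cexpN (ltW v0 : 0 <= Re (ray v t)))|
    exact: (citg_cexpN (ltW v0 : 0 <= Re (Cx v)))].
- by apply: itgZ; exact: itg_expNV.
move=> w; have x0 : 0 <= v * V w by rewrite mulr_ge0// ltW.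
have -> : ray v t * Cx (V w) = Cx (v * V w) + Complex 0 (v * V w * t).
  by apply/eqP; rewrite eq_complex; apply/andP; split; apply/eqP => /=; ring.
rewrite cexpND -CxM cexpN_Cx -[X in _ - X]mulr1 -mulrBr normcM normc_Cx ger0_norm ?expR_ge0//.
apply: (le_trans (ler_wpM2l (expR_ge0 _) (cexpN_imB1 _))).
rewrite [`|_ * t|]normrM (ger0_norm x0).
have -> : expR (- (v * V w)) * (v * V w * `|t|) = `|t| * (v * V w * expR (- (v * V w))) by ring.
rewrite ler_wpM2l//.
apply: (le_trans (xexpN_le x0)); rewrite ler_expR lerN2; lra.
Qed.

End laplace_transform.

(** * The scaling equation for the transform of W *)

Section laplace_scaling.
Context d (T : measurableType d) (R : realType) (P : probability T R).
Local Notation C := (complex R).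
Variables (X : {RV P >-> nat}) (HX : offspring_law X).
Variables (Y : {RV P >-> nat}) (nu : nat).
Hypothesis Y_ge1 : forall w, (1 <= Y w)%N.
Hypothesis q_nu : 0 < mass Y nu.
Hypothesis nu_min : forall i : nat, 0 < mass Y i -> (nu <= i)%N.
Variables (Xs : nat -> nat -> {RV P >-> nat}) (Ys : nat -> {RV P >-> nat}).
Hypothesis Xs_law : forall n i, same_law (Xs n i) X.
Hypothesis Ys_law : forall j, same_law (Ys j) Y.
Hypothesis indep : mutually_independent P (joint_family Xs Ys).
Local Notation a := (offmean X).
Variable V : T -> R.
Hypothesis mV : measurable_fun setT V.
Hypothesis V0 : forall w, 0 <= V w.
Hypothesis V_lim : {ae P, forall w,
    (gwi Xs Ys n w)%:R / a ^+ n @[n --> \oo] --> V w}.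
Implicit Types (z : C) (x v t : R).

Let X1 := offspring_ge1 HX.
Let Xnd := offspring_nondeg HX.
Let Xlog := offspring_XlogX HX.
Let a1 : 1 < a := offmean_gt1 X1 Xnd Xlog.
Let a0 : 0 < a := offmean_gt0 X1 Xnd Xlog.
Let aX n : 0 < a ^+ n. Proof. exact: exprn_gt0. Qed.

Lemma cexpN_cvg (u : nat -> C) z : (forall n, 0 <= Re (u n)) -> 0 <= Re z -> ccvg u z ->
  ccvg (fun n => cexpN (u n)) (cexpN z).
Proof.
move=> u0 z0 [hr hi]; apply: ccvgP.
apply: (@squeeze_cvgr _ _ _ _ (fun=> 0) (fun n => `|Re (u n) - Re z| + `|Im (u n) - Im z|)).
- by apply: nearW => n; rewrite normc_ge0 /=; exact: cexpN_lip.
- exact: cvg_cst.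
- have c0 (f : nat -> R) (l : R) : f @ \oo --> l -> `|f n - l| @[n --> \oo] --> (0 : R).
    move=> fl; rewrite -(@normr0 _ R) -(subrr l); apply: cvg_norm.
    by apply: cvgB => //; exact: cvg_cst.
  by rewrite -[X in _ --> X]addr0; apply: cvgD; exact: c0.
Qed.

(** The immigrants who arrived j generations before time n contribute Q at the j-th iterate,
    independently of the others; j = n is the initial population. *)
Lemma gwi_gf n z : normc z <= 1 ->
  CE P (fun w => z ^+ gwi Xs Ys n w) = \prod_(j < n.+1) gf P Y (fit X j z).
Proof.
have E m w : gwi Xs Ys m w = gproc Xs Ys (fun=> id) m w.
  by elim: m => //= m ->.
elim: n z => [|n ih] z z1.
  rewrite big_ord1 /=; apply: (CE_law (g := fun k => z ^+ k) (M := 1)) => // k.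
  by rewrite normc_X exprn_ile1 ?normc_ge0.
under eq_CE do rewrite E.
rewrite (CE_gproc_S Xs_law Ys_law indep)// big_ord_recl; congr (_ * _).
rewrite -/(gf P X z); under eq_CE do rewrite -E.
rewrite ih ?normc_gf_le1//; apply: eq_bigr => j _.
by rewrite /fit -iterSr.
Qed.

Lemma lap_cvg z : 0 <= Re z ->
  ccvg (fun n => \prod_(j < n.+1) gf P Y (fit X j (cexpN (Cx (a ^- n) * z)))) (lap P V z).
Proof.
move=> z0; have zn n : 0 <= Re (Cx (a ^- n) * z) by rewrite ReZ mulr_ge0// invr_ge0 ltW.
have mg n : measurable_fun setT (gwi Xs Ys n).
  have -> : gwi Xs Ys n = gproc Xs Ys (fun=> id) n.
    by apply/funext => w; elim: n => //= n ->.
  exact: measurable_gproc.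
have -> : (fun n => \prod_(j < n.+1) gf P Y (fit X j (cexpN (Cx (a ^- n) * z)))) =
    (fun n => CE P (fun w => cexpN (Cx (a ^- n) * z) ^+ gwi Xs Ys n w)).
  by apply/funext => n; rewrite gwi_gf// normc_cexpN_le1.
apply: (CE_dct (M := 1)).
- by move=> n; exact: (cmeas_nat (fun k => cexpN (Cx (a ^- n) * z) ^+ k)).
- exact: cmeas_cexpN.
- by move=> n w; rewrite normc_X exprn_ile1 ?normc_ge0// normc_cexpN_le1.
apply: filterS V_lim => w hw.
have E n : cexpN (Cx (a ^- n) * z) ^+ gwi Xs Ys n w =
    cexpN (z * Cx ((gwi Xs Ys n w)%:R / a ^+ n)).
  by rewrite -cexpN_natM -Cx_nat CxM; congr cexpN; ring.
under [X in ccvg X]eq_fun do rewrite E.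
apply: cexpN_cvg.
- by move=> n; rewrite mulrC ReZ mulr_ge0// divr_ge0// ltW.
- by rewrite mulrC ReZ mulr_ge0.
- by apply: ccvgM; [exact: ccvg_cst|exact: ccvg_Cx].
Qed.

(** The product for a z at time n + 1 is the product for z at time n with one more factor,
    Q(psi_{n+1}(a z)). *)
Lemma lap_scale z : 0 <= Re z ->
  lap P V (Cx a * z) = lap P V z * gf P Y (psi X (Cx a * z)).
Proof.
move=> z0; have az0 : 0 <= Re (Cx a * z) by rewrite ReZ mulr_ge0// ltW.
have := ccvg_shift 1 (lap_cvg az0).
have E n : Cx (a ^- (n + 1)) * (Cx a * z) = Cx (a ^- n) * z.
  by rewrite mulrA -CxM addn1 exprS invfM mulrAC mulVf ?gt_eqF// mul1r.
have -> : (fun n => \prod_(j < (n + 1).+1) gf P Y (fit X j (cexpN (Cx (a ^- (n + 1)) * (Cx a * z))))) =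
   fun n => (\prod_(j < n.+1) gf P Y (fit X j (cexpN (Cx (a ^- n) * z)))) *
     gf P Y (psin X (n + 1) (Cx a * z)).
  by apply/funext => n; rewrite /psin E addn1 big_ord_recr.
move=> h; apply: (ccvg_unique h).
apply: ccvgM; first exact: lap_cvg.
apply: gf_cvg => //.
- by move=> n; rewrite /psin normc_fit_le1// normc_cexpN_le1// ReZ mulr_ge0// invr_ge0 ltW.
- exact: normc_psi_le1.
- exact: (ccvg_shift 1 (psi_cvg HX az0)).
Qed.

Lemma lapR_scale v : 0 <= v -> lapR P V (a * v) = lapR P V v * gfR P Y (psiR X (a * v)).
Proof.
move=> v0; apply: (@complexI R); rewrite CxM -!lap_Cx CxM lap_scale// -CxM (psi_Cx HX).
  by rewrite gf_Cx.
by rewrite mulr_ge0// ltW.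
Qed.

Lemma lapR_scale_iter m v : 0 <= v ->
  lapR P V (a ^+ m * v) = lapR P V v * \prod_(j < m) gfR P Y (fitR X j.+1 (psiR X v)).
Proof.
move=> v0; elim: m => [|m ih]; first by rewrite mul1r big_ord0 mulr1.
rewrite exprS -mulrA lapR_scale ?mulr_ge0 ?(ltW (aX m))// ih big_ord_recr /= mulrA.
by rewrite mulrA -exprS (psiR_scale_iter HX m.+1 v0).
Qed.

Lemma lap_ratio m v t : 0 < v ->
  lap P V (ray (a ^+ m * v) t) / Cx (lapR P V (a ^+ m * v)) =
  lap P V (ray v t) / Cx (lapR P V v) * Rprod X Y v t m.
Proof.
move=> v0; elim: m => [|m ih]; first by rewrite mul1r /Rprod big_ord0 mulr1.
have amv : 0 < a ^+ m * v by rewrite mulr_gt0.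
have rayS : ray (a ^+ m.+1 * v) t = Cx a * ray (a ^+ m * v) t.
  by rewrite !ray_scale exprS CxM mulrA.
have r0 : 0 <= Re (ray (a ^+ m * v) t) by exact: ltW.
have lS : lapR P V (a ^+ m.+1 * v) = lapR P V (a ^+ m * v) * gfR P Y (psiR X (a ^+ m.+1 * v)).
  by rewrite exprS -[in LHS]mulrA lapR_scale ?(ltW amv)// mulrA.
rewrite rayS lap_scale// -rayS lS CxM invfM mulrACA ih.
have -> : Rprod X Y v t m.+1 = Rprod X Y v t m *
    (gf P Y (psi X (ray (a ^+ m.+1 * v) t)) / Cx (gfR P Y (psiR X (a ^+ m.+1 * v)))).
  rewrite (ray_scale X m.+1 v t) (psi_scale_iter HX m.+1 (ltW v0 : 0 <= Re (ray v t))).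
  by rewrite (psiR_scale_iter HX m.+1 (ltW v0)) [LHS]big_ord_recr.
by rewrite [RHS]mulrA.
Qed.

End laplace_scaling.

(** * Integrals on segments and half-lines from primitives *)

Section ftc_wrappers.
Context {R : realType}.
Local Notation mu := (@lebesgue_measure R).
Implicit Types (f F : R -> R) (a b x l : R).

Lemma is_derive_continuous F (x df : R) : is_derive x 1 F df -> {for x, continuous F}.
Proof.
move=> [dF _]; apply: differentiable_continuous.
by apply/derivable1_diffP.
Qed.

Lemma integral_seg_primitive F f a b : a < b -> (forall x, is_derive x 1 F (f x)) ->
  continuous f -> (\int[mu]_(x in `[a, b]) (f x)%:E = (F b - F a)%:E)%E.
Proof.
move=> ab dF cf; rewrite EFinB; apply: continuous_FTC2 => //.
- exact: continuous_subspaceT.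
- split.
  + by move=> x _; have [] := dF x.
  + by apply: cvg_at_right_filter; exact: is_derive_continuous (dF a).
  + by apply: cvg_at_left_filter; exact: is_derive_continuous (dF b).
- by move=> x _; rewrite derive1E; have [_] := dF x.
Qed.

Lemma integral_ray_primitive F f a l : (forall x, a <= x -> is_derive x 1 F (f x)) ->
  (forall x, a <= x -> {for x, continuous f}) -> (forall x, a <= x -> 0 <= f x) ->
  F x @[x --> +oo] --> l -> (\int[mu]_(x in `[a, +oo[) (f x)%:E = (l - F a)%:E)%E.
Proof.
move=> dF cf f0 Fl; rewrite EFinB; apply: ge0_continuous_FTC2y => //.
- apply/continuous_within_itvcyP; split.
    by move=> x; rewrite in_itv /= andbT => ax; apply: cf; exact: ltW.
  by apply: cvg_at_right_filter; exact: cf.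
- by move=> x ax; have [] := dF x (ltW ax).
- by apply: cvg_at_right_filter; exact: is_derive_continuous (dF a (lexx a)).
- by move=> x; rewrite in_itv /= andbT => ax; rewrite derive1E; have [_] := dF x (ltW ax).
Qed.

End ftc_wrappers.

(** * The Fejer kernel *)

Section fejer_kernel.
Context {R : realType}.
Local Notation mu := (@lebesgue_measure R).
Implicit Types (s t A y r : R).

(** The function (sin(s/2) / (s/2))^2, with its limit as value at 0. *)
Definition fej s : R := if s == 0 then 1 else 2 * (1 - cos s) / s ^+ 2.

Lemma fej_ge0 s : 0 <= fej s.
Proof.
by rewrite /fej; case: ifP => // _; rewrite divr_ge0 ?sqr_ge0// mulr_ge0// subr_ge0 cos_le1.
Qed.

Lemma fejN s : fej (- s) = fej s.
Proof. by rewrite /fej oppr_eq0 cosN sqrrN. Qed.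

Lemma fej_le s : s != 0 -> fej s <= 4 / s ^+ 2.
Proof.
move=> s0; rewrite /fej (negbTE s0) ler_wpM2r ?invr_ge0 ?sqr_ge0//.
have := cos_geN1 s; lra.
Qed.

Lemma fej_le1 s : fej s <= 1.
Proof.
rewrite /fej; case: eqP => // /eqP s0.
have s2 : 0 < s ^+ 2 by rewrite exprn_even_gt0.
rewrite ler_pdivrMr// mul1r; have := normr_cosB1_le s.
rewrite ler_norml => /andP[+ _]; lra.
Qed.

Lemma fej_near s : `|fej s - 1| <= 2 * `|s|.
Proof.
rewrite /fej; case: eqP => [->|/eqP s0]; first by rewrite subrr normr0 mulr0.
have s2 : 0 < s ^+ 2 by rewrite exprn_even_gt0.
have -> : 2 * (1 - cos s) / s ^+ 2 - 1 = - (2 / s ^+ 2 * (cos s - 1 + s ^+ 2 / 2)).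
  by field.
rewrite normrN normrM ger0_norm ?divr_ge0 ?(ltW s2)//.
apply: (le_trans (ler_wpM2l _ (normr_cosB2_le s))); first by rewrite divr_ge0// ltW.
rewrite -[s ^+ 2]real_normK ?num_real// le_eqVlt; apply/orP; left; apply/eqP.
by field; rewrite normr_eq0.
Qed.

Lemma continuous_fej : continuous fej.
Proof.
move=> x; have [->|x0] := eqVneq x 0.
  apply/cvgrPdist_le => e e0; near=> y.
  have -> : fej 0 = 1 by rewrite /fej eqxx.
  rewrite distrC; apply: (le_trans (fej_near y)).
  rewrite mulrC -ler_pdivlMr//.
  near: y; have := @nbhs0_le R R (e / 2); rewrite divr_gt0// => /(_ isT).
  by [].
pose g s := 2 * (1 - cos s) / s ^+ 2.
have cg : g s @[s --> x] --> g x.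
  apply: cvgM; last first.
    by apply: cvgV; [rewrite expf_eq0 /=|exact: exprn_continuous].
  apply: cvgM; first exact: cvg_cst.
  by apply: cvgB; [exact: cvg_cst|exact: continuous_cos].
have gx : fej x = g x by rewrite /fej (negbTE x0).
suff : fej s @[s --> x] --> g x by rewrite -gx.
apply: cvg_trans cg; apply: near_eq_cvg; near=> s.
rewrite /fej ifN//; near: s; exact: open_neq.
Unshelve. all: by end_near. Qed.

Lemma measurable_fej : measurable_fun setT fej.
Proof. by apply: continuous_measurable_fun; exact: continuous_fej. Qed.

Definition fejA A s := A * fej (A * s).

Lemma measurable_fejA A y : measurable_fun setT (fun s => fejA A (s - y)).
Proof.
apply: measurable_funM => //; apply: measurableT_comp; first exact: measurable_fej.
by apply: measurable_funM => //; exact: measurable_funB.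
Qed.

Lemma fejA_ge0 A s : 0 <= A -> 0 <= fejA A s.
Proof. by move=> A0; rewrite mulr_ge0// fej_ge0. Qed.

Let half_cont A r c x : 0 < A -> 0 < r -> r + c <= x ->
  {for x, continuous (fun x => 4 / (A * (x - c) ^+ 2))}.
Proof.
move=> A0 r0 h; have xc : 0 < x - c by rewrite subr_gt0 (lt_le_trans _ h)// ltrDr.
apply: cvgM; first exact: cvg_cst.
apply: cvgV; first by rewrite mulf_neq0 ?gt_eqF// exprn_gt0.
apply: cvgM; first exact: cvg_cst.
apply: (@cvg_comp _ _ _ (fun x => x - c) (fun x => x ^+ 2)); last exact: exprn_continuous.
by apply: cvgB; [exact: cvg_id|exact: cvg_cst].
Qed.

Let half A r c : 0 < A -> 0 < r ->
  (\int[mu]_(x in `[(r + c)%R, +oo[) (4 / (A * (x - c) ^+ 2))%:E = (4 / (A * r))%:E)%E.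
Proof.
move=> A0 r0.
have pos x : r + c <= x -> 0 < x - c by move=> h; rewrite subr_gt0 (lt_le_trans _ h)// ltrDr.
have -> : 4 / (A * r) = 0 - (- (4 / A)) * (r + c - c)^-1.
  by rewrite addrK sub0r mulNr opprK invfM mulrA.
apply: (@integral_ray_primitive _ (fun x => - (4 / A) * (x - c)^-1)
   (fun x => 4 / (A * (x - c) ^+ 2)) (r + c) 0).
- move=> x /pos xc.
  have -> : 4 / (A * (x - c) ^+ 2) = - (4 / A) * (- (x - c) ^- 2 * 1).
    by rewrite mulr1 mulrN mulNr opprK invfM mulrA.
  apply: is_deriveZ; apply: is_deriveV; first by rewrite gt_eqF.
  by apply: is_derive_eq; rewrite subr0.
- by move=> x h; exact: half_cont h.
- by move=> x /pos xc; rewrite divr_ge0// mulr_ge0 ?(ltW A0)// sqr_ge0.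
- rewrite -(mulr0 (- (4 / A))); apply: cvgM; first exact: cvg_cst.
  apply/(gtr0_cvgV0 (f := fun x => x - c)); last exact: cvg_addrr.
  by near=> x; rewrite subr_gt0; near: x; apply: nbhs_pinfty_gt; exact: num_real.
Unshelve. all: by end_near. Qed.

Definition outer y r : set R := [set s | r <= `|s - y|].

Lemma outerE y r : 0 < r -> outer y r = `]-oo, y - r] `|` `[r + y, +oo[.
Proof.
move=> r0; apply/seteqP; split => s; rewrite /outer /= !in_itv /= ?andbT.
  by rewrite ler_normr => /orP[h|h]; [right|left]; lra.
by rewrite ler_normr => -[h|h]; apply/orP; [right|left]; lra.
Qed.

Lemma measurable_outer y r : 0 < r -> measurable (outer y r).
Proof. by move=> r0; rewrite outerE//; exact: measurableU. Qed.

(** The scaled kernel is at most 4 / (A s^2) at distance s from its center, and each half-line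
    contributes 4 / (A r). *)
Lemma fejA_tail A y r : 0 < A -> 0 < r ->
  (\int[mu]_(s in outer y r) (fejA A (s - y))%:E <= (8 / (A * r))%:E)%E.
Proof.
move=> A0 r0; rewrite outerE//.
have mf D : measurable_fun D (fun s => (fejA A (s - y))%:E).
  by apply/measurable_EFinP; apply: measurable_funTS; exact: measurable_fejA.
have f0 (x : R) : (0 <= (fejA A (x - y))%:E)%E by rewrite lee_fin fejA_ge0// ltW.
have bd c (x : R) : c != x -> fejA A (x - c) <= 4 / (A * (x - c) ^+ 2).
  move=> cx; have xc : x - c != 0 by rewrite subr_eq0 eq_sym.
  apply: (@le_trans _ _ (A * (4 / (A * (x - c)) ^+ 2))).
    by rewrite ler_wpM2l ?(ltW A0)// fej_le// mulf_neq0// gt_eqF.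
  by rewrite le_eqVlt; apply/orP; left; apply/eqP; field; rewrite xc gt_eqF.
have ray c : (\int[mu]_(x in `[(r + c)%R, +oo[) (fejA A (x - c))%:E <= (4 / (A * r))%:E)%E.
  rewrite -(half c A0 r0); apply: ge0_le_integral => //.
  - by move=> x _; rewrite lee_fin fejA_ge0// ltW.
  - by apply/measurable_EFinP; apply: measurable_funTS; exact: measurable_fejA.
  - apply/measurable_EFinP; apply: subspace_continuous_measurable_fun => //.
    apply/continuous_within_itvcyP; split.
      by move=> x; rewrite in_itv /= andbT => /ltW h; exact: half_cont h.
    by apply: cvg_at_right_filter; exact: (half_cont A0 r0 (lexx (r + c))).
  - move=> x /=; rewrite in_itv /= andbT lee_fin => xr; apply: bd.
    by rewrite lt_eqF// (lt_le_trans _ xr)// ltrDr.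
rewrite ge0_integral_setU//; last 2 first.
- exact: mf.
- apply/disj_setPS => x /=; rewrite !in_itv /= andbT => -[h1 h2].
  suff: False by []; lra.
rewrite (_ : y - r = - (r + - y)); last by lra.
rewrite ge0_integration_by_substitutionNy.
- have -> : 8 / (A * r) = 4 / (A * r) + 4 / (A * r) by lra.
  rewrite EFinD; apply: leeD; last exact: ray.
  apply: (le_trans _ (ray (- y))); rewrite le_eqVlt; apply/orP; left; apply/eqP.
  apply: eq_integral => x _ /=; congr EFin; rewrite /fejA -fejN; congr (_ * fej _); ring.
- apply: continuous_subspaceT => x; apply: cvgM; first exact: cvg_cst.
  apply: (@cvg_comp _ _ _ (fun x => A * (x - y)) fej); last exact: continuous_fej.
  by apply: cvgM; [exact: cvg_cst|apply: cvgB; [exact: cvg_id|exact: cvg_cst]].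
- by move=> x _; rewrite fejA_ge0// ltW.
Qed.

(** Kept as a symbol: it ends up in the additive constant of M2, through the logarithm of sqrt(2 pi)
    / [fej_mass]. *)
Definition fej_mass : R := fine (\int[mu]_s (fej s)%:E)%E.

Let mfejE D : measurable_fun D (fun s => (fej s)%:E).
Proof. by apply/measurable_EFinP; apply: measurable_funTS; exact: measurable_fej. Qed.

Let fej0E (x : R) : (0 <= (fej x)%:E)%E.
Proof. by rewrite lee_fin fej_ge0. Qed.

Lemma fej_massE : (\int[mu]_s (fej s)%:E = fej_mass%:E)%E.
Proof.
rewrite /fej_mass fineK// ge0_fin_numE; last exact: integral_ge0.
have := fejA_tail 0 (ltr01 : 0 < 1) (ltr01 : 0 < 1).
have -> : (fun s : R => (fejA 1 (s - 0))%:E) = (fun s => (fej s)%:E).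
  by apply/funext => s; rewrite /fejA !mul1r subr0.
have mo : measurable (outer 0 1) by exact: measurable_outer.
move=> tl; rewrite -(setUv (outer 0 1)) ge0_integral_setU;
  [|exact: mo|exact: measurableC|exact: mfejE|by []|exact/disj_setPCl].
apply: lte_add_pinfty.
    by apply: (le_lt_trans tl); rewrite ltry.
  apply: (@le_lt_trans _ _ (\int[mu]_(s in `[(-1)%R, 1%R]) 1%:E)%E).
    apply: (@le_trans _ _ (\int[mu]_(s in `[(-1)%R, 1%R]) (fej s)%:E)%E).
      apply: ge0_subset_integral => //.
      + by apply: measurableC; exact: measurable_outer.
      + exact: mfejE.
      move=> s; rewrite /outer /= in_itv /= subr0 => /negP; rewrite -ltNge ltr_norml => /andP[h1 h2].
      by rewrite (ltW h1) ltW.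
    by apply: ge0_le_integral => //; [exact: mfejE|move=> s _; rewrite lee_fin fej_le1].
  by rewrite integral_cst//= mul1e lebesgue_measure_itv /=; case: ifP => // _; rewrite ltry.
Qed.

Lemma fej_mass_gt0 : 0 < fej_mass.
Proof.
rewrite -lte_fin -fej_massE.
apply: (@lt_le_trans _ _ (\int[mu]_(s in `[0%R, (1 / 4)%R]) (1 / 2)%:E)%E).
  rewrite integral_cst//= lebesgue_measure_itv /= lte_fin ifT ?divr_gt0//.
  by rewrite sube0 -EFinM lte_fin mulr_gt0// divr_gt0.
apply: (@le_trans _ _ (\int[mu]_(s in `[0%R, (1 / 4)%R]) (fej s)%:E)%E).
  apply: ge0_le_integral => //; first exact: mfejE.
  move=> s; rewrite /= in_itv /= => /andP[s0 s4]; rewrite lee_fin.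
    have := fej_near s; rewrite (ger0_norm s0) ler_norml => /andP[h _]; lra.
by apply: ge0_subset_integral => //; exact: mfejE.
Qed.

Lemma fejA_total A y : 0 < A -> (\int[mu]_s (fejA A (s - y))%:E = fej_mass%:E)%E.
Proof.
move=> A0; rewrite -fej_massE.
pose F s := A * (s - y).
have dF (x : R) : is_derive x 1 F A.
  by apply: is_derive_eq; rewrite subr0 /GRing.scale /= mulr1.
have F' : derive1 F = cst A.
  by apply/funext => x; rewrite derive1E; have [_] := dF x.
rewrite (@increasing_ge0_integration_by_substitutionT _ F fej) ?F'.
- by apply: eq_integral => s _; rewrite /fejA /= /F /= mulrC.
- by move=> x z xz; rewrite /F ltr_pM2l// ltrD2r.
- by move=> x; exact: cvg_cst.
- exact: is_cvg_cst.
- exact: is_cvg_cst.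
- by move=> x; have [] := dF x.
- apply: gt0_cvgMrNy => //; exact: cvg_addrr_Ny.
- apply: gt0_cvgMry => //; exact: cvg_addrr.
- exact: continuous_fej.
- exact: fej_ge0.
Qed.

Lemma fejA_core A y r : 0 < A -> 0 < r ->
  ((fej_mass - 8 / (A * r))%:E <= \int[mu]_(s in ~` outer y r) (fejA A (s - y))%:E)%E.
Proof.
move=> A0 r0; have mo : measurable (outer y r) by exact: measurable_outer.
have := fejA_total y A0; rewrite -(setUv (outer y r)) ge0_integral_setU; [|exact: mo|exact: measurableC| | |exact/disj_setPCl].
- move=> h; have t := fejA_tail y A0 r0.
  rewrite EFinB leeBlDr// -h addeC; exact: leeD2l.
- by apply/measurable_EFinP; apply: measurable_funTS; exact: measurable_fejA.
- by move=> x _; rewrite lee_fin fejA_ge0// ltW.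
Qed.

(* [2 (1 - t/A)] is the Fourier transform of the kernel; the [1 +] keeps the integrand
   nonnegative so that only Tonelli's theorem is needed later *)
Lemma fejA_fourier A s : 0 < A ->
  (\int[mu]_(t in `[0%R, A]) (2 * (1 - t / A) * (1 + cos (t * s)))%:E = (A + fejA A s)%:E)%E.
Proof.
move=> A0; have An0 : A != 0 by rewrite gt_eqF.
have cc : continuous (fun t => 2 * (1 - t / A) * (1 + cos (t * s))).
  move=> t; apply: cvgM.
    apply: cvgM; first exact: cvg_cst.
    by apply: cvgB; [exact: cvg_cst|apply: cvgM; [exact: cvg_id|exact: cvg_cst]].
  apply: cvgD; first exact: cvg_cst.
  apply: (@cvg_comp _ _ _ (fun t => t * s) cos); last exact: continuous_cos.
  by apply: cvgM; [exact: cvg_id|exact: cvg_cst].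
have [->|s0] := eqVneq s 0.
  have dF (t : R) : is_derive t 1 (fun t => 4 * t - 2 * t ^+ 2 / A) (2 * (1 - t / A) * (1 + cos (t * 0))).
    apply: is_derive_eq; rewrite !scaler0 /GRing.scale /= mulr0 cos0; field.
    by rewrite ?An0.
  have c0 : continuous (fun t => 2 * (1 - t / A) * (1 + cos (t * 0))).
    move=> t; apply: cvgM.
      apply: cvgM; first exact: cvg_cst.
      by apply: cvgB; [exact: cvg_cst|apply: cvgM; [exact: cvg_id|exact: cvg_cst]].
    apply: cvgD; first exact: cvg_cst.
    apply: (@cvg_comp _ _ _ (fun t => t * 0) cos); last exact: continuous_cos.
    by apply: cvgM; [exact: cvg_id|exact: cvg_cst].
  rewrite (integral_seg_primitive A0 dF c0); congr EFin.
  by rewrite /fejA /fej [A * 0]mulr0 eqxx; field.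
have dF (t : R) : is_derive t 1 (fun t => 2 * t - t ^+ 2 / A + 2 * (1 - t / A) * sin (t * s) / s
    - 2 / (A * s ^+ 2) * cos (t * s)) (2 * (1 - t / A) * (1 + cos (t * s))).
  apply: is_derive_eq; rewrite !scaler0 /GRing.scale /=; field.
  by rewrite ?An0 ?s0.
rewrite (integral_seg_primitive A0 dF cc); congr EFin.
rewrite /fejA /fej mulf_eq0 (negbTE An0) (negbTE s0) /= !mul0r sin0 cos0; field.
by rewrite ?An0 ?s0.
Qed.

End fejer_kernel.

(** * Recovering a function from its Fejer means *)

Section tauberian.
Context {R : realType}.
Local Notation mu := (@lebesgue_measure R).
Implicit Types (s t A y r : R).
Variable J : R -> R.
Hypothesis mJ : measurable_fun setT J.
Hypothesis J0 : forall s, 0 <= J s.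
Hypothesis J_mono : forall s s', s <= s' -> J s <= expR (s' - s) * J s'.

Definition fejconv A y : \bar R := (\int[mu]_s (J s * fejA A (s - y))%:E)%E.

Let mJK A y D : measurable_fun D (fun s => (J s * fejA A (s - y))%:E).
Proof.
apply/measurable_EFinP; apply: measurable_funTS; apply: measurable_funM => //.
exact: measurable_fejA.
Qed.

Let mK A y c D : measurable_fun D (fun s => (c * fejA A (s - y))%:E).
Proof.
apply/measurable_EFinP; apply: measurable_funTS; apply: measurable_funM => //.
exact: measurable_fejA.
Qed.

Let mK1 A y D : measurable_fun D (fun s => (fejA A (s - y))%:E).
Proof. by apply/measurable_EFinP; apply: measurable_funTS; exact: measurable_fejA. Qed.

Let intZ A y c D : 0 < A -> 0 <= c -> measurable D ->
  (\int[mu]_(s in D) (c * fejA A (s - y))%:E = c%:E * \int[mu]_(s in D) (fejA A (s - y))%:E)%E.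
Proof.
move=> A0 c0 mD; under eq_integral do rewrite EFinM.
rewrite ge0_integralZl ?lee_fin//; first exact: mK1.
by move=> s _; rewrite lee_fin fejA_ge0// ltW.
Qed.

(** The kernel is centered at s0 + delta/2, so its window of radius delta/2 lies to the right of s0,
    where J >= e^{-delta} J(s0). The mass outside the window is at most 16 / (A delta). *)
Lemma fejconv_ge A s0 delta : 0 < A -> 0 < delta ->
  ((expR (- delta) * J s0 * (fej_mass - 16 / (A * delta)))%:E <= fejconv A (s0 + delta / 2))%E.
Proof.
move=> A0 d0; set y := s0 + delta / 2; set r := delta / 2.
have r0 : 0 < r by rewrite divr_gt0.
have c0 : 0 <= expR (- delta) * J s0 by rewrite mulr_ge0 ?expR_ge0.
have mo : measurable (~` outer y r) by apply: measurableC; exact: measurable_outer.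
apply: (@le_trans _ _ (\int[mu]_(s in ~` outer y r) (expR (- delta) * J s0 * fejA A (s - y))%:E)%E).
  rewrite intZ// EFinM; apply: lee_wpmul2l; rewrite ?lee_fin//.
  apply: le_trans (fejA_core y A0 r0); rewrite lee_fin lerD2l lerN2 le_eqVlt; apply/orP; left.
  by apply/eqP; rewrite /r; field; rewrite ?gt_eqF.
have JK0 s : (0 <= (J s * fejA A (s - y))%:E)%E by rewrite lee_fin mulr_ge0// fejA_ge0// ltW.
apply: (@le_trans _ _ (\int[mu]_(s in ~` outer y r) (J s * fejA A (s - y))%:E)%E).
  apply: ge0_le_integral => //; [|exact: mK|exact: mJK|].
    by move=> s _; rewrite lee_fin mulr_ge0// fejA_ge0// ltW.
  move=> s; rewrite /outer /= => /negP; rewrite -ltNge ltr_norml => /andP[h1 h2].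
  rewrite lee_fin ler_wpM2r ?fejA_ge0 ?(ltW A0)//.
  have s0s : s0 <= s by move: h1; rewrite /y /r; lra.
  rewrite expRN mulrC ler_pdivrMr ?expR_gt0// mulrC; apply: (le_trans (J_mono s0s)).
  by rewrite ler_wpM2r// ler_expR; move: h2; rewrite /y /r; lra.
apply: ge0_subset_integral => //; exact: mJK.
Qed.

(** The mirror image: the window lies to the left of s0, where J <= e^{delta} J(s0). Outside it a
    uniform bound [S] on J is required, which the lower estimate supplies beforehand. *)
Lemma fejconv_le A s0 delta S : 0 < A -> 0 < delta -> (forall s, J s <= S) ->
  (fejconv A (s0 - delta / 2) <=
   (expR delta * J s0 * fej_mass + S * (16 / (A * delta)))%:E)%E.
Proof.
move=> A0 d0 JS; set y := s0 - delta / 2; set r := delta / 2.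
have r0 : 0 < r by rewrite divr_gt0.
have S0 : 0 <= S by exact: le_trans (J0 0) (JS 0).
have c0 : 0 <= expR delta * J s0 by rewrite mulr_ge0 ?expR_ge0.
have mo : measurable (outer y r) by exact: measurable_outer.
have moC : measurable (~` outer y r) by exact: measurableC.
have K0 s : (0 <= (fejA A (s - y))%:E)%E by rewrite lee_fin fejA_ge0// ltW.
have JK0 s : (0 <= (J s * fejA A (s - y))%:E)%E by rewrite lee_fin mulr_ge0// fejA_ge0// ltW.
rewrite /fejconv -(setUv (outer y r)) ge0_integral_setU;
  [|exact: mo|exact: moC|exact: mJK|by []|exact/disj_setPCl].
rewrite addeC EFinD; apply: leeD.
  apply: (@le_trans _ _ (\int[mu]_(s in ~` outer y r) (expR delta * J s0 * fejA A (s - y))%:E)%E).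
    apply: ge0_le_integral => //; [exact: mJK|exact: mK|].
    move=> s; rewrite /outer /= => /negP; rewrite -ltNge ltr_norml => /andP[h1 h2].
    rewrite lee_fin ler_wpM2r ?fejA_ge0 ?(ltW A0)//.
    have ss0 : s <= s0 by move: h2; rewrite /y /r; lra.
    apply: (le_trans (J_mono ss0)); rewrite ler_wpM2r// ler_expR.
    by move: h1; rewrite /y /r; lra.
  rewrite intZ// [X in (_ <= X)%E]EFinM; apply: lee_wpmul2l; rewrite ?lee_fin//.
  rewrite -(fejA_total y A0); apply: ge0_subset_integral => //; exact: mK1.
apply: (@le_trans _ _ (\int[mu]_(s in outer y r) (S * fejA A (s - y))%:E)%E).
  apply: ge0_le_integral => //; [exact: mJK|exact: mK|].
  by move=> s _; rewrite lee_fin ler_wpM2r// fejA_ge0// ltW.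
rewrite intZ// [X in (_ <= X)%E]EFinM; apply: lee_wpmul2l; rewrite ?lee_fin//.
apply: (le_trans (fejA_tail y A0 r0)); rewrite lee_fin le_eqVlt; apply/orP; left.
by apply/eqP; rewrite /r; field; rewrite ?gt_eqF.
Qed.

End tauberian.

(** * Gaussian integrals on half-lines and segments *)

Section gaussian_integrals.
Context {R : realType}.
Local Notation mu := (@lebesgue_measure R).
Implicit Types (lam c t A : R).

(** The factor 2 is that of the kernel transform 2 (1 - t/A) near t = 0; with it the half-line
    carries the full mass sqrt(2 pi / lam). *)
Definition gaus lam t : R := 2 * expR (- (lam * t ^+ 2 / 2)).

Lemma gaus_ge0 lam t : 0 <= gaus lam t.
Proof. by rewrite mulr_ge0 ?expR_ge0. Qed.

Lemma is_derive_expN_sqr c t : is_derive t 1 (fun t => expR (- (c * t ^+ 2))) (- (2 * c * t) * expR (- (c * t ^+ 2))).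
Proof.
by apply: is_derive_eq; rewrite ?scaler0 /GRing.scale /=; ring.
Qed.

Lemma continuous_expN_sqr c : continuous (fun t : R => expR (- (c * t ^+ 2))).
Proof. by move=> t; apply: is_derive_continuous; exact: is_derive_expN_sqr. Qed.

Lemma continuous_gaus lam : continuous (gaus lam).
Proof.
have -> : gaus lam = (fun t : R => 2 * expR (- (lam / 2 * t ^+ 2))).
  by apply/funext => x; congr (_ * expR _); ring.
by move=> t; apply: cvgM; [exact: cvg_cst|exact: continuous_expN_sqr].
Qed.

Lemma measurable_gaus lam D : measurable_fun D (fun t => (gaus lam t)%:E).
Proof.
apply/measurable_EFinP; apply: measurable_funTS; apply: continuous_measurable_fun.
exact: continuous_gaus.
Qed.

Lemma integral_gaus lam : 0 < lam ->
  (\int[mu]_(t in `[0%R, +oo[) (gaus lam t)%:E = (Num.sqrt (2 * pi / lam))%:E)%E.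
Proof.
move=> l0; pose s := (Num.sqrt lam)^-1.
have sl0 : 0 < Num.sqrt lam by rewrite sqrtr_gt0.
have s0 : s != 0 by rewrite invr_neq0// gt_eqF.
have s2 : s ^+ 2 = lam^-1 by rewrite /s exprVn sqr_sqrtr// ltW.
have nE x : normal_pdf 0 s x = (Num.sqrt (2 * pi / lam))^-1 * (gaus lam x / 2).
  rewrite /normal_pdf (negbTE s0) /normal_peak /normal_fun s2 /gaus; congr (_^-1 * _).
    by congr Num.sqrt; ring.
  rewrite mulrAC divff// mul1r; congr expR; rewrite subr0.
  by field; rewrite gt_eqF.
have q0 : 0 < Num.sqrt (2 * pi / lam) by rewrite sqrtr_gt0 divr_gt0// mulr_gt0// pi_gt0.
have := @integral_normal_pdf R 0 s.
under eq_integral do rewrite nE.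
rewrite ge0_symfun_integralT.
- rewrite -set_itvcy => h.
  have {}h : (2%:E * \int[mu]_(x in `[0%R, +oo[) ((Num.sqrt (2 * pi / lam))^-1 / 2 * gaus lam x)%:E = 1)%E.
    rewrite -[RHS]h; congr (_ * _)%E; apply: eq_integral => x _; congr EFin; ring.
  move: h; under eq_integral do rewrite EFinM.
  rewrite ge0_integralZl ?lee_fin//.
  + rewrite muleA -EFinM => h.
    have -> : (\int[mu]_(x in `[0%R, +oo[) (gaus lam x)%:E =
      (Num.sqrt (2 * pi / lam))%:E * ((2 * ((Num.sqrt (2 * pi / lam))^-1 / 2))%:E *
      \int[mu]_(x in `[0%R, +oo[) (gaus lam x)%:E))%E.
      rewrite muleA -EFinM.
      have -> : Num.sqrt (2 * pi / lam) * (2 * ((Num.sqrt (2 * pi / lam))^-1 / 2)) = 1.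
        by field; rewrite gt_eqF.
      by rewrite mul1e.
    by rewrite h mule1.
  + exact: measurable_gaus.
  + by move=> x _; rewrite lee_fin gaus_ge0.
- by move=> x; rewrite mulr_ge0 ?invr_ge0 ?(ltW q0)// divr_ge0// gaus_ge0.
- move=> x; apply: cvgM; first exact: cvg_cst.
  by apply: cvgM; [exact: continuous_gaus|exact: cvg_cst].
- by move=> x /=; rewrite /gaus sqrrN.
Qed.

Lemma integral_lin_gaus c A : 0 < c -> 0 < A ->
  (\int[mu]_(t in `[0%R, A]) (t * expR (- (c * t ^+ 2)))%:E <= (1 / (2 * c))%:E)%E.
Proof.
move=> c0 A0.
have dF (t : R) : is_derive t 1 (fun t => - (1 / (2 * c)) * expR (- (c * t ^+ 2))) (t * expR (- (c * t ^+ 2))).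
  have h := is_derive_expN_sqr c t.
  by apply: is_derive_eq; rewrite ?scaler0 /GRing.scale /=; field; rewrite gt_eqF.
rewrite (integral_seg_primitive A0 dF); last first.
  by move=> t; apply: cvgM; [exact: cvg_id|exact: continuous_expN_sqr].
rewrite lee_fin expr0n /= mulr0 oppr0 expR0.
have : 0 <= 1 / (2 * c) * expR (- (c * A ^+ 2)) by rewrite mulr_ge0 ?expR_ge0// divr_ge0// mulr_ge0// ltW.
lra.
Qed.

(** On t >= A the factor t / A is at least 1, and with it the integrand has an explicit
    primitive. *)
Lemma integral_gaus_tail lam A : 0 < lam -> 0 < A ->
  (\int[mu]_(t in `[A, +oo[) (gaus lam t)%:E <= (2 / (lam * A))%:E)%E.
Proof.
move=> l0 A0.
pose f t := 2 / A * (t * expR (- (lam / 2 * t ^+ 2))).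
pose F t := - (2 / (lam * A)) * expR (- (lam / 2 * t ^+ 2)).
have cf (t : R) : {for t, continuous f}.
  apply: cvgM; first exact: cvg_cst.
  by apply: cvgM; [exact: cvg_id|exact: continuous_expN_sqr].
have dF (t : R) : A <= t -> is_derive t 1 F (f t).
  move=> _; have h := is_derive_expN_sqr (lam / 2) t.
  by apply: is_derive_eq; rewrite ?scaler0 /GRing.scale /= /f; field; rewrite !gt_eqF.
have f0 t : A <= t -> 0 <= f t.
  move=> At; rewrite mulr_ge0 ?divr_ge0 ?(ltW A0)// mulr_ge0 ?expR_ge0//.
  exact: le_trans (ltW A0) At.
have Fy : F t @[t --> +oo] --> 0.
  rewrite -(mulr0 (- (2 / (lam * A)))); apply: cvgM; first exact: cvg_cst.
  apply: (@squeeze_cvgr _ _ _ _ (fun=> 0) (fun t => expR (- t))).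
  - near=> t; rewrite expR_ge0 /= ler_expR lerN2.
    have t2 : 2 / lam <= t by near: t; apply: nbhs_pinfty_ge; exact: num_real.
    have t0 : 0 <= t by apply: le_trans t2; rewrite divr_ge0// ltW.
    rewrite expr2 mulrA ler_peMl//; move: t2; rewrite ler_pdivrMr//; lra.
  - exact: cvg_cst.
  - exact: cvgr_expR.
apply: (@le_trans _ _ (\int[mu]_(t in `[A, +oo[) (f t)%:E)%E).
  apply: ge0_le_integral => //.
  - by move=> t _; rewrite lee_fin gaus_ge0.
  - exact: measurable_gaus.
  - by apply/measurable_EFinP; apply: measurable_funTS; exact: continuous_measurable_fun.
  - move=> t /=; rewrite in_itv /= andbT => At; rewrite lee_fin /gaus /f.
    rewrite (_ : lam / 2 * t ^+ 2 = lam * t ^+ 2 / 2); last by ring.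
    by rewrite [leRHS]mulrA ler_wpM2r ?expR_ge0// mulrAC ler_pdivlMr// ler_pM2l.
rewrite (integral_ray_primitive dF (fun x _ => cf x) f0 Fy) lee_fin /F sub0r mulNr opprK.
rewrite ler_piMr ?divr_ge0 ?mulr_ge0 ?(ltW l0) ?(ltW A0)//.
by rewrite expR_le1 oppr_le0 mulr_ge0 ?divr_ge0 ?sqr_ge0// ltW.
Unshelve. all: by end_near. Qed.

Lemma integral_gaus_seg lam A : 0 < lam -> 0 < A ->
  (\int[mu]_(t in `[0%R, A]) (gaus lam t)%:E <= (Num.sqrt (2 * pi / lam))%:E)%E /\
  ((Num.sqrt (2 * pi / lam))%:E <=
    \int[mu]_(t in `[0%R, A]) (gaus lam t)%:E + (2 / (lam * A))%:E)%E.
Proof.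
move=> l0 A0; have g0 x : (0 <= (gaus lam x)%:E)%E by rewrite lee_fin gaus_ge0.
rewrite -integral_gaus//; split.
  apply: ge0_subset_integral => //; first exact: measurable_gaus.
  by move=> x /=; rewrite !in_itv /= => /andP[->].
apply: (@le_trans _ _ (\int[mu]_(t in `[0%R, A]) (gaus lam t)%:E + \int[mu]_(t in `]A, +oo[) (gaus lam t)%:E)%E).
  rewrite -ge0_integral_setU//; last 2 first.
  - exact: measurable_gaus.
  - apply/disj_setPS => x /=; rewrite !in_itv /= andbT => -[/andP[_ h1] h2].
    by move: (lt_le_trans h2 h1); rewrite ltxx.
  apply: ge0_subset_integral => //; [exact: measurableU|exact: measurable_gaus|].
  move=> x /=; rewrite !in_itv /= !andbT => ->.
  by case: (leP x A) => h; [left|right].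
rewrite leeD2l// integral_itv_obnd_cbnd; last exact: measurable_gaus.
exact: integral_gaus_tail.
Qed.

End gaussian_integrals.

(** * Fejer means of a density with nearly Gaussian transform *)

Section kernel_estimate.
Context {R : realType}.
Local Notation mu := (@lebesgue_measure R).

(** A is itself the integral of 2 (1 - t/A). Left on both sides, it keeps every integrand
    nonnegative, so integrals are only added and compared. *)
Lemma fejconv_estimate (J r : R -> R) (A y lam C c : R) : 0 < A -> 0 < lam -> 0 < c -> 0 <= C ->
  measurable_fun `[0, A] r -> (forall t, 0 <= 1 + r t) ->
  (A%:E + fejconv J A y = \int[mu]_(t in `[0%R, A]) (2 * (1 - t / A) * (1 + r t))%:E)%E ->
  (forall t, 0 <= t -> t <= A ->
     `|2 * (1 - t / A) * r t - gaus lam t| <= C * (t * expR (- (c * t ^+ 2)))) ->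
  (fejconv J A y <= (Num.sqrt (2 * pi / lam) + C / (2 * c))%:E)%E /\
  ((Num.sqrt (2 * pi / lam) - C / (2 * c) - 2 / (lam * A))%:E <= fejconv J A y)%E.
Proof.
move=> A0 l0 c0 C0 mr r1 hF hr.
have [g1 g2] := integral_gaus_seg l0 A0.
have g3 := integral_lin_gaus c0 A0.
have mlin D : measurable_fun D (fun t : R => (2 * (1 - t / A))%:E).
  apply/measurable_EFinP; apply: measurable_funM => //; apply: measurable_funB => //.
  exact: measurable_funM.
have mte D : measurable_fun D (fun t : R => (C * (t * expR (- (c * t ^+ 2))))%:E).
  apply/measurable_EFinP; apply: measurable_funM => //; apply: measurable_funM => //.
  by apply: measurable_funTS; apply: continuous_measurable_fun; exact: continuous_expN_sqr.
have mF : measurable_fun `[0, A] (fun t : R => (2 * (1 - t / A) * (1 + r t))%:E).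
  apply/measurable_EFinP; apply: measurable_funM; first by apply/measurable_EFinP; exact: mlin.
  exact: measurable_funD.
have lin0 t : t \in `[0, A] -> 0 <= 2 * (1 - t / A).
  by rewrite in_itv /= => /andP[_ tA]; rewrite mulr_ge0// subr_ge0 ler_pdivrMr// mul1r.
have te0 t : t \in `[0, A] -> 0 <= C * (t * expR (- (c * t ^+ 2))).
  by rewrite in_itv /= => /andP[t0 _]; rewrite mulr_ge0// mulr_ge0// expR_ge0.
have ilin : (\int[mu]_(t in `[0%R, A]) (2 * (1 - t / A))%:E = A%:E)%E.
  have dF (t : R) : is_derive t 1 (fun t => 2 * t - t ^+ 2 / A) (2 * (1 - t / A)).
    by apply: is_derive_eq; rewrite ?scaler0 /GRing.scale /=; field; rewrite gt_eqF.
  rewrite (integral_seg_primitive A0 dF).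
    by congr EFin; field; rewrite gt_eqF.
  move=> t; apply: cvgM; first exact: cvg_cst.
  by apply: cvgB; [exact: cvg_cst|apply: cvgM; [exact: cvg_id|exact: cvg_cst]].
have ite : (\int[mu]_(t in `[0%R, A]) (C * (t * expR (- (c * t ^+ 2))))%:E <= (C / (2 * c))%:E)%E.
  under eq_integral do rewrite EFinM.
  rewrite ge0_integralZl ?lee_fin//.
  - by rewrite -[C / _]mulr1 mulrAC -mulrA EFinM; apply: lee_wpmul2l; rewrite ?lee_fin.
  - apply/measurable_EFinP; apply: measurable_funM => //.
    by apply: measurable_funTS; apply: continuous_measurable_fun; exact: continuous_expN_sqr.
  - by move=> t /=; rewrite in_itv /= => /andP[t0 _]; rewrite lee_fin mulr_ge0// expR_ge0.
have m2 : measurable_fun `[0, A] (fun t => (2 * (1 - t / A))%:E + (gaus lam t)%:E)%E.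
  by apply: emeasurable_funD; [exact: mlin|exact: measurable_gaus].
have Afin : A%:E \is a fin_num by [].
split.
- rewrite -(@leeD2lE _ A%:E)// hF.
  apply: (@le_trans _ _ (\int[mu]_(t in `[0%R, A]) ((2 * (1 - t / A))%:E +
     ((gaus lam t)%:E + (C * (t * expR (- (c * t ^+ 2))))%:E)))%E).
    apply: ge0_le_integral; [by []|by move=> t tA; rewrite lee_fin mulr_ge0// lin0|exact: mF|
      apply: emeasurable_funD; [exact: mlin|]|].
      by apply: emeasurable_funD; [exact: measurable_gaus|exact: mte].
    move=> t /=; rewrite in_itv /= => /andP[t0 tA]; have := hr t t0 tA.
      rewrite ler_norml -!EFinD lee_fin => /andP[_]; lra.
  rewrite ge0_integralD; [|by []|by move=> t tA; rewrite lee_fin lin0|exact: mlin|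
    by move=> t tA; rewrite -EFinD lee_fin addr_ge0 ?gaus_ge0// te0|
    by apply: emeasurable_funD; [exact: measurable_gaus|exact: mte]].
  rewrite ilin leeD2l// ge0_integralD; [|by []|by move=> t _; rewrite lee_fin gaus_ge0|
    exact: measurable_gaus|by move=> t tA; rewrite lee_fin te0|exact: mte].
  by rewrite EFinD leeD.
(* The lower bound is rearranged into an inequality between sums before integrating, again to keep
   integrands nonnegative. *)
- suff : (A%:E + (Num.sqrt (2 * pi / lam))%:E <=
     A%:E + fejconv J A y + (C / (2 * c))%:E + (2 / (lam * A))%:E)%E.
    rewrite -!addeA leeD2lE// addeA -!EFinD => h.
    by rewrite -addrA -opprD EFinB leeBlDr// addeC; move: h; rewrite -addeA -EFinD addeC.
  apply: (@le_trans _ _ (A%:E + (\int[mu]_(t in `[0%R, A]) (gaus lam t)%:E + (2 / (lam * A))%:E))%E).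
    by rewrite leeD2l.
  rewrite addeA leeD2r//.
  rewrite -{1}ilin -ge0_integralD; [|by []|by move=> t tA; rewrite lee_fin lin0|exact: mlin|
    by move=> t _; rewrite lee_fin gaus_ge0|exact: measurable_gaus].
  apply: (@le_trans _ _ (\int[mu]_(t in `[0%R, A]) ((2 * (1 - t / A) * (1 + r t))%:E +
     (C * (t * expR (- (c * t ^+ 2))))%:E))%E).
    apply: ge0_le_integral; [by []|
      by move=> t tA; rewrite -EFinD lee_fin addr_ge0 ?gaus_ge0// lin0|exact: m2|
      by apply: emeasurable_funD; [exact: mF|exact: mte]|].
    move=> t /=; rewrite in_itv /= => /andP[t0 tA]; have := hr t t0 tA.
      rewrite ler_norml -!EFinD lee_fin => /andP[+ _]; lra.
  rewrite ge0_integralD; [|by []|by move=> t tA; rewrite lee_fin mulr_ge0// lin0|exact: mF|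
    by move=> t tA; rewrite lee_fin te0|exact: mte].
  by rewrite hF leeD2l.
Qed.

End kernel_estimate.

(** * The tilted density and its Fourier transform *)

Section tilted_distribution.
Context d (T : measurableType d) (R : realType) (P : probability T R).
Local Notation C := (complex R).
Local Notation mu := (@lebesgue_measure R).
Variable V : T -> R.
Hypothesis mV : measurable_fun setT V.
Hypothesis V0 : forall w, 0 <= V w.
Variables u b : R.
Hypothesis u0 : 0 < u.
Implicit Types (s t y : R).

Local Notation l := (lapR P V u).

Let l0 : 0 < l. Proof. exact: (lapR_gt0 P mV V0 (ltW u0)). Qed.

Definition tilt s w : R := if u * V w < b + s then expR (- (b + s)) / l else 0.

(** Under the law of V tilted by e^{-u V}, this is the density at s of u V - b plus an independent
    standard exponential variable. At s = 0 it contains P(u V < b), and e^s times it is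
    nondecreasing. *)
Definition tiltJ s : R := Ex P (tilt s).

Lemma tilt_ge0 s w : 0 <= tilt s w.
Proof. by rewrite /tilt; case: ifP => // _; rewrite divr_ge0 ?expR_ge0// ltW. Qed.

Lemma measurable_tilt : measurable_fun setT (fun z : R * T => tilt z.1 z.2).
Proof.
have m1 : measurable_fun setT (fun z : R * T => b + z.1).
  by apply: measurable_funD => //; exact: measurable_fst.
apply: measurable_fun_ifT => //.
- apply: measurable_fun_ltr => //; apply: measurable_funM => //.
  by apply: measurableT_comp => //; exact: measurable_snd.
- apply: measurable_funM => //; apply: measurableT_comp => //.
  exact: measurableT_comp.
Qed.

Let A s := [set w | u * V w < b + s].

Let mA s : measurable (A s).
Proof.
have := @measurable_fun_ltr _ _ R setT (fun w => u * V w) (fun=> b + s).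
move=> h; have := h (measurable_funM (measurable_cst _) mV) (measurable_cst _) measurableT [set true].
by move=> /(_ I); rewrite setTI; congr measurable; apply/seteqP; split.
Qed.

Let tilt_indic s w : tilt s w = expR (- (b + s)) / l * \1_(A s) w.
Proof.
rewrite /tilt indicE; case: ifP => h.
  by rewrite mem_set// mulr1.
by rewrite memNset ?mulr0// /A /= h.
Qed.

Lemma tiltJE s : tiltJ s = expR (- (b + s)) / l * fine (P [set w | u * V w < b + s]).
Proof.
rewrite -Ex_indic; last exact: mA.
rewrite -ExZ; last by apply: itg_indic; exact: mA.
by apply: eq_Ex => w; exact: tilt_indic.
Qed.

Lemma tiltJ_ge0 s : 0 <= tiltJ s.
Proof. by apply: Ex_ge0 => w; exact: tilt_ge0. Qed.

Let tiltJ_int s : (tiltJ s)%:E = (\int[P]_w (tilt s w)%:E)%E.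
Proof.
rewrite /tiltJ /Ex /Rintegral fineK//; apply: integrable_fin_num => //.
have : itg P (fun w => expR (- (b + s)) / l * \1_(A s) w).
  by apply: itgZ; apply: itg_indic; exact: mA.
by congr (itg P _); apply/funext => w; rewrite tilt_indic.
Qed.

Lemma measurable_tiltJ : measurable_fun setT tiltJ.
Proof.
apply/measurable_EFinP.
have h := @measurable_fun_fubini_tonelli_F _ _ R T R P
  (fun z : R * T => (tilt z.1 z.2)%:E).
have -> : EFin \o tiltJ = fubini_F P (fun z : R * T => (tilt z.1 z.2)%:E).
  by apply/funext => s /=; rewrite tiltJ_int.
apply: h; first by apply/measurable_EFinP; exact: measurable_tilt.
by move=> z; rewrite lee_fin tilt_ge0.
Qed.

Lemma tiltJ_mono s s' : s <= s' -> tiltJ s <= expR (s' - s) * tiltJ s'.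
Proof.
move=> ss'; rewrite !tiltJE mulrA mulrA -expRD.
have -> : s' - s - (b + s') = - (b + s) by ring.
rewrite ler_wpM2l ?divr_ge0 ?expR_ge0 ?(ltW l0)//.
rewrite fine_le ?fin_num_measure//; [exact: mA|exact: mA|].
apply: le_measure; rewrite ?inE; [exact: mA|exact: mA|].
by move=> w /= /lt_le_trans; apply; rewrite lerD2l.
Qed.

(* the Fourier transform at [t] of [tiltJ], shifted by [y] *)
Definition tiltF y t : C := cexpN (Complex 0 (- (t * (y + b)))) * (lap P V (ray u t) / Cx l) /
  Complex 1 t.

Let den t : Complex 1 t != 0 :> C.
Proof. by rewrite eq_complex /= oner_eq0. Qed.

Let exp_ray_integral t y x :
  (\int[mu]_(s in `[x, +oo[) (expR (- s) * (1 + cos (t * (s - y))))%:E =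
   (expR (- x) * (1 + (cos (t * (x - y)) - t * sin (t * (x - y))) / (1 + t ^+ 2)))%:E)%E.
Proof.
pose F s := - (expR (- s) * (1 + (cos (t * (s - y)) - t * sin (t * (s - y))) / (1 + t ^+ 2))).
have t2 : 0 < 1 + t ^+ 2 by rewrite ltr_pwDl// sqr_ge0.
have -> : expR (- x) * (1 + (cos (t * (x - y)) - t * sin (t * (x - y))) / (1 + t ^+ 2)) = 0 - F x.
  by rewrite /F opprK add0r.
apply: (@integral_ray_primitive _ F (fun s => expR (- s) * (1 + cos (t * (s - y)))) x 0).
- move=> s _; apply: is_derive_eq; rewrite ?scaler0 /GRing.scale /=; field.
  by rewrite gt_eqF.
- move=> s _; apply: cvgM.
    apply: (@cvg_comp _ _ _ (fun s => - s) expR); last exact: continuous_expR.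
    by apply: cvgN; exact: cvg_id.
  apply: cvgD; first exact: cvg_cst.
  apply: (@cvg_comp _ _ _ (fun s => t * (s - y)) cos); last exact: continuous_cos.
  by apply: cvgM; [exact: cvg_cst|apply: cvgB; [exact: cvg_id|exact: cvg_cst]].
- move=> s _; rewrite mulr_ge0 ?expR_ge0//; have := cos_geN1 (t * (s - y)); lra.
- have bd (s : R) : `|F s| <= expR (- s) * (2 + `|t|).
    rewrite normrN normrM ger0_norm ?expR_ge0// ler_wpM2l ?expR_ge0//.
    apply: (le_trans (ler_normD _ _)); rewrite normr1.
    suff : `|(cos (t * (s - y)) - t * sin (t * (s - y))) / (1 + t ^+ 2)| <= 1 + `|t| by lra.
    rewrite normrM normfV [X in _ / X]gtr0_norm//.
    apply: (@le_trans _ _ `|cos (t * (s - y)) - t * sin (t * (s - y))|).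
      rewrite ler_pdivrMr// ler_peMr//; have := sqr_ge0 t; lra.
    apply: (le_trans (ler_normB _ _)); rewrite normrM lerD ?cos_max//.
    by rewrite ler_piMr ?sin_max.
  apply/cvgr0Pnorm_le => e e0.
  have : (expR (- s) * (2 + `|t|)) @[s --> +oo] --> (0 : R).
    by rewrite -(mul0r (2 + `|t|)); apply: cvgM; [exact: cvgr_expR|exact: cvg_cst].
  move=> /cvgr0Pnorm_le /(_ e e0); apply: filterS => s; apply: le_trans.
  by apply: (le_trans (bd s)); exact: ler_norm.
Qed.

Let ReF y t w : Re (cexpN (Complex 0 (- (t * (y + b)))) * cexpN (ray u t * Cx (V w)) / Complex 1 t) =
  expR (- (u * V w)) * ((cos (t * (u * V w - b - y)) - t * sin (t * (u * V w - b - y))) / (1 + t ^+ 2)).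
Proof.
rewrite -cexpND; set th := t * (u * V w - b - y).
have -> : Complex 0 (- (t * (y + b))) + ray u t * Cx (V w) = Complex (u * V w) th.
  by apply/eqP; rewrite eq_complex; apply/andP; split; apply/eqP; rewrite /th /=; ring.
rewrite /cexpN /= expr1n.
have tn0 : 1 + t ^+ 2 != 0 by rewrite gt_eqF// ltr_pwDl// sqr_ge0.
by field.
Qed.

(** Tonelli: for fixed w the integral over s runs from u V - b to infinity and is elementary. The
    convolution with the exponential law appears as the denominator 1 + i t. *)
Lemma tiltJ_fourier y t : (\int[mu]_s (tiltJ s * (1 + cos (t * (s - y))))%:E =
  (1 + Re (tiltF y t))%:E)%E.
Proof.
have c0 s : 0 <= 1 + cos (t * (s - y)) by have := cos_geN1 (t * (s - y)); lra.
have mc : measurable_fun setT (fun s : R => 1 + cos (t * (s - y))).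
  apply: measurable_funD => //; apply: measurableT_comp.
    by apply: continuous_measurable_fun; exact: continuous_cos.
  by apply: measurable_funM => //; exact: measurable_funB.
have mts s : measurable_fun setT (fun w => (tilt s w)%:E).
  apply/measurable_EFinP; have -> : tilt s = (fun w => expR (- (b + s)) / l * \1_(A s) w).
    by apply/funext => w; exact: tilt_indic.
  by apply: measurable_funM => //; apply: measurable_indic; exact: mA.
transitivity (\int[mu]_s \int[P]_w (tilt s w * (1 + cos (t * (s - y))))%:E)%E.
  apply: eq_integral => s _; rewrite EFinM tiltJ_int -ge0_integralZr; [by []|by []|exact: mts|
    by move=> w _; rewrite lee_fin tilt_ge0|by rewrite lee_fin].
transitivity (\int[P]_w \int[mu]_s (tilt s w * (1 + cos (t * (s - y))))%:E)%E.
  have := fubini_tonelli (m1 := mu) (m2 := P)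
    (fun z : R * T => (tilt z.1 z.2 * (1 + cos (t * (z.1 - y))))%:E).
  apply; last by move=> z; rewrite lee_fin mulr_ge0// tilt_ge0.
  apply/measurable_EFinP; apply: measurable_funM; first exact: measurable_tilt.
  exact: (measurableT_comp mc measurable_fst).
pose H w := expR (- (u * V w)) / l *
   (1 + (cos (t * (u * V w - b - y)) - t * sin (t * (u * V w - b - y))) / (1 + t ^+ 2)).
transitivity (\int[P]_w (H w)%:E)%E.
  apply: eq_integral => w _ /=.
  transitivity (\int[mu]_(s in `](u * V w - b)%R, +oo[) ((expR (- b) / l)%:E * (expR (- s) * (1 + cos (t * (s - y))))%:E))%E.
    rewrite [RHS]integral_mkcond; apply: eq_integral => s _; rewrite patchE /tilt.
    rewrite mem_setE in_itv /= andbT ltrBlDl; case: ifP => _; last by rewrite mul0r.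
    by rewrite -EFinM opprD expRD; congr EFin; ring.
  have me D : measurable_fun D (fun s : R => (expR (- s) * (1 + cos (t * (s - y))))%:E).
    apply/measurable_EFinP; apply: measurable_funTS; apply: measurable_funM => //.
    exact: measurableT_comp.
  rewrite ge0_integralZl; [|by []|exact: me|
    by move=> s _; rewrite lee_fin mulr_ge0// expR_ge0|
    by rewrite lee_fin divr_ge0 ?expR_ge0// ltW].
  rewrite integral_itv_obnd_cbnd; last exact: me.
  rewrite exp_ray_integral -EFinM /H; congr EFin.
  have -> : expR (- (u * V w)) = expR (- b) * expR (- (u * V w - b)) by rewrite -expRD; congr expR; ring.
  by ring.
pose G w : C := cexpN (Complex 0 (- (t * (y + b)))) / Cx l / Complex 1 t * cexpN (ray u t * Cx (V w)).
have iG : citg P G by apply: citgZ; exact: (citg_cexpN P mV V0 (ltW u0 : 0 <= Re (ray u t))).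
have iE : itg P (fun w => l^-1 * expR (- (u * V w))).
  by apply: itgZ; exact: (itg_expNV P mV V0 (ltW u0)).
have HE w : H w = l^-1 * expR (- (u * V w)) + Re (G w).
  have -> : G w = Cx l^-1 * (cexpN (Complex 0 (- (t * (y + b)))) * cexpN (ray u t * Cx (V w)) / Complex 1 t).
    by rewrite /G CxV; ring.
  by rewrite ReZ ReF /H; ring.
have iH : itg P H.
  have := itgD iE (proj1 iG); congr (itg P _); apply/funext => w; rewrite HE//.
transitivity (Ex P H)%:E.
  by rewrite /Ex /Rintegral fineK//; exact: integrable_fin_num.
congr EFin; under eq_Ex do rewrite HE.
rewrite ExD//; last exact: (proj1 iG).
rewrite ExZ; last exact: (itg_expNV P mV V0 (ltW u0)).
rewrite -/(lapR P V u) mulVf ?gt_eqF//; congr (_ + _).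
transitivity (Re (CE P G)) => //; congr (Re _).
rewrite CEZ; last exact: (citg_cexpN P mV V0 (ltW u0 : 0 <= Re (ray u t))).
by rewrite -/(lap P V (ray u t)) /tiltF; ring.
Qed.

Let F0 y : Re (tiltF y 0) = 1.
Proof.
rewrite /tiltF mul0r oppr0 (_ : Complex 0 0 = 0)// cexpN0.
have -> : ray u 0 = Cx u by rewrite /ray mulr0.
by rewrite lap_Cx -CxV -CxM divff ?gt_eqF// (_ : Complex 1 0 = 1)// divr1 mulr1.
Qed.

Lemma tiltJ_total : (\int[mu]_s (tiltJ s)%:E = 1)%E.
Proof.
have := tiltJ_fourier 0 0; rewrite F0.
under eq_integral do rewrite mul0r cos0 mulrC EFinM.
rewrite ge0_integralZl; [|by []|by apply/measurable_EFinP; exact: measurable_tiltJ|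
  by move=> s _; rewrite lee_fin tiltJ_ge0|by rewrite lee_fin addr_ge0].
move=> h; have : ((1 + 1)^-1%:E * ((1 + 1)%:E * \int[mu]_s (tiltJ s)%:E) = (1 + 1)^-1%:E * (1 + 1)%:E)%E.
  by rewrite h.
rewrite muleA -!EFinM mulVf ?mul1e// gt_eqF//; lra.
Qed.

(** Measurability in t is read off from [tiltJ_fourier], as an integral depending on a parameter. *)
Lemma measurable_tiltF y : measurable_fun setT (fun t => Re (tiltF y t)).
Proof.
have c0 (z : R * R) : 0 <= 1 + cos (z.1 * (z.2 - y)) by have := cos_geN1 (z.1 * (z.2 - y)); lra.
have h := measurable_fun_fubini_tonelli_F (m2 := mu)
  (fun z : R * R => (tiltJ z.2 * (1 + cos (z.1 * (z.2 - y))))%:E).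
have {}h : measurable_fun setT (fun t => (1 + Re (tiltF y t))%:E).
  have -> : (fun t => (1 + Re (tiltF y t))%:E) =
     fubini_F mu (fun z : R * R => (tiltJ z.2 * (1 + cos (z.1 * (z.2 - y))))%:E).
    by apply/funext => t; rewrite -tiltJ_fourier.
  apply: h; last by move=> z; rewrite lee_fin mulr_ge0// tiltJ_ge0.
  apply/measurable_EFinP; apply: measurable_funM.
    exact: (measurableT_comp measurable_tiltJ measurable_snd).
  apply: measurable_funD => //; apply: measurableT_comp.
    by apply: continuous_measurable_fun; exact: continuous_cos.
  apply: measurable_funM; first exact: measurable_fst.
  by apply: measurable_funB => //; exact: measurable_snd.
move/measurable_EFinP : h => h.
have -> : (fun t => Re (tiltF y t)) = (fun t => (1 + Re (tiltF y t)) - 1).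
  by apply/funext => t; ring.
exact: measurable_funB.
Qed.

Lemma tiltF_geN1 y t : 0 <= 1 + Re (tiltF y t).
Proof.
rewrite -lee_fin -tiltJ_fourier; apply: integral_ge0 => s _.
by rewrite lee_fin mulr_ge0 ?tiltJ_ge0//; have := cos_geN1 (t * (s - y)); lra.
Qed.

(** Integrates [fejA_fourier] against the density [tiltJ] and exchanges; the total mass 1 turns the
    first summand into K. *)
Lemma tiltJ_fejconv K y : 0 < K -> (K%:E + fejconv tiltJ K y =
  \int[mu]_(t in `[0%R, K]) (2 * (1 - t / K) * (1 + Re (tiltF y t)))%:E)%E.
Proof.
move=> K0.
have mJ := measurable_tiltJ.
have k0 t : 0 <= t <= K -> 0 <= 2 * (1 - t / K).
  by move=> /andP[_ tA]; rewrite mulr_ge0// subr_ge0 ler_pdivrMr// mul1r.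
have c0 t s : 0 <= 1 + cos (t * (s - y)) by have := cos_geN1 (t * (s - y)); lra.
pose D : set R := `[0, K]%classic.
pose q (z : R * R) : R := tiltJ z.1 * (2 * (1 - z.2 / K) * (1 + cos (z.2 * (z.1 - y)))) * \1_D z.2.
have q0 z : 0 <= q z.
  rewrite /q indicE; case: (boolP (z.2 \in D)) => h; last by rewrite mulr0.
  rewrite mulr1; apply: mulr_ge0; first exact: tiltJ_ge0.
  by apply: mulr_ge0 (c0 _ _); apply: k0; move: h; rewrite mem_setE in_itv.
have mq : measurable_fun setT (fun z => (q z)%:E).
  apply/measurable_EFinP; apply: measurable_funM; last first.
    exact: (measurableT_comp (measurable_indic (measurable_itv _)) measurable_snd).
  apply: measurable_funM; first exact: (measurableT_comp mJ measurable_fst).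
  apply: measurable_funM.
    apply: measurable_funM => //; apply: measurable_funB => //; exact: measurable_funM.
  apply: measurable_funD => //; apply: measurableT_comp.
    by apply: continuous_measurable_fun; exact: continuous_cos.
  apply: measurable_funM; first exact: measurable_snd.
  by apply: measurable_funB => //; exact: measurable_fst.
have indicI (f : R -> R) : (\int[mu]_t (f t * \1_D t)%:E = \int[mu]_(t in D) (f t)%:E)%E.
  rewrite [RHS]integral_mkcond; apply: eq_integral => t _; rewrite patchE indicE.
  by case: ifP => _; rewrite ?mulr1 ?mulr0.
transitivity (\int[mu]_s \int[mu]_t (q (s, t))%:E)%E.
  have -> : K%:E = (\int[mu]_s (K * tiltJ s)%:E)%E.
    under eq_integral do rewrite EFinM.
    rewrite ge0_integralZl; [by rewrite tiltJ_total mule1|by []|exact/measurable_EFinP|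
      by move=> s _; rewrite lee_fin tiltJ_ge0|by rewrite lee_fin ltW].
  rewrite /fejconv -ge0_integralD.
  - apply: eq_integral => s _; rewrite /q /=.
    rewrite (indicI (fun t => tiltJ s * (2 * (1 - t / K) * (1 + cos (t * (s - y)))))).
    under eq_integral do rewrite EFinM.
    rewrite ge0_integralZl.
    + by rewrite fejA_fourier// -EFinM -EFinD; congr EFin; ring.
    + exact: measurable_itv.
    + apply/measurable_EFinP; apply: measurable_funTS; apply: measurable_funM.
        by apply: measurable_funM => //; apply: measurable_funB => //; exact: measurable_funM.
      apply: measurable_funD => //; apply: measurableT_comp.
        by apply: continuous_measurable_fun; exact: continuous_cos.
      exact: measurable_funM.
    + by move=> t; rewrite /D /= in_itv /= => h; rewrite lee_fin; exact: mulr_ge0 (k0 _ h) (c0 _ _).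
    + by rewrite lee_fin tiltJ_ge0.
  - by [].
  - by move=> s _; rewrite lee_fin; exact: mulr_ge0 (ltW K0) (tiltJ_ge0 s).
  - by apply/measurable_EFinP; exact: measurable_funM.
  - by move=> s _; rewrite lee_fin; exact: mulr_ge0 (tiltJ_ge0 s) (fejA_ge0 _ (ltW K0)).
  - apply/measurable_EFinP; apply: measurable_funM => //; exact: measurable_fejA.
transitivity (\int[mu]_t \int[mu]_s (q (s, t))%:E)%E.
  exact: (fubini_tonelli (m1 := mu) (m2 := mu) (fun z => (q z)%:E)).
rewrite -(indicI (fun t => 2 * (1 - t / K) * (1 + Re (tiltF y t)))).
apply: eq_integral => t _; rewrite /q /= indicE.
case: (boolP (t \in D)) => h; last first.
  by under eq_integral do rewrite mulr0; rewrite integral0 mulr0.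
rewrite mulr1 EFinM -tiltJ_fourier.
rewrite -ge0_integralZl.
- by apply: eq_integral => s _; rewrite -EFinM mulr1; congr EFin; ring.
- exact: measurableT.
- apply/measurable_EFinP; apply: measurable_funM => //.
  apply: measurable_funD => //; apply: measurableT_comp.
    by apply: continuous_measurable_fun; exact: continuous_cos.
  by apply: measurable_funM => //; exact: measurable_funB.
- by move=> s _; rewrite lee_fin; exact: mulr_ge0 (tiltJ_ge0 s) (c0 _ _).
- by rewrite lee_fin k0//; move: h; rewrite mem_setE in_itv.
Qed.

End tilted_distribution.

(** * A one-sided kernel bound and the removal of the smoothing *)

Section kernel_upper_estimate.
Context {R : realType}.
Local Notation mu := (@lebesgue_measure R).

(** Uses a one-sided bound on the transform and nothing about its phase, so it applies with the same
    right-hand side for every center y. *)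
Lemma fejconv_le_gaus (J r : R -> R) (A y lam : R) : 0 < A -> 0 < lam ->
  measurable_fun `[0, A] r -> (forall t, 0 <= 1 + r t) ->
  (A%:E + fejconv J A y = \int[mu]_(t in `[0%R, A]) (2 * (1 - t / A) * (1 + r t))%:E)%E ->
  (forall t, 0 <= t -> t <= A -> 2 * (1 - t / A) * r t <= gaus lam t) ->
  (fejconv J A y <= (Num.sqrt (2 * pi / lam))%:E)%E.
Proof.
move=> A0 l0 mr r1 hF hr.
have [g1 _] := integral_gaus_seg l0 A0.
have mlin D : measurable_fun D (fun t : R => (2 * (1 - t / A))%:E).
  apply/measurable_EFinP; apply: measurable_funM => //; apply: measurable_funB => //.
  exact: measurable_funM.
have mF : measurable_fun `[0, A] (fun t : R => (2 * (1 - t / A) * (1 + r t))%:E).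
  apply/measurable_EFinP; apply: measurable_funM; first by apply/measurable_EFinP; exact: mlin.
  exact: measurable_funD.
have lin0 t : t \in `[0, A] -> 0 <= 2 * (1 - t / A).
  by rewrite in_itv /= => /andP[_ tA]; rewrite mulr_ge0// subr_ge0 ler_pdivrMr// mul1r.
have ilin : (\int[mu]_(t in `[0%R, A]) (2 * (1 - t / A))%:E = A%:E)%E.
  have dF (t : R) : is_derive t 1 (fun t => 2 * t - t ^+ 2 / A) (2 * (1 - t / A)).
    by apply: is_derive_eq; rewrite ?scaler0 /GRing.scale /=; field; rewrite gt_eqF.
  rewrite (integral_seg_primitive A0 dF).
    by congr EFin; field; rewrite gt_eqF.
  move=> t; apply: cvgM; first exact: cvg_cst.
  by apply: cvgB; [exact: cvg_cst|apply: cvgM; [exact: cvg_id|exact: cvg_cst]].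
have m2 : measurable_fun `[0, A] (fun t => (2 * (1 - t / A))%:E + (gaus lam t)%:E)%E.
  by apply: emeasurable_funD; [exact: mlin|exact: measurable_gaus].
rewrite -(@leeD2lE _ A%:E)// hF.
apply: (@le_trans _ _ (\int[mu]_(t in `[0%R, A]) ((2 * (1 - t / A))%:E + (gaus lam t)%:E))%E).
  apply: ge0_le_integral; [by []|by move=> t tA; rewrite lee_fin mulr_ge0// lin0|exact: mF|
    exact: m2|].
  move=> t /=; rewrite in_itv /= => /andP[t0 tA]; have := hr t t0 tA.
  rewrite -EFinD lee_fin; lra.
rewrite ge0_integralD; [|by []|by move=> t tA; rewrite lee_fin lin0|exact: mlin|
  by move=> t _; rewrite lee_fin gaus_ge0|exact: measurable_gaus].
by rewrite ilin leeD2l.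
Qed.

(* [X N] is squeezed around [q] up to errors controlled by the smoothing width [delta] *)
Lemma squeeze_delta (X N q S E1 E2 delta : R) : 0 <= X -> X <= S -> 0 < N ->
  0 <= delta -> delta <= 1 / 2 ->
  expR (- delta) * X * (N - delta) <= q + E1 ->
  q - E2 <= expR delta * X * N + S * delta -> 0 <= E1 -> 0 <= E2 ->
  `|X * N - q| <= E1 + E2 + delta * (S + 2 * S * N).
Proof.
move=> X0 XS N0 d0 d2 h1 h2 E10 E20.
have S0 : 0 <= S by exact: le_trans XS.
have e1 : 1 - delta <= expR (- delta) by exact: expR_ge1Dx.
have eN1 : expR (- delta) <= 1 by rewrite expR_le1 oppr_le0.
have e2 : expR delta * (1 - delta) <= 1.
  apply: (@le_trans _ _ (expR delta * expR (- delta))); last by rewrite expRxMexpNx_1.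
  by rewrite ler_wpM2l ?expR_ge0.
have ep : 0 < expR delta := expR_gt0 _.
have e3 : expR delta <= 2.
  have : expR delta * (1 / 2) <= expR delta * (1 - delta) by rewrite ler_wpM2l ?(ltW ep)//; lra.
  lra.
have e4 : expR delta <= 1 + 2 * delta.
  have : expR delta * delta <= 2 * delta by rewrite ler_wpM2r.
  rewrite mulrBr in e2; lra.
have XN0 : 0 <= X * N by rewrite mulr_ge0// ltW.
have XN : X * N <= S * N by rewrite ler_wpM2r// ltW.
have Xd : X * delta <= S * delta by rewrite ler_wpM2r.
have dXN : delta * (X * N) <= delta * (S * N) by rewrite ler_wpM2l.
have SN0 : 0 <= delta * (S * N) by rewrite !mulr_ge0// ltW.
have SD0 : 0 <= S * delta by rewrite mulr_ge0.
rewrite ler_norml; apply/andP; split.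
- have : expR delta * (X * N) <= (1 + 2 * delta) * (X * N) by rewrite ler_wpM2r.
  lra.
- have k1 : (1 - delta) * (X * N) <= expR (- delta) * (X * N) by rewrite ler_wpM2r.
  have k2 : expR (- delta) * (X * delta) <= X * delta by rewrite ler_piMl// mulr_ge0.
  lra.
Qed.

End kernel_upper_estimate.

(** * Fejer means of the tilted density at scale a^m v *)

Section local_limit.
Context d (T : measurableType d) (R : realType) (P : probability T R).
Local Notation C := (complex R).
Variables (X : {RV P >-> nat}) (HX : offspring_law X).
Variables (Y : {RV P >-> nat}) (nu : nat).
Hypothesis Y_ge1 : forall w, (1 <= Y w)%N.
Hypothesis q_nu : 0 < mass Y nu.
Hypothesis nu_min : forall i : nat, 0 < mass Y i -> (nu <= i)%N.
Variables (Xs : nat -> nat -> {RV P >-> nat}) (Ys : nat -> {RV P >-> nat}).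
Hypothesis Xs_law : forall n i, same_law (Xs n i) X.
Hypothesis Ys_law : forall j, same_law (Ys j) Y.
Hypothesis indep : mutually_independent P (joint_family Xs Ys).
Local Notation a := (offmean X).
Variable V : T -> R.
Hypothesis mV : measurable_fun setT V.
Hypothesis V0 : forall w, 0 <= V w.
Hypothesis V_lim : {ae P, forall w,
    (gwi Xs Ys n w)%:R / a ^+ n @[n --> \oo] --> V w}.
Implicit Types (v t x y : R) (m : nat).

Let X1 := offspring_ge1 HX.
Let Xnd := offspring_nondeg HX.
Let Xlog := offspring_XlogX HX.
Let a1 : 1 < a := offmean_gt1 X1 Xnd Xlog.
Let a0 : 0 < a := offmean_gt0 X1 Xnd Xlog.
Let aX n : 0 < a ^+ n. Proof. exact: exprn_gt0. Qed.

(** The part of the transform that does not depend on m: the normalized transform at scale v, the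
    denominator 1 + i t and a bounded shift of the center. It is 1 + O(|t|). *)
Let Phi v y t : C := cexpN (Complex 0 (- (t * y))) * (lap P V (ray v t) / Cx (lapR P V v)) /
  Complex 1 t.

Let den_ge1 t : 1 <= normc (Complex 1 t).
Proof.
rewrite -(ler_pXn2r (n := 2))// ?nnegrE ?normc_ge0//.
by rewrite normc_sqr /= expr1n lerDl sqr_ge0.
Qed.

Let den0 t : Complex 1 t != 0 :> C.
Proof. by rewrite eq_complex /= oner_eq0. Qed.

Let lap1 v t : 0 < v -> normc (lap P V (ray v t) / Cx (lapR P V v)) <= 1.
Proof.
move=> v0; have l0 := lapR_gt0 P mV V0 (ltW v0).
rewrite normcM normcV normc_Cx gtr0_norm// ler_pdivrMr// mul1r.
exact: (normc_lap_le P mV V0 (ltW v0 : 0 <= Re (ray v t))).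
Qed.

Let inv1 t : normc (Complex 1 t)^-1 <= 1.
Proof. by rewrite normcV invf_le1 ?den_ge1// (lt_le_trans ltr01). Qed.

Let nexp t : normc (cexpN (Complex 0 t)) = 1.
Proof. by rewrite normc_cexpN /= oppr0 expR0. Qed.

Let Phi1 v y t : 0 < v -> normc (Phi v y t) <= 1.
Proof.
move=> v0; rewrite normcM normcM nexp mul1r -[leRHS]mul1r ler_pM ?normc_ge0//; exact: lap1.
Qed.

Let Phi_dev v vmax y t : 0 < v -> v <= vmax ->
  normc (Phi v y t - 1) <= (`|y| + (lapR P V vmax)^-1 + 1) * `|t|.
Proof.
move=> v0 vM; have l0 := lapR_gt0 P mV V0 (ltW v0).
have lM := lapR_gt0 P mV V0 (le_trans (ltW v0) vM).
set e := cexpN (Complex 0 (- (t * y))); set q := lap P V (ray v t) / Cx (lapR P V v).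
set i := (Complex 1 t)^-1.
have -> : Phi v y t - 1 = (e - 1) * (q * i) + (q - 1) * i + (i - 1).
  by rewrite /Phi -/e -/q -/i; ring.
have n1 : normc (e - 1) <= `|y| * `|t|.
  by apply: (le_trans (cexpN_imB1 _)); rewrite normrN normrM mulrC.
have n2 : normc (q - 1) <= (lapR P V vmax)^-1 * `|t|.
  have -> : q - 1 = (lap P V (ray v t) - Cx (lapR P V v)) / Cx (lapR P V v).
    by rewrite /q; field; rewrite Cx_eq0 gt_eqF.
  rewrite normcM normcV normc_Cx gtr0_norm// ler_pdivrMr//.
  apply: (le_trans (lap_ray P mV V0 t v0)); rewrite mulrAC ler_wpM2r//.
  rewrite [leRHS]mulrC ler_pdivlMr// [leLHS]mulrC.
  have h1 := lapR_le P mV V0 (ltW v0) vM.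
  have v2 : 0 <= v / 2 by rewrite divr_ge0// ltW.
  have h2 := lapR_le1 P mV V0 v2.
  have h3 : lapR P V vmax * lapR P V (v / 2) <= lapR P V vmax by rewrite ler_piMr// ltW.
  exact: le_trans h3 h1.
have n3 : normc (i - 1) <= `|t|.
  have -> : i - 1 = - (Complex 0 t * i).
    have -> : Complex 0 t = Complex 1 t - 1 :> C.
      by apply/eqP; rewrite eq_complex /= subrr oppr0 addr0 !eqxx.
    by rewrite /i; field.
  rewrite normcN normcM /= expr0n add0r sqrtr_sqr ler_piMr//; exact: inv1.
have q1 : normc q <= 1 by exact: lap1.
have i1 : normc i <= 1 by exact: inv1.
have qi : normc (q * i) <= 1 by rewrite normcM -[leRHS]mul1r ler_pM ?normc_ge0.
have k1 : normc ((e - 1) * (q * i)) <= `|y| * `|t|.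
  by rewrite normcM; apply: (le_trans _ n1); rewrite ler_piMr ?normc_ge0.
have k2 : normc ((q - 1) * i) <= (lapR P V vmax)^-1 * `|t|.
  by rewrite normcM; apply: (le_trans _ n2); rewrite ler_piMr ?normc_ge0.
apply: (le_trans (le_normcD _ _)); apply: (le_trans (lerD (le_normcD _ _) (lexx _))); lra.
Qed.

(** Of the center nu al (m + x), the part nu al m cancels the mean of the m factors of [Rprod]; nu
    al x stays bounded and goes into [Phi]. *)
Let tiltF_Phi m v al x y t : 0 < v ->
  tiltF P V (a ^+ m * v) (nu%:R * al * (m%:R + x)) y t =
  Rprod X Y v t m * cexpN (Complex 0 (- (nu%:R * al * m%:R * t))) * Phi v (y + nu%:R * al * x) t.
Proof.
move=> v0; rewrite /tiltF (lap_ratio HX Xs_law Ys_law indep mV V0 V_lim m t v0).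
have -> : Complex 0 (- (t * (y + nu%:R * al * (m%:R + x)))) =
   Complex 0 (- (nu%:R * al * m%:R * t)) + Complex 0 (- (t * (y + nu%:R * al * x))) :> C.
  by apply/eqP; rewrite eq_complex; apply/andP; split; apply/eqP => /=; ring.
by rewrite cexpND /Phi; ring.
Qed.

Variables (vmin vmax K : R).
Hypothesis vm0 : 0 < vmin.
Hypothesis vmM : vmin <= vmax.
Hypothesis K0 : 0 <= K.

Definition saddle v al B x := [/\ vmin <= v <= vmax, 0 <= al <= K, 0 <= B <= K,
  0 <= x <= 1 & quad_exp K (Hfun X v) al B].

(** The bound for every y uses moduli alone and will give a uniform bound on the density. The
    two-sided estimate needs phases to cancel, so the center must stay within bounded distance of
    the mean. *)
Lemma tiltJ_fejconv_bounds A0 : 1 <= A0 -> exists D c, [/\ 0 <= D, 0 < c &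
  forall v al B x m, saddle v al B x -> (0 < m)%N ->
  let J := tiltJ P V (a ^+ m * v) (nu%:R * al * (m%:R + x)) in
  let q := Num.sqrt (2 * pi / (nu%:R * (B - al ^+ 2) * m%:R)) in
  [/\ c <= B - al ^+ 2,
   forall y, (fejconv J A0 y <= (Num.sqrt (2 * pi / (2 * c * m%:R)))%:E)%E &
   forall y, `|y| <= 1 -> (fejconv J A0 y <= (q + D / m%:R)%:E)%E /\
     ((q - D / m%:R)%:E <= fejconv J A0 y)%E]].
Proof.
move=> A01; have A00 : 0 < A0 by exact: lt_le_trans A01.
have [D [c [D0 c0 hD]]] := Rprod_bounds HX Y_ge1 q_nu nu_min vm0 vmM K0 A01.
have lM := lapR_gt0 P mV V0 (le_trans (ltW vm0) vmM).
have nu1 : 1 <= nu%:R :> R by rewrite ler1n; exact: (nu_ge1 Y_ge1 q_nu).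
have nu0 : 0 < nu%:R :> R by exact: lt_le_trans nu1.
(* The three summands bound the deviations from 1, relative to |t|, of the three factors of [Phi]:
   the phase, the transform at v and 1/(1 + i t). In [C2] the last 1 pays for replacing the triangle
   1 - t/A0 by 1. *)
pose C1 := (1 + nu%:R * K) + (lapR P V vmax)^-1 + 1.
have nK : 0 <= nu%:R * K by exact: mulr_ge0.
have C10 : 0 <= C1 by rewrite /C1 !addr_ge0 ?invr_ge0 ?(ltW lM).
pose C2 := 2 * (D * (1 + 1 / c) + C1 + 1).
have C20 : 0 <= C2.
  have h : 0 <= 1 + 1 / c by rewrite addr_ge0// divr_ge0// ltW.
  exact: mulr_ge0 (ler0n _ _) (addr_ge0 (addr_ge0 (mulr_ge0 D0 h) C10) ler01).
exists (C2 / c + 2 / c), c; split => //.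
  exact: addr_ge0 (divr_ge0 C20 (ltW c0)) (divr_ge0 (ler0n _ _) (ltW c0)).
move=> v al B x m [/andP[h1 h2] /andP[h3 h4] /andP[h5 h6] /andP[x0 x1] hq] m0 J q.
have [ck hR] := hD v al B h1 h2 h3 h4 h5 h6 hq.
have v0 : 0 < v := lt_le_trans vm0 h1.
have u0 : 0 < a ^+ m * v by rewrite mulr_gt0.
have mR : 0 < m%:R :> R by rewrite ltr0n.
set k := B - al ^+ 2 in ck hR q *.
have k0 : 0 < k := lt_le_trans c0 ck.
pose b := nu%:R * al * (m%:R + x).
have FE := tiltJ_fejconv P mV V0 b u0.
have mF y : measurable_fun `[0, A0] (fun t => Re (tiltF P V (a ^+ m * v) b y t)).
  by apply: measurable_funTS; exact: (measurable_tiltF P mV V0 b u0).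
have F1 y t := tiltF_geN1 P mV V0 b u0 y t.
have lin t : 0 <= t -> t <= A0 -> 0 <= 1 - t / A0 <= 1.
  move=> t0 tA; rewrite subr_ge0 ler_pdivrMr// mul1r tA gerBl divr_ge0//; exact: ltW.
have lam0 : 0 < nu%:R * k * m%:R by rewrite !mulr_gt0.
have cm0 : 0 < c * m%:R / 2 by rewrite divr_gt0// mulr_gt0.
split => //.
- move=> y; apply: (fejconv_le_gaus A00 _ (mF y) (F1 y) (FE _ _ A00)).
    by rewrite !mulr_gt0.
  move=> t t0 tA; have /andP[l1 l2] := lin t t0 tA.
  have tA' : `|t| <= A0 by rewrite ger0_norm.
  have [hR1 _] := hR m t tA'.
  have Fn : normc (tiltF P V (a ^+ m * v) b y t) <= expR (- (c * m%:R * t ^+ 2)).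
    rewrite tiltF_Phi// normcM normcM nexp mulr1 -[leRHS]mulr1 ler_pM ?normc_ge0//.
    exact: Phi1.
  have Fr : Re (tiltF P V (a ^+ m * v) b y t) <= expR (- (c * m%:R * t ^+ 2)).
    by apply: le_trans Fn; apply: (le_trans (ler_norm _)); exact: le_Re_normc.
  rewrite /gaus (_ : 2 * c * m%:R * t ^+ 2 / 2 = c * m%:R * t ^+ 2); last by field.
  rewrite -mulrA ler_wpM2l//; apply: (@le_trans _ _ ((1 - t / A0) * expR (- (c * m%:R * t ^+ 2)))).
    by rewrite ler_wpM2l.
  by rewrite ler_piMl ?expR_ge0.
move=> y y1.
have est : forall t, 0 <= t -> t <= A0 ->
    `|2 * (1 - t / A0) * Re (tiltF P V (a ^+ m * v) b y t) - gaus (nu%:R * k * m%:R) t| <=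
    C2 * (t * expR (- (c * m%:R / 2 * t ^+ 2))).
  move=> t t0 tA; have /andP[l1 l2] := lin t t0 tA.
  have nt : `|t| = t by rewrite ger0_norm.
  have tA' : `|t| <= A0 by rewrite nt.
  have [_ hR2] := hR m t tA'; rewrite nt in hR2.
  rewrite tiltF_Phi//; set M := Rprod _ _ _ _ _ * _ in hR2 *.
  set y' := y + _; have y'1 : `|y'| <= 1 + nu%:R * K.
    rewrite (le_trans (ler_normD _ _))// lerD//.
    rewrite ger0_norm; last by rewrite mulr_ge0// mulr_ge0.
    by rewrite -[leRHS]mulr1 ler_pM ?mulr_ge0// ler_wpM2l.
  set F := Phi v y' t; set g := expR _ in hR2.
  have P1 : normc F <= 1 by exact: Phi1.
  have P2 : normc (F - 1) <= C1 * t.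
    apply: (le_trans (Phi_dev y' t v0 h2)); rewrite nt ler_wpM2r//.
    by rewrite /C1 !lerD2r.
  pose lt : C := Cx (1 - t / A0).
  have nlt : normc lt <= 1 by rewrite normc_Cx ger0_norm.
  pose Ec := expR (- (c * m%:R / 2 * t ^+ 2)).
  have Ec0 : 0 <= Ec := expR_ge0 _.
  have gE : g <= Ec.
    have h : c * m%:R * t ^+ 2 <= nu%:R * k * m%:R * t ^+ 2.
      rewrite ler_wpM2r ?sqr_ge0// ler_wpM2r//.
      by apply: (le_trans ck); rewrite ler_peMl// ltW.
    rewrite ler_expR lerN2; lra.
  have g0 : 0 <= g := expR_ge0 _.
  have MG : normc (M - Cx g) <= D * (1 + 1 / c) * (t * Ec).
    apply: (le_trans hR2); rewrite -[leLHS]mulrA -[leRHS]mulrA ler_wpM2l//.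
    set E1 := expR _.
    have x0' : 0 <= c * m%:R * t ^+ 2 by rewrite mulr_ge0 ?sqr_ge0// mulr_ge0// ltW.
    have e1 : E1 <= Ec by rewrite ler_expR lerN2; lra.
    have e2 : c * m%:R * t ^+ 2 * E1 <= Ec.
      by apply: (le_trans (xexpN_le x0')); rewrite ler_expR lerN2; lra.
    have e3 : m%:R * t ^+ 3 * E1 <= 1 / c * (t * Ec).
      have -> : m%:R * t ^+ 3 * E1 = 1 / c * (t * (c * m%:R * t ^+ 2 * E1)).
        by field; rewrite gt_eqF.
      by rewrite ler_wpM2l ?divr_ge0 ?(ltW c0)// ler_wpM2l.
    have e4 : t * E1 <= t * Ec by rewrite ler_wpM2l.
    rewrite mulrDl mulrDl; lra.
  have key : normc (M * F * lt - Cx g) <= C2 / 2 * (t * Ec).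
    have -> : M * F * lt - Cx g = (M - Cx g) * (F * lt) + Cx g * (F * lt - 1) by ring.
    apply: (le_trans (le_normcD _ _)).
    have f1 : normc ((M - Cx g) * (F * lt)) <= D * (1 + 1 / c) * (t * Ec).
      rewrite normcM; apply: (le_trans _ MG); rewrite ler_piMr ?normc_ge0//.
      by rewrite normcM -[leRHS]mul1r ler_pM ?normc_ge0.
    have f2 : normc (F * lt - 1) <= (C1 + 1) * t.
      have -> : F * lt - 1 = (F - 1) * lt - Cx (t / A0) by rewrite /lt CxB Cx1; ring.
      apply: (le_trans (le_normcB _ _)).
      have f3 : normc ((F - 1) * lt) <= C1 * t.
        by rewrite normcM; apply: (le_trans _ P2); rewrite ler_piMr ?normc_ge0.
      have f4 : normc (Cx (t / A0)) <= t.
        rewrite normc_Cx ger0_norm ?divr_ge0 ?(ltW A00)//.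
        by rewrite ler_pdivrMr// ler_peMr.
      lra.
    have f5 : normc (Cx g * (F * lt - 1)) <= Ec * ((C1 + 1) * t).
      by rewrite normcM normc_Cx (ger0_norm g0) ler_pM ?normc_ge0.
    rewrite /C2; lra.
  have -> : 2 * (1 - t / A0) * Re (M * F) - gaus (nu%:R * k * m%:R) t =
      2 * Re (M * F * lt - Cx g).
    have -> : Re (M * F * lt - Cx g) = (1 - t / A0) * Re (M * F) - g.
      by rewrite [M * F * lt]mulrC ReD ReN ReZ.
    by rewrite /gaus -/g; ring.
  rewrite normrM ger0_norm//; have := le_trans (le_Re_normc _) key; rewrite -/Ec; lra.
have [e1 e2] := fejconv_estimate A00 lam0 cm0 C20 (mF y) (F1 y) (FE _ _ A00) est.
have E : C2 / (2 * (c * m%:R / 2)) = C2 / c / m%:R.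
  by field; rewrite !gt_eqF.
rewrite -/q E in e1 e2.
have p1 : 0 <= 2 / c / m%:R by rewrite divr_ge0 ?divr_ge0 ?(ltW c0)// ltW.
split.
  apply: (le_trans e1); rewrite lee_fin lerD2l mulrDl; lra.
apply: (le_trans _ e2); rewrite lee_fin -addrA lerD2l mulrDl opprD lerD2l lerN2.
have -> : 2 / c / m%:R = 2 / (c * m%:R) by field; rewrite !gt_eqF.
rewrite ler_wpM2l// lef_pV2 ?posrE; [|exact: mulr_gt0|exact: mulr_gt0].
rewrite [leRHS]mulrAC ler_wpM2r ?(ltW mR)//.
have k1 : k <= nu%:R * k by rewrite ler_peMl// ltW.
apply: (le_trans ck); apply: (le_trans k1); rewrite ler_peMr//.
by rewrite mulr_ge0// ltW.
Qed.

End local_limit.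

(** * The local limit theorem at the saddle point *)

Section local_limit.
Context d (T : measurableType d) (R : realType) (P : probability T R).
Variables (X : {RV P >-> nat}) (HX : offspring_law X).
Variables (Y : {RV P >-> nat}) (nu : nat).
Hypothesis Y_ge1 : forall w, (1 <= Y w)%N.
Hypothesis q_nu : 0 < mass Y nu.
Hypothesis nu_min : forall i : nat, 0 < mass Y i -> (nu <= i)%N.
Variables (Xs : nat -> nat -> {RV P >-> nat}) (Ys : nat -> {RV P >-> nat}).
Hypothesis Xs_law : forall n i, same_law (Xs n i) X.
Hypothesis Ys_law : forall j, same_law (Ys j) Y.
Hypothesis indep : mutually_independent P (joint_family Xs Ys).
Local Notation a := (offmean X).
Variable V : T -> R.
Hypothesis mV : measurable_fun setT V.
Hypothesis V0 : forall w, 0 <= V w.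
Hypothesis V_lim : {ae P, forall w,
    (gwi Xs Ys n w)%:R / a ^+ n @[n --> \oo] --> V w}.
Variables (vmin vmax K : R).
Hypothesis vm0 : 0 < vmin.
Hypothesis vmM : vmin <= vmax.
Hypothesis K0 : 0 <= K.

Let bounds := tiltJ_fejconv_bounds HX Y_ge1 q_nu nu_min Xs_law Ys_law indep mV V0 V_lim vm0 vmM K0.

(** The order of choices matters: a fixed kernel first gives the uniform bound [S] on the rescaled
    density; then come the window [de], the kernel width [A0], whose constant [D] depends on it, and
    last the threshold on m. *)
Lemma local_limit eps : 0 < eps -> exists m0 : nat, forall m v al B x, (m0 <= m)%N ->
  saddle X vmin vmax K v al B x ->
  0 < B - al ^+ 2 /\
  `|tiltJ P V (a ^+ m * v) (nu%:R * al * (m%:R + x)) 0 *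
     Num.sqrt (nu%:R * (B - al ^+ 2) * m%:R) * fej_mass - Num.sqrt (2 * pi)| <= eps.
Proof.
move=> e0; have N0 := @fej_mass_gt0 R; set N := fej_mass in N0 *.
have nu1 : 1 <= nu%:R :> R by rewrite ler1n; exact: (nu_ge1 Y_ge1 q_nu).
have nu0 : 0 < nu%:R :> R by exact: lt_le_trans nu1.
(* With a window of width 1 the kernel loses at most half of its mass. *)
pose K1 := Num.max 1 (32 / N).
have K11 : 1 <= K1 by rewrite le_max lexx.
have K1p : 0 < K1 by exact: lt_le_trans K11.
have K1N : 16 / (K1 * 1) <= N / 2.
  have : 32 / N <= K1 by rewrite le_max lexx orbT.
  rewrite mulr1 ler_pdivrMr// => h; rewrite ler_pdivrMr//; lra.
have [D1 [c1 [D10 c10 h1]]] := bounds K11.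
pose S := 2 * expR 1 / N * Num.sqrt (nu%:R * K * pi / c1).
have S0 : 0 <= S by rewrite mulr_ge0 ?sqrtr_ge0// divr_ge0 ?(ltW N0)// mulr_ge0 ?expR_ge0.
pose Q := S + 2 * S * N.
have Q0 : 0 <= Q by rewrite addr_ge0// mulr_ge0 ?(ltW N0)// mulr_ge0.
(* [Q] is the coefficient of the window width in [squeeze_delta]; that error is then at most eps /
   2. *)
pose de := Num.min (1 / 2) (eps / 2 / (Q + 1)).
have Q1 : 0 < Q + 1 by rewrite ltr_wpDl.
have de0 : 0 < de by rewrite lt_min !divr_gt0.
have de2 : de <= 1 / 2 by rewrite ge_min lexx.
have deQ : de * Q <= eps / 2.
  have : de <= eps / 2 / (Q + 1) by rewrite ge_min lexx orbT.
  rewrite ler_pdivlMr// mulrDr mulr1; have := ltW de0; lra.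
(* Makes the mass outside the window at most [de]. *)
pose A0 := Num.max 1 (16 / de ^+ 2).
have A01 : 1 <= A0 by rewrite le_max lexx.
have A0p : 0 < A0 by exact: lt_le_trans A01.
have A0d : 16 / (A0 * de) <= de.
  have : 16 / de ^+ 2 <= A0 by rewrite le_max lexx orbT.
  rewrite ler_pdivrMr ?exprn_gt0// => h; rewrite ler_pdivrMr ?mulr_gt0//.
  by have -> : de * (A0 * de) = A0 * de ^+ 2 by ring.
have [D [c [D0 c0 h2]]] := bounds A01.
pose H := D * Num.sqrt (nu%:R * K).
have H0 : 0 <= H by rewrite mulr_ge0 ?sqrtr_ge0.
(* The error D / m times the scale, which is of order sqrt(m), becomes at most eps / 4; it occurs in
   both one-sided estimates. *)
pose m1 := (Num.truncn ((4 * H / eps) ^+ 2)).+1.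
exists m1 => m v al B x m1m hs.
have m0 : (0 < m)%N by exact: leq_trans m1m.
have mR : 0 < m%:R :> R by rewrite ltr0n.
have [_ /andP[al0 _] /andP[B0 BK] _ _] := hs.
have := h1 v al B x m hs m0; have := h2 v al B x m hs m0.
set b := nu%:R * al * _; set J := tiltJ _ _ _ _; set k := B - _; set q := Num.sqrt (2 * pi / (nu%:R * k * m%:R)).
move=> [ck _ hy] [c1k hS _].
have k0 : 0 < k := lt_le_trans c0 ck.
split => //.
have kK : k <= K by rewrite (le_trans _ BK)// gerBl sqr_ge0.
have u0 : 0 < a ^+ m * v.
  have [/andP[vv _] _ _ _ _] := hs.
  have a0 := offmean_gt0 (offspring_ge1 HX) (offspring_nondeg HX) (offspring_XlogX HX).
  exact: mulr_gt0 (exprn_gt0 m a0) (lt_le_trans vm0 vv).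
have mJ : measurable_fun setT J := measurable_tiltJ P mV V0 b u0.
have J0 s : 0 <= J s := tiltJ_ge0 P mV V0 b u0 s.
have Jm s s' : s <= s' -> J s <= expR (s' - s) * J s' by exact: (tiltJ_mono P mV V0 b u0).
pose w := Num.sqrt (nu%:R * k * m%:R).
have lam0 : 0 < nu%:R * k * m%:R by rewrite !mulr_gt0.
have w0 : 0 < w by rewrite sqrtr_gt0.
have pi0 : 0 < pi :> R := pi_gt0 _.
have qw : q * w = Num.sqrt (2 * pi).
  by rewrite /q /w -sqrtrM ?divr_ge0 ?(ltW lam0) ?mulr_ge0 ?(ltW pi0)// divfK// gt_eqF.
have JS s : J s * w <= S.
  have := hS (s + 1 / 2); have := fejconv_ge mJ J0 Jm s K1p (ltr01 : 0 < 1).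
  move=> /le_trans h /h {h}; rewrite lee_fin -/N => h.
  have e1 : 0 < expR (-1) :> R := expR_gt0 _.
  have h3 : expR (-1) * J s * (N / 2) <= Num.sqrt (2 * pi / (2 * c1 * m%:R)).
    apply: le_trans h; rewrite ler_wpM2l ?mulr_ge0 ?(ltW e1)//; lra.
  have h4 : Num.sqrt (2 * pi / (2 * c1 * m%:R)) * w <= Num.sqrt (nu%:R * K * pi / c1).
    rewrite /w -sqrtrM; last by rewrite divr_ge0 ?mulr_ge0 ?(ltW pi0) ?(ltW c10) ?(ltW mR).
    rewrite ler_wsqrtr//.
    have -> : 2 * pi / (2 * c1 * m%:R) * (nu%:R * k * m%:R) = nu%:R * k * pi / c1.
      by field; rewrite !gt_eqF.
    by rewrite ler_wpM2r ?invr_ge0 ?(ltW c10)// ler_wpM2r ?(ltW pi0)// ler_wpM2l// ltW.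
  have h5 := ler_wpM2r (ltW w0) h3.
  have h6 := le_trans h5 h4.
  rewrite /S -ler_pdivrMl; last by rewrite divr_gt0// mulr_gt0// expR_gt0.
  apply: le_trans h6; rewrite le_eqVlt; apply/orP; left; apply/eqP.
  by rewrite expRN; field; rewrite !gt_eqF// expR_gt0.
have JSw s : J s <= S / w by rewrite ler_pdivlMr.
have dn : `|de / 2| <= 1 by rewrite ger0_norm ?divr_ge0 ?(ltW de0)//; lra.
have dn' : `|0 - de / 2| <= 1 by rewrite sub0r normrN.
have Ew : D / m%:R * w <= eps / 4.
  have sm0 : 0 < Num.sqrt m%:R :> R by rewrite sqrtr_gt0.
  have sm2 : Num.sqrt m%:R * Num.sqrt m%:R = m%:R :> R by rewrite -expr2 sqr_sqrtr// ltW.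
  have hw : w <= Num.sqrt (nu%:R * K) * Num.sqrt m%:R.
    rewrite /w sqrtrM ?mulr_ge0 ?(ltW k0)// ler_wpM2r ?sqrtr_ge0// ler_wsqrtr//.
    by rewrite ler_wpM2l.
  have hm : 4 * H / eps <= Num.sqrt m%:R.
    rewrite -(ler_pXn2r (n := 2))// ?nnegrE ?sqrtr_ge0//; last first.
      by rewrite divr_ge0 ?mulr_ge0// ltW.
    rewrite sqr_sqrtr ?(ltW mR)//; apply: (@le_trans _ _ m1%:R); last by rewrite ler_nat.
    by apply: ltW; exact: truncnS_gt.
  rewrite ler_pdivrMr// in hm.
  apply: (@le_trans _ _ (D / m%:R * (Num.sqrt (nu%:R * K) * Num.sqrt m%:R))).
    by rewrite ler_wpM2l// divr_ge0// ltW.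
  have -> : D / m%:R * (Num.sqrt (nu%:R * K) * Num.sqrt m%:R) = H / Num.sqrt m%:R.
    move: (sm2) (sm0); set s := Num.sqrt m%:R => <- s0.
    by rewrite /H; field; rewrite gt_eqF.
  rewrite ler_pdivrMr//; lra.
have E0 : 0 <= D / m%:R * w by rewrite mulr_ge0 ?(ltW w0)// divr_ge0// ltW.
have main : `|J 0 * w * N - Num.sqrt (2 * pi)| <=
    D / m%:R * w + D / m%:R * w + de * (S + 2 * S * N).
  apply: squeeze_delta => //.
  - by rewrite mulr_ge0// ltW.
  - exact: ltW.
  - have := fejconv_ge mJ J0 Jm 0 A0p de0; rewrite add0r.
    have [/[swap] _ h /le_trans/(_ h)] := hy _ dn; rewrite lee_fin -/N => {}h.
    apply: (@le_trans _ _ (expR (- de) * J 0 * (N - 16 / (A0 * de)) * w)).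
      have -> : expR (- de) * (J 0 * w) * (N - de) = expR (- de) * J 0 * (N - de) * w by ring.
      rewrite ler_wpM2r ?(ltW w0)// ler_wpM2l ?mulr_ge0 ?expR_ge0//; lra.
    by rewrite -qw -mulrDl ler_wpM2r// ltW.
  - have := fejconv_le mJ J0 Jm 0 A0p de0 JSw.
    have [_ h] := hy _ dn'; move=> /(le_trans h); rewrite lee_fin -/N => {}h.
    have {}h := ler_wpM2r (ltW w0) h.
    rewrite -qw -mulrBl; apply: (le_trans h).
    have -> : (expR de * J 0 * N + S / w * (16 / (A0 * de))) * w =
       expR de * (J 0 * w) * N + S * (16 / (A0 * de)).
      by field; rewrite !gt_eqF.
    by rewrite lerD2l ler_wpM2l.
apply: (le_trans main); rewrite -/Q; lra.
Qed.

End local_limit.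

Lemma normr_expRB1_le (R : realType) (r : R) : `|r| <= 1 / 2 -> `|expR r - 1| <= 2 * `|r|.
Proof.
move=> h; have e1 := expR_ge1Dx r; have e2 := expR_ge1Dx (- r).
have e0 : 0 < expR r := expR_gt0 _.
have [r0|r0] := leP 0 r.
  rewrite (ger0_norm r0) in h *.
  have e3 : expR r * (1 - r) <= 1.
    apply: (@le_trans _ _ (expR r * expR (- r))); last by rewrite expRxMexpNx_1.
    by rewrite ler_wpM2l// ltW.
  have e4 : expR r <= 2.
    have : expR r * (1 / 2) <= expR r * (1 - r) by rewrite ler_wpM2l ?(ltW e0)//; lra.
    lra.
  have e5 : expR r * r <= 2 * r by rewrite ler_wpM2r.
  rewrite ger0_norm; lra.
rewrite (ltr0_norm r0); have : expR r <= 1 by rewrite expR_le1 ltW.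
by move=> e3; rewrite ler0_norm; lra.
Qed.

(** * Asymptotics of the transform and a choice of saddle point for each phase *)

Section phase_data.
Context d (T : measurableType d) (R : realType) (P : probability T R).
Variables (X : {RV P >-> nat}) (HX : offspring_law X).
Variables (Y : {RV P >-> nat}) (nu : nat).
Hypothesis Y_ge1 : forall w, (1 <= Y w)%N.
Hypothesis q_nu : 0 < mass Y nu.
Hypothesis nu_min : forall i : nat, 0 < mass Y i -> (nu <= i)%N.
Variables (Xs : nat -> nat -> {RV P >-> nat}) (Ys : nat -> {RV P >-> nat}).
Hypothesis Xs_law : forall n i, same_law (Xs n i) X.
Hypothesis Ys_law : forall j, same_law (Ys j) Y.
Hypothesis indep : mutually_independent P (joint_family Xs Ys).
Local Notation a := (offmean X).
Variable V : T -> R.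
Hypothesis mV : measurable_fun setT V.
Hypothesis V0 : forall w, 0 <= V w.
Hypothesis V_lim : {ae P, forall w,
    (gwi Xs Ys n w)%:R / a ^+ n @[n --> \oo] --> V w}.

Let X1 := offspring_ge1 HX.
Let Xnd := offspring_nondeg HX.
Let Xlog := offspring_XlogX HX.
Let a1 : 1 < a := offmean_gt1 X1 Xnd Xlog.
Let a0 : 0 < a := offmean_gt0 X1 Xnd Xlog.
Let L0 : 0 < ln a. Proof. exact: ln_gt0. Qed.
Let aE : expR (ln a) = a. Proof. by rewrite lnK. Qed.
Let nu1 : 1 <= nu%:R :> R. Proof. by rewrite ler1n; exact: (nu_ge1 Y_ge1 q_nu). Qed.
Let nu0 : 0 < nu%:R :> R. Proof. exact: lt_le_trans nu1. Qed.

Let ln01 (y x : R) : 0 < y -> y <= x -> x <= 1 -> `|ln x| <= - ln y.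
Proof.
move=> y0 yx x1; have x0 : 0 < x := lt_le_trans y0 yx.
have h : ln y <= ln x by rewrite ler_ln.
have h' : ln x <= 0 by exact: ln_le0.
by rewrite ler0_norm// lerN2.
Qed.

(** The scaling equation turns ln of the transform at a^m v into a sum of ln Q along the orbit of
    psi(v), to which [second_difference_sum] applies. Monotonicity in v gives constants uniform on
    the interval. *)
Lemma lapR_asymp vmin vmax : 0 < vmin -> vmin <= vmax -> exists Kb th, [/\ 0 <= Kb, 0 <= th < 1 &
  forall v, vmin <= v <= vmax -> exists be ga, [/\ `|be| <= Kb, `|ga| <= Kb &
    forall m, `|ln (lapR P V (a ^+ m * v)) -
      (nu%:R * ln (mass X 1) * (m%:R * (m%:R + 1) / 2) + be * m%:R + ga)| <= Kb * th ^+ m]].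
Proof.
move=> vm0 vmM; have vM0 : 0 < vmax := lt_le_trans vm0 vmM.
have /andP[r0 r1] := psiR_01 HX vm0; have /andP[pM0 pM1] := psiR_01 HX vM0.
have [K K0 hK] := ln_QR_step HX q_nu nu_min r0 r1.
have th01 := gXR_theta HX (ltW r0) r1.
set th := gXR X (psiR X vmin) in hK th01; have /andP[th0 th1] := th01.
have t1 : 0 < 1 - th by rewrite subr_gt0.
pose QM := gfR P Y (psiR X vmax).
have QM0 : 0 < QM := QR_gt0 q_nu nu_min pM0 (ltW pM1).
have lM0 := lapR_gt0 P mV V0 (ltW vM0).
pose c1 := K / (1 - th) + - ln QM; pose c2 := K / (1 - th) ^+ 2 + - ln (lapR P V vmax).
have QM1 : QM <= 1 by apply: gfR_le1; rewrite ?(ltW pM0) ?(ltW pM1).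
have b1 : 0 <= K / (1 - th) by rewrite divr_ge0// ltW.
have b2 : 0 <= K / (1 - th) ^+ 2 by rewrite divr_ge0// exprn_ge0// ltW.
have b3 : 0 <= - ln QM by rewrite oppr_ge0 ln_le0.
have b4 : 0 <= - ln (lapR P V vmax) by rewrite oppr_ge0 ln_le0// (lapR_le1 P mV V0 (ltW vM0)).
exists (c1 + c2), th; split => //.
  by rewrite !addr_ge0.
move=> v /andP[vv vM]; have v0 : 0 < v := lt_le_trans vm0 vv.
have /andP[p0 p1] := psiR_01 HX v0.
have pr : psiR X v <= psiR X vmin := psiR_le HX (ltW vm0) vv.
have pM : psiR X vmax <= psiR X v := psiR_le HX (ltW v0) vM.
have l0 := lapR_gt0 P mV V0 (ltW v0).
pose D j := ln (gfR P Y (fitR X j (psiR X v))).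
have [be [ga [hb hg hm]]] := second_difference_sum K0 th01 (fun j => hK (psiR X v) j p0 pr : `|D j.+1 - D j - _| <= _).
exists be, (ga + ln (lapR P V v)); split.
- have hD : `|D 0%N| <= - ln QM.
    rewrite /D /=; apply: ln01 => //; last by apply: gfR_le1; rewrite ?(ltW p0) ?(ltW p1).
    by apply: gfR_le => //; exact: ltW.
  have := ler_normD (be - D 0%N) (D 0%N); rewrite subrK /c1 /c2; lra.
- have hl : `|ln (lapR P V v)| <= - ln (lapR P V vmax).
    apply: ln01 => //; first exact: (lapR_le P mV V0 (ltW v0) vM).
    exact: (lapR_le1 P mV V0 (ltW v0)).
  have := ler_normD ga (ln (lapR P V v)); rewrite /c1 /c2; lra.
move=> m; rewrite (lapR_scale_iter HX Xs_law Ys_law indep mV V0 V_lim m (ltW v0)).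
have Qp j : 0 < gfR P Y (fitR X j (psiR X v)).
  apply: (QR_gt0 q_nu nu_min); first by apply: (fitR_gt0 HX) => //; exact: ltW.
  by apply: fitR_le1; exact: ltW.
have lnprod : ln (\prod_(j < m) gfR P Y (fitR X j.+1 (psiR X v))) = \sum_(0 <= j < m) D j.+1 /\
    0 < \prod_(j < m) gfR P Y (fitR X j.+1 (psiR X v)).
  elim: m => [|m [ih ihp]]; first by rewrite big_ord0 big_geq// ln1.
  have Qm := Qp m.+1.
  rewrite big_ord_recr big_nat_recr //=; split; last exact: mulr_gt0.
  have lnE := lnM (ihp : _ \is Num.pos) (Qm : _ \is Num.pos).
  by rewrite [LHS]lnE ih.
have [lp pp] := lnprod; rewrite lnM ?posrE// lp.
apply: (@le_trans _ _ (K / (1 - th) ^+ 2 * th ^+ m)).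
  apply: le_trans (hm m); rewrite le_eqVlt; apply/orP; left; apply/eqP.
  by congr (`| _ |); ring.
rewrite ler_wpM2r ?exprn_ge0// /c1 /c2; lra.
Qed.

(** The saddle equation is solved with c = nu e^{w0} for each phase w0, and [choice] collects the
    solutions into functions of w0 with common bounds. *)
Lemma saddle_data : exists (vmin vmax K Kb th : R) (vf Af Bf bf gf : R -> R),
  [/\ 0 < vmin, vmin <= vmax, 0 <= K, 0 <= Kb /\ 0 <= th < 1 &
  forall w0, 0 <= w0 <= ln a ->
    [/\ vf w0 = nu%:R * expR w0 * Af w0,
        forall x, 0 <= x <= 1 -> saddle X vmin vmax K (vf w0) (Af w0) (Bf w0) x,
        `|bf w0| <= Kb, `|gf w0| <= Kb &
        forall m, `|ln (lapR P V (a ^+ m * vf w0)) -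
         (nu%:R * ln (mass X 1) * (m%:R * (m%:R + 1) / 2) + bf w0 * m%:R + gf w0)| <= Kb * th ^+ m]].
Proof.
have [al [K [al0 K0 hE]]] := Hfun_expand HX q_nu nu_min Xs_law Ys_law indep.
have sp c : 0 < c -> exists v A B, [/\ c * al <= v, v = c * A, A <= K, 0 <= B <= K &
    quad_exp K (Hfun X v) A B].
  by move=> c0; exact: (saddle_point HX q_nu nu_min al0 K0 c0 hE).
(* The summand al in [vmax] ensures [vmin <= vmax] directly, with no comparison of al and K. *)
pose vmin := nu%:R * al; pose vmax := nu%:R * a * (K + al).
have vm0 : 0 < vmin by exact: mulr_gt0.
have vmM : vmin <= vmax.
  rewrite /vmin /vmax -mulrA ler_wpM2l ?(ltW nu0)//.
  apply: (@le_trans _ _ (K + al)); first by rewrite lerDr.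
  by rewrite ler_peMl ?(ltW a1)// addr_ge0// ltW.
have [Kb [th [Kb0 th01 hL]]] := lapR_asymp vm0 vmM.
have key w0 : exists s : R * R * R * R * R, 0 <= w0 <= ln a ->
    [/\ s.1.1.1.1 = nu%:R * expR w0 * s.1.1.1.2,
        forall x, 0 <= x <= 1 -> saddle X vmin vmax K s.1.1.1.1 s.1.1.1.2 s.1.1.2 x,
        `|s.1.2| <= Kb, `|s.2| <= Kb &
        forall m, `|ln (lapR P V (a ^+ m * s.1.1.1.1)) -
         (nu%:R * ln (mass X 1) * (m%:R * (m%:R + 1) / 2) + s.1.2 * m%:R + s.2)| <= Kb * th ^+ m].
  have [/andP[w00 w0L]|nw] := boolP (0 <= w0 <= ln a); last by exists (0, 0, 0, 0, 0).
  have c0 : 0 < nu%:R * expR w0 by rewrite mulr_gt0 ?expR_gt0.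
  have [v [A [B [h1 h2 h3 h4 h5]]]] := sp _ c0.
  have e1 : 1 <= expR w0 by rewrite -expR0 ler_expR.
  have ea : expR w0 <= a by rewrite -aE ler_expR.
  have vv : vmin <= v.
    apply: le_trans h1; rewrite /vmin ler_wpM2r ?(ltW al0)//.
    by rewrite ler_peMr// ltW.
  have A0 : 0 <= A.
    have v0 : 0 < v := lt_le_trans vm0 vv.
    by rewrite -(pmulr_rge0 _ c0) -h2 ltW.
  have vM : v <= vmax.
    have Kal : A <= K + al by rewrite (le_trans h3)// lerDl ltW.
    rewrite h2 /vmax; apply: (ler_pM (ltW c0) A0 _ Kal).
    by rewrite ler_wpM2l// ltW.
  have [|be [ga [hb hg hm]]] := hL v; first by rewrite vv vM.
  exists (v, A, B, be, ga) => _ /=; split => // x x01.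
  by split => //; [rewrite vv vM|rewrite A0 h3].
have [s hs] := choice key.
exists vmin, vmax, K, Kb, th, (fun w => (s w).1.1.1.1), (fun w => (s w).1.1.1.2),
  (fun w => (s w).1.1.2), (fun w => (s w).1.2), (fun w => (s w).2); split => //.
Qed.

End phase_data.

(** * Assembly of the left tail asymptotics *)

Section left_tail.
Context d (T : measurableType d) (R : realType) (P : probability T R).
Variables (X : {RV P >-> nat}) (HX : offspring_law X).
Variables (Y : {RV P >-> nat}) (nu : nat).
Hypothesis Y_ge1 : forall w, (1 <= Y w)%N.
Hypothesis q_nu : 0 < mass Y nu.
Hypothesis nu_min : forall i : nat, 0 < mass Y i -> (nu <= i)%N.
Variables (Xs : nat -> nat -> {RV P >-> nat}) (Ys : nat -> {RV P >-> nat}).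
Hypothesis Xs_law : forall n i, same_law (Xs n i) X.
Hypothesis Ys_law : forall j, same_law (Ys j) Y.
Hypothesis indep : mutually_independent P (joint_family Xs Ys).
Local Notation a := (offmean X).
Variable W : {RV P >-> R}.
Hypothesis W_lim : {ae P, forall w,
    (gwi Xs Ys n w)%:R / a ^+ n @[n --> \oo] --> W w}.
Variable omega : R -> R.
Hypothesis omegaP : is_omega a omega.

Let X1 := offspring_ge1 HX.
Let Xnd := offspring_nondeg HX.
Let Xlog := offspring_XlogX HX.
Let a1 : 1 < a := offmean_gt1 X1 Xnd Xlog.
Let a0 : 0 < a := offmean_gt0 X1 Xnd Xlog.
Local Notation L := (ln a).
Let L0 : 0 < ln a. Proof. exact: ln_gt0. Qed.
Let aE : expR (ln a) = a. Proof. by rewrite lnK. Qed.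
Let nu1 : 1 <= nu%:R :> R. Proof. by rewrite ler1n; exact: (nu_ge1 Y_ge1 q_nu). Qed.
Let nu0 : 0 < nu%:R :> R. Proof. exact: lt_le_trans nu1. Qed.

(** W is nonnegative only almost surely, while the Laplace transform is set up for variables
    nonnegative everywhere. For e > 0 the events V < e and W < e coincide. *)
Let V w : R := Num.max (W w) 0.

Let mV : measurable_fun setT V.
Proof. by apply: measurable_maxr. Qed.

Let V0 w : 0 <= V w. Proof. by rewrite le_max lexx orbT. Qed.

Let V_lim : {ae P, forall w, (gwi Xs Ys n w)%:R / a ^+ n @[n --> \oo] --> V w}.
Proof.
apply: filterS W_lim => w hw; rewrite /V max_l//.
apply: (ler_cvg_to (cvg_cst 0) hw); apply: nearW => n.
by rewrite divr_ge0// exprn_ge0// ltW.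
Qed.

(** The residue of w modulo ln a in [0, ln a); data depending on the phase alone are periodic. *)
Let phase w : R := w - ln a * (Num.floor (w / ln a))%:~R.

Let phase_itv w : 0 <= phase w / ln a < 1.
Proof.
have /andP[h1 h2] := Num.Theory.floor_itv (w / ln a).
have -> : phase w / ln a = w / ln a - (Num.floor (w / ln a))%:~R.
  by rewrite /phase; field; rewrite gt_eqF.
rewrite subr_ge0 h1 /= ltrBlDl; by rewrite intrD addrC in h2; rewrite addrC.
Qed.

Let phase_period w : phase (w + ln a) = phase w.
Proof.
rewrite /phase mulrDl divff ?gt_eqF// Num.Theory.floorDrz ?rpred1//.
by rewrite Num.Theory.floor1 intrD; ring.
Qed.

Let phaseE w : 0 <= w -> exists m : nat, w = phase w + m%:R * ln a.
Proof.
move=> w0; exists `|Num.floor (w / ln a)|%N.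
have f0 : (0 <= Num.floor (w / ln a))%R by rewrite Num.Theory.floor_ge0 divr_ge0// ltW.
by rewrite pmulrn gez0_abs// /phase [ln a * _]mulrC subrK.
Qed.

Let lnw (m : nat) (x : R) : 0 <= x -> x <= 1 -> (0 < m)%N ->
  0 <= ln ((m%:R + x) * ln a) - ln (ln a) - ln m%:R <= m%:R^-1.
Proof.
move=> x0 x1 m0; have mR : 0 < m%:R :> R by rewrite ltr0n.
have mx : 0 < m%:R + x by rewrite ltr_wpDr.
rewrite lnM ?posrE//.
have h1 : ln m%:R <= ln (m%:R + x) by rewrite ler_ln ?posrE// lerDl.
have h2 : ln (m%:R + x) <= ln m%:R + m%:R^-1.
  rewrite -ler_expR lnK ?posrE// expRD lnK ?posrE//.
  apply: (@le_trans _ _ (m%:R * (1 + m%:R^-1))); last first.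
    by rewrite ler_wpM2l ?(ltW mR)// expR_ge1Dx.
  by rewrite mulrDr mulr1 mulfV ?gt_eqF// lerD2l.
apply/andP; split; lra.
Qed.

(** With m = omega / log a - x and x the phase divided by log a, the term m (m + 1) / 2 becomes a
    quadratic polynomial in omega. Its leading term is -sigma omega^2; the linear and constant
    terms, like those of beta m + gamma and of u epsilon, go into [m1f] and [m2f]. *)
Lemma left_tail : exists M1 M2 : R -> R,
    [/\ bounded_fun M1, periodic M1 (ln a), bounded_fun M2, periodic M2 (ln a) &
        fine (P [set w | W w < e]) /
          expR (- sigma nu (mass X 1) a * omega e ^+ 2 + omega e * M1 (omega e)
                - 1 / 2 * ln (omega e) + M2 (omega e))
        @[e --> 0^'+] --> (1 : R)].
Proof.
have [vmin [vmax [K [Kb [th [vf [Af [Bf [bf [gf [vm0 vmM K0 [Kb0 /andP[th0 th1]] hd]]]]]]]]]]] :=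
  saddle_data HX Y_ge1 q_nu nu_min Xs_law Ys_law indep mV V0 V_lim.
pose lam := nu%:R * ln (mass X 1).
pose kap w0 := Bf w0 - Af w0 ^+ 2.
have N0 := @fej_mass_gt0 R; set N := fej_mass in N0.
have s2p : 0 < Num.sqrt (2 * pi) :> R by rewrite sqrtr_gt0 mulr_gt0// pi_gt0.
pose C0 := 1 / 2 * ln L + ln (Num.sqrt (2 * pi) / N).
pose x w0 := w0 / L.
pose m1f w0 := lam * (1 - 2 * x w0) / (2 * L) + (bf w0 + nu%:R * Af w0) / L.
pose m2f w0 := lam * (x w0 ^+ 2 - x w0) / 2 - bf w0 * x w0 + gf w0 - 1 / 2 * ln (nu%:R * kap w0) + C0.
have phL w : 0 <= phase w <= L.
  have /andP[h1 h2] := phase_itv w; rewrite -[phase w](divfK (_ : L != 0)) ?gt_eqF//.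
  by rewrite mulr_ge0 ?(ltW L0)//= ler_piMl ?(ltW L0)// ltW.
have phx w : 0 <= x (phase w) <= 1.
  by have /andP[h1 h2] := phase_itv w; rewrite /x h1 ltW.
(* Used here for its lower bound [c] on the variance, which keeps ln (nu kap), and with it M2,
   bounded. *)
have [D [c [_ c0 hc]]] :=
  tiltJ_fejconv_bounds HX Y_ge1 q_nu nu_min Xs_law Ys_law indep mV V0 V_lim vm0 vmM K0 (lexx 1).
have kapb w0 : 0 <= w0 <= L -> c <= kap w0.
  move=> hw; have [_ sd _ _ _] := hd w0 hw.
  by have [] := hc _ _ _ 0 1%N (sd 0 (introT andP (conj (lexx 0) ler01))) isT.
have kapK w0 : 0 <= w0 <= L -> kap w0 <= K.
  move=> hw; have [_ sd _ _ _] := hd w0 hw.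
  have [_ _ /andP[_ BK] _ _] := sd 0 (introT andP (conj (lexx 0) ler01)).
  by rewrite /kap (le_trans _ BK)// gerBl sqr_ge0.
have AfK w0 : 0 <= w0 <= L -> 0 <= Af w0 <= K.
  move=> hw; have [_ sd _ _ _] := hd w0 hw.
  by have [] := sd 0 (introT andP (conj (lexx 0) ler01)).
exists (m1f \o phase), (m2f \o phase); split.
- exists (`|lam| / (2 * L) + (Kb + nu%:R * K) / L); split; first exact: num_real.
  move=> z Mz w _ /=; apply: le_trans (ltW Mz); rewrite /m1f.
  have /andP[x0 x1] := phx w; have [_ _ b1 _ _] := hd _ (phL w).
  have /andP[A0 AK] := AfK _ (phL w).
  apply: (le_trans (ler_normD _ _)); apply: lerD.
    rewrite normrM normfV (gtr0_norm (_ : 0 < 2 * L)) ?mulr_gt0// ler_wpM2r ?invr_ge0 ?mulr_ge0 ?(ltW L0)//.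
    rewrite normrM ler_piMr//; rewrite ler_norml; apply/andP; split; lra.
  rewrite normrM normfV (gtr0_norm L0) ler_wpM2r ?invr_ge0 ?(ltW L0)//.
  apply: (le_trans (ler_normD _ _)); apply: lerD => //.
  by rewrite ger0_norm ?mulr_ge0// ler_wpM2l.
- by move=> w; rewrite /= phase_period.
- exists (`|lam| + Kb + Kb + (`|ln (nu%:R * c)| + `|ln (nu%:R * K)|) + `|C0|); split; first exact: num_real.
  move=> z Mz w _ /=; apply: le_trans (ltW Mz); rewrite /m2f.
  have /andP[x0 x1] := phx w; have [_ _ b1 g1 _] := hd _ (phL w).
  have ck := kapb _ (phL w); have kK := kapK _ (phL w).
  have k0 : 0 < kap (phase w) := lt_le_trans c0 ck.
  have Kp : 0 < K := lt_le_trans k0 kK.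
  apply: (le_trans (ler_normD _ _)); rewrite lerD2r.
  apply: (le_trans (ler_normB _ _)); apply: lerD.
    apply: (le_trans (ler_normD _ _)); apply: lerD => //.
    apply: (le_trans (ler_normB _ _)); apply: lerD.
      rewrite -mulrA normrM ler_piMr//.
      have xx : 0 <= x (phase w) ^+ 2 <= 1 by rewrite sqr_ge0 exprn_ile1.
      move: xx => /andP[y0 y1]; rewrite ler_norml; apply/andP; split; lra.
    by rewrite normrM (ger0_norm x0); apply: (le_trans _ b1); rewrite ler_piMr.
  have h1 : ln (nu%:R * c) <= ln (nu%:R * kap (phase w)).
    by rewrite ler_ln ?posrE ?mulr_gt0// ler_wpM2l// ltW.
  have h2 : ln (nu%:R * kap (phase w)) <= ln (nu%:R * K).
    by rewrite ler_ln ?posrE ?mulr_gt0// ler_wpM2l// ltW.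
  have h3 := ler_norm (- ln (nu%:R * c)); rewrite normrN in h3.
  have h4 := ler_norm (ln (nu%:R * K)).
  have h5 := normr_ge0 (ln (nu%:R * c)); have h6 := normr_ge0 (ln (nu%:R * K)).
  rewrite ler_norml; apply/andP; split; lra.
- by move=> w; rewrite /= phase_period.
apply/cvgrPdist_le => eps eps0.
pose eta := Num.min (1 / 2) (eps / 4).
have eta0 : 0 < eta by rewrite lt_min !divr_gt0.
have eta2 : eta <= 1 / 2 by rewrite ge_min lexx.
have etae : eta <= eps / 4 by rewrite ge_min lexx orbT.
have [|m1 hm1] := local_limit HX Y_ge1 q_nu nu_min Xs_law Ys_law indep mV V0 V_lim vm0 vmM K0
  (eps := eta * Num.sqrt (2 * pi)).
- by rewrite mulr_gt0.
(* The two summands will dominate the two parts of the logarithmic error [r]: the asymptotics of the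
   transform, and half of ln omega - ln L - ln m, at most 1/(2m) <= 1/(m+1). *)
have [m2 hm2] : exists m2 : nat, forall m, (m2 <= m)%N -> Kb * th ^+ m + m.+1%:R^-1 <= eta.
  have : Kb * th ^+ m + m.+1%:R^-1 @[m --> \oo] --> (Kb * 0 + 0 : R).
    apply: cvgD; last exact: cvg_harmonic.
    apply: cvgM; first exact: cvg_cst.
    have := @cvg_geometric R 1 th; rewrite ger0_norm// => /(_ th1).
    by rewrite /geometric /=; under eq_fun do rewrite mul1r.
  rewrite mulr0 addr0 => /cvgr0Pnorm_le /(_ eta eta0)[m2 _ h]; exists m2 => m m2m.
  by apply: le_trans (ler_norm _) (h m m2m).
have [om1 om2] := omegaP.
near=> e.
have e0 : 0 < e by near: e; exact: nbhs_right_gt.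
have omE : omega e - ln (omega e) + ln L = ln (1 / e) by near: e; exact: om1.
(* One period is lost in passing from omega to the integer m; the other makes m positive. *)
have omB : (m1 + m2 + 2)%:R * L <= omega e.
  by near: e; move/cvgryPge : om2 => /(_ ((m1 + m2 + 2)%:R * L)).
set om := omega e in omE omB *.
have om0 : 0 < om by apply: lt_le_trans omB; rewrite mulr_gt0// ltr0n addn2.
have [m mE] := phaseE (ltW om0).
set w0 := phase om in mE *.
have w0L : 0 <= w0 <= L := phL om.
have /andP[w00 w01] := w0L.
have /andP[x0 x1] : 0 <= x w0 <= 1 := phx om.
have mlow : (m1 + m2 + 1 <= m)%N.
  rewrite -(ler_nat R) -(ler_pM2r L0).
  have : (m1 + m2 + 2)%:R * L = (m1 + m2 + 1)%:R * L + L by rewrite !natrD; ring.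
  lra.
have m0 : (0 < m)%N by apply: leq_trans mlow; rewrite addn1.
have mR : 0 < m%:R :> R by rewrite ltr0n.
have [vE sd hb hg hl] := hd w0 w0L.
have sdx := sd (x w0) (phx om).
have [k0 hJ] := hm1 m (vf w0) (Af w0) (Bf w0) (x w0)
  (leq_trans (leq_trans (leq_addr _ _) (leq_addr _ _)) mlow) sdx.
have {}hl := hl m.
have r2 := hm2 m (leq_trans (leq_trans (leq_addl m1 _) (leq_addr _ _)) mlow).
rewrite -/(kap w0) in k0 hJ.
set u := a ^+ m * vf w0 in hJ hl.
set b := nu%:R * Af w0 * (m%:R + x w0) in hJ.
have [/andP[vv _] _ _ _ _] := sdx.
have u0 : 0 < u by rewrite mulr_gt0 ?exprn_gt0// (lt_le_trans vm0).
have omx : om = (m%:R + x w0) * L by rewrite mE /x; field; rewrite gt_eqF.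
(* The equation for omega gives e = omega e^{-omega} / L, and v = nu e^{w0} A gives u = nu A
   e^omega. Hence u e = nu A omega / L = nu A (m + x), so s = 0 in the tilted density corresponds
   exactly to the threshold e. *)
have ue : u * e = b.
  have eE : e = expR (- om) * om / L.
    have : expR (- ln (1 / e)) = expR (- om) * expR (ln om) / expR (ln L).
      by rewrite -omE -expRD -expRN -expRD; congr expR; ring.
    by rewrite div1r lnV ?posrE// opprK !lnK ?posrE.
  have aom : a ^+ m * expR w0 = expR om.
    have -> : a ^+ m = expR (m%:R * L) by rewrite expRM_natl aE.
    by rewrite -expRD mE addrC.
  have ee : expR om * expR (- om) = 1 by rewrite expRxMexpNx_1.
  rewrite /u vE eE /b.
  have -> : a ^+ m * (nu%:R * expR w0 * Af w0) = nu%:R * Af w0 * expR om by rewrite -aom; ring.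
  have -> : nu%:R * Af w0 * expR om * (expR (- om) * om / L) =
     nu%:R * Af w0 * (expR om * expR (- om)) * (om / L) by ring.
  by rewrite ee mulr1 omx mulfK// gt_eqF.
have setE : [set w | u * V w < b + 0] = [set w | W w < e].
  apply/seteqP; split => w /=; rewrite addr0 -ue ltr_pM2l// /V gt_max; first by case/andP.
  by move=> ->; rewrite e0.
have l0 : 0 < lapR P V u := lapR_gt0 P mV V0 (ltW u0).
have JE := tiltJE P mV u b 0; rewrite setE addr0 in JE.
set p := fine _ in JE *; set J0 := tiltJ _ _ _ _ _ in hJ JE.
pose wm := Num.sqrt (nu%:R * kap w0 * m%:R).
have km0 : 0 < nu%:R * kap w0 * m%:R by rewrite !mulr_gt0.
have wm0 : 0 < wm by rewrite sqrtr_gt0.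
have lnwm : ln wm = 1 / 2 * ln (nu%:R * kap w0) + 1 / 2 * ln m%:R.
  have : ln (wm ^+ 2) = ln (nu%:R * kap w0) + ln m%:R.
    by rewrite sqr_sqrtr ?(ltW km0)// lnM ?posrE// mulr_gt0.
  rewrite lnXn// mulr2n; lra.
(* The quotient in the theorem is exactly Z e^r: Z is close to 1 by the local limit theorem, and r
   gathers the logarithmic errors. *)
pose Z := J0 * wm * N / Num.sqrt (2 * pi).
pose r := (ln (lapR P V u) - (lam * (m%:R * (m%:R + 1) / 2) + bf w0 * m%:R + gf w0)) +
  1 / 2 * (ln om - ln L - ln m%:R).
have Z1 : `|Z - 1| <= eta.
  have -> : Z - 1 = (J0 * wm * N - Num.sqrt (2 * pi)) / Num.sqrt (2 * pi).
    by rewrite /Z; field; rewrite gt_eqF.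
  by rewrite normrM normfV (gtr0_norm s2p) ler_pdivrMr.
have rb : `|r| <= eta.
  have := lnw x0 x1 m0; rewrite -omx => /andP[q1 q2].
  have hm : 1 / 2 * m%:R^-1 <= m.+1%:R^-1 :> R.
    rewrite mul1r -invfM lef_pV2 ?posrE ?mulr_gt0// -natrM ler_nat mul2n -addnn -addn1.
    by rewrite leq_add2l.
  apply: (le_trans (ler_normD _ _)); apply: le_trans r2; apply: lerD; first exact: hl.
  move: q1 q2; set q := _ - ln m%:R => q1 q2.
  rewrite ger0_norm; last by rewrite mulr_ge0.
  by apply: le_trans hm; rewrite ler_wpM2l.
have ratioE : p / expR (- sigma nu (mass X 1) a * om ^+ 2 + om * (m1f \o phase) om
     - 1 / 2 * ln om + (m2f \o phase) om) = Z * expR r.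
  (* The exponent is introduced as an opaque variable, so that rewriting [expR] of sums does not
     split it. *)
  have [Ex ExE] : exists Ex, Ex = - sigma nu (mass X 1) a * om ^+ 2 + om * m1f w0 - 1 / 2 * ln om + m2f w0.
    by eexists.
  rewrite [X in expR X](_ : _ = Ex); last by rewrite ExE.
  have pE : p = J0 * expR b * lapR P V u.
    rewrite JE expRN; field; rewrite !gt_eqF// expR_gt0//.
  have ln1p : ln (1 / mass X 1) = - ln (mass X 1) by rewrite div1r lnV// posrE (offspring_p1 HX).
  have rE : r = b + ln (lapR P V u) - ln wm + ln (Num.sqrt (2 * pi) / N) - Ex.
    rewrite ExE.
    have xL : x w0 = om / L - m%:R by rewrite omx mulfK ?gt_eqF//; ring.
    rewrite /r lnwm /sigma ln1p /m1f /m2f /C0 /b xL /lam.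
    by field; rewrite gt_eqF.
  rewrite rE expRB !expRD expRN !lnK ?posrE ?divr_gt0// pE /Z.
  by field; rewrite !gt_eqF// expR_gt0.
rewrite ratioE distrC.
have er : `|expR r - 1| <= 2 * eta.
  apply: (le_trans (normr_expRB1_le (le_trans rb eta2))); rewrite ler_wpM2l//.
have er2 : expR r <= 2 by have := ler_norm (expR r - 1); lra.
have -> : Z * expR r - 1 = (Z - 1) * expR r + (expR r - 1) by ring.
apply: (le_trans (ler_normD _ _)).
have : `|(Z - 1) * expR r| <= eta * 2.
  by rewrite normrM (ger0_norm (expR_ge0 _)) ler_pM ?expR_ge0.
lra.
Unshelve. all: by end_near. Qed.

End left_tail.

Unset Implicit Arguments.
Set Strict Implicit.
Set Printing Implicit Defensive.

Theorem theorem1p2 (d : measure_display) (T : measurableType d) (R : realType)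
  (P : probability T R)
  (X Y : {RV P >-> nat})
  (X_ge1 : forall w, (1 <= X w)%N) (X_nondeg : nonconstant_rv X)
  (p1_gt0 : 0 < mass X 1)
  (Y_ge1 : forall w, (1 <= Y w)%N)
  (XlogX : ('E_P[fun w => ((X w)%:R * ln (X w)%:R)%R] < +oo)%E)
  (logY : ('E_P[fun w => ln (Y w)%:R] < +oo)%E)
  (nu : nat) (q_nu : 0 < mass Y nu)
  (nu_min : forall i : nat, 0 < mass Y i -> (nu <= i)%N)
  (Xs : nat -> nat -> {RV P >-> nat}) (Ys : nat -> {RV P >-> nat})
  (Xs_law : forall n i, same_law (Xs n i) X)
  (Ys_law : forall j, same_law (Ys j) Y)
  (indep : mutually_independent P (joint_family Xs Ys))
  (W : {RV P >-> R})
  (W_lim : {ae P, forall w,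
    (gwi Xs Ys n w)%:R / mean X ^+ n @[n --> \oo] --> W w})
  (omega : R -> R) (omegaP : is_omega (mean X) omega) :
  exists M1 M2 : R -> R,
    [/\ bounded_fun M1, periodic M1 (ln (mean X)),
        bounded_fun M2, periodic M2 (ln (mean X)) &
        fine (P [set w | W w < e]) /
          expR (- sigma nu (mass X 1) (mean X) * omega e ^+ 2
                + omega e * M1 (omega e)
                - 1 / 2 * ln (omega e) + M2 (omega e))
        @[e --> 0^'+] --> (1 : R)].
Proof.
have HX := OffspringLaw X_ge1 X_nondeg p1_gt0 XlogX.
rewrite mean_Ex in W_lim omegaP *.
exact: (left_tail HX Y_ge1 q_nu nu_min Xs_law Ys_law indep W_lim omegaP).
Qed.
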